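(* Let $n\ge 3$. Let $\Gamma\subset\mathbb{R}^n$ be an open convex symmetric cone with vertex at the origin such that $\Gamma_n\subset\Gamma\subset\Gamma_1$. Let $f\in C^\infty(\Gamma)\cap C^0(\overline{\Gamma})$ be a symmetric function with $f>0$ in $\Gamma$, such that $f$ is homogeneous of degree one on $\Gamma$, $f_i:=\partial f/\partial\lambda_i>0$ on $\Gamma$ for every $i$, and there is a constant $c_0>0$ with $\sum_i f_i(\lambda)\ge c_0$ for all $\lambda\in\Gamma$. Let $(\mathcal{M}^n,g)$ be a smooth compact Riemannian manifold with nonempty smooth boundary $\partial\mathcal{M}$, let $\mathcal{O}_1$ be an open set of $\mathcal{M}$, and let $\psi\in C^2(\mathcal{O}_1\times\mathbb{R})$ and $\eta\in C^2((\mathcal{O}_1\cap\partial\mathcal{M})\times\mathbb{R})$. Let $a,b$ be constants and let $\mathcal{O}_2$ be an open set of $\mathcal{M}$ with $\overline{\mathcal{O}}_2\subset\mathcal{O}_1$. Then there is a positive constant $C$, depending only on $n$, $(f,\Gamma)$, $g$, $\psi$, $\eta$, $a$, $b$, $\mathcal{O}_1$ and $\mathcal{O}_2$, such that every $u\in C^3(\mathcal{O}_1)$ satisfying $$\begin{cases} f(\lambda_g(U))=\psi(x,u),\quad \lambda_g(U)\in\Gamma & \text{on } \mathcal{O}_1,\\ \dfrac{\partial u}{\partial\nu}=\eta(x,u)-h_g & \text{on }\mathcal{O}_1\cap\partial\mathcal{M},\end{cases}\qquad U:=\nabla^2u+du\otimes du-\tfrac12|\nabla u|_g^2\,g+A_g,$$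 and $a\le u\le b$ on $\mathcal{O}_1$ satisfies $$|\nabla u|_g\le C\quad\text{on }\mathcal{O}_2 .$$
   Context: $\Gamma_1=\{\lambda\in\mathbb{R}^n:\sum_i\lambda_i>0\}$ and $\Gamma_n=\{\lambda\in\mathbb{R}^n:\lambda_i>0 \text{ for all } i\}$. ''Symmetric'' means invariant under permutations of the coordinates. Open sets of $\mathcal{M}$ are open in the topology of the manifold with boundary, so they may meet $\partial\mathcal{M}$. The Schouten tensor of $g$ is $A_g=\frac{1}{n-2}\left(Ric_g-\frac{1}{2(n-1)}R_g\,g\right)$, where $Ric_g$, $R_g$ are the Ricci tensor and scalar curvature of $g$. For a symmetric 2-tensor $U$, $\lambda_g(U)$ denotes its eigenvalues with respect to $g$. $\nabla$ is the Levi-Civita connection of $g$, and $\nu$ is the unit inward normal vector field to $\partial\mathcal{M}$ in $(\mathcal{M},g)$. The second fundamental form of $\partial\mathcal{M}$ is $\Pi(X,Y)=-g(\nabla_X\nu,Y)$ for $X,Y\in T(\partial\mathcal{M})$, and the mean curvature is $h_g=\frac{1}{n-1}\operatorname{tr}_g\Pi$ (so a Euclidean ball has positive boundary mean curvature). *)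

(* Defs.v *)
From HB Require Import structures.
From mathcomp Require Import all_boot all_order all_algebra all_fingroup.
From mathcomp Require Import all_classical all_reals all_analysis.

Set Implicit Arguments.
Unset Strict Implicit.
Unset Printing Implicit Defensive.

Import Order.TTheory GRing.Theory Num.Theory.
Import numFieldNormedType.Exports.

Local Open Scope classical_set_scope.
Local Open Scope ring_scope.

(** * Differentiability up to the boundary *)

Section Ck.
Variables (R : realType) (p : nat).
Implicit Types (D W : set 'rV[R]_p) (f : 'rV[R]_p -> R) (x : 'rV[R]_p).

(* Increments are restricted to those keeping the point in the model space D
   (the whole space, a half-space, or a half-space times R), so that at a
   boundary point the derivative across the boundary is one-sided. *)
Definition diff_quot D (i : 'I_p) f x (t : R) : R :=
  t^-1 * (f (x + t *: delta_mx 0 i) - f x).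

Definition dir_filter D (i : 'I_p) x : set_system R :=
  within [set t : R | D (x + t *: delta_mx 0 i)] (0 : R)^'.

Definition partial D (i : 'I_p) f x : R :=
  lim (diff_quot D i f x @ dir_filter D i x).

(* f is C^k on W, a relatively open subset of D.  When D is a half-space this
   is C^k up to the boundary: derivatives taken in the interior extend
   continuously, equivalently f locally extends to a C^k function on R^p. *)
Fixpoint Ck D W (k : nat) f : Prop :=
  {within W, continuous f} /\
  match k with
  | 0 => True
  | k'.+1 => forall i : 'I_p,
      (forall x, W x -> cvg (diff_quot D i f x @ dir_filter D i x)) /\
      Ck D W k' (partial D i f)
  end.

Definition smooth D W f : Prop := forall k, Ck D W k f.

End Ck.

(** * Manifolds with boundary, of dimension n = m.+1 *)

Definition half_space (R : realType) (m : nat) : set 'rV[R]_m.+1 :=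
  [set x | 0 <= x 0 ord0].
Arguments half_space {R m}.

(* Only the values of [crd] on [dom], and of [pnt] on [chart_img], matter. *)
Record chart (R : realType) (m : nat) (M : topologicalType) := Chart {
  dom : set M;
  crd : M -> 'rV[R]_m.+1;
  pnt : 'rV[R]_m.+1 -> M }.

Section ChartDefs.
Variables (R : realType) (m : nat) (M : topologicalType).
Implicit Types c : chart R m M.

Definition chart_img c (O : set M) : set 'rV[R]_m.+1 :=
  crd c @` (dom c `&` O).

(* A homeomorphism from an open subset of M onto a relatively open subset of
   the half-space. *)
Definition is_chart c : Prop :=
  [/\ open (dom c),
      (exists2 V : set 'rV[R]_m.+1,
         open V & chart_img c setT = V `&` half_space),
      (forall q, dom c q -> pnt c (crd c q) = q),
      {within dom c, continuous (crd c)} &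
      {within chart_img c setT, continuous (pnt c)}].

Definition transition c c' (x : 'rV[R]_m.+1) : 'rV[R]_m.+1 :=
  crd c' (pnt c x).

End ChartDefs.

Record bmanifold (R : realType) (m : nat) (M : topologicalType) := BManifold {
  atlas : set (chart R m M);
  bm_hausdorff : hausdorff_space M;
  bm_second_countable : @second_countable M;
  bm_chart : forall c, atlas c -> is_chart c;
  bm_cover : forall q : M, exists2 c, atlas c & dom c q;
  bm_smooth : forall c c', atlas c -> atlas c' -> forall j : 'I_m.+1,
    smooth half_space (chart_img c (dom c')) (fun x => transition c c' x 0 j)
}.

Definition bdry (R : realType) (m : nat) (M : topologicalType)
    (X : bmanifold R m M) : set M :=
  [set q | exists c, [/\ atlas X c, dom c q & crd c q 0 ord0 = 0]].

Section Regularity.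
Variables (R : realType) (m : nat) (M : topologicalType).
Variable X : bmanifold R m M.
Implicit Type O : set M.

Definition Ck_on O (k : nat) (u : M -> R) : Prop :=
  forall c, atlas X c -> Ck half_space (chart_img c O) k (u \o pnt c).

(* In coordinates (x, s), the last entry s being the real variable. *)
Definition Ck_onxR O (k : nat) (psi : M -> R -> R) : Prop :=
  forall c, atlas X c ->
    Ck [set z : 'rV[R]_(m.+1 + 1) | half_space (lsubmx z)]
       [set z : 'rV[R]_(m.+1 + 1) | chart_img c O (lsubmx z)]
       k (fun z => psi (pnt c (lsubmx z)) (rsubmx z 0 0)).

Definition bdry_emb (y : 'rV[R]_m) : 'rV[R]_m.+1 := row_mx (0 : 'rV[R]_1) y.

(* In coordinates (y, s), with y in R^m the boundary coordinates. *)
Definition Ck_bdryxR O (k : nat) (eta : M -> R -> R) : Prop :=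
  forall c, atlas X c ->
    Ck setT
       [set z : 'rV[R]_(m + 1) | chart_img c O (bdry_emb (lsubmx z))]
       k (fun z => eta (pnt c (bdry_emb (lsubmx z))) (rsubmx z 0 0)).

End Regularity.

(** * Riemannian geometry in local coordinates *)

Section Local.
Variables (R : realType) (m : nat).
Notation n := (m.+1).
Notation V := 'rV[R]_n.
(* G is the matrix (g_ij) of the metric in a chart. *)
Variable G : V -> 'M[R]_n.
Implicit Types (x v w : V) (u : V -> R) (i j k l : 'I_n).

Definition pd i u x : R := partial half_space i u x.

Definition ip x v w : R := (v *m G x *m w^T) 0 0.

Definition gnorm x v : R := Num.sqrt (ip x v v).

Definition ginv x : 'M[R]_n := invmx (G x).

(* Gamma^k_ij *)
Definition christoffel k i j x : R :=
  2^-1 * \sum_l ginv x k l *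
    (pd i (fun y => G y j l) x + pd j (fun y => G y i l) x
     - pd l (fun y => G y i j) x).

(* R(e_i, e_j) e_k = riemann l k i j e_l, with
   R(X, Y) = [nabla_X, nabla_Y] - nabla_[X, Y]. *)
Definition riemann l k i j x : R :=
  pd i (christoffel l j k) x - pd j (christoffel l i k) x
  + \sum_(q < n) (christoffel l i q x * christoffel q j k x
                  - christoffel l j q x * christoffel q i k x).

(* Ric(Y, Z) = tr (X |-> R(X, Y) Z) *)
Definition ricci x : 'M[R]_n :=
  \matrix_(j, k) \sum_i riemann i k i j x.

Definition scalar_curv x : R := \sum_i \sum_j ginv x i j * ricci x i j.

Definition schouten x : 'M[R]_n :=
  (n%:R - 2)^-1 *:
    (ricci x - (2 * (n%:R - 1))^-1 *: (scalar_curv x *: G x)).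

Definition hessian u x : 'M[R]_n :=
  \matrix_(i, j)
    (pd i (pd j u) x - \sum_k christoffel k i j x * pd k u x).

Definition du u x : V := \row_i pd i u x.

Definition grad u x : V := \row_i \sum_j ginv x i j * pd j u x.

Definition Utensor u x : 'M[R]_n :=
  hessian u x + (du u x)^T *m du u x
  - (2^-1 * gnorm x (grad u x) ^+ 2) *: G x + schouten x.

(* The eigenvalues of the 2-tensor A with respect to g, i.e. those of the
   endomorphism g^-1 A, with multiplicity and listed in nondecreasing order. *)
Definition eigvals x (A : 'M[R]_n) : V :=
  get [set lam : V |
    char_poly (ginv x *m A) = \prod_(i < n) ('X - (lam 0 i)%:P) /\
    forall i j, (i <= j)%N -> lam 0 i <= lam 0 j].

(* The boundary is x_0 = 0 and the manifold lies in x_0 >= 0; the vectors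
   e_(lift ord0 i), i : 'I_m, span the tangent space of the boundary. *)
Definition bvec (i : 'I_m) : V := delta_mx 0 (lift ord0 i).

Definition normal x : V :=
  get [set v : V | [/\ ip x v v = 1,
                       (forall i : 'I_m, ip x v (bvec i) = 0) &
                       0 < v 0 ord0]].

(* nabla_(e_i) nu, for e_i tangent to the boundary *)
Definition cov_normal (i : 'I_m) x : V :=
  \row_k (pd (lift ord0 i) (fun y => normal y 0 k) x
          + \sum_j christoffel k (lift ord0 i) j x * normal x 0 j).

Definition second_form x : 'M[R]_m :=
  \matrix_(i, j) - ip x (cov_normal i x) (bvec j).

Definition bdry_metric x : 'M[R]_m :=
  \matrix_(i, j) G x (lift ord0 i) (lift ord0 j).

Definition mean_curv x : R :=
  (n%:R - 1)^-1 * \tr (invmx (bdry_metric x) *m second_form x).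

Definition normal_deriv u x : R := \sum_k normal x 0 k * pd k u x.

End Local.

Definition jacobian (R : realType) (m : nat)
    (tau : 'rV[R]_m.+1 -> 'rV[R]_m.+1) (x : 'rV[R]_m.+1) : 'M[R]_m.+1 :=
  \matrix_(k, i) pd i (fun y => tau y 0 k) x.

Record riem_metric (R : realType) (m : nat) (M : topologicalType)
    (X : bmanifold R m M) := RiemMetric {
  gcomp : chart R m M -> 'rV[R]_m.+1 -> 'M[R]_m.+1;
  rm_smooth : forall c, atlas X c -> forall i j : 'I_m.+1,
    smooth half_space (chart_img c setT) (fun x => gcomp c x i j);
  rm_sym : forall c, atlas X c -> forall x, chart_img c setT x ->
    (gcomp c x)^T = gcomp c x;
  rm_posdef : forall c, atlas X c -> forall x, chart_img c setT x ->
    forall v : 'rV[R]_m.+1, v != 0 -> 0 < ip (gcomp c) x v v;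
  rm_tensor : forall c c', atlas X c -> atlas X c' ->
    forall x, chart_img c (dom c') x ->
    gcomp c x = (jacobian (transition c c') x)^T
                *m gcomp c' (transition c c' x)
                *m jacobian (transition c c') x
}.

(** * The boundary value problem *)

Section Problem.
Variables (R : realType) (m : nat) (M : topologicalType).
Variables (X : bmanifold R m M) (g : riem_metric X).

Definition interior_eq (Gam : set 'rV[R]_m.+1) (f : 'rV[R]_m.+1 -> R)
    (psi : M -> R -> R) (O : set M) (u : M -> R) : Prop :=
  forall c q, atlas X c -> dom c q -> O q ->
    let lam := eigvals (gcomp g c) (crd c q)
                 (Utensor (gcomp g c) (u \o pnt c) (crd c q)) in
    f lam = psi q (u q) /\ Gam lam.

Definition boundary_eq (eta : M -> R -> R) (O : set M) (u : M -> R) : Prop :=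
  forall c q, atlas X c -> dom c q -> O q -> bdry X q ->
    normal_deriv (gcomp g c) (u \o pnt c) (crd c q)
    = eta q (u q) - mean_curv (gcomp g c) (crd c q).

Definition grad_le (C : R) (O : set M) (u : M -> R) : Prop :=
  forall c q, atlas X c -> dom c q -> O q ->
    gnorm (gcomp g c) (crd c q) (grad (gcomp g c) (u \o pnt c) (crd c q)) <= C.

End Problem.

(** * The cone and the symmetric function *)

Section Cone.
Variables (R : realType) (n : nat).

Definition Gamma1 : set 'rV[R]_n := [set lam | 0 < \sum_i lam 0 i].

Definition Gamman : set 'rV[R]_n := [set lam | forall i, 0 < lam 0 i].

Definition is_cone (Gam : set 'rV[R]_n) : Prop :=
  forall (t : R) lam, 0 < t -> Gam lam -> Gam (t *: lam).

Definition symmetric_set (Gam : set 'rV[R]_n) : Prop :=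
  forall (s : 'S_n) lam, Gam lam -> Gam (col_perm s lam).

Definition symmetric_fun (D : set 'rV[R]_n) (f : 'rV[R]_n -> R) : Prop :=
  forall (s : 'S_n) lam, D lam -> f (col_perm s lam) = f lam.

Definition homogeneous1 (Gam : set 'rV[R]_n) (f : 'rV[R]_n -> R) : Prop :=
  forall (t : R) lam, 0 < t -> Gam lam -> f (t *: lam) = t * f lam.

End Cone.

Arguments Gamma1 {R n}.
Arguments Gamman {R n}.

(* Main.v *)
Require Import Defs.
From HB Require Import structures.
From mathcomp Require Import all_boot all_order all_algebra all_fingroup.
From mathcomp Require Import all_classical all_reals all_analysis.
From mathcomp Require Import ring lra.
Import Order.TTheory GRing.Theory Num.Theory.
Import numFieldNormedType.Exports.
Local Open Scope classical_set_scope.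
Local Open Scope ring_scope.

(** Bernstein's method with a cut-off, up to the boundary.  The estimate is
    local, so work in a chart [x_0 >= 0].  Fix one admissible [u0] (if there is none, nothing is to
    be proved) and put [X = du - beta] with
    [beta = du0 + e_0 (eta(x',u) - eta(x',u0)) / sqrt(g^00)]: then [X] is
    tangential at the boundary, [h_g] has disappeared, and [beta] involves second
    derivatives of [u] only in its own second derivatives, linearly and with
    bounded factor.  Take the maximum of [sigma^2 |X|^2 / theta(u)], where
    [theta'' <= -theta' < 0].  At a boundary maximum, tangency bounds the normal
    derivative of [|X|^2] by [|X|^2]; but
    [sigma = r^2 - |x - x*|^2 + L (x_0 - x*_0)], with [L] comparable to [r], has
    normal derivative at least of order [r] there while [sigma <= r^2], which is
    impossible for small [r].  At an interior maximum, the equation differentiated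
    along [X] in a [g]-orthonormal eigenframe of [U] cancels the third derivatives
    in the second-order condition; [sum f_a lambda_a = psi] by homogeneity, and
    the good quadratic gradient term, weighted by [sum f_a >= c0], bounds
    [sigma |X|].  Eigenvalues are only Lipschitz; [f(lambda(U))] is differentiated
    through the min-max bounds, using [f_a = f_b] where [lambda_a = lambda_b].
    Compactness and the invariance of [|du|_g] under chart changes globalize. *)

Set Implicit Arguments.
Unset Strict Implicit.
Unset Printing Implicit Defensive.

(** * Jets and C^k calculus on orthants *)

(** No upper bound for the [f_a] is at hand. Every error at an interior maximum is therefore
    estimated in its own row [a] of the eigenframe, keeping its weight [f_a], against the good terms
    of that row; only terms without a weight are paid for with [c0]. The second derivatives of [u]
    are not bounded either: contracted with [X] they are known from the first-order condition, and
    along a row they cost no more than the derivative of [X] in that row, up to [|X|]. The terms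
    quadratic in the row component of [du] cancel exactly, and half of [(theta' / theta) |X|^4]
    survives. Subtracting a fixed solution spares an extension of [h_g] to the interior: [du0]
    carries that boundary datum and has the two derivatives that [beta] must have. As [u0] is picked
    once, constants may depend on it. At the boundary the order of choices matters: the logarithmic
    conormal derivative is bounded for all cut-offs at once, and only then is the radius fixed. *)

Section RowNorm.
Variables (R : realType) (p : nat).
Implicit Types x y : 'rV[R]_p.

Lemma ler_norm_coord x i : `|x 0 i| <= `|x|.
Proof.
rewrite [leRHS]mx_normrE; apply: le_trans (le_bigmax _ _ (0, i)) => //.
Qed.

Lemma rV_norm_le x e : 0 <= e -> (forall i, `|x 0 i| <= e) -> `|x| <= e.
Proof.
move=> e0 h; rewrite [leLHS]mx_normrE; apply/bigmax_leP; split=> // -[i j] _.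
by rewrite [i]ord1; exact: h.
Qed.

Lemma norm_delta i : `|(delta_mx 0 i : 'rV[R]_p)| = 1.
Proof.
apply/eqP; rewrite eq_le; apply/andP; split.
  apply: rV_norm_le => // j; rewrite mxE eqxx /=; case: (j == i); by rewrite ?normr1 ?normr0.
by have := ler_norm_coord (delta_mx 0 i) i; rewrite mxE !eqxx normr1.
Qed.

End RowNorm.

(** * Peano expansions along a punctured filter *)

Section Jets.
Variable R : realType.

(** One interface for the three ways in which a point is approached: from both sides along an
    interior line, from the right into the half-space, and through the increments that [partial]
    admits. *)
Class punctured_filter (F : set_system R) := PuncturedFilter {
  path_proper : ProperFilter F;
  path_dnbhs : F --> (0 : R)^' }.

#[global] Instance punctured_filter_proper F : punctured_filter F -> ProperFilter F.
Proof. by case. Qed.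

#[global] Instance punctured_filter_dnbhs : punctured_filter (0 : R)^'.
Proof. by split; [exact: Proper_dnbhs_numFieldType | exact: cvg_id]. Qed.

#[global] Instance punctured_filter_right : punctured_filter (0 : R)^'+.
Proof.
split; first exact: at_right_proper_filter.
move=> A [r /= r0 hA]; exists r => //= t tr t0.
by apply: hA => //; rewrite gt_eqF.
Qed.

(* Inductive rather than a bare limit, so that unification never unfolds it;
   the filter property is carried along to spare side conditions. *)
Variant jet1 (F : set_system R) (phi : R -> R) (c0 c1 : R) : Prop :=
  Jet1 of punctured_filter F & (fun t => t^-1 * (phi t - c0)) @ F --> c1.

Variant jet2 (F : set_system R) (phi : R -> R) (c0 c1 c2 : R) : Prop :=
  Jet2 of punctured_filter F &
    (fun t => t^-2 * (phi t - c0 - c1 * t)) @ F --> c2 / 2.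

Section PuncturedFilter.
Variables (F : set_system R) (pF : punctured_filter F).
Implicit Types phi psi : R -> R.

Lemma path_neq0 : \forall t \near F, t != 0.
Proof. by apply: path_dnbhs; exists 1 => //= t _. Qed.

Lemma path_cvg0 : (fun t => t) @ F --> (0 : R).
Proof.
apply: cvg_trans (path_dnbhs : F --> _) _.
exact: cvg_within.
Qed.

Lemma path_small (e : R) : 0 < e -> \forall t \near F, `|t| < e.
Proof.
move=> e0; have /cvgrPdist_lt/(_ _ e0) := path_cvg0.
by apply: filterS => t; rewrite sub0r normrN.
Qed.

Lemma cvg_near_to phi psi (l : R) : (\forall t \near F, phi t = psi t) ->
  phi @ F --> l -> psi @ F --> l.
Proof. by move=> h; apply: cvg_trans; apply: near_eq_cvg; exact: filterS h. Qed.

Lemma jet1_cst c : jet1 F (fun=> c) c 0.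
Proof.
split=> //; under eq_fun do rewrite subrr mulr0; exact: cvg_cst.
Qed.

Lemma jet1_lin c d : jet1 F (fun t => c + t * d) c d.
Proof.
split=> //; apply: cvg_near_cst.
by apply: filterS path_neq0 => t t0; rewrite addrC addKr mulKf.
Qed.

Lemma jet2_cst c : jet2 F (fun=> c) c 0 0.
Proof.
split=> //; apply: cvg_near_cst; apply: nearW => t; ring.
Qed.

Lemma jet2_lin c d : jet2 F (fun t => c + t * d) c d 0.
Proof.
split=> //; apply: cvg_near_cst; apply: nearW => t; ring.
Qed.

Lemma jet1P phi c0 c1 : jet1 F phi c0 c1 <->
  forall e, 0 < e -> \forall t \near F, `|phi t - c0 - c1 * t| <= e * `|t|.
Proof.
split=> [[_ /cvgrPdist_le h] e e0|h].
  near=> t; have t0 : t != 0 by near: t; exact: path_neq0.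
  have : `|c1 - t^-1 * (phi t - c0)| <= e by near: t; exact: h.
  have -> : c1 - t^-1 * (phi t - c0) = - (phi t - c0 - c1 * t) / t by field.
  by rewrite normrM normrN normfV ler_pdivrMr ?normr_gt0.
split=> //; apply/cvgrPdist_le => e e0; near=> t.
have t0 : t != 0 by near: t; exact: path_neq0.
have -> : c1 - t^-1 * (phi t - c0) = - (phi t - c0 - c1 * t) / t by field.
rewrite normrM normrN normfV ler_pdivrMr ?normr_gt0 //.
by near: t; exact: h.
Unshelve. all: by end_near. Qed.

Lemma jet2P phi c0 c1 c2 : jet2 F phi c0 c1 c2 <->
  forall e, 0 < e -> \forall t \near F,
    `|phi t - c0 - c1 * t - c2 / 2 * t ^+ 2| <= e * t ^+ 2.
Proof.
split=> [[_ /cvgrPdist_le h] e e0|h].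
  near=> t; have t0 : t != 0 by near: t; exact: path_neq0.
  have : `|c2 / 2 - t^-2 * (phi t - c0 - c1 * t)| <= e by near: t; exact: h.
  have -> : c2 / 2 - t^-2 * (phi t - c0 - c1 * t) =
    - (phi t - c0 - c1 * t - c2 / 2 * t ^+ 2) / t ^+ 2 by field.
  rewrite normrM normrN normfV normrX real_normK ?num_real //.
  by rewrite ler_pdivrMr // exprn_even_gt0.
split=> //; apply/cvgrPdist_le => e e0; near=> t.
have t0 : t != 0 by near: t; exact: path_neq0.
have -> : c2 / 2 - t^-2 * (phi t - c0 - c1 * t) =
    - (phi t - c0 - c1 * t - c2 / 2 * t ^+ 2) / t ^+ 2 by field.
rewrite normrM normrN normfV normrX real_normK ?num_real //.
rewrite ler_pdivrMr // ?exprn_even_gt0 //.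
by near: t; exact: h.
Unshelve. all: by end_near. Qed.

End PuncturedFilter.

Section JetAlgebra.
Context {F : set_system R}.
Implicit Types phi psi : R -> R.

Lemma jet1_unique phi c0 c1 d1 : jet1 F phi c0 c1 -> jet1 F phi c0 d1 -> c1 = d1.
Proof. by case=> pF h1 [_ h2]; exact: (cvg_unique _ h1 h2). Qed.

Lemma jet1_near phi psi c0 c1 : (\forall t \near F, phi t = psi t) ->
  jet1 F phi c0 c1 -> jet1 F psi c0 c1.
Proof.
move=> h [pF hp]; split=> //; apply: cvg_near_to hp.
by apply: filterS h => t ->.
Qed.

Lemma jet1_eq phi psi c0 c1 : (forall t, phi t = psi t) ->
  jet1 F phi c0 c1 -> jet1 F psi c0 c1.
Proof. by move=> h; have -> : phi = psi by exact/funext. Qed.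

Lemma jet2_eq phi psi c0 c1 c2 : (forall t, phi t = psi t) ->
  jet2 F phi c0 c1 c2 -> jet2 F psi c0 c1 c2.
Proof. by move=> h; have -> : phi = psi by exact/funext. Qed.

Lemma jet1_cvg phi c0 c1 : jet1 F phi c0 c1 -> phi @ F --> c0.
Proof.
case=> pF h; rewrite -[c0]addr0 -(mul0r c1).
apply: cvg_near_to (cvgD (cvg_cst c0) (cvgM (path_cvg0 pF) h)).
by apply: filterS (path_neq0 pF) => t t0; rewrite !fctE /= mulVKf // addrC subrK.
Qed.

Lemma jet2_jet1 phi c0 c1 c2 : jet2 F phi c0 c1 c2 -> jet1 F phi c0 c1.
Proof.
case=> pF h; split=> //; rewrite -[c1]addr0 -(mul0r (c2 / 2)).
apply: cvg_near_to (cvgD (cvg_cst c1) (cvgM (path_cvg0 pF) h)).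
apply: filterS (path_neq0 pF) => t t0; rewrite !fctE /=; field; exact: t0.
Qed.

Lemma jet1D phi psi c0 c1 d0 d1 : jet1 F phi c0 c1 -> jet1 F psi d0 d1 ->
  jet1 F (fun t => phi t + psi t) (c0 + d0) (c1 + d1).
Proof.
case=> pF h1 [_ h2]; split=> //; apply: cvg_near_to (cvgD h1 h2).
by apply: nearW => t; rewrite !fctE /=; ring.
Qed.

Lemma jet2D phi psi c0 c1 c2 d0 d1 d2 :
  jet2 F phi c0 c1 c2 -> jet2 F psi d0 d1 d2 ->
  jet2 F (fun t => phi t + psi t) (c0 + d0) (c1 + d1) (c2 + d2).
Proof.
case=> pF h1 [_ h2]; split=> //; rewrite mulrDl; apply: cvg_near_to (cvgD h1 h2).
by apply: nearW => t; rewrite !fctE /=; ring.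
Qed.

Lemma jet1M phi psi c0 c1 d0 d1 : jet1 F phi c0 c1 -> jet1 F psi d0 d1 ->
  jet1 F (fun t => phi t * psi t) (c0 * d0) (c1 * d0 + c0 * d1).
Proof.
case=> pF h1 h2'; have h2c := jet1_cvg h2'; case: h2' => _ h2; split=> //.
apply: cvg_near_to (cvgD (cvgM h1 h2c) (cvgM (cvg_cst c0) h2)).
by apply: nearW => t; rewrite !fctE /=; ring.
Qed.

Lemma jet2M phi psi c0 c1 c2 d0 d1 d2 :
  jet2 F phi c0 c1 c2 -> jet2 F psi d0 d1 d2 ->
  jet2 F (fun t => phi t * psi t) (c0 * d0) (c1 * d0 + c0 * d1)
    (c2 * d0 + 2 * c1 * d1 + c0 * d2).
Proof.
case=> pF h1 h2'; have h21 := jet2_jet1 h2'; have hp := jet1_cvg h21.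
case: h2' => _ h2; case: h21 => _ h21; split=> //.
have -> : (c2 * d0 + 2 * c1 * d1 + c0 * d2) / 2 =
  c2 / 2 * d0 + c0 * (d2 / 2) + c1 * d1 by field.
apply: cvg_near_to (cvgD (cvgD (cvgM h1 hp) (cvgM (cvg_cst c0) h2))
  (cvgM (cvg_cst c1) h21)).
apply: filterS (path_neq0 pF) => t t0; rewrite !fctE /=; field; exact: t0.
Qed.

Lemma jet1Z k phi c0 c1 : jet1 F phi c0 c1 ->
  jet1 F (fun t => k * phi t) (k * c0) (k * c1).
Proof.
by move=> h; case: (h) => pF _; have := jet1M (jet1_cst pF k) h; rewrite mul0r add0r.
Qed.

Lemma jet2Z k phi c0 c1 c2 : jet2 F phi c0 c1 c2 ->
  jet2 F (fun t => k * phi t) (k * c0) (k * c1) (k * c2).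
Proof.
move=> h; case: (h) => pF _; have := jet2M (jet2_cst pF k) h.
by rewrite !(mul0r, mulr0, add0r).
Qed.

Lemma jet1N phi c0 c1 : jet1 F phi c0 c1 -> jet1 F (fun t => - phi t) (- c0) (- c1).
Proof.
move=> /(jet1Z (- 1)); rewrite !mulN1r.
by apply: jet1_eq => t; rewrite mulN1r.
Qed.

Lemma jet2N phi c0 c1 c2 : jet2 F phi c0 c1 c2 ->
  jet2 F (fun t => - phi t) (- c0) (- c1) (- c2).
Proof.
move=> /(jet2Z (- 1)); rewrite !mulN1r.
by apply: jet2_eq => t; rewrite mulN1r.
Qed.

Lemma jet1B phi psi c0 c1 d0 d1 : jet1 F phi c0 c1 -> jet1 F psi d0 d1 ->
  jet1 F (fun t => phi t - psi t) (c0 - d0) (c1 - d1).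
Proof. by move=> h1 h2; exact: jet1D h1 (jet1N h2). Qed.

Lemma jet2B phi psi c0 c1 c2 d0 d1 d2 :
  jet2 F phi c0 c1 c2 -> jet2 F psi d0 d1 d2 ->
  jet2 F (fun t => phi t - psi t) (c0 - d0) (c1 - d1) (c2 - d2).
Proof. by move=> h1 h2; exact: jet2D h1 (jet2N h2). Qed.

Lemma jet1_sum (pF : punctured_filter F) (I : Type) (r : seq I) (P : pred I)
    (phi : I -> R -> R) c0 c1 :
  (forall i, P i -> jet1 F (phi i) (c0 i) (c1 i)) ->
  jet1 F (fun t => \sum_(i <- r | P i) phi i t) (\sum_(i <- r | P i) c0 i)
    (\sum_(i <- r | P i) c1 i).
Proof.
move=> h; elim: r => [|i r IH].
  rewrite !big_nil; apply: jet1_eq (jet1_cst pF 0) => t; by rewrite big_nil.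
rewrite !big_cons; case: ifPn => Pi.
  apply: jet1_eq (jet1D (h i Pi) IH) => t; by rewrite big_cons Pi.
by apply: jet1_eq IH => t; rewrite big_cons (negbTE Pi).
Qed.

Lemma jet2_sum (pF : punctured_filter F) (I : Type) (r : seq I) (P : pred I)
    (phi : I -> R -> R) c0 c1 c2 :
  (forall i, P i -> jet2 F (phi i) (c0 i) (c1 i) (c2 i)) ->
  jet2 F (fun t => \sum_(i <- r | P i) phi i t) (\sum_(i <- r | P i) c0 i)
    (\sum_(i <- r | P i) c1 i) (\sum_(i <- r | P i) c2 i).
Proof.
move=> h; elim: r => [|i r IH].
  rewrite !big_nil; apply: jet2_eq (jet2_cst pF 0) => t; by rewrite big_nil.
rewrite !big_cons; case: ifPn => Pi.
  apply: jet2_eq (jet2D (h i Pi) IH) => t; by rewrite big_cons Pi.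
by apply: jet2_eq IH => t; rewrite big_cons (negbTE Pi).
Qed.

Lemma jet1_filter (G : set_system R) phi c0 c1 : punctured_filter G ->
  G --> F -> jet1 F phi c0 c1 -> jet1 G phi c0 c1.
Proof. by move=> pG GF [_ h]; split=> // A /h; exact: GF. Qed.

End JetAlgebra.

End Jets.

Section JetExtremum.
Variable R : realType.
Implicit Types phi : R -> R.

Lemma jet1_right_le phi c1 : jet1 0^'+ phi 0 c1 ->
  (\forall t \near (0 : R)^'+, phi t <= 0) -> c1 <= 0.
Proof.
case=> _ h hle; rewrite -(cvg_lim (@Rhausdorff R) h).
apply: limr_le; first by apply/cvg_ex; exists c1.
near=> t; have t0 : 0 < t by near: t; exact: nbhs_right_gt.
rewrite subr0 pmulr_rle0 ?invr_gt0 //; near: t; exact: hle.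
Unshelve. all: by end_near. Qed.

(** The one-sided test applied to [phi] and to its reflection kills [c1]; the quotient that defines
    [c2] is then nonpositive. *)
Lemma jet2_max phi c1 c2 : jet2 0^' phi 0 c1 c2 ->
  (\forall t \near (0 : R)^', phi t <= 0) -> c1 = 0 /\ c2 <= 0.
Proof.
move=> h hle.
have h1 := jet2_jet1 h.
have hle1 : c1 <= 0.
  apply: (@jet1_right_le phi); last exact: path_dnbhs hle.
  by apply: jet1_filter h1; exact: path_dnbhs.
have hge1 : - c1 <= 0.
  apply: (@jet1_right_le (fun t => phi (- t))).
    move/(jet1P (punctured_filter_dnbhs R)) : h1 => hj.
    apply/(jet1P (punctured_filter_right R)) => e e0; have [r /= r0 hA] := hj e e0.
    exists r => //= t tr t0.
    have := hA (- t); rewrite /= sub0r opprK oppr_eq0 gt_eqF // !normrN mulrN -mulNr.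
    by apply => //; rewrite /= sub0r normrN in tr.
  move: hle => [r /= r0 hA]; exists r => //= t tr t0.
  apply: (hA (- t)); rewrite /= ?oppr_eq0 ?gt_eqF // sub0r opprK.
  by rewrite /= sub0r normrN in tr.
have c10 : c1 = 0 by apply/eqP; rewrite eq_le hle1 -oppr_le0.
split=> //; suff : c2 / 2 <= 0 by lra.
case: h => _ h; rewrite -(cvg_lim (@Rhausdorff R) h).
apply: limr_le; first by apply/cvg_ex; exists (c2 / 2).
near=> t; have t0 : t != 0 by near: t; exact: path_neq0.
rewrite subr0 c10 mul0r subr0 pmulr_rle0 ?invr_gt0 ?exprn_even_gt0 //.
near: t; exact: hle.
Unshelve. all: by end_near. Qed.

End JetExtremum.

Lemma within_itv_eps (R : realType) (phi : R -> R) (s : R) :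
  (forall t, 0 <= t <= s -> forall e, 0 < e -> exists2 d, 0 < d &
     forall t', 0 <= t' <= s -> `|t' - t| < d -> `|phi t' - phi t| <= e) ->
  {within `[0, s], continuous phi}.
Proof.
move=> hc; apply/subspace_continuousP => t /=; rewrite in_itv /= => ht.
apply/cvgrPdist_le => e e0; have [d d0 hdd] := hc t ht e e0.
rewrite near_withinE; apply/nbhs_ballP; exists d => //= t' tt'.
rewrite in_itv /= => ht'; rewrite distrC; apply: hdd => //.
by rewrite distrC.
Qed.

Lemma mvt_jet (R : realType) (phi dphi : R -> R) (s : R) : 0 < s ->
  (forall t, 0 < t < s -> jet1 0^' (fun h => phi (t + h)) (phi t) (dphi t)) ->
  {within `[0, s], continuous phi} ->
  exists2 xi, 0 < xi < s & phi s - phi 0 = s * dphi xi.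
Proof.
move=> s0 hd hc.
have [||xi xi01 ->] := @MVT R phi dphi 0 s s0 => //.
- move=> t; rewrite in_itv /= => ht.
  have h : h^-1 *: (phi (h *: (1:R) + t) - phi t) @[h --> 0^'] --> dphi t.
    case: (hd t ht) => pF hj; apply: cvg_near_to hj; apply: nearW => h /=.
    by rewrite /GRing.scale /= mulr1 [h + t]addrC.
  by apply: DeriveDef; [apply/cvg_ex; exists (dphi t) | exact: cvg_lim h].
exists xi; first by move: xi01; rewrite in_itv.
by rewrite subr0 mulrC.
Qed.

(** * First- and second-order expansions up to the boundary of an orthant *)

Section Orthant.
Variables (R : realType) (p : nat).
Implicit Types (D W : set 'rV[R]_p) (f g : 'rV[R]_p -> R) (x y : 'rV[R]_p).

(* Covers the model spaces of the definitions: the whole space, a half-space,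
   and a half-space times a line. *)
Definition orthant (S : pred 'I_p) : set 'rV[R]_p :=
  [set x | forall i, S i -> 0 <= x 0 i].

Definition relopen D W : Prop :=
  forall x, W x -> D x /\ exists2 d, 0 < d & forall y, D y -> `|y - x| < d -> W y.

Definition cont_in D f x : Prop :=
  forall e, 0 < e -> exists2 d, 0 < d &
    forall y, D y -> `|y - x| < d -> `|f y - f x| <= e.

(** Differentiability relative to [D]: at a boundary point only increments into the domain are
    tested, which suffices for paths that stay inside. *)
Definition hasgrad D f x (L : 'I_p -> R) : Prop :=
  forall e, 0 < e -> exists2 d, 0 < d & forall y, D y -> `|y - x| < d ->
    `|f y - f x - \sum_i (y 0 i - x 0 i) * L i| <= e * `|y - x|.

Definition hastaylor D f x (L : 'I_p -> R) (H : 'I_p -> 'I_p -> R) : Prop :=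
  forall e, 0 < e -> exists2 d, 0 < d & forall y, D y -> `|y - x| < d ->
    `|f y - f x - \sum_i (y 0 i - x 0 i) * L i
      - 2^-1 * \sum_i \sum_j (y 0 i - x 0 i) * (y 0 j - x 0 j) * H i j|
    <= e * `|y - x| ^+ 2.

Lemma within_cont_in D W f x : relopen D W -> {within W, continuous f} ->
  W x -> cont_in D f x.
Proof.
move=> DW /subspace_continuousP cf Wx e e0.
have := cf x Wx => /cvgrPdist_le/(_ e e0); rewrite near_withinE.
move=> /nbhs_ballP[d /= d0 hd].
have [_ [d' d'0 hd']] := DW x Wx.
exists (Num.min d d'); first by rewrite lt_min d0.
move=> y Dy; rewrite lt_min => /andP[yd yd'].
rewrite distrC; apply: hd; last exact: hd'.
by rewrite -ball_normE /= distrC.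
Qed.

Lemma norm_line x (t : R) i : `|(x + t *: delta_mx 0 i) - x| = `|t|.
Proof. by rewrite addrC addKr normrZ norm_delta mulr1. Qed.

Section Path.
Variables (F : set_system R) (pF : punctured_filter F).
Variables (D : set 'rV[R]_p) (z : R -> 'rV[R]_p) (x v : 'rV[R]_p).
Hypothesis zD : \forall t \near F, D (z t).
Hypothesis zj : forall i, jet1 F (fun t => z t 0 i) (x 0 i) (v 0 i).

Lemma path_lip : \forall t \near F, `|z t - x| <= (`|v| + 1) * `|t|.
Proof.
have h i : \forall t \near F, `|z t 0 i - x 0 i| <= (`|v| + 1) * `|t|.
  have /(jet1P pF)/(_ 1 ltr01) := zj i; apply: filterS => t ht.
  have -> : z t 0 i - x 0 i = (z t 0 i - x 0 i - v 0 i * t) + v 0 i * t by rewrite subrK.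
  apply: le_trans (ler_normD _ _) _; rewrite normrM mulrDl addrC lerD //.
  by rewrite ler_wpM2r // ler_norm_coord.
have hh : \forall t \near F, forall i : 'I_p,
    `|z t 0 i - x 0 i| <= (`|v| + 1) * `|t| by exact: filter_forall h.
apply: filterS hh => t ht.
apply: rV_norm_le => [|i]; first by rewrite mulr_ge0 // addr_ge0.
by rewrite !mxE.
Qed.

Lemma path_close d : 0 < d -> \forall t \near F, `|z t - x| < d.
Proof.
move=> d0; near=> t.
have h1 : `|z t - x| <= (`|v| + 1) * `|t| by near: t; exact: path_lip.
apply: le_lt_trans h1 _; rewrite mulrC -ltr_pdivlMr ?ltr_wpDl //.
by near: t; apply: path_small => //; rewrite divr_gt0 // ltr_wpDl.
Unshelve. all: by end_near. Qed.

(** The remainder is small against [|z t - x|], which [path_lip] bounds by a multiple of [|t|];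
    hence a chain rule for curved paths, at the boundary as well as inside. *)
Lemma hasgrad_path f L : hasgrad D f x L ->
  jet1 F (fun t => f (z t)) (f x) (\sum_i v 0 i * L i).
Proof.
move=> h.
have h1 : jet1 F (fun t => f (z t) - f x - \sum_i (z t 0 i - x 0 i) * L i) 0 0.
  apply/(jet1P pF) => e e0.
  have C0 : 0 < `|v| + 1 by rewrite ltr_wpDl.
  have [d d0 hd] := h (e / (`|v| + 1)) (divr_gt0 e0 C0).
  near=> t.
  have ht : `|z t - x| < d by near: t; exact: path_close.
  have hl : `|z t - x| <= (`|v| + 1) * `|t| by near: t; exact: path_lip.
  have Dt : D (z t) by near: t.
  rewrite subr0 mul0r subr0; apply: le_trans (hd _ Dt ht) _.
  rewrite -mulrA ler_pM2l // mulrC ler_pdivrMr //; by rewrite mulrC in hl.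
have h2 : jet1 F (fun t => \sum_i (z t 0 i - x 0 i) * L i)
    (\sum_i (x 0 i - x 0 i) * L i)
    (\sum_i ((v 0 i - 0) * L i + (x 0 i - x 0 i) * 0)).
  apply: jet1_sum => // i _; apply: jet1M; last exact: jet1_cst.
  by apply: jet1B; [exact: zj | exact: jet1_cst].
have := jet1D (jet1D h1 h2) (jet1_cst pF (f x)).
have -> : 0 + \sum_i (x 0 i - x 0 i) * L i + f x = f x.
  by rewrite big1 ?add0r // => i _; rewrite subrr mul0r.
have -> : 0 + \sum_i ((v 0 i - 0) * L i + (x 0 i - x 0 i) * 0) + 0 = \sum_i v 0 i * L i.
  by rewrite add0r addr0; apply: eq_bigr => i _; rewrite mulr0 addr0 subr0.
by apply: jet1_eq => t; ring.
Unshelve. all: by end_near. Qed.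

Lemma hastaylor_path f L H (a : 'rV[R]_p) :
  (forall i, jet2 F (fun t => z t 0 i) (x 0 i) (v 0 i) (a 0 i)) ->
  hastaylor D f x L H ->
  jet2 F (fun t => f (z t)) (f x) (\sum_i v 0 i * L i)
    (\sum_i a 0 i * L i + \sum_i \sum_j v 0 i * v 0 j * H i j).
Proof.
move=> zj2 h.
have h1 : jet2 F (fun t => f (z t) - f x - \sum_i (z t 0 i - x 0 i) * L i
    - 2^-1 * \sum_i \sum_j (z t 0 i - x 0 i) * (z t 0 j - x 0 j) * H i j) 0 0 0.
  apply/(jet2P pF) => e e0.
  have C0 : 0 < `|v| + 1 by rewrite ltr_wpDl.
  have C20 : 0 < (`|v| + 1) ^+ 2 by rewrite exprn_gt0.
  have [d d0 hd] := h (e / (`|v| + 1) ^+ 2) (divr_gt0 e0 C20).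
  near=> t.
  have ht : `|z t - x| < d by near: t; exact: path_close.
  have hl : `|z t - x| <= (`|v| + 1) * `|t| by near: t; exact: path_lip.
  have Dt : D (z t) by near: t.
  rewrite subr0 !mul0r !subr0; apply: le_trans (hd _ Dt ht) _.
  rewrite -mulrA ler_pM2l // mulrC ler_pdivrMr // -[t ^+ 2]real_normK ?num_real //.
  by rewrite -exprMn [X in _ <= X ^+ 2]mulrC lerXn2r // nnegrE ?mulr_ge0 ?(ltW C0).
have zx i : jet2 F (fun t => z t 0 i - x 0 i) 0 (v 0 i) (a 0 i).
  have := jet2B (zj2 i) (jet2_cst pF (x 0 i)).
  by rewrite subrr !subr0.
have h2 := jet2_sum pF (index_enum 'I_p) (P := xpredT)
  (fun i _ => jet2M (zx i) (jet2_cst pF (L i))).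
have h3 i := jet2_sum pF (index_enum 'I_p) (P := xpredT)
  (fun j _ => jet2M (jet2M (zx i) (zx j)) (jet2_cst pF (H i j))).
have h4 := jet2Z 2^-1 (jet2_sum pF (index_enum 'I_p) (P := xpredT)
  (fun i _ => h3 i)).
have := jet2D (jet2D (jet2D h1 h2) h4) (jet2_cst pF (f x)).
rewrite /= => h5.
have e0 : f x = 0 + \sum_i 0 * L i + 2^-1 * \sum_i \sum_j 0 * 0 * H i j + f x.
  rewrite big1 => [|i _]; last by rewrite mul0r.
  rewrite big1 => [|i _]; first by rewrite mulr0 !add0r.
  by rewrite big1 // => j _; rewrite !mul0r.
have e1 : \sum_i v 0 i * L i = 0 + \sum_i (v 0 i * L i + 0 * 0) +
   2^-1 * \sum_i \sum_j ((v 0 i * 0 + 0 * v 0 j) * H i j + 0 * 0 * 0) + 0.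
  rewrite [X in 2^-1 * X]big1 => [|i _].
    by rewrite !mulr0 !addr0 add0r; apply: eq_bigr => i _; rewrite addr0.
  by rewrite big1 // => j _; rewrite !(mul0r,mulr0,addr0).
have e2 : \sum_i a 0 i * L i + \sum_i \sum_j v 0 i * v 0 j * H i j =
  0 + \sum_i (a 0 i * L i + 2 * v 0 i * 0 + 0 * 0) +
   2^-1 * \sum_i \sum_j ((a 0 i * 0 + 2 * v 0 i * v 0 j + 0 * a 0 j) * H i j +
   2 * (v 0 i * 0 + 0 * v 0 j) * 0 + 0 * 0 * 0) + 0.
  rewrite add0r addr0; congr (_ + _).
    by apply: eq_bigr => i _; rewrite !mulr0 !addr0.
  rewrite mulr_sumr; apply: eq_bigr => i _; rewrite mulr_sumr; apply: eq_bigr => j _.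
  by field.
rewrite {1}e0 e1 e2; move: h5; apply: jet2_eq => t; ring.
Unshelve. all: by end_near. Qed.

End Path.


Lemma orthant_segment S x v t : orthant S x -> orthant S (x + v) -> 0 <= t <= 1 ->
  orthant S (x + t *: v).
Proof.
move=> hx hy /andP[t0 t1] i Si; have := hx i Si; have := hy i Si; rewrite !mxE => h1 h2.
have -> : x 0 i + t * v 0 i = (1 - t) * x 0 i + t * (x 0 i + v 0 i) by ring.
by rewrite addr_ge0 // mulr_ge0 // subr_ge0.
Qed.

Lemma orthant_right S i x t : orthant S x -> 0 <= t -> orthant S (x + t *: delta_mx 0 i).
Proof.
move=> hx t0 j Sj; rewrite !mxE; apply: addr_ge0; first exact: hx.
by rewrite mulr_ge0 // eqxx; case: (j == i).
Qed.

(** Positive increments never leave an orthant. This makes the directional filter proper, also at a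
    boundary point. *)
Lemma dir_right S i x (A : set R) : orthant S x -> dir_filter (orthant S) i x A ->
  0^'+ A.
Proof.
move=> hx [r /= r0 hA]; exists r => //= t tr t0; apply: hA => //.
  by rewrite gt_eqF.
exact: orthant_right hx (ltW t0).
Qed.

Lemma dir_punctured S i x : orthant S x -> punctured_filter (dir_filter (orthant S) i x).
Proof.
move=> hx; split; last first.
  by move=> A [r /= r0 hA]; exists r => //= t tr t0 _; exact: hA.
have hF : Filter (dir_filter (orthant S) i x) by exact: within_filter.
apply: Build_ProperFilter_ex => A hA.
have : 0^'+ A by exact: dir_right hA.
by move=> /filter_ex.
Qed.

Lemma line_coord x v (F : set_system R) (pF : punctured_filter F) j :
  jet1 F (fun t => (x + t *: v) 0 j) (x 0 j) (v 0 j).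
Proof.
by apply: jet1_eq (jet1_lin pF _ _) => t; rewrite !mxE.
Qed.

Lemma line_coord2 x v (F : set_system R) (pF : punctured_filter F) j :
  jet2 F (fun t => (x + t *: v) 0 j) (x 0 j) (v 0 j) 0.
Proof.
by apply: jet2_eq (jet2_lin pF _ _) => t; rewrite !mxE.
Qed.

Lemma sum_delta (i : 'I_p) (L : 'I_p -> R) :
  \sum_j (delta_mx 0 i : 'rV[R]_p) 0 j * L j = L i.
Proof.
rewrite (bigD1 i) //= mxE !eqxx mul1r big1 ?addr0 // => j ji.
by rewrite mxE (negbTE ji) mul0r.
Qed.

Section PartialOrthant.
Variable S : pred 'I_p.
Notation D := (orthant S).

Lemma partialE f x L i : D x ->
  jet1 (dir_filter D i x) (fun t => f (x + t *: delta_mx 0 i)) (f x) L ->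
  partial D i f x = L.
Proof.
move=> Dx h; have pF := dir_punctured i Dx.
by case: h => _ h; exact: (cvg_lim (@Rhausdorff R) h).
Qed.

Lemma dir_relopen W x i : relopen D W -> W x ->
  \forall t \near dir_filter D i x, W (x + t *: delta_mx 0 i).
Proof.
move=> DW Wx; have [Dx [d d0 hd]] := DW x Wx; exists d => //= t td _ Dt.
by apply: hd => //; rewrite norm_line; rewrite /= sub0r normrN in td.
Qed.

Lemma relopen_sub W x : relopen D W -> W x -> D x.
Proof. by move=> h /h []. Qed.

Lemma partial_ext W f g x i : relopen D W -> W x -> (forall y, W y -> f y = g y) ->
  partial D i f x = partial D i g x.
Proof.
move=> DW Wx fg; rewrite /partial; congr (lim _).
have h : \forall t \near dir_filter D i x, diff_quot D i f x t = diff_quot D i g x t.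
  by apply: filterS (dir_relopen i DW Wx) => t Wt; rewrite /diff_quot !fg.
have pF := dir_punctured i (relopen_sub DW Wx).
rewrite eqEsubset; split => A; apply: near_eq_cvg => //.
by apply: filterS h.
Qed.

Lemma cvg_diff_ext W f g x i : relopen D W -> W x -> (forall y, W y -> f y = g y) ->
  cvg (diff_quot D i f x @ dir_filter D i x) ->
  cvg (diff_quot D i g x @ dir_filter D i x).
Proof.
move=> DW Wx fg /cvg_ex[/= l hl]; apply/cvg_ex; exists l.
have pF := dir_punctured i (relopen_sub DW Wx).
apply: cvg_near_to hl.
by apply: filterS (dir_relopen i DW Wx) => t Wt; rewrite /diff_quot !fg.
Qed.

Lemma within_ext W f g : (forall y, W y -> f y = g y) ->
  {within W, continuous f} -> {within W, continuous g}.
Proof.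
move=> fg /subspace_continuousP h; apply/subspace_continuousP => x Wx.
have := h x Wx; rewrite /from_subspace (fg x Wx).
apply: cvg_trans; apply: near_eq_cvg.
by rewrite near_withinE; apply: nearW => y Wy; rewrite fg.
Qed.

Lemma Ck_ext W f g k : relopen D W -> (forall y, W y -> f y = g y) ->
  Ck D W k f -> Ck D W k g.
Proof.
move=> DW; elim: k f g => [|k IH] f g fg /= [hc h]; split => //;
  try exact: within_ext hc.
move=> i; have [h1 h2] := h i; split.
  by move=> x Wx; exact: (cvg_diff_ext DW Wx fg (h1 x Wx)).
by apply: IH h2 => y Wy; exact: (partial_ext i DW Wy fg).
Qed.

Lemma Ck_cont W f k : Ck D W k f -> {within W, continuous f}.
Proof. by case: k => [|k] []. Qed.

Lemma Ck_partial W f k i : Ck D W k.+1 f -> Ck D W k (partial D i f).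
Proof. by move=> [_ /(_ i) []]. Qed.

Lemma Ck_S W f k : Ck D W k.+1 f -> Ck D W k f.
Proof.
elim: k f => [|k IH] f; first by case.
move=> [hc h]; split => // i; have [h1 h2] := h i; split => //; exact: IH.
Qed.

Lemma Ck_jet1 W f k i x : relopen D W -> Ck D W k.+1 f -> W x ->
  jet1 (dir_filter D i x) (fun t => f (x + t *: delta_mx 0 i)) (f x) (partial D i f x).
Proof.
move=> DW [_ /(_ i) [h _]] Wx; split; last exact: h.
by apply: dir_punctured; exact: relopen_sub Wx.
Qed.

(** At an interior parameter of the segment both signs of the increment stay in [W], so the
    restricted derivative is two-sided there and the mean value theorem applies. *)
Lemma seg_jet W f z i s t : relopen D W -> Ck D W 1 f ->
  (forall t, 0 <= t <= s -> W (z + t *: delta_mx 0 i)) -> 0 < t < s ->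
  jet1 0^' (fun h => f (z + (t + h) *: delta_mx 0 i)) (f (z + t *: delta_mx 0 i))
    (partial D i f (z + t *: delta_mx 0 i)).
Proof.
move=> DW hf hW /andP[t0 ts].
have Wt : W (z + t *: delta_mx 0 i) by apply: hW; rewrite !ltW.
have [_ h] := Ck_jet1 i DW hf Wt; split; first exact: punctured_filter_dnbhs.
move=> A /h [r /= r0 hA].
exists (Num.min r (Num.min t (s - t))); first by rewrite /= !lt_min r0 t0 subr_gt0.
move=> h0 /=; rewrite sub0r normrN !lt_min => /and3P[hr ht hs] hn0.
have := hA h0; rewrite /= sub0r normrN => /(_ hr hn0); rewrite -addrA -scalerDl; apply.
apply: relopen_sub DW _; apply: hW.
by move: (ltW ht) (ltW hs); rewrite !ler_norml => /andP[a1 a2] /andP[a3 a4]; lra.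
Qed.

Lemma seg_cont W f z v s : relopen D W -> {within W, continuous f} ->
  (forall t, 0 <= t <= s -> W (z + t *: v)) ->
  {within `[0, s], continuous (fun t => f (z + t *: v))}.
Proof.
move=> DW hf hW; apply: within_itv_eps => t ht e e0.
have [d d0 hd] := within_cont_in DW hf (hW t ht) e0.
have v0 : 0 < `|v| + 1 by rewrite ltr_wpDl.
exists (d / (`|v| + 1)); first by rewrite divr_gt0.
move=> t' ht' tt'; apply: hd; first by apply: relopen_sub DW _; exact: hW.
have -> : z + t' *: v - (z + t *: v) = (t' - t) *: v.
  by rewrite scalerBl opprD addrACA subrr add0r.
rewrite normrZ; rewrite ltr_pdivlMr // in tt'; apply: le_lt_trans tt'.
by rewrite ler_wpM2l // lerDl.
Qed.

Lemma seg_mvt W f z i s : relopen D W -> Ck D W 1 f -> 0 < s ->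
  (forall t, 0 <= t <= s -> W (z + t *: delta_mx 0 i)) ->
  exists2 xi, 0 < xi < s &
    f (z + s *: delta_mx 0 i) - f z = s * partial D i f (z + xi *: delta_mx 0 i).
Proof.
move=> DW hf s0 hW.
have [||xi h1 h2] := @mvt_jet R (fun t => f (z + t *: delta_mx 0 i))
   (fun t => partial D i f (z + t *: delta_mx 0 i)) s s0.
- by move=> t ht; exact: (seg_jet DW hf hW ht).
- exact: (seg_cont DW (Ck_cont hf) hW).
by exists xi => //; move: h2; rewrite scale0r addr0.
Qed.

Lemma seg_mvt_norm W f z i s e c : relopen D W -> Ck D W 1 f ->
  (forall t, 0 <= t <= 1 -> W (z + (t * s) *: delta_mx 0 i) /\
      `|partial D i f (z + (t * s) *: delta_mx 0 i) - c| <= e) ->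
  `|f (z + s *: delta_mx 0 i) - f z - s * c| <= `|s| * e.
Proof.
move=> DW hf h.
have key z' s' : 0 < s' -> (forall t, 0 <= t <= s' -> W (z' + t *: delta_mx 0 i) /\
    `|partial D i f (z' + t *: delta_mx 0 i) - c| <= e) ->
    `|f (z' + s' *: delta_mx 0 i) - f z' - s' * c| <= `|s'| * e.
  move=> s0 h'; have [xi /andP[x0 x1] ->] := @seg_mvt W f z' i s' DW hf s0 (fun t ht => (h' t ht).1).
  rewrite -mulrBr normrM ler_wpM2l //; apply: (h' _ _).2; by rewrite !ltW.
have [s0|s0|s0] := ltrgt0P s; last first.
- rewrite s0 scale0r addr0 subrr mul0r subrr normr0 mul0r //.
- have := key (z + s *: delta_mx 0 i) (- s); rewrite oppr_gt0 => /(_ s0).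
  rewrite -[X in f X - f _]addrA -scalerDl subrr scale0r addr0 normrN (ltr0_norm s0).
  have -> : f z - f (z + s *: delta_mx 0 i) - - s * c =
     - (f (z + s *: delta_mx 0 i) - f z - s * c) by ring.
  rewrite normrN; apply => t /andP[t0 ts].
  have := h (1 + t / s); rewrite -addrA -scalerDl.
  have -> : (1 + t / s) * s = s + t by field; lra.
  apply; apply/andP; split; last by rewrite gerDl mulr_ge0_le0 // invr_le0 ltW.
  by rewrite -lerBlDl sub0r ler_ndivlMr // mulN1r.
- rewrite -[X in _ <= X * e](gtr0_norm s0); apply: key => // t /andP[t0 ts].
  have := h (t / s); rewrite divfK ?gt_eqF //; apply.
  by rewrite divr_ge0 ?(ltW s0) //= ler_pdivrMr ?mul1r.
Qed.

(** Coordinates are changed one at a time. An orthant is a product, so the intermediate points stay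
    in it; in the sup norm they are no farther from [x] than [y] is. *)
Lemma Ck1_hasgrad W f x : relopen D W -> Ck D W 1 f -> W x ->
  hasgrad D f x (fun i => partial D i f x).
Proof.
move=> DW hf Wx e e0.
have p0 : 0 < p%:R + 1 :> R by rewrite ltr_wpDl.
have [Dx [d d0 hd]] := DW x Wx.
have hc i : exists2 d, 0 < d & forall y, D y -> `|y - x| < d ->
   `|partial D i f y - partial D i f x| <= e / (p%:R + 1).
  apply: (within_cont_in DW _ Wx); last by rewrite divr_gt0.
  exact: Ck_cont (Ck_partial i hf).
have [dd hdd] := choice (fun i => let: ex_intro2 d a b := hc i in
   ex_intro (fun d => 0 < d /\ forall y, D y -> `|y - x| < d ->
   `|partial D i f y - partial D i f x| <= e / (p%:R + 1)) d (conj a b)).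
pose dm := \big[Num.min/d]_i dd i.
have dm0 : 0 < dm by apply: lt_bigmin => // i _; exact: (hdd i).1.
exists dm => // y Dy yx.
pose z k : 'rV[R]_p := \row_i if (i < k)%N then y 0 i else x 0 i.
have zS (i : 'I_p) : z i.+1 = z i + (y 0 i - x 0 i) *: delta_mx 0 i.
  apply/rowP => j; rewrite !mxE eqxx /= ltnS leq_eqVlt.
  have [->|ne] := eqVneq j i; first by rewrite eqxx ltnn /= mulr1 subrKC.
  rewrite mulr0 addr0; suff -> : (j == i :> nat) = false by [].
  by apply/eqP => h; move/eqP: ne; apply; exact: val_inj.
have zin (i : 'I_p) t : 0 <= t <= 1 ->
   D (z i + (t * (y 0 i - x 0 i)) *: delta_mx 0 i) /\
   `|z i + (t * (y 0 i - x 0 i)) *: delta_mx 0 i - x| <= `|y - x|.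
  move=> /andP[t0 t1]; split.
    move=> j Sj; rewrite !mxE eqxx /=.
    have hx := Dx j Sj; have hy := Dy j Sj.
    have [je|ne] := eqVneq j i.
      rewrite -je ltnn mulr1.
      have -> : x 0 j + t * (y 0 j - x 0 j) = (1 - t) * x 0 j + t * y 0 j by ring.
      by rewrite addr_ge0 // mulr_ge0 // subr_ge0.
    by rewrite mulr0 addr0; case: ifP.
  apply: rV_norm_le => // j; rewrite !mxE eqxx /=.
  have := ler_norm_coord (y - x) j; rewrite !mxE => hj.
  have [je|ne] := eqVneq j i.
    rewrite -je ltnn mulr1 addrAC subrr add0r normrM ger0_norm //.
    by apply: le_trans hj; rewrite ler_piMl.
  by rewrite mulr0 addr0; case: ifP => _ //; rewrite subrr normr0.
have dmi i : dm <= dd i by exact: bigmin_le_cond.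
have dmd : dm <= d by exact: bigmin_le_id.
have step (i : 'I_p) : `|f (z i.+1) - f (z i) - (y 0 i - x 0 i) * partial D i f x|
   <= `|y 0 i - x 0 i| * (e / (p%:R + 1)).
  rewrite zS; apply: seg_mvt_norm DW hf _ => t ht.
  have [h1 h2] := zin i t ht; have h3 := le_lt_trans h2 yx; split.
    by apply: hd => //; exact: lt_le_trans dmd.
  by apply: (hdd i).2 => //; exact: lt_le_trans (dmi i).
have -> : f y - f x = \sum_(i < p) (f (z i.+1) - f (z i)).
  rewrite -(big_mkord xpredT (fun i => f (z i.+1) - f (z i))) telescope_sumr //.
  congr (f _ - f _); apply/rowP => i; rewrite !mxE ?ltn_ord ?ltn0 //.
rewrite -sumrB; apply: le_trans (ler_norm_sum _ _ _) _.
apply: (@le_trans _ _ (\sum_(i < p) `|y - x| * (e / (p%:R + 1)))).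
  apply: ler_sum => i _; apply: le_trans (step i) _; rewrite ler_wpM2r //.
    by rewrite ltW // divr_gt0.
  by have := ler_norm_coord (y - x) i; rewrite !mxE.
rewrite sumr_const card_ord -[_ *+ p]mulr_natr.
have -> : `|y - x| * (e / (p%:R + 1)) * p%:R = (e * (p%:R / (p%:R + 1))) * `|y - x|.
  by field; rewrite gt_eqF.
rewrite ler_wpM2r // ler_piMr ?(ltW e0) // ler_pdivrMr // mul1r; lra.
Qed.


(** The double difference is symmetric in [i] and [j], so its limit yields the symmetry of second
    derivatives. Only positive steps are taken, which keeps all four corners in the orthant at a
    boundary point. *)
Lemma double_diff_cvg W f x i j : relopen D W -> Ck D W 2 f -> W x ->
  (fun t => t^-2 * (f (x + t *: delta_mx 0 i + t *: delta_mx 0 j)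
     - f (x + t *: delta_mx 0 i) - f (x + t *: delta_mx 0 j) + f x)) @ 0^'+
  --> partial D i (partial D j f) x.
Proof.
move=> DW hf Wx; apply/cvgrPdist_le => e e0.
have e40 : 0 < e / 4 by rewrite divr_gt0.
have [d1 d10 hd1] := Ck1_hasgrad DW (Ck_partial j hf) Wx e40.
have [Dx [d2 d20 hd2]] := DW x Wx.
near=> t.
have t0 : 0 < t by near: t; exact: nbhs_right_gt.
have t1 : t < d1 / 2 by near: t; apply: nbhs_right_lt; rewrite divr_gt0.
have t2 : t < d2 / 2 by near: t; apply: nbhs_right_lt; rewrite divr_gt0.
have ball a b : 0 <= a <= t -> 0 <= b <= t ->
   D (x + a *: delta_mx 0 i + b *: delta_mx 0 j) /\
   `|x + a *: delta_mx 0 i + b *: delta_mx 0 j - x| <= 2 * t.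
  move=> /andP[a0 at0] /andP[b0 bt0]; split.
    by apply: orthant_right => //; exact: orthant_right.
  rewrite addrAC [x + _ - x]addrAC subrr add0r; apply: le_trans (ler_normD _ _) _.
  by rewrite !normrZ !norm_delta !mulr1 !ger0_norm //; lra.
have Wball a b : 0 <= a <= t -> 0 <= b <= t ->
   W (x + a *: delta_mx 0 i + b *: delta_mx 0 j).
  by move=> ha hb; have [h1 h2] := ball a b ha hb; apply: hd2 => //; lra.
have tt : 0 <= t <= t by rewrite lexx ltW.
have zt : (0 : R) <= 0 <= t by apply/andP; split; [exact: lexx | exact: ltW].
pose z1 := x + t *: delta_mx 0 i; pose z0 := x + 0 *: delta_mx 0 i.
have hf1 : Ck D W 1 f by exact: Ck_S.
(* The mean value theorem in direction [j], for the difference of [f] along two parallel sides; the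
   expansion of the [j]-th partial at [x] then evaluates the result. *)
have [||xi /andP[x0 xt] hx] := @mvt_jet R (fun s => f (z1 + s *: delta_mx 0 j) - f (z0 + s *: delta_mx 0 j))
   (fun s => partial D j f (z1 + s *: delta_mx 0 j) - partial D j f (z0 + s *: delta_mx 0 j)) t t0.
- move=> s hs; apply: jet1B; apply: (seg_jet DW hf1 _ hs) => s' hs'; exact: Wball.
- move=> s; apply: cvgB.
    apply: (seg_cont (z := z1) DW (Ck_cont hf)) => s' hs'; exact: Wball.
  apply: (seg_cont (z := z0) DW (Ck_cont hf)) => s' hs'; exact: Wball.
have hxi : 0 <= xi <= t by rewrite !ltW.
have [D1 n1] := ball t xi tt hxi; have [D0 n0] := ball 0 xi zt hxi.
have h1 := hd1 _ D1 (le_lt_trans n1 _); have h0 := hd1 _ D0 (le_lt_trans n0 _).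
have t2d : 2 * t < d1 by lra.
move: (h1 t2d) (h0 t2d) => {}h1 {}h0.
have {}h1 := le_trans h1 (ler_wpM2l (ltW e40) n1).
have {}h0 := le_trans h0 (ler_wpM2l (ltW e40) n0).
move: h1 h0 hx; rewrite /z1 /z0 !scale0r !addr0.
set S1 := \sum_k _; set S0 := \sum_k _.
have SE : S1 - S0 = t * partial D i (partial D j f) x.
  rewrite /S1 /S0 -sumrB -(sum_delta i (fun k => partial D k (partial D j f) x)) mulr_sumr.
  by apply: eq_bigr => k _; rewrite !mxE; ring.
set a1 := partial D j f _; set a0 := partial D j f (x + xi *: _); set ax := partial D j f x.
set Li := partial D i (partial D j f) x in SE *.
set f11 := f (_ + _ + _); set f10 := f (x + t *: delta_mx 0 i); set f01 := f (x + t *: delta_mx 0 j).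
move=> h1 h0 hx.
have -> : f11 - f10 - f01 + f x = t * (a1 - a0) by rewrite -hx; ring.
have -> : Li - t^-2 * (t * (a1 - a0)) = - ((a1 - a0 - t * Li) / t) by field; lra.
rewrite normrN normrM normfV (gtr0_norm t0) ler_pdivrMr //.
move: h1 h0; rewrite !ler_norml => /andP[b1 b2] /andP[b3 b4].
by apply/andP; split; lra.
Unshelve. all: by end_near. Qed.

Lemma young W f x i j : relopen D W -> Ck D W 2 f -> W x ->
  partial D i (partial D j f) x = partial D j (partial D i f) x.
Proof.
move=> DW hf Wx; have h1 := @double_diff_cvg W f x i j DW hf Wx.
have h2 := @double_diff_cvg W f x j i DW hf Wx.
apply: (cvg_unique _ h1); first exact: Rhausdorff.
apply: cvg_trans h2; apply: near_eq_cvg; apply: nearW => t.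
by congr (_ * _); rewrite [x + t *: _ + _]addrAC; ring.
Qed.

(** The mean value theorem is applied to [f] minus its quadratic part along the segment to [y]; the
    first-order expansions of the partial derivatives at [x] bound the derivative that it
    produces. *)
Lemma Ck2_taylor W f x : relopen D W -> Ck D W 2 f -> W x ->
  hastaylor D f x (fun i => partial D i f x)
    (fun i j => partial D j (partial D i f) x).
Proof.
move=> DW hf Wx e e0.
have p0 : 0 < p%:R + 1 :> R by rewrite ltr_wpDl.
have [Dx [d d0 hd]] := DW x Wx.
have ep : 0 < e / (p%:R + 1) by rewrite divr_gt0.
have hc i := Ck1_hasgrad DW (Ck_partial i hf) Wx ep.
have [dd hdd] := choice (fun i => let: ex_intro2 d a b := hc i in
   ex_intro (fun d => 0 < d /\ forall y, D y -> `|y - x| < d ->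
    `|partial D i f y - partial D i f x -
       \sum_j (y 0 j - x 0 j) * partial D j (partial D i f) x|
    <= e / (p%:R + 1) * `|y - x|) d (conj a b)).
pose dm := \big[Num.min/d]_i dd i.
have dm0 : 0 < dm by apply: lt_bigmin => // i _; exact: (hdd i).1.
have dmi i : dm <= dd i by exact: bigmin_le_cond.
have dmd : dm <= d by exact: bigmin_le_id.
exists dm => // y Dy yx.
pose v := y - x.
have yE : y = x + v by rewrite /v subrKC.
have line s : 0 <= s <= 1 -> [/\ D (x + s *: v), W (x + s *: v) &
    `|x + s *: v - x| <= s * `|v|].
  move=> hs; have h1 : D (x + s *: v) by apply: orthant_segment => //; rewrite -yE.
  have [s0 s1] := andP hs.
  have h2 : `|x + s *: v - x| <= s * `|v| by rewrite addrC addKr normrZ ger0_norm.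
  split=> //; apply: hd => //; apply: le_lt_trans h2 _.
  by apply: le_lt_trans (lt_le_trans yx dmd); rewrite ler_piMl.
pose c1 := \sum_i v 0 i * partial D i f x.
pose c2 := \sum_i \sum_j v 0 i * v 0 j * partial D j (partial D i f) x.
have hf1 : Ck D W 1 f by exact: Ck_S.
have [||xi /andP[x0 x1] hx] := @mvt_jet R (fun s => f (x + s *: v) - (s * c1 + 2^-1 * (s * s) * c2))
   (fun s => \sum_i v 0 i * partial D i f (x + s *: v) - (c1 + s * c2)) 1 ltr01.
- move=> s /andP[s0 s1]; have hs : 0 <= s <= 1 by rewrite !ltW.
  have [Ds Ws _] := line s hs.
  have pF := punctured_filter_dnbhs R.
  apply: jet1B.
    apply: (@jet1_eq _ _ (fun h => f ((x + s *: v) + h *: v))) => [h|].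
      by rewrite -addrA -scalerDl.
    apply: (hasgrad_path pF (D := D)).
    + exists (Num.min s (1 - s)); first by rewrite /= lt_min s0 subr_gt0.
      move=> h /=; rewrite sub0r normrN lt_min => /andP[h1 h2] _.
      rewrite -addrA -scalerDl.
      have [] // := line (s + h); move: (ltW h1) (ltW h2).
      by rewrite !ler_norml => /andP[a1 a2] /andP[a3 a4]; lra.
    + by move=> i; exact: line_coord.
    + exact: (Ck1_hasgrad DW hf1 Ws).
  have c20 : 0 < `|c2 / 2| + 1 by rewrite ltr_wpDl.
  apply/(jet1P pF) => e' e'0; near=> h.
  have -> : (s + h) * c1 + 2^-1 * ((s + h) * (s + h)) * c2 - (s * c1 + 2^-1 * (s * s) * c2)
    - (c1 + s * c2) * h = h * (h * c2 / 2) by field.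
  rewrite normrM mulrC ler_wpM2r // -mulrA normrM.
  apply: (@le_trans _ _ (`|h| * (`|c2 / 2| + 1))); first by rewrite ler_wpM2l // lerDl.
  rewrite -ler_pdivlMr //; near: h.
  apply: filterS (path_small pF (divr_gt0 e'0 c20)) => h; exact: ltW.
- move=> s; apply: cvgB.
    by apply: (seg_cont DW (Ck_cont hf)) => s' hs'; have [] := line s' hs'.
  have hP : continuous (fun s' : R => s' * c1 + 2^-1 * (s' * s') * c2).
    move=> s'; apply: cvgD; first by apply: cvgM; [exact: cvg_id | exact: cvg_cst].
    apply: cvgM; last exact: cvg_cst.
    by apply: cvgM; [exact: cvg_cst | apply: cvgM; exact: cvg_id].
  have hP1 : {within `[0, 1], continuous (fun s' : R => s' * c1 + 2^-1 * (s' * s') * c2)}.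
    exact: continuous_subspaceT hP.
  exact: hP1.
have hxi : 0 <= xi <= 1 by rewrite !ltW.
have [Dxi Wxi nxi] := line xi hxi.
move: hx; rewrite !scale1r !scale0r !mul0r !mulr0 !mul0r !mul1r !addr0 -yE subr0 mulr1 => hx.
have vE i : v 0 i = y 0 i - x 0 i by rewrite /v !mxE.
under eq_bigr do rewrite -vE.
under [X in _ - _ * X]eq_bigr do under eq_bigr do rewrite -!vE.
rewrite -/c1 -/c2.
have -> : f y - f x - c1 - 2^-1 * c2 = f y - (c1 + 2^-1 * c2) - f x by ring.
rewrite hx.
have -> : \sum_i v 0 i * partial D i f (x + xi *: v) - (c1 + xi * c2) =
  \sum_i v 0 i * (partial D i f (x + xi *: v) - partial D i f x -
    \sum_j ((x + xi *: v) 0 j - x 0 j) * partial D j (partial D i f) x).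
  rewrite /c1 /c2 mulr_sumr -big_split -sumrB /=; apply: eq_bigr => i _.
  rewrite !mulrBr -addrA -opprD; congr (_ - (_ + _)).
  rewrite !mulr_sumr; apply: eq_bigr => j _; rewrite !mxE; ring.
apply: le_trans (ler_norm_sum _ _ _) _.
apply: (@le_trans _ _ (\sum_(i < p) `|v| * (e / (p%:R + 1) * `|v|))).
  apply: ler_sum => i _; rewrite normrM ler_pM //; first exact: ler_norm_coord.
  apply: le_trans ((hdd i).2 _ Dxi _) _.
    apply: le_lt_trans nxi _; apply: le_lt_trans (lt_le_trans yx (dmi i)).
    by rewrite ler_piMl // ltW.
  rewrite ler_wpM2l ?(ltW ep) //; apply: le_trans nxi _; by rewrite ler_piMl // ltW.
rewrite sumr_const card_ord -[_ *+ p]mulr_natr -/v.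
have -> : `|v| * (e / (p%:R + 1) * `|v|) * p%:R = (e * (p%:R / (p%:R + 1))) * `|v| ^+ 2.
  by field; rewrite gt_eqF.
rewrite ler_wpM2r ?exprn_ge0 // ler_piMr ?(ltW e0) // ler_pdivrMr // mul1r; lra.
Unshelve. all: by end_near. Qed.

End PartialOrthant.

End Orthant.

Section JetInverse.
Variables (R : realType) (F : set_system R).
Implicit Types phi : R -> R.

Lemma jet1V phi c0 c1 : c0 != 0 -> jet1 F phi c0 c1 ->
  jet1 F (fun t => (phi t)^-1) c0^-1 (- c1 * (c0^-1 * c0^-1)).
Proof.
move=> c00 h; have hc := jet1_cvg h; case: h => pF h; split=> //.
apply: cvg_near_to (cvgM (cvgN h) (cvgM (cvgV c00 hc) (cvg_cst c0^-1))).
have hn : \forall t \near F, phi t != 0.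
  have := c00; rewrite -normr_gt0 => c0n; have /cvgrPdist_lt/(_ _ c0n) := hc.
  by apply: filterS => t; apply: contraTneq => ->; rewrite subr0 ltxx.
apply: filterS2 hn (path_neq0 pF) => t t0 tn; rewrite !fctE /=; field.
by rewrite ?c00 ?t0 ?tn.
Qed.

Lemma jet1_sqrt phi c0 c1 : 0 < c0 -> jet1 F phi c0 c1 ->
  jet1 F (fun t => Num.sqrt (phi t)) (Num.sqrt c0) (c1 * (2 * Num.sqrt c0)^-1).
Proof.
move=> c00 h; have hc := jet1_cvg h; case: h => pF h; split=> //.
have hs : (fun t => Num.sqrt (phi t)) @ F --> Num.sqrt c0.
  by apply: continuous_cvg => //; exact: sqrt_continuous.
have s0 : 0 < Num.sqrt c0 by rewrite sqrtr_gt0.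
have sn0 : Num.sqrt c0 + Num.sqrt c0 != 0 by rewrite gt_eqF // addr_gt0.
rewrite (_ : 2 * Num.sqrt c0 = Num.sqrt c0 + Num.sqrt c0); last by ring.
apply: cvg_near_to (cvgM h (cvgV sn0 (cvgD hs (cvg_cst (Num.sqrt c0))))).
have hn : \forall t \near F, 0 < phi t.
  have /cvgrPdist_lt/(_ _ c00) := hc; apply: filterS => t.
  by rewrite ltr_norml => /andP[]; lra.
apply: filterS hn => t t0; rewrite !fctE /=.
have st : 0 < Num.sqrt (phi t) by rewrite sqrtr_gt0.
have e1 : phi t = Num.sqrt (phi t) ^+ 2 by rewrite sqr_sqrtr // ltW.
have e2 : c0 = Num.sqrt c0 ^+ 2 by rewrite sqr_sqrtr // ltW.
rewrite {1}e1 {1}e2 subr_sqr -!mulrA mulfV ?mulr1 //.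
by rewrite gt_eqF // addr_gt0.
Qed.

End JetInverse.

(** * Algebra of functions of class C^k *)

Section CkAlgebra.
Variables (R : realType) (p : nat) (S : pred 'I_p) (W : set 'rV[R]_p).
Notation D := (orthant S).
Hypothesis DW : relopen D W.
Implicit Types f g : 'rV[R]_p -> R.

(** The common entry of the closure rules: [partial] is a limit whose value is known on [W] only, so
    the candidate derivative is exchanged for it through [Ck_ext]. *)
Lemma Ck_succ f df k : {within W, continuous f} ->
  (forall i x, W x -> jet1 (dir_filter D i x)
    (fun t => f (x + t *: delta_mx 0 i)) (f x) (df i x)) ->
  (forall i, Ck D W k (df i)) -> Ck D W k.+1 f.
Proof.
move=> hc hj hk; split=> // i; split.
  by move=> x Wx; case: (hj i x Wx) => _ h; apply/cvg_ex; exists (df i x).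
apply: (Ck_ext DW _ (hk i)) => x Wx; apply/esym/partialE; last exact: hj.
exact: relopen_sub DW Wx.
Qed.

Lemma Ck_cst k (c : R) : Ck D W k (fun=> c).
Proof.
elim: k c => [|k IH] c; first by split=> // x; exact: cvg_cst.
apply: (@Ck_succ _ (fun _ _ => 0)) => [|i x Wx|//].
  by move=> x; exact: cvg_cst.
apply: jet1_cst; apply: dir_punctured; exact: relopen_sub DW Wx.
Qed.

Lemma CkD k f g : Ck D W k f -> Ck D W k g -> Ck D W k (fun x => f x + g x).
Proof.
elim: k f g => [|k IH] f g hf hg.
  split=> //; have cf := Ck_cont hf; have cg := Ck_cont hg.
  by move=> x; apply: cvgD; [exact: cf | exact: cg].
have cf := Ck_cont hf; have cg := Ck_cont hg.
apply: (@Ck_succ _ (fun i x => partial D i f x + partial D i g x)).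
- by move=> x; apply: cvgD; [exact: cf | exact: cg].
- by move=> i x Wx; apply: jet1D; [exact: (Ck_jet1 i DW hf Wx) | exact: (Ck_jet1 i DW hg Wx)].
- by move=> i; apply: IH; exact: Ck_partial.
Qed.

Lemma CkM k f g : Ck D W k f -> Ck D W k g -> Ck D W k (fun x => f x * g x).
Proof.
elim: k f g => [|k IH] f g hf hg; have cf := Ck_cont hf; have cg := Ck_cont hg.
  by split=> //; move=> x; apply: cvgM; [exact: cf | exact: cg].
apply: (@Ck_succ _ (fun i x => partial D i f x * g x + f x * partial D i g x)).
- by move=> x; apply: cvgM; [exact: cf | exact: cg].
- by move=> i x Wx; apply: jet1M; [exact: (Ck_jet1 i DW hf Wx) | exact: (Ck_jet1 i DW hg Wx)].
- move=> i; apply: CkD; apply: IH => //; by [exact: Ck_partial | exact: Ck_S].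
Qed.

Lemma CkV k f : (forall x, W x -> f x != 0) -> Ck D W k f ->
  Ck D W k (fun x => (f x)^-1).
Proof.
move=> f0; have hcV : forall f : 'rV[R]_p -> R, (forall x, W x -> f x != 0) -> {within W, continuous f} ->
   {within W, continuous (fun x => (f x)^-1)}.
  move=> h h0 /subspace_continuousP hc; apply/subspace_continuousP => x Wx.
  by apply: cvgV; [exact: h0 | exact: hc].
elim: k f f0 => [|k IH] f f0 hf; have cf := Ck_cont hf.
  by split=> //; exact: hcV.
apply: (@Ck_succ _ (fun i x => - 1 * partial D i f x * ((f x)^-1 * (f x)^-1))).
- exact: hcV.
- move=> i x Wx; rewrite mulN1r; apply: jet1V; first exact: f0.
  exact: (Ck_jet1 i DW hf Wx).
- move=> i; have hi := IH f f0 (Ck_S hf); apply: CkM; last exact: CkM.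
  by apply: CkM; [exact: Ck_cst | exact: Ck_partial].
Qed.

Lemma Ck_sqrt k f : (forall x, W x -> 0 < f x) -> Ck D W k f ->
  Ck D W k (fun x => Num.sqrt (f x)).
Proof.
move=> f0; have hcV : {within W, continuous f} ->
   {within W, continuous (fun x => Num.sqrt (f x))}.
  move=> /subspace_continuousP hc; apply/subspace_continuousP => x Wx.
  by apply: continuous_cvg; [exact: sqrt_continuous | exact: hc].
elim: k => [|k IH] hf; have cf := Ck_cont hf.
  by split=> //; exact: hcV.
apply: (@Ck_succ _ (fun i x => partial D i f x * (2 * Num.sqrt (f x))^-1)).
- exact: hcV.
- by move=> i x Wx; apply: jet1_sqrt; [exact: f0 | exact: (Ck_jet1 i DW hf Wx)].
- move=> i; have hi := IH (Ck_S hf); apply: CkM; first exact: Ck_partial.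
  apply: CkV; last by apply: CkM => //; exact: Ck_cst.
  by move=> x Wx; rewrite gt_eqF // mulr_gt0 // sqrtr_gt0 f0.
Qed.

Lemma CkN k f : Ck D W k f -> Ck D W k (fun x => - f x).
Proof.
move=> h; apply: (Ck_ext DW _ (CkM (Ck_cst k (- 1)) h)) => x _.
by rewrite mulN1r.
Qed.

Lemma CkB k f g : Ck D W k f -> Ck D W k g -> Ck D W k (fun x => f x - g x).
Proof. by move=> hf hg; apply: CkD => //; exact: CkN. Qed.

Lemma CkZ k c f : Ck D W k f -> Ck D W k (fun x => c * f x).
Proof. by move=> hf; apply: CkM => //; exact: Ck_cst. Qed.

Lemma Ck_sum k (I : Type) (r : seq I) (P : pred I) (f : I -> 'rV[R]_p -> R) :
  (forall i, P i -> Ck D W k (f i)) -> Ck D W k (fun x => \sum_(i <- r | P i) f i x).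
Proof.
move=> h; elim: r => [|i r IH].
  by apply: (Ck_ext DW _ (Ck_cst k 0)) => x _; rewrite big_nil.
case Pi: (P i).
  by apply: (Ck_ext DW _ (CkD (h i Pi) IH)) => x _; rewrite big_cons Pi.
by apply: (Ck_ext DW _ IH) => x _; rewrite big_cons Pi.
Qed.

Lemma Ck_prod k (I : Type) (r : seq I) (P : pred I) (f : I -> 'rV[R]_p -> R) :
  (forall i, P i -> Ck D W k (f i)) -> Ck D W k (fun x => \prod_(i <- r | P i) f i x).
Proof.
move=> h; elim: r => [|i r IH].
  by apply: (Ck_ext DW _ (Ck_cst k 1)) => x _; rewrite big_nil.
case Pi: (P i).
  by apply: (Ck_ext DW _ (CkM (h i Pi) IH)) => x _; rewrite big_cons Pi.
by apply: (Ck_ext DW _ IH) => x _; rewrite big_cons Pi.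
Qed.

Lemma Ck_det k q (A : 'rV[R]_p -> 'M[R]_q) :
  (forall i j, Ck D W k (fun x => A x i j)) -> Ck D W k (fun x => \det (A x)).
Proof.
move=> h; apply: Ck_sum => s _; apply: CkM; first exact: Ck_cst.
by apply: Ck_prod => i _; exact: h.
Qed.

Lemma Ck_invmx k q (A : 'rV[R]_p -> 'M[R]_q) :
  (forall x, W x -> A x \in unitmx) ->
  (forall i j, Ck D W k (fun x => A x i j)) ->
  forall i j, Ck D W k (fun x => invmx (A x) i j).
Proof.
move=> hu h i j.
have hd : Ck D W k (fun x => (\det (A x))^-1).
  by apply: CkV; [move=> x /hu; rewrite unitmxE unitfE | exact: Ck_det].
have hc : Ck D W k (fun x => cofactor (A x) j i).
  apply: CkM; first exact: Ck_cst.
  apply: Ck_det => a b; apply: (Ck_ext DW _ (h (lift j a) (lift i b))) => x _.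
  by rewrite !mxE.
apply: (Ck_ext DW _ (CkM hd hc)) => x Wx.
by rewrite /invmx hu // !mxE.
Qed.

Lemma Ck_le k l f : (k <= l)%N -> Ck D W l f -> Ck D W k f.
Proof.
move=> /subnK <-; elim: (l - k)%N => [//|j IH] h; apply: IH; exact: Ck_S.
Qed.

Lemma Ck_bounded k f (K : set 'rV[R]_p) : Ck D W k f -> compact K -> K `<=` W ->
  exists C, forall x, K x -> `|f x| <= C.
Proof.
move=> /Ck_cont hf Kc KW.
have hK : {within K, continuous f} by exact: continuous_subspaceW hf.
have /compact_bounded [M [_ hM]] := continuous_compact hK Kc.
exists (M + 1) => x Kx; apply: hM; first by rewrite ltrDl.
by exists x.
Qed.

End CkAlgebra.

Lemma Ck_sub (R : realType) (p : nat) (S : pred 'I_p) (W W' : set 'rV[R]_p) k f :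
  relopen (orthant S) W -> relopen (orthant S) W' -> W' `<=` W ->
  Ck (orthant S) W k f -> Ck (orthant S) W' k f.
Proof.
move=> DW DW' sub; elim: k f => [|k IH] f [hc h]; split=> //;
  try exact: continuous_subspaceW hc.
move=> i; have [h1 h2] := h i; split; last exact: IH.
by move=> x /sub; exact: h1.
Qed.

(** * Eigenvalues of a symmetric form with respect to a metric *)

Section Pencil.
Variables (R : realType) (n : nat).
Implicit Types (G U : 'M[R]_n) (v w : 'rV[R]_n).

Definition bil G v w : R := (v *m G *m w^T) 0 0.

Lemma bilDl G u v w : bil G (u + v) w = bil G u w + bil G v w.
Proof. by rewrite /bil !mulmxDl mxE. Qed.

Lemma bilDr G u v w : bil G u (v + w) = bil G u v + bil G u w.
Proof. by rewrite /bil linearD mulmxDr mxE. Qed.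

Lemma bilZl G a v w : bil G (a *: v) w = a * bil G v w.
Proof. by rewrite /bil -!scalemxAl mxE. Qed.

Lemma bilZr G a v w : bil G v (a *: w) = a * bil G v w.
Proof. by rewrite /bil linearZ /= -scalemxAr mxE. Qed.

Lemma bilC G v w : G^T = G -> bil G v w = bil G w v.
Proof.
move=> sG; rewrite /bil -[in RHS]sG -[w in RHS]trmxK -!trmx_mul mulmxA.
by rewrite [RHS]mxE.
Qed.

Lemma bilE G v w : bil G v w = \sum_i \sum_j v 0 i * G i j * w 0 j.
Proof.
rewrite /bil mxE exchange_big; apply: eq_bigr => j _.
by rewrite !mxE mulr_suml.
Qed.

Lemma sum_cont (T : topologicalType) (I : Type) (r : seq I) (f : I -> T -> R) :
  (forall i, continuous (f i)) -> continuous (fun x => \sum_(i <- r) f i x).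
Proof.
move=> hf; elim: r => [|i r IH] x.
  by under eq_fun do rewrite big_nil; exact: cvg_cst.
under eq_fun do rewrite big_cons; apply: cvgD; [exact: hf | exact: IH].
Qed.

Lemma coordM_cont (T : topologicalType) (f : T -> 'rV[R]_n) i (c : R) :
  continuous f -> continuous (fun x => f x 0 i * c).
Proof.
move=> hf x; apply: cvgM; last exact: cvg_cst.
apply: (@continuous_cvg _ _ _ _ _ f (fun M : 'rV[R]_n => M 0 i)); last exact: hf.
exact: coord_continuous.
Qed.

Lemma bil_continuous G (T : topologicalType) (f g : T -> 'rV[R]_n) :
  continuous f -> continuous g -> continuous (fun x => bil G (f x) (g x)).
Proof.
move=> hf hg; have -> : (fun x => bil G (f x) (g x)) =
    (fun x => \sum_i \sum_j f x 0 i * G i j * g x 0 j) by apply/funext => x; exact: bilE.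
apply: sum_cont => i; apply: sum_cont => j x.
apply: cvgM; first apply: cvgM.
- apply: (@continuous_cvg _ _ _ _ _ f (fun M : 'rV[R]_n => M 0 i)); last exact: hf.
  exact: coord_continuous.
- exact: cvg_cst.
- apply: (@continuous_cvg _ _ _ _ _ g (fun M : 'rV[R]_n => M 0 j)); last exact: hg.
  exact: coord_continuous.
Qed.

Definition posdef G := forall v, v != 0 -> 0 < bil G v v.

Lemma posdef_ge0 G v : posdef G -> 0 <= bil G v v.
Proof.
move=> hG; have [->|v0] := eqVneq v 0; last exact/ltW/hG.
by rewrite /bil !mul0mx mxE.
Qed.

Lemma quad_nonpos (b c : R) : (forall t, 2 * t * b + t ^+ 2 * c <= 0) -> b = 0.
Proof.
move=> h; apply/eqP/negPn/negP => b0.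
pose k := `|c| + 1; have k0 : 0 < k by rewrite ltr_wpDl.
have := h (b / k); have -> : 2 * (b / k) * b + (b / k) ^+ 2 * c = (b / k) ^+ 2 * (2 * k + c).
  by field; rewrite gt_eqF.
apply/negP; rewrite -ltNge mulr_gt0 //.
  by rewrite exprn_even_gt0 //= mulf_neq0 // invr_eq0 gt_eqF.
have := ler_norm (- c); rewrite normrN /k; have := normr_ge0 c; lra.
Qed.

(** The next eigenvector maximizes the Rayleigh quotient of [U] over [G] on the [G]-orthogonal
    complement of the rows of [Q], which is nonzero because [k < n]. *)
Lemma pencil_step G U k (Q : 'M[R]_(k, n)) l : (k < n)%N ->
  G^T = G -> U^T = U -> posdef G -> Q *m G *m Q^T = 1%:M ->
  Q *m U = diag_mx l *m Q *m G ->
  exists v mu, [/\ bil G v v = 1, v *m G *m Q^T = 0 & v *m U = mu *: (v *m G)].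
Proof.
move=> kn sG sU hG hQ hQU.
pose A : 'M[R]_(n, k) := G *m Q^T.
(* The quotient is homogeneous of degree zero, so the unit sphere of the complement, which is
   compact, suffices. *)
pose B := [set v : 'rV[R]_n | `|v| = 1 /\ v *m A = 0].
have [v1 v10 v1A] : exists2 v : 'rV[R]_n, v != 0 & v *m A = 0.
  have : kermx A != 0.
    rewrite -mxrank_eq0 mxrank_ker subn_eq0 -ltnNge.
    by apply: leq_ltn_trans (rank_leq_col A) kn.
  by move=> /rowV0Pn[v /sub_kermxP h0 h1]; exists v.
have Bne : B !=set0.
  exists (`|v1|^-1 *: v1); split; last by rewrite -scalemxAl v1A scaler0.
  by rewrite normrZ normfV normr_id mulVf // normr_eq0.
have Bco : compact B.
  apply: bounded_closed_compact.
    by exists 1; split=> // M M1 v [hv _]; have := ltW M1; rewrite -hv.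
  have -> : B = [set v : 'rV[R]_n | `|v| = 1] `&`
     \bigcap_(j in [set: 'I_k]) [set v : 'rV[R]_n | (v *m A) 0 j = 0].
    rewrite eqEsubset; split=> v.
      by move=> [h1 h2]; split=> // j _; rewrite /= h2 mxE.
    by move=> [h1 h2]; split=> //; apply/rowP => j; rewrite h2 // mxE.
  apply: closedI.
    have -> : [set v : 'rV[R]_n | `|v| = 1] = (fun v : 'rV[R]_n => `|v|) @^-1` [set 1] by [].
    apply: closed_comp; last exact: closed_eq.
    by move=> v _; exact: norm_continuous.
  apply: closed_bigI => j _.
  have -> : [set v : 'rV[R]_n | (v *m A) 0 j = 0] =
     (fun v : 'rV[R]_n => (v *m A) 0 j) @^-1` [set 0] by [].
  apply: closed_comp; last exact: closed_eq.
  have -> : (fun v : 'rV[R]_n => (v *m A) 0 j) = (fun v => \sum_i v 0 i * A i j).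
    by apply/funext => v; rewrite mxE.
  by move=> v _; apply: sum_cont => i; apply: (@coordM_cont _ (fun v => v)) => x; exact: cvg_id.
have B0 v : B v -> v != 0.
  by move=> [h _]; rewrite -normr_gt0 h.
have cont : {within B, continuous (fun v => bil U v v / bil G v v)}.
  apply/subspace_continuousP => v Bv.
  have cid : continuous (fun v : 'rV[R]_n => v) by move=> x; exact: cvg_id.
  have hU := @bil_continuous U _ _ _ cid cid v.
  have hGc := @bil_continuous G _ _ _ cid cid v.
  apply: cvgM.
    by apply: cvg_within_filter; exact hU.
  apply: cvgV; first by rewrite gt_eqF // hG // B0.
  by apply: cvg_within_filter; exact hGc.
have [v vB vmax] := EVT_max_rV Bne Bco cont.
move: vB; rewrite in_setE => -[v1n vA].
have v0 : v != 0 by apply: B0.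
pose mu := bil U v v / bil G v v.
have Gv0 := hG v v0.
have muE : bil U v v = mu * bil G v v by rewrite /mu divfK // gt_eqF.
have le w : w *m A = 0 -> bil U w w <= mu * bil G w w.
  move=> wA; have [->|w0] := eqVneq w 0; first by rewrite /bil !mul0mx mxE mulr0.
  rewrite -ler_pdivrMr ?hG //.
  have wn : `|w| != 0 by rewrite normr_eq0.
  have := vmax (`|w|^-1 *: w); rewrite in_setE => /(_ _).
  rewrite !bilZl !bilZr -/mu.
  have -> : `|w|^-1 * (`|w|^-1 * bil U w w) / (`|w|^-1 * (`|w|^-1 * bil G w w)) =
    bil U w w / bil G w w by field; rewrite wn gt_eqF ?hG.
  apply; split; first by rewrite normrZ normfV normr_id mulVf.
  by rewrite -scalemxAl wA scaler0.
(* First variation: in [v + t *: w] the inequality [le] becomes a quadratic in [t] without constant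
   term, since [v] attains the maximum. *)
have crit w : w *m A = 0 -> bil U v w - mu * bil G v w = 0.
  move=> wA; apply: (@quad_nonpos _ (bil U w w - mu * bil G w w)) => t.
  have := le (v + t *: w); rewrite mulmxDl vA -scalemxAl wA scaler0 addr0 => /(_ erefl).
  rewrite !bilDl !bilDr !bilZl !bilZr (bilC w v sU) (bilC w v sG) muE.
  by rewrite -subr_ge0 => h; rewrite -oppr_ge0; move: h; congr (_ <= _); ring.
have vUQ : v *m U *m Q^T = 0.
  have -> : v *m U *m Q^T = (Q *m U *m v^T)^T by rewrite !trmx_mul trmxK sU mulmxA.
  rewrite hQU -!mulmxA; have -> : Q *m (G *m v^T) = (v *m A)^T.
    by rewrite /A !trmx_mul trmxK sG mulmxA.
  by rewrite vA trmx0 mulmx0 trmx0.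
have vU : v *m U = mu *: (v *m G).
  apply/subr0_eq/rowP => j; rewrite [RHS]mxE.
  (* An arbitrary vector is split into its part in the complement, handled by [crit], and a
     combination of rows of [Q], on which [v *m U] and [v *m G] both vanish. *)
  pose w : 'rV[R]_n := delta_mx 0 j; pose w' := w - w *m A *m Q.
  have w'A : w' *m A = 0.
    by rewrite mulmxBl -!mulmxA (mulmxA Q) -/A hQ mulmx1 subrr.
  have e : (v *m U - mu *: (v *m G)) *m w^T = 0.
    have -> : w = w' + w *m A *m Q by rewrite /w' subrK.
    rewrite linearD /= mulmxDr.
    have -> : (v *m U - mu *: (v *m G)) *m w'^T = 0.
      apply/matrixP => a b; rewrite !ord1 mulmxBl -scalemxAl.
      by have := crit w' w'A; rewrite /bil !mxE.
    rewrite add0r trmx_mul mulmxA mulmxBl vUQ -scalemxAl -mulmxA -/A vA scaler0 subrr.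
    by rewrite mul0mx.
  have := congr1 (fun M : 'M[R]_1 => M 0 0) e.
  by rewrite /w trmx_delta -colE [RHS]mxE mxE.
pose c := (Num.sqrt (bil G v v))^-1.
have c2 : c * (c * bil G v v) = 1.
  by rewrite /c mulrA -invfM -expr2 sqr_sqrtr ?ltW // mulVf // gt_eqF.
exists (c *: v), mu; split.
- by rewrite bilZl bilZr.
- by rewrite -!scalemxAl -mulmxA -/A vA scaler0.
- by rewrite -!scalemxAl vU !scalerA mulrC.
Qed.

Lemma pencil_partial G U k : (k <= n)%N -> G^T = G -> U^T = U -> posdef G ->
  exists (Q : 'M[R]_(k, n)) l, Q *m G *m Q^T = 1%:M /\ Q *m U = diag_mx l *m Q *m G.
Proof.
move=> kn sG sU hG; elim: k kn => [_|k IH kn].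
  by exists 0, 0; split; apply/matrixP => -[].
have [Q [l [hQ hQU]]] := IH (ltnW kn).
have [v [mu [v1 vQ vU]]] := pencil_step kn sG sU hG hQ hQU.
rewrite -addn1; exists (col_mx Q v), (row_mx l (const_mx mu)); split.
  rewrite mul_col_mx tr_col_mx mul_col_row hQ vQ.
  have -> : Q *m G *m v^T = 0.
    have -> : Q *m G *m v^T = (v *m G *m Q^T)^T by rewrite !trmx_mul trmxK sG mulmxA.
    by rewrite vQ trmx0.
  have -> : v *m G *m v^T = 1%:M.
    by apply/matrixP => i j; rewrite !ord1 -[LHS]/(bil G v v) v1 mxE.
  by rewrite -scalar_mx_block.
rewrite !mul_col_mx diag_mx_row mul_block_col !mul0mx addr0 add0r mul_col_mx hQU vU.
congr (col_mx _ _); have -> : diag_mx (const_mx mu : 'rV_1) = mu%:M by rewrite diag_const_mx.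
by rewrite mul_scalar_mx -scalemxAl.
Qed.

(** The rows of [Q] form a [G]-orthonormal basis of eigenvectors of the pencil; the second equation
    says, row by row, that [U] acts as [l] times [G]. *)
Definition frame G U (Q : 'M[R]_n) (l : 'rV[R]_n) :=
  Q *m G *m Q^T = 1%:M /\ Q *m U = diag_mx l *m Q *m G.

Lemma frame_exists G U : G^T = G -> U^T = U -> posdef G -> exists Q l, frame G U Q l.
Proof. by move=> sG sU hG; exact: pencil_partial. Qed.


Lemma frame_inv G U Q l : frame G U Q l -> Q^T *m Q *m G = 1%:M.
Proof. by move=> [h _]; rewrite -mulmxA; apply: mulmx1C. Qed.

Lemma frame_invmx G U Q l : frame G U Q l -> invmx G = Q^T *m Q.
Proof.
move=> /frame_inv h; have [_ Gu] := mulmx1_unit h.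
by rewrite -[LHS]mul1mx -h mulmxK.
Qed.

Lemma frame_unit G U Q l : frame G U Q l -> G \in unitmx.
Proof. by move=> /frame_inv /mulmx1_unit []. Qed.

Lemma frame_diag G U Q l : frame G U Q l -> Q *m U *m Q^T = diag_mx l.
Proof. by move=> [h1 ->]; rewrite -!mulmxA (mulmxA Q) h1 mulmx1. Qed.

Lemma frame_char_poly G U Q l : frame G U Q l ->
  char_poly (invmx G *m U) = \prod_(i < n) ('X - (l 0 i)%:P).
Proof.
move=> hf; have h1 := frame_inv hf; have [h2 h3] := hf.
rewrite (frame_invmx hf) -mulmxA h3.
pose A := map_mx (@polyC R) Q^T; pose B := map_mx (@polyC R) (Q *m G).
have AB : A *m B = 1%:M by rewrite -map_mxM mulmxA h1 map_mx1.
rewrite /char_poly.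
have -> : char_poly_mx (Q^T *m (diag_mx l *m Q *m G)) = A *m char_poly_mx (diag_mx l) *m B.
  rewrite /char_poly_mx mulmxBr mulmxBl.
  have -> : A *m 'X%:M *m B = 'X%:M by rewrite scalar_mxC -mulmxA AB mulmx1.
  congr (_ - _).
  by rewrite -!map_mxM -!mulmxA.
rewrite !det_mulmx mulrAC -det_mulmx AB det1 mul1r -/(char_poly (diag_mx l)).
rewrite char_poly_trig ?diag_mx_is_trig //; apply: eq_bigr => i _.
by rewrite mxE eqxx.
Qed.

Lemma frame_perm G U Q l (s : 'S_n) : frame G U Q l ->
  frame G U (row_perm s Q) (col_perm s l).
Proof.
move=> [h1 h2]; split.
  rewrite !row_permE trmx_mul -!mulmxA (mulmxA Q) (mulmxA (Q *m G)) h1 mul1mx.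
  by rewrite tr_perm_mx -perm_mxM mulgV perm_mx1.
have -> : diag_mx (col_perm s l) *m row_perm s Q *m G = row_perm s (diag_mx l *m Q *m G).
  rewrite -!mulmxA (mul_diag_mx l) mul_diag_mx; apply/matrixP => i j; rewrite !mxE.
  by congr (_ * _); apply: eq_bigr => k _; rewrite mxE.
by rewrite !row_permE -mulmxA h2.
Qed.

Lemma eq_prod_perm (l l' : 'rV[R]_n) :
  \prod_(i < n) ('X - (l 0 i)%:P) = \prod_(i < n) ('X - (l' 0 i)%:P) ->
  exists s : 'S_n, l = col_perm s l'.
Proof.
have e (v : 'rV[R]_n) : \prod_(i < n) ('X - (v 0 i)%:P) =
   \prod_(x <- [tuple v 0 i | i < n]) ('X - x%:P).
  by rewrite /= big_map big_enum.
rewrite !e => /prod_XsubC_eq /tuple_permP [s hs]; exists s.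
apply/rowP => i; rewrite mxE.
have := congr1 (fun t => nth 0 t i) hs.
rewrite -!tnth_nth.
by rewrite !tnth_map !tnth_ord_tuple.
Qed.

Definition sorted_row (l : 'rV[R]_n) := forall i j : 'I_n, (i <= j)%N -> l 0 i <= l 0 j.

(** The given list differs from the eigenvalues of some frame only in its order, and permuting the
    rows of a frame permutes its eigenvalues alike. *)
Lemma eigval_frame G U (l : 'rV[R]_n) : G^T = G -> U^T = U -> posdef G ->
  char_poly (invmx G *m U) = \prod_(i < n) ('X - (l 0 i)%:P) ->
  exists Q, frame G U Q l.
Proof.
move=> sG sU hG hl; have [Q [l' hf]] := frame_exists sG sU hG.
have := frame_char_poly hf; rewrite hl => /eq_prod_perm [s ->].
by exists (row_perm s Q); exact: frame_perm.
Qed.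

Lemma frame_bilG G U Q l a b : frame G U Q l ->
  bil G (a *m Q) (b *m Q) = \sum_i a 0 i * b 0 i.
Proof.
move=> [h _]; rewrite /bil trmx_mul -!mulmxA (mulmxA Q) (mulmxA (Q *m G)) h mul1mx.
by rewrite mxE; apply: eq_bigr => i _; rewrite mxE.
Qed.

Lemma frame_bilU G U Q l a b : frame G U Q l ->
  bil U (a *m Q) (b *m Q) = \sum_i l 0 i * (a 0 i * b 0 i).
Proof.
move=> hf; rewrite /bil trmx_mul -!mulmxA (mulmxA Q) (mulmxA (Q *m U)) (frame_diag hf).
rewrite mulmxA mul_mx_diag mxE; apply: eq_bigr => i _; rewrite !mxE; ring.
Qed.

(* The column [k] of the test matrix vanishes, so some nonzero combination of
   the rows of [Q1] of index [>= k] is one of the rows of [Q0] of index [<= k]. *)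
Lemma minmax_vector (Q0 Q1 : 'M[R]_n) (k : 'I_n) : Q0 \in unitmx -> Q1 \in unitmx ->
  exists a b : 'rV[R]_n, [/\ a != 0, a *m Q1 = b *m Q0,
    (forall i : 'I_n, (i < k)%N -> a 0 i = 0) &
    (forall i : 'I_n, (k < i)%N -> b 0 i = 0)].
Proof.
move=> u0 u1; pose M := Q1 *m invmx Q0.
pose C : 'M[R]_n := \matrix_(i, j) if (j < k)%N then (i == j)%:R else
   if (k < j)%N then M i j else 0.
have : \det C == 0.
  rewrite -det_tr (expand_det_row _ k) big1 // => j _.
  by rewrite !mxE ltnn mul0r.
move=> /det0P [a a0 aC]; exists a, (a *m M); split=> //.
- by rewrite /M mulmxA mulmxKV.
- move=> i ik; have := congr1 (fun v : 'rV_n => v 0 i) aC; rewrite !mxE => <-.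
  rewrite (bigD1 i) //= mxE ik eqxx mulr1 big1 ?addr0 // => j ji.
  by rewrite mxE ik (negbTE ji) mulr0.
- move=> i ki; have := congr1 (fun v : 'rV_n => v 0 i) aC; rewrite !mxE => h.
  rewrite -[RHS]h; apply: eq_bigr => j _; by rewrite [in RHS]mxE ltnNge (ltnW ki) /= ki.
Qed.

(** Courant-Fischer for one index, in the form of a single vector that tests both pencils at once:
    eigenvalues are compared without any infimum or supremum over subspaces. *)
Lemma minmax_le G0 U0 Q0 l0 G1 U1 Q1 l1 (k : 'I_n) : frame G0 U0 Q0 l0 ->
  frame G1 U1 Q1 l1 -> sorted_row l0 -> sorted_row l1 ->
  exists v, [/\ v != 0, l1 0 k * bil G1 v v <= bil U1 v v &
     bil U0 v v <= l0 0 k * bil G0 v v].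
Proof.
move=> f0 f1 s0 s1.
have uQ G U Q l : frame G U Q l -> Q \in unitmx.
  by move=> [h _]; move: h; rewrite -mulmxA => /mulmx1_unit [].
have [a [b [a0 ab ha hb]]] := minmax_vector k (uQ _ _ _ _ f0) (uQ _ _ _ _ f1).
exists (a *m Q1); split.
- apply: contraNneq a0 => h; rewrite -(mulmxK (uQ _ _ _ _ f1) a) h mul0mx //.
- rewrite (frame_bilG _ _ f1) (frame_bilU _ _ f1) mulr_sumr; apply: ler_sum => i _.
  have [ik|ki] := ltnP i k; first by rewrite ha // !(mul0r, mulr0).
  by rewrite ler_wpM2r ?s1 // -expr2 sqr_ge0.
- rewrite ab (frame_bilG _ _ f0) (frame_bilU _ _ f0) mulr_sumr; apply: ler_sum => i _.
  have [ki|ik] := ltnP k i; first by rewrite hb // !(mul0r, mulr0).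
  by rewrite ler_wpM2r ?s0 // -expr2 sqr_ge0.
Qed.


Definition l1norm v : R := \sum_i `|v 0 i|.

Lemma l1norm_ge0 v : 0 <= l1norm v.
Proof. exact: sumr_ge0. Qed.

Lemma l1norm_coord v i : `|v 0 i| <= l1norm v.
Proof. by rewrite /l1norm (bigD1 i) //= lerDl sumr_ge0. Qed.

Lemma bil_close G1 G0 v (e : R) : (forall i j, `|G1 i j - G0 i j| <= e) ->
  `|bil G1 v v - bil G0 v v| <= e * l1norm v ^+ 2.
Proof.
move=> h; rewrite !bilE -sumrB; apply: le_trans (ler_norm_sum _ _ _) _.
rewrite expr2 /l1norm mulr_suml mulr_sumr; apply: ler_sum => i _.
rewrite -sumrB; apply: le_trans (ler_norm_sum _ _ _) _.
rewrite mulr_sumr mulr_sumr; apply: ler_sum => j _.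
by rewrite -mulrBl -mulrBr !normrM mulrAC [leLHS]mulrC; rewrite ler_wpM2r.
Qed.

Lemma frame_l1 G U Q l : frame G U Q l ->
  exists C, 0 <= C /\ forall v, l1norm v ^+ 2 <= C * bil G v v.
Proof.
move=> hf; pose q := \sum_i \sum_j `|Q i j|; exists (q ^+ 2); split.
  exact: sqr_ge0.
have uQ : Q \in unitmx by case: hf => h _; move: h; rewrite -mulmxA => /mulmx1_unit [].
have q0 : 0 <= q by apply: sumr_ge0 => i _; exact: sumr_ge0.
move=> v; pose b := v *m invmx Q.
have vE : v = b *m Q by rewrite /b mulmxKV.
rewrite [in X in _ <= X]vE (frame_bilG _ _ hf).
pose S := \sum_i b 0 i * b 0 i.
have S0 : 0 <= S by apply: sumr_ge0 => i _; rewrite -expr2 sqr_ge0.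
have bs i : `|b 0 i| <= Num.sqrt S.
  rewrite -sqrtr_sqr ler_wsqrtr // /S (bigD1 i) //= expr2 lerDl.
  by apply: sumr_ge0 => j _; rewrite -expr2 sqr_ge0.
have h : l1norm v <= q * Num.sqrt S.
  rewrite /l1norm /q exchange_big mulr_suml; apply: ler_sum => j _.
  rewrite vE mxE; apply: le_trans (ler_norm_sum _ _ _) _.
  rewrite mulr_suml; apply: ler_sum => i _; rewrite normrM mulrC.
  by rewrite ler_wpM2l.
rewrite -/S -[S]sqr_sqrtr // -exprMn lerXn2r // nnegrE ?l1norm_ge0 //.
by rewrite mulr_ge0 // sqrtr_ge0.
Qed.

(** Weyl's inequality for pencils. Both one-sided bounds come from [minmax_le], with the two pencils
    in either order; the entries of [Q1] are bounded because its rows have unit [G1]-length. *)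
Lemma frame_perturb G0 U0 Q0 l0 : frame G0 U0 Q0 l0 -> sorted_row l0 ->
  exists2 K, 0 < K & forall e G1 U1 Q1 l1, frame G1 U1 Q1 l1 -> sorted_row l1 ->
    0 <= e -> K * e <= 1 ->
    (forall i j, `|G1 i j - G0 i j| <= e) -> (forall i j, `|U1 i j - U0 i j| <= e) ->
    (forall k, `|l1 0 k - l0 0 k| <= K * e) /\ (forall i j, `|Q1 i j| <= K).
Proof.
move=> f0 s0; have [C [C0 hC]] := frame_l1 f0.
pose L := l1norm l0; have L0 : 0 <= L by exact: l1norm_ge0.
(* [C] compares the squared l1 norm with the form of [G0], the factor 2 passes from [G0] to [G1],
   and [L + 1] dominates [|l0 k| + 1], the coefficient with which the errors in [G] and [U]
   enter. *)
exists (2 * (L + 1) * (C + 1)); first by rewrite !mulr_gt0 // ltr_wpDl.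
move=> e G1 U1 Q1 l1 f1 s1 e0 Ke hG hU.
have Ce : 2 * C * e <= 1.
  apply: le_trans Ke; rewrite ler_wpM2r // -subr_ge0.
  have -> : 2 * (L + 1) * (C + 1) - 2 * C = 2 * (L * C) + 2 * L + 2 by ring.
  by have := mulr_ge0 L0 C0; lra.
have N2 v : l1norm v ^+ 2 <= 2 * C * bil G1 v v.
  have := bil_close v hG; rewrite ler_norml => /andP[h _].
  have := hC v; have := sqr_ge0 (l1norm v); set N := _ ^+ 2 in h * => N0 hN.
  have h3 : C * bil G0 v v <= C * (bil G1 v v + e * N) by rewrite ler_wpM2l //; lra.
  have h4 : 2 * C * e * N <= 1 * N by rewrite ler_wpM2r.
  lra.
have pos1 v : v != 0 -> 0 < bil G1 v v.
  move=> v0; have N0 : 0 < l1norm v.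
    rewrite lt_neqAle l1norm_ge0 andbT eq_sym; apply: contraNneq v0 => h.
    apply/eqP/rowP => i; apply/eqP; rewrite mxE -normr_eq0 eq_le normr_ge0 andbT -h.
    exact: l1norm_coord.
  have := lt_le_trans (exprn_gt0 2 N0) (N2 v).
  by apply: contraTT; rewrite -!leNgt => hle; rewrite mulr_ge0_le0 // mulr_ge0.
split=> [k|i j].
  have key v (d : R) : v != 0 -> d * bil G1 v v <= (`|l0 0 k| + 1) * (e * l1norm v ^+ 2) ->
      d <= 2 * (L + 1) * (C + 1) * e.
    move=> v0 h; have p := pos1 v v0.
    have h2 : (`|l0 0 k| + 1) * (e * l1norm v ^+ 2) <= (L + 1) * (e * (2 * C * bil G1 v v)).
      apply: ler_pM.
      - by rewrite addr_ge0.
      - by rewrite mulr_ge0 // sqr_ge0.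
      - by rewrite lerD2r; exact: l1norm_coord.
      - by rewrite ler_wpM2l.
    have h3 := le_trans h h2.
    have {h3} : d * bil G1 v v <= ((L + 1) * e * 2 * C) * bil G1 v v.
      by apply: le_trans h3 _; rewrite le_eqVlt; apply/orP; left; apply/eqP; ring.
    rewrite ler_pM2r // => h3; apply: le_trans h3 _; rewrite -subr_ge0.
    have -> : 2 * (L + 1) * (C + 1) * e - (L + 1) * e * 2 * C = 2 * (L + 1) * e by ring.
    by rewrite !mulr_ge0 // addr_ge0.
  have lk v : l0 0 k * bil G0 v v - l0 0 k * bil G1 v v <= `|l0 0 k| * (e * l1norm v ^+ 2)
     /\ l0 0 k * bil G1 v v - l0 0 k * bil G0 v v <= `|l0 0 k| * (e * l1norm v ^+ 2).
    have h := bil_close v hG; rewrite -!mulrBr; split; apply: le_trans (ler_norm _) _;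
    by rewrite normrM ler_wpM2l // distrC // distrC.
  rewrite ler_norml; apply/andP; split.
    have [v [v0 h1 h2]] := minmax_le k f1 f0 s1 s0.
    rewrite -opprB lerN2; apply: (key v) => //.
    have [h3 h4] := lk v; have := bil_close v hU; rewrite ler_norml => /andP[h5 h6].
    rewrite mulrBl mulrDl mul1r; lra.
  have [v [v0 h1 h2]] := minmax_le k f0 f1 s0 s1.
  apply: (key v) => //.
  have [h3 h4] := lk v; have := bil_close v hU; rewrite ler_norml => /andP[h5 h6].
  rewrite mulrBl mulrDl mul1r; lra.
have qi : bil G1 (row i Q1) (row i Q1) = 1.
  have [h _] := f1; have h' : (Q1 *m G1 *m Q1^T) i i = 1 by rewrite h mxE eqxx.
  rewrite -h' /bil -row_mul tr_row !mxE.
  by apply: eq_bigr => k _; rewrite !mxE.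
have := N2 (row i Q1); rewrite qi mulr1 => h.
have h1 : `|Q1 i j| <= l1norm (row i Q1) by have := l1norm_coord (row i Q1) j; rewrite mxE.
apply: le_trans h1 _.
have h2 : 2 * C + 1 <= 2 * (L + 1) * (C + 1).
  have -> : 2 * (L + 1) * (C + 1) = 2 * (L * C) + 2 * L + 2 * C + 2 by ring.
  by have := mulr_ge0 L0 C0; lra.
apply: le_trans h2; rewrite leNgt; apply/negP => h3.
have : (2 * C + 1) ^+ 2 < l1norm (row i Q1) ^+ 2.
  by move: (C0) h3; set q := l1norm _ => C0' h3; rewrite !expr2; nra.
have := sqr_ge0 C; move: h; rewrite expr2 => *; nra.
Qed.


Lemma mulmx_bound p q r (A : 'M[R]_(p, q)) (B : 'M[R]_(q, r)) (a b : R) i j :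
  0 <= a -> (forall i j, `|A i j| <= a) -> (forall i j, `|B i j| <= b) ->
  `|(A *m B) i j| <= q%:R * a * b.
Proof.
move=> a0 hA hB; rewrite mxE; apply: le_trans (ler_norm_sum _ _ _) _.
apply: (@le_trans _ _ (\sum_(k < q) a * b)).
  by apply: ler_sum => k _; rewrite normrM ler_pM.
by rewrite sumr_const card_ord -[_ *+ q]mulr_natl mulrA.
Qed.

Lemma mx_bounded p q (A : 'M[R]_(p, q)) : exists2 a, 0 <= a & forall i j, `|A i j| <= a.
Proof.
exists (\sum_i \sum_j `|A i j|); first by apply: sumr_ge0 => i _; exact: sumr_ge0.
move=> i j; rewrite (bigD1 i) //= (bigD1 j) //= -addrA lerDl addr_ge0 ?sumr_ge0 //.
by move=> k _; exact: sumr_ge0.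
Qed.

Lemma gap_exists (l : 'rV[R]_n) : exists2 g, 0 < g &
  forall a b, l 0 a != l 0 b -> g <= `|l 0 a - l 0 b|.
Proof.
exists (\big[Num.min/1]_a \big[Num.min/1]_(b | l 0 a != l 0 b) `|l 0 a - l 0 b|).
  apply: lt_bigmin => // a _; apply: lt_bigmin => // b ab.
  by rewrite normr_gt0 subr_eq0.
move=> a b ab; apply: le_trans (bigmin_le_cond _ _ _) _; first by [].
exact: bigmin_le_cond.
Qed.

(* With [E] and [F] the two inverse changes of frame, the weights [E a b * F b a]
   have row and column sums one and are quadratically small across distinct
   eigenvalues of the unperturbed pencil. *)
Lemma frame_linearize G0 U0 Q0 l0 (c : 'I_n -> R) : frame G0 U0 Q0 l0 ->
  sorted_row l0 -> (forall a b, l0 0 a = l0 0 b -> c a = c b) ->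
  exists2 K, 0 < K & forall e G1 U1 Q1 l1, frame G1 U1 Q1 l1 -> sorted_row l1 ->
    0 <= e -> K * e <= 1 ->
    (forall i j, `|G1 i j - G0 i j| <= e) -> (forall i j, `|U1 i j - U0 i j| <= e) ->
    (forall i j, `|(invmx G1 *m U1 - invmx G0 *m U0) i j| <= e) ->
    (forall k, `|l1 0 k - l0 0 k| <= K * e) /\
    `|\sum_a c a * (l1 0 a - l0 0 a) -
       \sum_a c a * (Q0 *m G0 *m (invmx G1 *m U1 - invmx G0 *m U0) *m Q0^T) a a|
      <= K * e ^+ 2.
Proof.
move=> f0 s0 hc.
have [K0 K00 hK0] := frame_perturb f0 s0.
have [g g0 hg] := gap_exists l0.
have [q q0 hq] := mx_bounded Q0.
have [w w0 hw] := mx_bounded (Q0 *m G0).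
have [y y0 hy] := mx_bounded G0.
have [z z0 hz] := mx_bounded l0.
pose N : R := n%:R; have N0 : 0 <= N by rewrite ler0n.
(* Entrywise bounds for the matrices [E], [F] and [Dl / e] below. [H] bounds, after division by
   [e ^+ 2], the product of the entries of [E] and [F] across a gap with an eigenvalue of the
   perturbed pencil. *)
pose KE := N * w * K0; pose KF := N * (N * K0 * (y + 1)) * q.
pose KD := N * (N * w * 1) * q.
have KE0 : 0 <= KE by rewrite /KE !mulr_ge0 // ltW.
have KF0 : 0 <= KF by rewrite /KF !mulr_ge0 ?addr_ge0 // ltW.
have KD0 : 0 <= KD by rewrite /KD !mulr_ge0.
pose H := (N * KD * KE * 2 / g) * (N * KF * KD * 2 / g) * (z + 1).
have H0 : 0 <= H by rewrite /H !mulr_ge0 ?addr_ge0 ?invr_ge0 // ltW.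
pose T := \sum_a \sum_b `|c a - c b| * H.
have T0 : 0 <= T by apply: sumr_ge0 => a _; apply: sumr_ge0 => b _; exact: mulr_ge0.
exists (K0 + 2 * K0 / g + 1 + T); first by rewrite !ltr_wpDr // ?addr_ge0 // divr_ge0 ?mulr_ge0 // ltW.
move=> e G1 U1 Q1 l1 f1 s1 e0 Ke hG hU hA.
have Kg0 : 0 <= 2 * K0 / g by rewrite divr_ge0 ?mulr_ge0 // ltW.
have Te : 0 <= T * e by exact: mulr_ge0.
have K0e : 0 <= K0 * e by rewrite mulr_ge0 // ltW.
have Kge : 0 <= 2 * K0 / g * e by rewrite mulr_ge0.
rewrite !mulrDl mul1r in Ke.
have e1 : e <= 1 by lra.
have [hl hQ] := hK0 e G1 U1 Q1 l1 f1 s1 e0 (ltac:(lra)) hG hU.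
have Kg : K0 * e <= g / 2.
  have : 2 * K0 / g * e <= 1 by lra.
  by rewrite mulrAC ler_pdivrMr // mul1r => h; lra.
split=> [k|].
  by apply: le_trans (hl k) _; rewrite !mulrDl mul1r; lra.
pose E := Q0 *m G0 *m Q1^T; pose F := Q1 *m G1 *m Q0^T.
pose A0 := invmx G0 *m U0; pose A1 := invmx G1 *m U1.
pose Dl := Q0 *m G0 *m (A1 - A0) *m Q0^T.
have inv0 := frame_inv f0; have inv1 := frame_inv f1.
have EF : E *m F = 1%:M.
  rewrite /E /F -!mulmxA (mulmxA Q1^T) (mulmxA (Q1^T *m Q1)) inv1 mul1mx mulmxA.
  by case: f0.
have FE : F *m E = 1%:M by exact: mulmx1C.
have A1E : A1 = Q1^T *m diag_mx l1 *m (Q1 *m G1).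
  by rewrite /A1 (frame_invmx f1) -!mulmxA; case: (f1) => _ ->; rewrite !mulmxA.
have B0E : Q0 *m G0 *m A0 *m Q0^T = diag_mx l0.
  rewrite /A0 mulmxA mulmxK ?(frame_unit f0) //; exact: frame_diag f0.
(* In the unperturbed frame the perturbed operator is [diag_mx l0 + Dl], and [E] and its inverse [F]
   diagonalize it. *)
have BE : diag_mx l0 + Dl = E *m diag_mx l1 *m F.
  rewrite -B0E -mulmxDl -mulmxDr subrKC A1E /E /F; by rewrite !mulmxA.
have hE a b : `|E a b| <= KE.
  by apply: mulmx_bound => // i j; rewrite mxE.
have hF a b : `|F a b| <= KF.
  apply: mulmx_bound => [|i j|i j]; first by rewrite !mulr_ge0 ?addr_ge0 // ltW.
    apply: mulmx_bound => // [|i' j']; first exact: ltW.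
    rewrite -[G1 i' j'](subrK (G0 i' j')); apply: le_trans (ler_normD _ _) _.
    by rewrite addrC lerD //; apply: le_trans (hG i' j') e1.
  by rewrite mxE.
have hD a b : `|Dl a b| <= KD * e.
  have -> : KD * e = N * (N * w * e) * q by rewrite /KD; ring.
  apply: mulmx_bound => [|i j|i j]; first by rewrite !mulr_ge0.
    exact: mulmx_bound.
  by rewrite mxE.
(* Comparing both sides of the intertwining relation entry by entry: the difference of eigenvalues
   times [E a b] is an entry of [Dl *m E], hence of order [e]. *)
have offE a b : `|l1 0 b - l0 0 a| * `|E a b| <= N * (KD * e) * KE.
  rewrite -normrM; have -> : (l1 0 b - l0 0 a) * E a b = (Dl *m E) a b.
    have : (diag_mx l0 + Dl) *m E = E *m diag_mx l1.
      by rewrite BE -(mulmxA (E *m diag_mx l1)) FE mulmx1.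
    move/(congr1 (fun M : 'M[R]_n => M a b)); rewrite mulmxDl mul_mx_diag mul_diag_mx.
    rewrite mxE [X in X + _ = _ -> _]mxE [X in _ = X -> _]mxE; lra.
  by apply: mulmx_bound => //; rewrite mulr_ge0.
have offF a b : `|l1 0 b - l0 0 a| * `|F b a| <= N * KF * (KD * e).
  rewrite -normrM; have -> : (l1 0 b - l0 0 a) * F b a = (F *m Dl) b a.
    have : F *m (diag_mx l0 + Dl) = diag_mx l1 *m F.
      by rewrite BE -(mulmxA E) (mulmxA F) FE mul1mx.
    move/(congr1 (fun M : 'M[R]_n => M b a)); rewrite mulmxDr mul_mx_diag mul_diag_mx.
    rewrite mxE [X in X + _ = _ -> _]mxE [X in _ = X -> _]mxE; lra.
  exact: mulmx_bound.
(* Equal unperturbed eigenvalues carry equal weights [c]; distinct ones are a gap apart, so [E a b]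
   and [F b a] are both of order [e]. *)
have term a b : `|(c a - c b) * (E a b * F b a * l1 0 b)| <= `|c a - c b| * H * e ^+ 2.
  have [ab|ab] := eqVneq (l0 0 a) (l0 0 b).
    by rewrite (hc a b ab) subrr mul0r normr0 !mul0r.
  have gp : g / 2 <= `|l1 0 b - l0 0 a|.
    have := hg a b ab; have := hl b.
    have -> : l0 0 a - l0 0 b = (l1 0 b - l0 0 b) - (l1 0 b - l0 0 a) by ring.
    by move=> h1 h2; have := le_trans h2 (ler_normB _ _); lra.
  have g20 : 0 < g / 2 by rewrite divr_gt0.
  have e1' : `|E a b| <= N * (KD * e) * KE / (g / 2).
    rewrite ler_pdivlMr // mulrC; apply: le_trans (offE a b); exact: ler_wpM2r.
  have f1' : `|F b a| <= N * KF * (KD * e) / (g / 2).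
    rewrite ler_pdivlMr // mulrC; apply: le_trans (offF a b); exact: ler_wpM2r.
  have l1' : `|l1 0 b| <= z + 1.
    rewrite -[l1 0 b](subrK (l0 0 b)); apply: le_trans (ler_normD _ _) _.
    by rewrite addrC lerD //; apply: le_trans (hl b) _; lra.
  rewrite normrM -[X in _ <= X]mulrA ler_wpM2l // !normrM.
  have -> : H * e ^+ 2 = N * (KD * e) * KE / (g / 2) * (N * KF * (KD * e) / (g / 2)) * (z + 1).
    by rewrite /H; field; rewrite gt_eqF.
  by rewrite !ler_pM // mulr_ge0.
(* Exact identity: each [l1 0 b] is spread over the rows [a] with the weights [E a b * F b a], whose
   sum over [a] is one, so only differences of the coefficients [c] remain. *)
have idn : \sum_a c a * (l1 0 a - l0 0 a) - \sum_a c a * Dl a a =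
   - \sum_a \sum_b (c a - c b) * (E a b * F b a * l1 0 b).
  have dBa a : l0 0 a + Dl a a = \sum_b E a b * F b a * l1 0 b.
    have := congr1 (fun M : 'M[R]_n => M a a) BE.
    rewrite mxE [X in X + _ = _ -> _]mxE eqxx mulr1n => ->.
    rewrite mxE; apply: eq_bigr => b _; rewrite mul_mx_diag mxE; ring.
  have sF b : \sum_a E a b * F b a = 1.
    have <- : (F *m E) b b = 1 by rewrite FE mxE eqxx.
    by rewrite [RHS]mxE; apply: eq_bigr => a _; rewrite mulrC.
  have -> : \sum_a \sum_b (c a - c b) * (E a b * F b a * l1 0 b) =
     \sum_a c a * (l0 0 a + Dl a a) - \sum_b c b * l1 0 b.
    under eq_bigr => a _ do under eq_bigr => b _ do rewrite mulrBl.
    under eq_bigr => a _ do rewrite sumrB -mulr_sumr -dBa.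
    rewrite sumrB; congr (_ - _); rewrite exchange_big; apply: eq_bigr => b _ /=.
    rewrite -mulr_sumr -mulr_suml sF mul1r //.
  rewrite -sumrB -sumrB -sumrN; apply: eq_bigr => a _; ring.
rewrite -/A1 -/A0 -/Dl idn normrN.
apply: (@le_trans _ _ (T * e ^+ 2)).
  apply: le_trans (ler_norm_sum _ _ _) _; rewrite /T mulr_suml; apply: ler_sum => a _.
  apply: le_trans (ler_norm_sum _ _ _) _; rewrite mulr_suml; apply: ler_sum => b _.
  exact: term.
by rewrite ler_wpM2r ?sqr_ge0 //; have := ltW K00; lra.
Qed.

End Pencil.

(** * The algebra of the maximum principle *)

Section BigO.
Variables (R : realType) (Om : Type).
Implicit Types f g h : Om -> R.

(* Asking [0 <= g] here as well keeps products and sums free of side conditions. *)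
Definition bO f g : Prop :=
  exists2 C, 0 <= C & forall w, 0 <= g w /\ `|f w| <= C * g w.

Lemma bOD f1 f2 g1 g2 : bO f1 g1 -> bO f2 g2 ->
  bO (fun w => f1 w + f2 w) (fun w => g1 w + g2 w).
Proof.
move=> [C1 C10 h1] [C2 C20 h2]; exists (C1 + C2); first exact: addr_ge0.
move=> w; have [a1 b1] := h1 w; have [a2 b2] := h2 w; split; first exact: addr_ge0.
have := ler_normD (f1 w) (f2 w); have := mulr_ge0 C10 a2; have := mulr_ge0 C20 a1; lra.
Qed.

Lemma bON f g : bO f g -> bO (fun w => - f w) g.
Proof. by move=> [C C0 h]; exists C => // w; rewrite normrN. Qed.

Lemma bOB f1 f2 g1 g2 : bO f1 g1 -> bO f2 g2 ->
  bO (fun w => f1 w - f2 w) (fun w => g1 w + g2 w).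
Proof. by move=> h1 h2; apply: bOD => //; exact: bON. Qed.

Lemma bOM f1 f2 g1 g2 : bO f1 g1 -> bO f2 g2 ->
  bO (fun w => f1 w * f2 w) (fun w => g1 w * g2 w).
Proof.
move=> [C1 C10 h1] [C2 C20 h2]; exists (C1 * C2); first exact: mulr_ge0.
move=> w; have [a1 b1] := h1 w; have [a2 b2] := h2 w; split; first exact: mulr_ge0.
by rewrite normrM mulrACA ler_pM.
Qed.

Lemma bOX f g k : bO f g -> bO (fun w => f w ^+ k) (fun w => g w ^+ k).
Proof.
move=> [C C0 h]; exists (C ^+ k); first exact: exprn_ge0.
move=> w; have [a b] := h w; split; first exact: exprn_ge0.
by rewrite normrX -exprMn lerXn2r // nnegrE // mulr_ge0.
Qed.

Lemma bO_cst c : bO (fun=> c) (fun=> 1).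
Proof. by exists `|c| => // w; split=> //; rewrite mulr1. Qed.

Lemma bO_refl g : (forall w, 0 <= g w) -> bO g g.
Proof. by move=> g0; exists 1 => // w; rewrite g0 mul1r ger0_norm. Qed.

Lemma bO_le C f g h : 0 < C -> bO f g -> (forall w, g w <= C * h w) -> bO f h.
Proof.
move=> C0 [K K0 hf] gh; exists (K * C); first by rewrite mulr_ge0 // ltW.
move=> w; have [a b] := hf w; split.
  by rewrite -(pmulr_rge0 _ C0); exact: le_trans (gh w).
by apply: le_trans b _; rewrite -mulrA ler_wpM2l.
Qed.

Lemma bODs f1 f2 g : bO f1 g -> bO f2 g -> bO (fun w => f1 w + f2 w) g.
Proof.
by move=> h1 h2; apply: (bO_le (C := 2) _ (bOD h1 h2)) => // w; rewrite mulr2n mulrDl mul1r.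
Qed.

Lemma bOBs f1 f2 g : bO f1 g -> bO f2 g -> bO (fun w => f1 w - f2 w) g.
Proof. by move=> h1 h2; apply: bODs => //; exact: bON. Qed.

Lemma bOZ c f g : bO f g -> bO (fun w => c * f w) g.
Proof.
move=> [C C0 h]; exists (`|c| * C); first exact: mulr_ge0.
by move=> w; have [a b] := h w; split=> //; rewrite normrM -mulrA ler_wpM2l.
Qed.

Lemma bO_sum (I : Type) (r : seq I) (P : pred I) (f : I -> Om -> R) g :
  (forall w, 0 <= g w) -> (forall i, bO (f i) g) ->
  bO (fun w => \sum_(i <- r | P i) f i w) g.
Proof.
move=> g0 h; elim: r => [|i r [C C0 IH]].
  by exists 0 => // w; rewrite big_nil normr0 mul0r.
have [C' C'0 h'] := h i; exists (C' + C); first exact: addr_ge0.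
move=> w; split=> //; rewrite big_cons mulrDl; case: ifP => _.
  apply: le_trans (ler_normD _ _) _; apply: lerD; [exact: (h' w).2 | exact: (IH w).2].
by apply: le_trans (IH w).2 _; rewrite lerDr mulr_ge0.
Qed.

Lemma bO_eq f f' g : (forall w, f w = f' w) -> bO f g -> bO f' g.
Proof. by move=> /funext ->. Qed.

End BigO.

(* [Om] indexes the configurations (solution, base point, interior maximum), so
   that one constant serves them all.  At a configuration: [s = |X|],
   [tau = 1 + 1/sigma], [q = theta'/theta], [P] is the eigenframe of [U] (rows
   [a]), [f a] the derivatives of [f] at the eigenvalues [lam a], [V a] the length
   of the derivative of [X] along row [a]; [sg1], [sg2] are the first and second
   derivatives of [sigma] divided by [sigma]; [b0], [b1] are [beta] and its first
   derivatives, and the second derivative of [beta k] along row [a] is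
   [r k a + c k * uaa a].  [g], [dg], [g2] belong to the inverse metric; [g1],
   [Gm], [Gm1], [A], [A1] to the metric, the Christoffel symbols and the Schouten
   tensor, contracted twice with row [a].  [crit] and [second] are the first- and
   second-order conditions at the maximum. *)
Section InteriorAlgebra.
Variables (R : realType) (Om : Type) (n : nat).
Notation F0 := (Om -> R).
Notation F1 := ('I_n -> Om -> R).
Notation F2 := ('I_n -> 'I_n -> Om -> R).
Notation F3 := ('I_n -> 'I_n -> 'I_n -> Om -> R).
Variables (s tau q psi0 : F0) (V f sg1 sg2 u1 b0 X c A psi1 : F1)
  (P g u2 u3 b1 r Gm mu g1 A1 : F2) (dg g2 Gm1 : F3).
Variables (c0 q0 : R).
Implicit Types (i j k l a : 'I_n) (w : Om).

Definition frame1 (v : F1) a w := \sum_i P a i w * v i w.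
Definition ua a w := frame1 u1 a w.
Definition uaa a w := \sum_i \sum_j P a i w * P a j w * u2 i j w.
Definition X1 k j w := u2 k j w - b1 k j w.
Definition X1a k a w := \sum_j P a j w * X1 k j w.
Definition X2 k a w := u3 k a w - (r k a w + c k w * uaa a w).
Definition dga k l a w := \sum_j P a j w * dg k l j w.
Definition W1 j w := \sum_k \sum_l ((dg k l j w * X k w + g k l w * X1 k j w) * X l w
   + g k l w * X k w * X1 l j w).
Definition W2 a w := \sum_k \sum_l
  ((g2 k l a w * X k w + 2 * dga k l a w * X1a k a w + g k l w * X2 k a w) * X l w
   + 2 * (dga k l a w * X k w + g k l w * X1a k a w) * X1a l a w
   + g k l w * X k w * X2 l a w).
Definition ww w := \sum_i \sum_j g i j w * u1 i w * u1 j w.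
Definition dww k w := \sum_i \sum_j ((dg i j k w * u1 i w + g i j w * u2 i k w) * u1 j w
   + g i j w * u1 i w * u2 j k w).
Definition lam a w := uaa a w - \sum_l Gm l a w * u1 l w + ua a w ^+ 2 - 2^-1 * ww w + A a w.
(** What the differentiated equation contains in row [a] besides the third derivatives of [u]; the
    term with [mu] comes from the derivative of the inverse metric and is a multiple of the
    eigenvalue. *)
Definition rest k a w := lam a w * mu a k w - \sum_l (Gm l a w * u2 l k w + Gm1 l a k w * u1 l w)
   + 2 * ua a w * \sum_i P a i w * u2 i k w - 2^-1 * (dww k w + ww w * g1 a k w) + A1 a k w.

Hypotheses (s1 : forall w, 1 <= s w) (t1 : forall w, 1 <= tau w)
  (V0 : forall a w, 0 <= V a w) (f0 : forall a w, 0 < f a w)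
  (c00 : 0 < c0) (q00 : 0 < q0)
  (sumf : forall w, c0 <= \sum_a f a w) (qq0 : forall w, q0 <= q w).
Hypotheses (hq : bO q (fun=> 1)) (hpsi0 : bO psi0 (fun=> 1)) (hsg1 : forall i, bO (sg1 i) tau)
  (hsg2 : forall a, bO (sg2 a) (fun w => tau w * tau w)) (hb0 : forall i, bO (b0 i) (fun=> 1))
  (hX : forall i, bO (X i) s) (hc : forall i, bO (c i) (fun=> 1))
  (hA : forall a, bO (A a) (fun=> 1)) (hpsi1 : forall k, bO (psi1 k) s)
  (hP : forall a i, bO (P a i) (fun=> 1)) (hg : forall k l, bO (g k l) (fun=> 1))
  (hb1 : forall k l, bO (b1 k l) s) (hr : forall k a, bO (r k a) (fun w => s w * s w))
  (hGm : forall l a, bO (Gm l a) (fun=> 1)) (hmu : forall a k, bO (mu a k) (fun=> 1))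
  (hg1 : forall a k, bO (g1 a k) (fun=> 1)) (hA1 : forall a k, bO (A1 a k) (fun=> 1))
  (hdg : forall k l j, bO (dg k l j) (fun=> 1)) (hg2 : forall k l a, bO (g2 k l a) (fun=> 1))
  (hGm1 : forall l a k, bO (Gm1 l a k) (fun=> 1))
  (hXV : forall k a, bO (X1a k a) (V a)).
Hypotheses (gC : forall k l w, g k l w = g l k w) (u2C : forall k l w, u2 k l w = u2 l k w)
  (u1E : forall k w, u1 k w = X k w + b0 k w)
  (sE : forall w, \sum_k \sum_l g k l w * X k w * X l w = s w ^+ 2)
  (VE : forall a w, \sum_k \sum_l g k l w * X1a k a w * X1a l a w = V a w ^+ 2)
  (crit : forall j w, W1 j w = s w ^+ 2 * (q w * u1 j w - 2 * sg1 j w))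
  (second : forall w, \sum_a f a w * (W2 a w + 4 * frame1 sg1 a w * frame1 W1 a w
     + (2 * sg2 a w + 2 * frame1 sg1 a w ^+ 2) * s w ^+ 2
     - s w ^+ 2 * (q w * uaa a w - q w * ua a w ^+ 2)) <= 0)
  (euler : forall w, \sum_a f a w * lam a w = psi0 w)
  (pde : forall k w, \sum_a f a w * (u3 k a w + rest k a w) = psi1 k w).

Let one := fun _ : Om => 1 : R.
Let s0 w : 0 <= s w. Proof. by apply: le_trans (s1 w). Qed.
Let t0 w : 0 <= tau w. Proof. by apply: le_trans (t1 w). Qed.
Let hs : bO s s. Proof. exact: bO_refl. Qed.

(** The common size of all errors in row [a]. Once [s] is large compared with [tau], it is dominated
    by the good terms [V a ^+ 2] and [s ^+ 4]. *)
Definition gauge a w := s w ^+ 2 * (s w * tau w + tau w ^+ 2) + s w * V a w.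

Let Y k w := \sum_l g l k w * X l w.

Lemma bO_Y k : bO (Y k) s.
Proof.
by apply: bO_sum => // l; apply: (bO_le (C := 1) _ (bOM (hg l k) (hX l))).
Qed.

Lemma bO_1s (h : F0) : bO h one -> bO h s.
Proof. by move=> hh; apply: (bO_le (C := 1) _ hh) => // w; rewrite mul1r. Qed.

Lemma bO_u1 k : bO (u1 k) s.
Proof.
apply: (bO_eq (f := fun w => X k w + b0 k w)) => [w|]; first by rewrite u1E.
apply: (bO_le (C := 2) _ (bOD (hX k) (bO_1s (hb0 k)))) => // w; lra.
Qed.

Lemma bO_frame v h a : (forall w, 0 <= h w) -> (forall i, bO (v i) h) -> bO (frame1 v a) h.
Proof.
by move=> h0 hv; apply: bO_sum => // i; apply: (bO_le (C := 1) _ (bOM (hP a i) (hv i))).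
Qed.

Lemma sum2_sym (a b : 'I_n -> R) (G : 'I_n -> 'I_n -> R) : (forall k l, G k l = G l k) ->
  \sum_k \sum_l G k l * a k * b l = \sum_k \sum_l G k l * b k * a l.
Proof.
move=> GC; rewrite exchange_big; apply: eq_bigr => k _; apply: eq_bigr => l _.
by rewrite GC mulrAC.
Qed.

Lemma sum2_Y w (b : 'I_n -> R) : \sum_k \sum_l g k l w * b k * X l w = \sum_k Y k w * b k.
Proof.
apply: eq_bigr => k _; rewrite /Y mulr_suml; apply: eq_bigr => l _.
by rewrite gC mulrAC.
Qed.

Lemma W1E j w : W1 j w = \sum_k \sum_l dg k l j w * X k w * X l w
  + 2 * \sum_k Y k w * u2 k j w - 2 * \sum_k Y k w * b1 k j w.
Proof.
rewrite -addrA -mulrBr -sumrB; under [X in 2 * X]eq_bigr => k _ do rewrite -mulrBr.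
rewrite -(sum2_Y w (fun k => X1 k j w)) mulrDl mul1r.
rewrite -{2}(sum2_sym (X^~ w) (fun k => X1 k j w) (fun k l => gC k l w)).
rewrite -!big_split; apply: eq_bigr => k _; rewrite -!big_split; apply: eq_bigr => l _ /=.
ring.
Qed.

Let Z l w := \sum_k Y k w * u2 k l w.

(** [Z] is the Hessian contracted with [X] raised by the metric. It is expressed by the first
    derivative of [|X|^2], which the critical point equation controls although the Hessian itself is
    not bounded. *)
Lemma ZE l w : 2 * Z l w = W1 l w - \sum_k \sum_j dg k j l w * X k w * X j w
  + 2 * \sum_k Y k w * b1 k l w.
Proof. by rewrite W1E /Z; ring. Qed.

Lemma bO_ZW l : bO (fun w => 2 * Z l w - W1 l w) (fun w => s w * s w).
Proof.
have ss w : 0 <= s w * s w by rewrite mulr_ge0.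
apply: (bO_eq (f := fun w => - (\sum_k \sum_j dg k j l w * X k w * X j w)
   + 2 * \sum_k Y k w * b1 k l w)) => [w|]; first by rewrite ZE; ring.
have h1 : bO (fun w => \sum_k \sum_j dg k j l w * X k w * X j w) (fun w => s w * s w).
  apply: bO_sum => // k; apply: bO_sum => // j.
  by apply: (bO_le (C := 1) _ (bOM (bOM (hdg k j l) (hX k)) (hX j))) => // w; rewrite !mul1r.
have h2 : bO (fun w => \sum_k Y k w * b1 k l w) (fun w => s w * s w).
  apply: bO_sum => // k; exact: bOM (bO_Y k) (hb1 k l).
apply: (bO_le (C := 2) _ (bOD (bON h1) (bOM (bO_cst Om 2) h2))) => // w; lra.
Qed.

Lemma bO_W1 l : bO (W1 l) (fun w => s w ^+ 2 * (s w + tau w)).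
Proof.
apply: (bO_eq (f := fun w => s w ^+ 2 * (q w * u1 l w - 2 * sg1 l w))) => [w|].
  by rewrite crit.
apply: (bO_le (C := 1) _ (bOM (bOX 2 hs)
  (bOB (bOM hq (bO_u1 l)) (bOM (bO_cst Om 2) (hsg1 l))))) => // w.
by rewrite !mul1r.
Qed.

Lemma bO_Z l : bO (Z l) (fun w => s w ^+ 2 * (s w + tau w)).
Proof.
apply: (bO_eq (f := fun w => 2^-1 * ((2 * Z l w - W1 l w) + W1 l w))) => [w|].
  by rewrite subrK mulKf.
apply: (bO_le (C := 2) _ (bOM (bO_cst Om 2^-1) (bOD (bO_ZW l) (bO_W1 l)))) => // w.
rewrite mul1r -expr2; have := exprn_ge0 2 (s0 w); have := s1 w; have := t0 w.
move: (s w ^+ 2) => S; nra.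
Qed.

Let up l w := \sum_i g i l w * u1 i w.

Lemma bO_up l : bO (up l) s.
Proof.
by apply: bO_sum => // i; apply: (bO_le (C := 1) _ (bOM (hg i l) (bO_u1 i))).
Qed.

Lemma Yw1 w : \sum_k Y k w * dww k w =
  \sum_k Y k w * (\sum_i \sum_j dg i j k w * u1 i w * u1 j w) + \sum_l up l w * (2 * Z l w).
Proof.
have -> : \sum_l up l w * (2 * Z l w) = \sum_k Y k w * (2 * \sum_l up l w * u2 l k w).
  under eq_bigr => l _ do rewrite /Z mulr_sumr mulr_sumr.
  rewrite exchange_big; apply: eq_bigr => k _; rewrite !mulr_sumr.
  by apply: eq_bigr => l _; rewrite (u2C k l); ring.
rewrite -big_split; apply: eq_bigr => k _ /=; rewrite -mulrDr; congr (_ * _).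
have h1 : \sum_i \sum_j g i j w * u1 i w * u2 j k w = \sum_l up l w * u2 l k w.
  rewrite exchange_big; apply: eq_bigr => l _; rewrite /up mulr_suml; exact: eq_bigr.
have h2 : \sum_i \sum_j g i j w * u2 i k w * u1 j w = \sum_l up l w * u2 l k w.
  by rewrite -h1; apply: (sum2_sym (u2^~ k ^~ w) (u1^~ w)) => i j; exact: gC.
rewrite mulrDl mul1r -{1}h2 -h1 /dww -!big_split; apply: eq_bigr => i _.
rewrite -!big_split; apply: eq_bigr => j _ /=; ring.
Qed.

Lemma upu1 w : \sum_l up l w * u1 l w = ww w.
Proof.
rewrite /ww exchange_big; apply: eq_bigr => l _; rewrite /up mulr_suml; exact: eq_bigr.
Qed.

(** Differentiating [|du|^2] along [X] produces twice the Hessian contracted with [X] and [du]; the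
    critical point equation turns this into [q s^2 |du|^2] and lower-order terms. *)
Lemma bO_Yw1 : bO (fun w => \sum_k Y k w * dww k w - s w ^+ 2 * (q w * ww w))
   (fun w => s w ^+ 2 * (s w * tau w)).
Proof.
have g0 w : 0 <= s w ^+ 2 * (s w * tau w) by rewrite !mulr_ge0.
apply: (bO_eq (f := fun w => \sum_k Y k w * (\sum_i \sum_j dg i j k w * u1 i w * u1 j w)
   + \sum_l up l w * ((2 * Z l w - W1 l w) - s w ^+ 2 * (2 * sg1 l w)))) => [w|].
  rewrite Yw1 -addrA; congr (_ + _).
  rewrite -upu1 mulr_sumr mulr_sumr -sumrB; apply: eq_bigr => l _; rewrite crit; ring.
have h1 k : bO (fun w => \sum_i \sum_j dg i j k w * u1 i w * u1 j w) (fun w => s w * s w).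
  apply: bO_sum => [w|i]; first exact: mulr_ge0.
  apply: bO_sum => [w|j]; first exact: mulr_ge0.
  by apply: (bO_le (C := 1) _ (bOM (bOM (hdg i j k) (bO_u1 i)) (bO_u1 j))) => // w; rewrite !mul1r.
apply: (bO_le (C := 2) (g := fun w => s w ^+ 2 * (s w * tau w) + s w ^+ 2 * (s w * tau w))) => // [|w].
  apply: bOD; apply: bO_sum => // k.
    apply: (bO_le (C := 1) _ (bOM (bO_Y k) (h1 k))) => // w.
    rewrite mul1r; have := mulr_ge0 (s0 w) (exprn_ge0 2 (s0 w)).
    have -> : s w ^+ 2 * (s w * tau w) = s w * s w ^+ 2 * tau w by ring.
    by rewrite -expr2 => h; rewrite ler_peMr.
  apply: (bO_le (C := 2) _ (bOM (bO_up k) (bOB (bO_ZW k) (bOM (bOX 2 hs)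
     (bOM (bO_cst Om 2) (hsg1 k)))))) => // w.
  rewrite mul1r -expr2; have := t1 w; have := mulr_ge0 (s0 w) (exprn_ge0 2 (s0 w)).
  have -> : s w * (s w ^+ 2 + s w ^+ 2 * tau w) = s w * s w ^+ 2 * (1 + tau w) by ring.
  have -> : 2 * (s w ^+ 2 * (s w * tau w)) = s w * s w ^+ 2 * (tau w + tau w) by ring.
  by move=> h h'; rewrite ler_wpM2l // lerD2r.
lra.
Qed.


Lemma gauge_monomials a w : [/\ s w * s w * s w <= gauge a w, s w * V a w <= gauge a w,
  s w ^+ 2 * (s w * tau w) <= gauge a w & s w ^+ 2 * tau w ^+ 2 <= gauge a w].
Proof.
have S0 := s0 w; have T1 := t1 w; have V0' := V0 a w; have S20 := exprn_ge0 2 S0.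
have sV : 0 <= s w * V a w by exact: mulr_ge0.
have T0 := t0 w; have ST : 0 <= s w ^+ 2 * (s w * tau w) by rewrite !mulr_ge0.
have TT : 0 <= s w ^+ 2 * tau w ^+ 2 by rewrite mulr_ge0 // exprn_ge0.
have e : s w * s w * s w <= s w ^+ 2 * (s w * tau w).
  by rewrite -expr2 ler_wpM2l // ler_peMr.
by rewrite /gauge mulrDr; split; lra.
Qed.

Lemma bO_gauge3 a (h : F0) : bO h (fun w => s w * s w * s w) -> bO h (gauge a).
Proof.
by move=> hh; apply: (bO_le (C := 1) _ hh) => // w; rewrite mul1r; case: (gauge_monomials a w).
Qed.

Lemma bO_gaugeV a (h : F0) : bO h (fun w => s w * V a w) -> bO h (gauge a).
Proof.
by move=> hh; apply: (bO_le (C := 1) _ hh) => // w; rewrite mul1r; case: (gauge_monomials a w).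
Qed.

Lemma bO_gaugeT a (h : F0) : bO h (fun w => s w ^+ 2 * (s w * tau w)) -> bO h (gauge a).
Proof.
by move=> hh; apply: (bO_le (C := 1) _ hh) => // w; rewrite mul1r; case: (gauge_monomials a w).
Qed.

Lemma bO_gaugeTT a (h : F0) : bO h (fun w => s w ^+ 2 * tau w ^+ 2) -> bO h (gauge a).
Proof.
by move=> hh; apply: (bO_le (C := 1) _ hh) => // w; rewrite mul1r; case: (gauge_monomials a w).
Qed.

Lemma le_s3 w : s w <= s w * s w * s w /\ s w * s w <= s w * s w * s w.
Proof.
have S1 := s1 w; have S0 := s0 w; have SS := mulr_ge0 S0 S0.
have h2 : s w * s w <= s w * s w * s w by rewrite ler_peMr.
by split=> //; apply: le_trans h2; rewrite ler_peMr.
Qed.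

Lemma bO_gauge2 a (h : F0) : bO h (fun w => s w * s w) -> bO h (gauge a).
Proof.
move=> hh; apply: bO_gauge3; apply: (bO_le (C := 1) _ hh) => // w.
by rewrite mul1r; case: (le_s3 w).
Qed.

Lemma bO_gauge1 a (h : F0) : bO h s -> bO h (gauge a).
Proof.
move=> hh; apply: bO_gauge3; apply: (bO_le (C := 1) _ hh) => // w.
by rewrite mul1r; case: (le_s3 w).
Qed.

Lemma bO_ua a : bO (ua a) s.
Proof. by apply: bO_frame => // i; exact: bO_u1. Qed.

Lemma bO_ww : bO ww (fun w => s w * s w).
Proof.
have ss w : 0 <= s w * s w by rewrite mulr_ge0.
apply: bO_sum => // i; apply: bO_sum => // j.
by apply: (bO_le (C := 1) _ (bOM (bOM (hg i j) (bO_u1 i)) (bO_u1 j))) => // w; rewrite !mul1r.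
Qed.

(** The Hessian of [u] is the derivative of [X] plus that of [beta], so along row [a] it costs [V a]
    and a multiple of [s]. *)
Lemma bO_uaa a : bO (uaa a) (fun w => s w + V a w).
Proof.
have h0 w : 0 <= s w + V a w by rewrite addr_ge0.
apply: (bO_eq (f := fun w => \sum_k P a k w * (X1a k a w + \sum_j P a j w * b1 k j w))) => [w|].
  apply: eq_bigr => k _; rewrite /X1a -big_split mulr_sumr /=.
  by apply: eq_bigr => j _; rewrite /X1; ring.
apply: bO_sum => // k; apply: (bO_le (C := 1) _ (bOM (hP a k) (bOD (hXV k a)
   (bO_sum (g := s) _ _ _ _)))) => // [j|w].
  by apply: (bO_le (C := 1) _ (bOM (hP a j) (hb1 k j))).
by rewrite !mul1r addrC.
Qed.

Lemma bO_e3 a : bO (fun w => lam a w - uaa a w - (ua a w ^+ 2 - 2^-1 * ww w)) s.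
Proof.
apply: (bO_eq (f := fun w => A a w - \sum_l Gm l a w * u1 l w)) => [w|].
  by rewrite /lam; ring.
apply: bOBs; first exact: bO_1s.
by apply: bO_sum => // l; apply: (bO_le (C := 1) _ (bOM (hGm l a) (bO_u1 l))) => // w; rewrite !mul1r.
Qed.

Lemma bO_lam_uaa a : bO (fun w => lam a w - uaa a w) (fun w => s w * s w).
Proof.
apply: (bO_eq (f := fun w => (lam a w - uaa a w - (ua a w ^+ 2 - 2^-1 * ww w))
   + (ua a w ^+ 2 - 2^-1 * ww w))) => [w|]; first by ring.
apply: bODs.
  apply: (bO_le (C := 1) _ (bO_e3 a)) => // w; rewrite mul1r ler_peMr //.
apply: bOBs; last by apply: bOZ; exact: bO_ww.
apply: (bO_eq (f := fun w => ua a w * ua a w)) => [w|]; first by rewrite expr2.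
exact: bOM (bO_ua a) (bO_ua a).
Qed.

Lemma bO_lam a : bO (lam a) (fun w => s w * s w + V a w).
Proof.
apply: (bO_eq (f := fun w => (lam a w - uaa a w) + uaa a w)) => [w|]; first by rewrite subrK.
apply: (bO_le (C := 2) _ (bOD (bO_lam_uaa a) (bO_uaa a))) => // w.
by have h : s w <= s w * s w by [rewrite ler_peMr]; have := V0 a w; lra.
Qed.

Lemma Yrest a w : \sum_k Y k w * rest k a w =
  lam a w * (\sum_k Y k w * mu a k w) - \sum_l Gm l a w * Z l w
  - \sum_k Y k w * (\sum_l Gm1 l a k w * u1 l w)
  + 2 * ua a w * (\sum_i P a i w * Z i w)
  - 2^-1 * (\sum_k Y k w * dww k w + ww w * \sum_k Y k w * g1 a k w)
  + \sum_k Y k w * A1 a k w.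
Proof.
have h1 : \sum_l Gm l a w * Z l w = \sum_k Y k w * \sum_l Gm l a w * u2 l k w.
  under eq_bigr => l _ do rewrite /Z mulr_sumr.
  rewrite exchange_big; apply: eq_bigr => k _; rewrite mulr_sumr; apply: eq_bigr => l _.
  by rewrite (u2C k l) mulrCA.
have h2 : \sum_i P a i w * Z i w = \sum_k Y k w * \sum_i P a i w * u2 i k w.
  under eq_bigr => l _ do rewrite /Z mulr_sumr.
  rewrite exchange_big; apply: eq_bigr => k _; rewrite mulr_sumr; apply: eq_bigr => l _.
  by rewrite (u2C k l) mulrCA.
rewrite h1 h2; under eq_bigr => k _ do rewrite /rest big_split /=.
move: (ua a w) (lam a w) (ww w) => U L wd.
rewrite !mulr_sumr -big_split !mulr_sumr -!sumrB -big_split -sumrB -big_split /=.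
by apply: eq_bigr => k _; ring.
Qed.

Lemma bO_Ysum (v : F1) (h : F0) : (forall w, 0 <= h w) -> (forall k, bO (v k) h) ->
  bO (fun w => \sum_k Y k w * v k w) (fun w => s w * h w).
Proof.
move=> h0 hv; apply: bO_sum => [w|k]; first by rewrite mulr_ge0.
exact: bOM (bO_Y k) (hv k).
Qed.

(** After contraction with [X] the second derivatives of [u] enter through [Z] or through [lam]. Two
    terms are of top order, the derivatives of [ua ^+ 2] and of [ww]; the critical point equation
    gives their leading parts. *)
Lemma bO_Yrest a : bO (fun w => 2 * (\sum_k Y k w * rest k a w)
   - (2 * s w ^+ 2 * q w * ua a w ^+ 2 - s w ^+ 2 * q w * ww w)) (gauge a).
Proof.
pose T0 w := 2 * (lam a w * (\sum_k Y k w * mu a k w)).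
pose T1 w := 2 * \sum_l Gm l a w * Z l w.
pose T2 w := 2 * (\sum_k Y k w * (\sum_l Gm1 l a k w * u1 l w)).
pose T3 w := 2 * (ua a w * (\sum_i P a i w * ((2 * Z i w - W1 i w) - s w ^+ 2 * (2 * sg1 i w)))).
pose T4 w := \sum_k Y k w * dww k w - s w ^+ 2 * (q w * ww w).
pose T5 w := ww w * \sum_k Y k w * g1 a k w.
pose T6 w := 2 * (\sum_k Y k w * A1 a k w).
have one0 w : 0 <= one w by [].
apply: (bO_eq (f := fun w => T0 w - T1 w - T2 w + T3 w - T4 w - T5 w + T6 w)) => [w|].
  rewrite Yrest /T0 /T1 /T2 /T3 /T4 /T5 /T6.
  have -> : \sum_i P a i w * ((2 * Z i w - W1 i w) - s w ^+ 2 * (2 * sg1 i w)) =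
    2 * (\sum_i P a i w * Z i w) - s w ^+ 2 * q w * ua a w.
    rewrite /ua /frame1 !mulr_sumr -sumrB; apply: eq_bigr => i _; rewrite crit; ring.
  by field.
have hT0 : bO T0 (gauge a).
  have hY := bO_Ysum one0 (hmu a).
  apply: bOZ; apply: (bO_le (C := 2) _ (bOM (bO_lam a) hY)) => // w.
  have [h1 h2 _ _] := gauge_monomials a w; rewrite /one mulr1; lra.
have hT1 : bO T1 (gauge a).
  apply: bOZ; apply: bO_gaugeT; apply: bO_sum => [w|l]; first by rewrite !mulr_ge0.
  apply: (bO_le (C := 2) _ (bOM (hGm l a) (bO_Z l))) => // w; rewrite mul1r.
  rewrite [leRHS]mulrCA ler_wpM2l ?exprn_ge0 //; have := s1 w; have := t1 w; nra.
have hT2 : bO T2 (gauge a).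
  apply: bOZ; apply: bO_gauge2; apply: bO_Ysum => // k; apply: bO_sum => // l.
  by apply: (bO_le (C := 1) _ (bOM (hGm1 l a k) (bO_u1 l))) => // w; rewrite !mul1r.
have hT3 : bO T3 (gauge a).
  apply: bOZ; apply: bO_gaugeT.
  have h i : bO (fun w => (2 * Z i w - W1 i w) - s w ^+ 2 * (2 * sg1 i w))
     (fun w => s w ^+ 2 * tau w).
    apply: bOBs.
      apply: (bO_le (C := 1) _ (bO_ZW i)) => // w; by rewrite mul1r -expr2 ler_peMr ?exprn_ge0.
    exact: bOM (bOX 2 hs) (bOZ 2 (hsg1 i)).
  have st0 w : 0 <= s w ^+ 2 * tau w by rewrite mulr_ge0 ?exprn_ge0.
  apply: (bO_le (C := 1) _ (bOM (bO_ua a) (bO_frame a st0 h))) => // w.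
  by rewrite mul1r mulrCA.
have hT4 : bO T4 (gauge a) by apply: bO_gaugeT; exact: bO_Yw1.
have hT5 : bO T5 (gauge a).
  apply: bO_gauge3; apply: (bO_le (C := 1) _ (bOM bO_ww (bO_Ysum one0 (hg1 a)))) => // w.
  by rewrite /one !mulr1 mul1r.
have hT6 : bO T6 (gauge a).
  apply: bOZ; apply: bO_gauge1; apply: (bO_le (C := 1) _ (bO_Ysum one0 (hA1 a))) => // w.
  by rewrite /one mulr1 mul1r.
by apply: bODs => //; apply: bOBs => //; apply: bOBs => //; apply: bODs => //;
  apply: bOBs => //; apply: bOBs.
Qed.

(** The term linear in [uaa] is not an error: [s * V a * s] would exceed the gauge. It is kept aside
    because its sum against the weights [f a] is accessible through Euler's identity. *)
Lemma bO_W2 a : bO (fun w => W2 a w - (2 * V a w ^+ 2 + 2 * (\sum_k Y k w * u3 k a w)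
   - 2 * (\sum_k Y k w * c k w) * uaa a w)) (gauge a).
Proof.
pose T0 w := \sum_k \sum_l g2 k l a w * X k w * X l w.
pose T1 w := \sum_k \sum_l 2 * (dga k l a w * X1a k a w * X l w).
pose T2 w := \sum_k \sum_l 2 * (dga k l a w * X k w * X1a l a w).
pose T3 w := 2 * \sum_k Y k w * r k a w.
apply: (bO_eq (f := fun w => T0 w + T1 w + T2 w - T3 w)) => [w|].
  have hX2 : 2 * (\sum_k Y k w * X2 k a w) = 2 * (\sum_k Y k w * u3 k a w)
     - 2 * (\sum_k Y k w * c k w) * uaa a w - T3 w.
    rewrite /T3 -mulrA -!mulrBr mulr_suml -!sumrB; congr (2 * _); apply: eq_bigr => k _.
    by rewrite /X2; ring.
  have hX2' : 2 * (\sum_k Y k w * X2 k a w) = \sum_k \sum_l g k l w * X2 k a w * X l w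
    + \sum_k \sum_l g k l w * X k w * X2 l a w.
    rewrite -(sum2_Y w (fun k => X2 k a w)) mulrDl mul1r.
    by rewrite {2}(sum2_sym (fun k => X2 k a w) (X^~ w) (fun k l => gC k l w)).
  have hV : 2 * V a w ^+ 2 = \sum_k \sum_l 2 * (g k l w * X1a k a w * X1a l a w).
    rewrite -VE mulr_sumr; apply: eq_bigr => k _; by rewrite mulr_sumr.
  have e : W2 a w = T0 w + T1 w + T2 w + 2 * V a w ^+ 2 + 2 * (\sum_k Y k w * X2 k a w).
    rewrite hV hX2' /T0 /T1 /T2 -!big_split; apply: eq_bigr => k _.
    rewrite -!big_split; apply: eq_bigr => l _ /=; ring.
  by rewrite e hX2; ring.
have hdga k l : bO (dga k l a) (fun=> 1).
  by apply: (bO_frame (v := dg k l)) => // j; exact: hdg.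
have hT0 : bO T0 (gauge a).
  have ss w : 0 <= s w * s w by rewrite mulr_ge0.
  apply: bO_gauge2; apply: bO_sum => // k; apply: bO_sum => // l.
  by apply: (bO_le (C := 1) _ (bOM (bOM (hg2 k l a) (hX k)) (hX l))) => // w; rewrite !mul1r.
have sV w : 0 <= s w * V a w by rewrite mulr_ge0.
have hT1 : bO T1 (gauge a).
  apply: bO_gaugeV; apply: bO_sum => // k; apply: bO_sum => // l; apply: bOZ.
  apply: (bO_le (C := 1) _ (bOM (bOM (hdga k l) (hXV k a)) (hX l))) => // w.
  by rewrite !mul1r mulrC.
have hT2 : bO T2 (gauge a).
  apply: bO_gaugeV; apply: bO_sum => // k; apply: bO_sum => // l; apply: bOZ.
  by apply: (bO_le (C := 1) _ (bOM (bOM (hdga k l) (hX k)) (hXV l a))) => // w; rewrite !mul1r.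
have hT3 : bO T3 (gauge a).
  have ss w : 0 <= s w * s w by rewrite mulr_ge0.
  apply: bOZ; apply: bO_gauge3; apply: (bO_le (C := 1) _ (bO_Ysum ss (hr^~ a))) => // w.
  by rewrite mul1r mulrA.
by apply: bOBs => //; apply: bODs => //; exact: bODs.
Qed.

Lemma bO_ww2 a : bO (fun w => s w ^+ 2 * q w * (ww w - s w ^+ 2)) (gauge a).
Proof.
have h : bO (fun w => ww w - s w ^+ 2) s.
  apply: (bO_eq (f := fun w => 2 * (\sum_k Y k w * b0 k w) +
      \sum_k \sum_l g k l w * b0 k w * b0 l w)) => [w|].
    rewrite -(sum2_Y w (fun k => b0 k w)) mulrDl mul1r.
    rewrite {2}(sum2_sym (fun k => b0 k w) (X^~ w) (fun k l => gC k l w)).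
    rewrite -sE /ww -!big_split -sumrB; apply: eq_bigr => k _.
    rewrite -!big_split -sumrB; apply: eq_bigr => l _ /=; rewrite !u1E; ring.
  apply: bODs.
    apply: bOZ; apply: (bO_le (C := 1) _ (bO_Ysum (h := one) _ hb0)) => // w.
    by rewrite /one mulr1 mul1r.
  apply: bO_1s; apply: bO_sum => // k; apply: bO_sum => // l.
  by apply: (bO_le (C := 1) _ (bOM (bOM (hg k l) (hb0 k)) (hb0 l))) => // w; rewrite !mul1r.
apply: bO_gauge3; apply: (bO_le (C := 1) _ (bOM (bOM (bOX 2 hs) hq) h)) => // w.
by rewrite mulr1 mul1r expr2.
Qed.

(** Count the coefficients of [s ^+ 2 * q]. The square [ua ^+ 2] occurs with 1 in the second-order
    condition, with -2 from the differentiated equation, and with 1 when [uaa] is expressed by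
    [lam]: it cancels. The norm [ww] occurs with 1 from the differentiated equation and with -1/2
    from [lam]: one half remains, and [ww] is [s ^+ 2] up to an error. *)
Lemma interior_sum : exists2 K, 0 <= K & forall w,
  \sum_a f a w * (2 * V a w ^+ 2 + 2^-1 * q w * s w ^+ 4) <= K * \sum_a f a w * gauge a w.
Proof.
pose cY w := \sum_k Y k w * c k w.
pose e1 a w := 2 * (\sum_k Y k w * rest k a w)
   - (2 * s w ^+ 2 * q w * ua a w ^+ 2 - s w ^+ 2 * q w * ww w).
pose e2 a w := W2 a w - (2 * V a w ^+ 2 + 2 * (\sum_k Y k w * u3 k a w)
   - 2 * cY w * uaa a w).
pose e3 a w := lam a w - uaa a w - (ua a w ^+ 2 - 2^-1 * ww w).
pose e4 a w := 4 * frame1 sg1 a w * frame1 W1 a w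
     + (2 * sg2 a w + 2 * frame1 sg1 a w ^+ 2) * s w ^+ 2.
pose e5 a w := 2 * cY w * (lam a w - uaa a w).
pose e6 a w := s w ^+ 2 * q w * (ww w - s w ^+ 2).
pose E a w := - e1 a w + e2 a w + e4 a w + s w ^+ 2 * q w * e3 a w + e5 a w + 2^-1 * e6 a w.
pose B w := 2 * (\sum_k Y k w * psi1 k w) - 2 * cY w * psi0 w - s w ^+ 2 * q w * psi0 w.
have hcY : bO cY s.
  apply: (bO_le (C := 1) _ (bO_Ysum (h := one) _ hc)) => // w; by rewrite /one mulr1 mul1r.
have hE a : bO (E a) (gauge a).
  have h4 : bO (e4 a) (gauge a).
    have hs1 : bO (frame1 sg1 a) tau by apply: bO_frame.
    have hw1 : bO (frame1 W1 a) (fun w => s w ^+ 2 * (s w + tau w)).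
      by apply: bO_frame => [w|i]; [rewrite mulr_ge0 ?exprn_ge0 ?addr_ge0 | exact: bO_W1].
    apply: bODs.
      apply: (bO_le (C := 1) _ (bOM (bOM (bO_cst Om 4) hs1) hw1)) => // w.
      rewrite !mul1r /gauge; have -> : tau w * (s w ^+ 2 * (s w + tau w)) =
        s w ^+ 2 * (s w * tau w + tau w ^+ 2) by ring.
      by rewrite lerDl mulr_ge0.
    apply: bO_gaugeTT; apply: (bO_eq (f := fun w => s w ^+ 2 * (2 * sg2 a w + 2 * frame1 sg1 a w ^+ 2))) => [w|].
      by rewrite mulrC.
    apply: bOM (bOX 2 hs) _; apply: bODs; apply: bOZ; last exact: bOX.
    by apply: (bO_le (C := 1) _ (hsg2 a)) => // w; rewrite mul1r expr2.
  have h3 : bO (fun w => s w ^+ 2 * q w * e3 a w) (gauge a).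
    apply: bO_gauge3; apply: (bO_le (C := 1) _ (bOM (bOM (bOX 2 hs) hq) (bO_e3 a))) => // w.
    by rewrite mulr1 mul1r expr2.
  have h5 : bO (e5 a) (gauge a).
    apply: bO_gauge3; apply: (bO_le (C := 1) _ (bOM (bOZ 2 hcY) (bO_lam_uaa a))) => // w.
    by rewrite mul1r mulrA.
  apply: bODs; last by apply: bOZ; exact: bO_ww2.
  apply: bODs => //; apply: bODs => //; apply: bODs => //; apply: bODs; last exact: bO_W2.
  by apply: bON; exact: bO_Yrest.
have hB : bO B (fun w => s w * s w).
  apply: bOBs.
    apply: bOBs; first by apply: bOZ; exact: bO_Ysum.
    apply: (bO_le (C := 1) _ (bOM (bOZ 2 hcY) hpsi0)) => // w.
    by rewrite mulr1 mul1r ler_peMr.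
  apply: (bO_le (C := 1) _ (bOM (bOM (bOX 2 hs) hq) hpsi0)) => // w.
  by rewrite !mulr1 mul1r expr2.
have main w : \sum_a f a w * (2 * V a w ^+ 2 + 2^-1 * q w * s w ^+ 4 + E a w) + B w <= 0.
  apply: le_trans (second w).
  have hpde : \sum_a f a w * (2 * (\sum_k Y k w * u3 k a w)) =
     2 * (\sum_k Y k w * psi1 k w) - \sum_a f a w * (2 * (\sum_k Y k w * rest k a w)).
    apply/eqP; rewrite eq_sym subr_eq; apply/eqP.
    under [X in _ = X + _]eq_bigr => a _ do rewrite mulrCA.
    under [X in _ = _ + X]eq_bigr => a _ do rewrite mulrCA.
    rewrite -!mulr_sumr -mulrDr; congr (2 * _).
    under [X in _ = X + _]eq_bigr => a _ do rewrite mulr_sumr.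
    under [X in _ = _ + X]eq_bigr => a _ do rewrite mulr_sumr.
    rewrite [X in _ = X + _]exchange_big [X in _ = _ + X]exchange_big -big_split.
    apply: eq_bigr => k _ /=; rewrite -pde -big_split mulr_sumr; apply: eq_bigr => a _ /=.
    ring.
  have heul : \sum_a f a w * uaa a w = psi0 w - \sum_a f a w * (lam a w - uaa a w).
    rewrite -euler -sumrB; apply: eq_bigr => a _; ring.
  have hq1 : (2 * cY w + s w ^+ 2 * q w) * \sum_a f a w * uaa a w =
     (2 * cY w + s w ^+ 2 * q w) * psi0 w
     - \sum_a f a w * ((2 * cY w + s w ^+ 2 * q w) * (lam a w - uaa a w)).
    rewrite heul mulrBr; congr (_ - _); rewrite [LHS]mulr_sumr; apply: eq_bigr => a _; ring.
  rewrite le_eqVlt; apply/orP; left; apply/eqP.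
  have -> : \sum_a f a w * (W2 a w + 4 * frame1 sg1 a w * frame1 W1 a w
     + (2 * sg2 a w + 2 * frame1 sg1 a w ^+ 2) * s w ^+ 2
     - s w ^+ 2 * (q w * uaa a w - q w * ua a w ^+ 2)) =
     \sum_a f a w * (2 * (\sum_k Y k w * u3 k a w))
     - (2 * cY w + s w ^+ 2 * q w) * (\sum_a f a w * uaa a w)
     + \sum_a f a w * (2 * V a w ^+ 2 + e2 a w + e4 a w + s w ^+ 2 * q w * ua a w ^+ 2).
    rewrite mulr_sumr -sumrB -big_split; apply: eq_bigr => a _; rewrite /e2 /e4 /=; ring.
  rewrite hpde hq1.
  have -> : \sum_a f a w * (2 * V a w ^+ 2 + 2^-1 * q w * s w ^+ 4 + E a w) =
    - (\sum_a f a w * (2 * (\sum_k Y k w * rest k a w)))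
    + \sum_a f a w * ((2 * cY w + s w ^+ 2 * q w) * (lam a w - uaa a w))
    + \sum_a f a w * (2 * V a w ^+ 2 + e2 a w + e4 a w + s w ^+ 2 * q w * ua a w ^+ 2).
    rewrite -sumrN -!big_split; apply: eq_bigr => a _.
    by rewrite /E /e1 /e3 /e5 /e6 /=; field.
  by rewrite /B; ring.
have [KE hKE0 hKE] : exists2 K, 0 <= K & forall a w, `|E a w| <= K * gauge a w.
  have [K hK] := choice (fun a => let: ex_intro2 C C0 hC := hE a in
    ex_intro (fun C => 0 <= C /\ forall w, 0 <= gauge a w /\ `|E a w| <= C * gauge a w) C (conj C0 hC)).
  exists (\sum_a K a); first by apply: sumr_ge0 => a _; case: (hK a).
  move=> a w; have [K0 hK'] := hK a; have [g0 hh] := hK' w; apply: le_trans hh _.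
  rewrite ler_wpM2r // (bigD1 a) //= lerDl; apply: sumr_ge0 => b _; by case: (hK b).
have [KB KB0 hKB] := hB.
exists (KE + KB / c0); first by rewrite addr_ge0 // divr_ge0 // ltW.
move=> w; have := main w; have [_ hb] := hKB w.
(* [B] collects the terms without weight; the lower bound [c0] for the sum of the weights lets it
   join the weighted errors. *)
have hb2 : KB * (s w * s w) <= KB / c0 * \sum_a f a w * gauge a w.
  have h1 : s w * s w * \sum_a f a w <= \sum_a f a w * gauge a w.
    rewrite mulr_sumr; apply: ler_sum => a _; rewrite mulrC ler_wpM2l ?(ltW (f0 a w)) //.
    by have [h _ _ _] := gauge_monomials a w; apply: le_trans h; case: (le_s3 w).
  rewrite -mulrA ler_wpM2l // ler_pdivlMl //; apply: le_trans h1.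
  by rewrite mulrC ler_wpM2l // mulr_ge0.
have hE' : - \sum_a f a w * E a w <= KE * \sum_a f a w * gauge a w.
  rewrite -sumrN mulr_sumr; apply: ler_sum => a _; rewrite -mulrN [leRHS]mulrCA.
  rewrite ler_wpM2l ?(ltW (f0 a w)) //; apply: le_trans (hKE a w); by rewrite -normrN ler_norm.
move: hb; rewrite ler_norml => /andP[hb _].
have -> : \sum_a f a w * (2 * V a w ^+ 2 + 2^-1 * q w * s w ^+ 4 + E a w) =
  \sum_a f a w * (2 * V a w ^+ 2 + 2^-1 * q w * s w ^+ 4) + \sum_a f a w * E a w.
  by rewrite -big_split; apply: eq_bigr => a _; rewrite mulrDr.
rewrite mulrDl; lra.
Qed.

(** If [s] were large compared with [tau], the good terms would exceed the errors in every single
    row, which contradicts the weighted sum. No bound on the individual weights enters. *)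
Lemma interior_bound : exists2 C, 0 < C & forall w, s w <= C * tau w.
Proof.
have [K K0 hK] := interior_sum.
(* [K + K] comes from [s * tau + tau ^+ 2 <= 2 * s * tau], valid when [tau <= s], and [K ^+ 2] from
   splitting [K * s * V] by Young's inequality. *)
pose L := K + K + K ^+ 2; have L0 : 0 <= L by rewrite !addr_ge0 // exprn_ge0.
exists (2 * L / q0 + 1); first by rewrite ltr_wpDl // divr_ge0 ?mulr_ge0 // ltW.
move=> w; rewrite leNgt; apply/negP => lt.
have S1 := s1 w; have T1 := t1 w; have S0 := s0 w.
have C1 : 0 <= 2 * L / q0 by rewrite divr_ge0 ?mulr_ge0 // ltW.
have ts : tau w <= s w.
  apply: ltW; apply: le_lt_trans lt; rewrite mulrDl mul1r lerDr mulr_ge0 //; lra.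
have ht : 2 * L * tau w < q0 * s w.
  have : 2 * L / q0 * tau w < s w.
    by apply: le_lt_trans lt; rewrite [leRHS]mulrDl mul1r lerDl; lra.
  by rewrite mulrAC ltr_pdivrMr // [s w * q0]mulrC.
have pos a : 0 < 2 * V a w ^+ 2 + 2^-1 * q w * s w ^+ 4 - K * gauge a w.
  have hv : K * (s w * V a w) <= V a w ^+ 2 + K ^+ 2 * s w ^+ 2.
    rewrite -subr_ge0; have -> : V a w ^+ 2 + K ^+ 2 * s w ^+ 2 - K * (s w * V a w) =
      (V a w - 2^-1 * K * s w) ^+ 2 + (3 / 4) * (K ^+ 2 * s w ^+ 2) by field.
    by rewrite addr_ge0 ?sqr_ge0 // !mulr_ge0 ?sqr_ge0.
  have hg' : K * gauge a w = s w ^+ 2 * (K * (s w * tau w + tau w ^+ 2)) + K * (s w * V a w).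
    by rewrite /gauge; ring.
  have S20 : 0 < s w ^+ 2 by rewrite exprn_gt0 //; lra.
  have h2 : K * (s w * tau w + tau w ^+ 2) + K ^+ 2 < 2^-1 * q w * s w ^+ 2.
    have a1 : tau w ^+ 2 <= s w * tau w by rewrite expr2 ler_wpM2r //; lra.
    have a2 : 1 <= s w * tau w by rewrite -[1]mulr1 ler_pM.
    have a3 : K * (s w * tau w + tau w ^+ 2) + K ^+ 2 <= L * (s w * tau w).
      have b1' : K * (s w * tau w + tau w ^+ 2) <= K * (s w * tau w + s w * tau w).
        by rewrite ler_wpM2l // lerD2l.
      have b2' : K ^+ 2 * 1 <= K ^+ 2 * (s w * tau w) by rewrite ler_wpM2l // exprn_ge0.
      by rewrite /L; lra.
    have a4 : 2 * L * tau w * s w < q0 * s w * s w by rewrite ltr_pM2r //; lra.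
    have a5 : q0 * s w ^+ 2 <= q w * s w ^+ 2 by rewrite ler_pM2r.
    by rewrite expr2 in a5 *; lra.
  have h3 : s w ^+ 2 * (K * (s w * tau w + tau w ^+ 2) + K ^+ 2) < s w ^+ 2 * (2^-1 * q w * s w ^+ 2).
    by rewrite ltr_pM2l.
  have e4 : s w ^+ 4 = s w ^+ 2 * s w ^+ 2 by rewrite -exprD.
  by have := sqr_ge0 (V a w); rewrite hg' e4; lra.
have : 0 < \sum_a f a w * (2 * V a w ^+ 2 + 2^-1 * q w * s w ^+ 4 - K * gauge a w).
  have : 0 < \sum_a f a w by exact: lt_le_trans (sumf w).
  case: (pickP (fun _ : 'I_n => true)) => [a0 _|no]; last by rewrite big1 ?ltxx // => a; have := no a.
  move=> _; rewrite (bigD1 a0) //= ltr_wpDr ?mulr_gt0 //.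
  by apply: sumr_ge0 => a _; rewrite mulr_ge0 ?(ltW (f0 a w)) // ltW.
apply/negP; rewrite -leNgt.
under eq_bigr => a _ do rewrite mulrBr.
rewrite sumrB subr_le0; apply: le_trans (hK w) _.
by rewrite mulr_sumr; apply: ler_sum => a _; rewrite mulrCA.
Qed.

End InteriorAlgebra.

Lemma le_half (R : realType) (z K : R) : 0 <= K -> 2 * z <= K -> z <= K + 1.
Proof. lra. Qed.

(** * The algebra of a maximum on the boundary *)

Section BoundaryAlgebra.
Variables (R : realType) (Om : Type) (n : nat) (i0 : 'I_n).
Notation F0 := (Om -> R).
Notation F1 := ('I_n -> Om -> R).
Notation F2 := ('I_n -> 'I_n -> Om -> R).
Notation F3 := ('I_n -> 'I_n -> 'I_n -> Om -> R).
Variables (s q sn : F0) (u1 b0 X : F1) (g u2 b1 : F2) (dg : F3).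
Implicit Types (i j k l : 'I_n) (w : Om).
Notation DX := (X1 u2 b1).
Notation W1 := (W1 X g u2 b1 dg).
Hypotheses (s1 : forall w, 1 <= s w) (hq : bO q (fun=> 1))
  (hb0 : forall i, bO (b0 i) (fun=> 1)) (hX : forall i, bO (X i) s)
  (hg : forall k l, bO (g k l) (fun=> 1)) (hb1 : forall k l, bO (b1 k l) s)
  (hdg : forall k l j, bO (dg k l j) (fun=> 1)).
Hypotheses (gC : forall k l w, g k l w = g l k w) (u2C : forall k l w, u2 k l w = u2 l k w)
  (u1E : forall k w, u1 k w = X k w + b0 k w)
  (bdX : forall w, \sum_k g i0 k w * X k w = 0)
  (tgX : forall l w, l != i0 -> \sum_j (dg i0 j l w * X j w + g i0 j w * DX j l w) = 0)
  (maxb : forall w, \sum_j g i0 j w * W1 j w + 2 * sn w * s w ^+ 2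
     <= s w ^+ 2 * q w * \sum_j g i0 j w * u1 j w).

Let s0 w : 0 <= s w. Proof. by apply: le_trans (s1 w). Qed.
Let ss w : 0 <= s w * s w. Proof. by rewrite mulr_ge0. Qed.

(** [sn] stands for the logarithmic conormal derivative of the cut-off. In the conormal derivative
    of [|X|^2] the second derivatives of [u] are contracted with [X], whose raised component of
    index [i0] vanishes; in the remaining directions the differentiated tangency [tgX] removes them,
    so that a multiple of [s ^+ 2] is left. The conormal derivative of [u] is that of the [b0] part
    alone. *)
Lemma boundary_bound : exists2 C, 0 < C & forall w, sn w <= C.
Proof.
pose Y k w := \sum_l g l k w * X l w.
have hY k : bO (Y k) s.
  apply: bO_sum => // l; apply: (bO_le (C := 1) _ (bOM (hg l k) (hX l))) => //.
have Y0 w : Y i0 w = 0 by rewrite -[RHS](bdX w); apply: eq_bigr => l _; rewrite gC.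
pose A w := \sum_j g i0 j w * \sum_k \sum_l dg k l j w * X k w * X l w.
pose B w := \sum_k Y k w * \sum_j g i0 j w * b1 j k w.
pose C w := \sum_k Y k w * \sum_j dg i0 j k w * X j w.
pose D w := \sum_j g i0 j w * \sum_k Y k w * b1 k j w.
have W1nE w : \sum_j g i0 j w * W1 j w = A w + 2 * B w - 2 * C w - 2 * D w.
  have -> : \sum_j g i0 j w * W1 j w = A w + 2 * (\sum_k Y k w * \sum_j g i0 j w * u2 j k w)
     - 2 * D w.
    have lin (a b c d : 'I_n -> R) : \sum_j a j * (b j + 2 * c j - 2 * d j) =
        \sum_j a j * b j + 2 * (\sum_j a j * c j) - 2 * \sum_j a j * d j.
      by rewrite !mulr_sumr -big_split -sumrB; apply: eq_bigr => j _ /=; ring.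
    have W1Y j : W1 j w = \sum_k \sum_l dg k l j w * X k w * X l w
       + 2 * (\sum_k Y k w * u2 k j w) - 2 * \sum_k Y k w * b1 k j w by exact: W1E.
    under eq_bigr => j _ do rewrite W1Y.
    rewrite lin -/(A w) -/(D w); congr (_ + 2 * _ - _).
    under eq_bigr => j _ do rewrite mulr_sumr.
    rewrite exchange_big /=; apply: eq_bigr => k _; rewrite mulr_sumr.
    by apply: eq_bigr => j _; rewrite (u2C k j) mulrCA.
  have -> : \sum_k Y k w * \sum_j g i0 j w * u2 j k w = B w - C w.
    rewrite -sumrB; apply: eq_bigr => k _.
    have [->|ki] := eqVneq k i0; first by rewrite Y0 !mul0r subrr.
    rewrite -mulrBr; congr (_ * _); have := tgX w ki; rewrite big_split /=.
    have -> : \sum_j g i0 j w * DX j k w = \sum_j g i0 j w * u2 j k w - \sum_j g i0 j w * b1 j k w.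
      by rewrite -sumrB; apply: eq_bigr => j _; rewrite mulrBr.
    lra.
  by ring.
have one0 (w : Om) : 0 <= 1 :> R by [].
have hA : bO A (fun w => s w * s w).
  apply: bO_sum => // j; apply: (bO_le (C := 1) (g := fun w => 1 * (s w * s w))) => //.
  apply: bOM; first exact: hg.
  apply: bO_sum => // k; apply: bO_sum => // l.
  by apply: (bO_le (C := 1) _ (bOM (bOM (hdg k l j) (hX k)) (hX l))) => // w; rewrite !mul1r.
have hB : bO B (fun w => s w * s w).
  apply: bO_sum => // k; apply: bOM => //; apply: bO_sum => // j.
  by apply: (bO_le (C := 1) _ (bOM (hg i0 j) (hb1 j k))).
have hC : bO C (fun w => s w * s w).
  apply: bO_sum => // k; apply: bOM => //; apply: bO_sum => // j.
  by apply: (bO_le (C := 1) _ (bOM (hdg i0 j k) (hX j))).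
have hD : bO D (fun w => s w * s w).
  apply: bO_sum => // j; apply: (bO_le (C := 1) (g := fun w => 1 * (s w * s w))) => //.
  apply: bOM; first exact: hg.
  by apply: bO_sum => // k; exact: bOM (hY k) (hb1 k j).
have hU : bO (fun w => s w ^+ 2 * q w * \sum_j g i0 j w * u1 j w) (fun w => s w * s w).
  have h : bO (fun w => \sum_j g i0 j w * b0 j w) (fun=> 1).
    by apply: bO_sum => // j; apply: (bO_le (C := 1) _ (bOM (hg i0 j) (hb0 j))).
  apply: (bO_eq (f := fun w => s w ^+ 2 * q w * \sum_j g i0 j w * b0 j w)) => [w|].
    congr (_ * _); under [RHS]eq_bigr => j _ do rewrite u1E mulrDr.
    by rewrite big_split /= bdX add0r.
  have hs : bO (fun w => s w ^+ 2) (fun w => s w ^+ 2) by apply: bO_refl => w; rewrite exprn_ge0.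
  by apply: (bO_le (C := 1) _ (bOM (bOM hs hq) h)) => // w; rewrite !mulr1 mul1r expr2.
have [K K0 hK] : bO (fun w => s w ^+ 2 * q w * (\sum_j g i0 j w * u1 j w)
    - (A w + 2 * B w - 2 * C w - 2 * D w)) (fun w => s w * s w).
  by apply: bOBs => //; apply: bOBs; [apply: bOBs; [apply: bODs => //|]|]; apply: bOZ.
exists (K + 1); first by rewrite ltr_wpDl.
move=> w; have [_] := hK w; rewrite ler_norml => /andP[_ h].
have := maxb w; rewrite W1nE => h2.
have S0 : 0 < s w * s w by apply: mulr_gt0; apply: lt_le_trans (s1 w).
have : 2 * sn w * (s w * s w) <= K * (s w * s w).
  by rewrite -lerBrDl in h2; rewrite -[X in _ * X <= _]expr2; exact: le_trans h2 h.
by rewrite ler_pM2r // => h3; exact: le_half.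
Qed.

End BoundaryAlgebra.

Lemma half_orthant (R : realType) (m : nat) :
  @half_space R m = orthant (pred1 (ord0 : 'I_m.+1)).
Proof.
rewrite eqEsubset; split=> x /=; first by move=> h i /eqP ->.
by apply; rewrite /= eqxx.
Qed.

(** * The equation in a chart *)

Section HalfSpace.
Variables (R : realType) (m : nat) (W : set 'rV[R]_m.+1).
Notation V := 'rV[R]_m.+1.
Notation H := (@half_space R m).
Hypothesis HW : relopen H W.
Implicit Types (f g : V -> R) (x v : V).

Let HW' : relopen (orthant (pred1 (ord0 : 'I_m.+1))) W.
Proof. by rewrite -half_orthant. Qed.

Lemma hCk_cst k c : Ck H W k (fun=> c).
Proof. by rewrite half_orthant; exact: Ck_cst. Qed.
Lemma hCkD k f g : Ck H W k f -> Ck H W k g -> Ck H W k (fun x => f x + g x).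
Proof. by rewrite half_orthant; exact: CkD. Qed.
Lemma hCkB k f g : Ck H W k f -> Ck H W k g -> Ck H W k (fun x => f x - g x).
Proof. by rewrite half_orthant; exact: CkB. Qed.
Lemma hCkM k f g : Ck H W k f -> Ck H W k g -> Ck H W k (fun x => f x * g x).
Proof. by rewrite half_orthant; exact: CkM. Qed.
Lemma hCkZ k c f : Ck H W k f -> Ck H W k (fun x => c * f x).
Proof. by rewrite half_orthant; exact: CkZ. Qed.
Lemma hCkV k f : (forall x, W x -> f x != 0) -> Ck H W k f -> Ck H W k (fun x => (f x)^-1).
Proof. by rewrite half_orthant; exact: CkV. Qed.
Lemma hCk_sqrt k f : (forall x, W x -> 0 < f x) -> Ck H W k f ->
  Ck H W k (fun x => Num.sqrt (f x)).
Proof. by rewrite half_orthant; exact: Ck_sqrt. Qed.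
Lemma hCk_sum k (I : Type) (r : seq I) (P : pred I) (f : I -> V -> R) :
  (forall i, Ck H W k (f i)) -> Ck H W k (fun x => \sum_(i <- r | P i) f i x).
Proof. by rewrite half_orthant => h; apply: Ck_sum. Qed.
Lemma hCk_invmx k q (A : V -> 'M[R]_q) : (forall x, W x -> A x \in unitmx) ->
  (forall i j, Ck H W k (fun x => A x i j)) -> forall i j, Ck H W k (fun x => invmx (A x) i j).
Proof. by rewrite half_orthant; exact: Ck_invmx. Qed.
Lemma hCk_pd k f i : Ck H W k.+1 f -> Ck H W k (pd i f).
Proof. by move=> [_ /(_ i) []]. Qed.
Lemma hCk_le k l f : (k <= l)%N -> Ck H W l f -> Ck H W k f.
Proof. by rewrite half_orthant; exact: Ck_le. Qed.
Lemma hCk_ext k f g : (forall x, W x -> f x = g x) -> Ck H W k f -> Ck H W k g.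
Proof. by rewrite half_orthant; exact: Ck_ext. Qed.
Lemma hCk_bounded k f (K : set V) : Ck H W k f -> compact K -> K `<=` W ->
  exists C, forall x, K x -> `|f x| <= C.
Proof. by rewrite half_orthant; exact: Ck_bounded. Qed.

Lemma pd_ext f g x i : W x -> (forall y, W y -> f y = g y) -> pd i f x = pd i g x.
Proof. by move=> Wx fg; rewrite /pd half_orthant; exact: (partial_ext i HW' Wx fg). Qed.

Lemma pd_hasgrad f x : Ck H W 1 f -> W x -> hasgrad H f x (fun i => pd i f x).
Proof. by rewrite /pd half_orthant; exact: Ck1_hasgrad. Qed.

Lemma pd_taylor f x : Ck H W 2 f -> W x ->
  hastaylor H f x (fun i => pd i f x) (fun i j => pd j (pd i f) x).
Proof. by rewrite /pd half_orthant; exact: Ck2_taylor. Qed.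

Lemma pd_young f x i j : Ck H W 2 f -> W x -> pd i (pd j f) x = pd j (pd i f) x.
Proof. by rewrite /pd half_orthant; exact: young. Qed.

Lemma pd_dir f x i : Ck H W 1 f -> W x ->
  jet1 (dir_filter H i x) (fun t => f (x + t *: delta_mx 0 i)) (f x) (pd i f x).
Proof. by rewrite /pd half_orthant; exact: Ck_jet1. Qed.

Lemma pd_eq f x i L : W x ->
  jet1 (dir_filter H i x) (fun t => f (x + t *: delta_mx 0 i)) (f x) L -> pd i f x = L.
Proof.
move=> Wx; have [Hx _] := HW Wx; move: Hx; rewrite /pd half_orthant => Hx.
exact: partialE.
Qed.

Lemma hdir_punctured x i : W x -> punctured_filter (dir_filter H i x).
Proof. by move=> /HW[Hx _]; move: Hx; rewrite half_orthant; exact: dir_punctured. Qed.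

Lemma pd_cst (c : R) x i : W x -> pd i (fun=> c) x = 0.
Proof. by move=> Wx; apply: pd_eq => //; apply: jet1_cst; exact: hdir_punctured. Qed.

Lemma pdD f g x i : Ck H W 1 f -> Ck H W 1 g -> W x ->
  pd i (fun y => f y + g y) x = pd i f x + pd i g x.
Proof. by move=> hf hg Wx; apply: pd_eq => //; apply: jet1D; exact: pd_dir. Qed.

Lemma pdB f g x i : Ck H W 1 f -> Ck H W 1 g -> W x ->
  pd i (fun y => f y - g y) x = pd i f x - pd i g x.
Proof. by move=> hf hg Wx; apply: pd_eq => //; apply: jet1B; exact: pd_dir. Qed.

Lemma pdM f g x i : Ck H W 1 f -> Ck H W 1 g -> W x ->
  pd i (fun y => f y * g y) x = pd i f x * g x + f x * pd i g x.
Proof. by move=> hf hg Wx; apply: pd_eq => //; apply: jet1M; exact: pd_dir. Qed.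

Lemma pdZ c f x i : Ck H W 1 f -> W x -> pd i (fun y => c * f y) x = c * pd i f x.
Proof. by move=> hf Wx; apply: pd_eq => //; apply: jet1Z; exact: pd_dir. Qed.

Lemma pd_sum (I : Type) (r : seq I) (P : pred I) (f : I -> V -> R) x i :
  (forall k, Ck H W 1 (f k)) -> W x ->
  pd i (fun y => \sum_(k <- r | P k) f k y) x = \sum_(k <- r | P k) pd i (f k) x.
Proof.
move=> hf Wx; apply: pd_eq => //; apply: jet1_sum; first exact: hdir_punctured.
by move=> k _; exact: pd_dir.
Qed.

Lemma interior_near x v : W x -> 0 < x 0 ord0 ->
  \forall t \near (0 : R)^', H (x + t *: v).
Proof.
move=> Wx x0; have v1 : 0 < `|v| + 1 by rewrite ltr_wpDl.
exists (x 0 ord0 / (`|v| + 1)); first by rewrite /= divr_gt0.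
move=> t /=; rewrite sub0r normrN ltr_pdivlMr // => ht _; rewrite /half_space /= !mxE.
have := ler_norm_coord v ord0 => hv.
have : `|t * v 0 ord0| <= `|t| * (`|v| + 1).
  by rewrite normrM ler_wpM2l // (le_trans hv) // lerDl.
by move=> h; have := le_lt_trans h ht; rewrite ltr_norml => /andP[h1 _]; lra.
Qed.

Lemma line_jet2 f x v : Ck H W 2 f -> W x -> 0 < x 0 ord0 ->
  jet2 0^' (fun t => f (x + t *: v)) (f x) (\sum_i v 0 i * pd i f x)
    (\sum_i \sum_j v 0 i * v 0 j * pd j (pd i f) x).
Proof.
move=> hf Wx x0; have pF := punctured_filter_dnbhs R.
have := hastaylor_path (a := 0) pF (interior_near v Wx x0)
  (fun i => line_coord x v pF i) _ (pd_taylor hf Wx).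
have -> : \sum_i (0 : V) 0 i * pd i f x = 0.
  by apply: big1 => i _; rewrite mxE mul0r.
rewrite add0r; apply => i; rewrite mxE; exact: line_coord2.
Qed.

Lemma line_jet1 f x v : Ck H W 1 f -> W x -> 0 < x 0 ord0 ->
  jet1 0^' (fun t => f (x + t *: v)) (f x) (\sum_i v 0 i * pd i f x).
Proof.
move=> hf Wx x0; have pF := punctured_filter_dnbhs R.
apply: (hasgrad_path pF (interior_near v Wx x0)); last exact: pd_hasgrad.
by move=> i; exact: line_coord.
Qed.

Lemma line_jet1_right f x v : Ck H W 1 f -> W x -> 0 <= v 0 ord0 ->
  jet1 0^'+ (fun t => f (x + t *: v)) (f x) (\sum_i v 0 i * pd i f x).
Proof.
move=> hf Wx v0; have pF := punctured_filter_right R.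
apply: (hasgrad_path pF (D := H)); last exact: pd_hasgrad.
  have [Hx _] := HW Wx; near=> t; rewrite /half_space /= !mxE addr_ge0 // mulr_ge0 // ltW.
by move=> i; exact: line_coord.
Unshelve. all: by end_near. Qed.

End HalfSpace.

Lemma sum2_mull (R : pzSemiRingType) (I : finType) (F : I -> I -> R) (z : R) :
  (\sum_c \sum_d F c d) * z = \sum_c \sum_d F c d * z.
Proof. by rewrite mulr_suml; apply: eq_bigr => c _; rewrite mulr_suml. Qed.

Lemma sum4C (R : nmodType) (n : nat) (F : 'I_n -> 'I_n -> 'I_n -> 'I_n -> R) :
  \sum_i \sum_l \sum_c \sum_d F i l c d = \sum_i \sum_l \sum_c \sum_d F c d i l.
Proof.
under eq_bigr => i _ do rewrite exchange_big /=.
under eq_bigr => i _ do under eq_bigr => c _ do rewrite exchange_big /=.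
rewrite exchange_big /=.
by under eq_bigr => i _ do rewrite exchange_big /=.
Qed.

(** * Regularity and symmetry of the curvature tensors *)

Section Geometry.
Variables (R : realType) (m : nat) (W : set 'rV[R]_m.+1).
Notation n := (m.+1).
Notation V := 'rV[R]_m.+1.
Notation H := (@half_space R m).
Hypothesis HW : relopen H W.
Variable G : V -> 'M[R]_n.
Hypothesis G_smooth : forall k i j, Ck H W k (fun x => G x i j).
Hypothesis G_sym : forall x, W x -> (G x)^T = G x.
Hypothesis G_pos : forall x, W x -> posdef (G x).
Implicit Types (x : V).

Lemma G_unit x : W x -> G x \in unitmx.
Proof.
move=> Wx; have [Q [l hf]] := frame_exists (G_sym Wx) (G_sym Wx) (G_pos Wx).
exact: frame_unit hf.
Qed.

Lemma GC x i j : W x -> G x i j = G x j i.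
Proof. by move=> Wx; rewrite -[in LHS](G_sym Wx) mxE. Qed.

Lemma ginvC x i j : W x -> ginv G x i j = ginv G x j i.
Proof. by move=> Wx; rewrite /ginv -[in LHS](G_sym Wx) -trmx_inv mxE. Qed.

Lemma Ck_ginv k i j : Ck H W k (fun x => ginv G x i j).
Proof. by apply: (hCk_invmx HW) => [x Wx|a b]; [exact: G_unit | exact: G_smooth]. Qed.

Lemma Ck_christoffel k l i j : Ck H W k (christoffel G l i j).
Proof.
apply: hCkZ => //; apply: hCk_sum => // q; apply: hCkM; [exact: HW| exact: Ck_ginv|].
by apply: hCkB => //; [apply: hCkD => //|]; apply: hCk_pd; exact: G_smooth.
Qed.

Lemma Ck_ricci k i j : Ck H W k (fun x => ricci G x i j).
Proof.
apply: (hCk_ext HW (f := fun x => \sum_l riemann G l j l i x)) => [x _|].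
  by rewrite mxE.
apply: hCk_sum => // l; apply: hCkD => //.
  by apply: hCkB => //; apply: hCk_pd; exact: Ck_christoffel.
apply: hCk_sum => // q; apply: hCkB => //; apply: hCkM => //; exact: Ck_christoffel.
Qed.

Lemma Ck_schouten k i j : Ck H W k (fun x => schouten G x i j).
Proof.
apply: (hCk_ext HW (f := fun x => (n%:R - 2)^-1 * (ricci G x i j - (2 * (n%:R - 1))^-1 *
    (scalar_curv G x * G x i j)))) => [x _|]; first by rewrite !mxE.
apply: hCkZ => //; apply: hCkB => //; first exact: Ck_ricci.
apply: hCkZ => //; apply: (hCkM HW (f := scalar_curv G) (g := fun x => G x i j)); last exact: G_smooth.
apply: hCk_sum => // a; apply: hCk_sum => // b; apply: hCkM => //; [exact: Ck_ginv | exact: Ck_ricci].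
Qed.

Lemma christoffelC l i j x : W x -> christoffel G l i j x = christoffel G l j i x.
Proof.
move=> Wx; rewrite /christoffel; congr (_ * _); apply: eq_bigr => q _; congr (_ * _).
rewrite [X in X - _]addrC; congr (_ - _).
by apply: (pd_ext HW) => // y Wy; exact: GC.
Qed.

(** This trace is the derivative of the logarithm of the square root of the determinant of the
    metric, written without the determinant. The symmetry of its derivatives is the only delicate
    point in the symmetry of the Ricci tensor. *)
Lemma christoffel_trace k x : W x -> \sum_i christoffel G i i k x =
  2^-1 * \sum_i \sum_l ginv G x i l * pd k (fun y => G y i l) x.
Proof.
move=> Wx; rewrite /christoffel -mulr_sumr; congr (_ * _).
under eq_bigr => i _ do under eq_bigr => l _ do rewrite mulrBr mulrDr.
under eq_bigr => i _ do rewrite sumrB big_split /=.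
rewrite sumrB big_split /= [X in X + _ - _](_ : _ = \sum_i \sum_l ginv G x i l * pd l (fun y => G y i k) x).
  by rewrite addrAC subrr add0r.
rewrite exchange_big; apply: eq_bigr => i _; apply: eq_bigr => l _.
by rewrite ginvC //; congr (_ * _); apply: (pd_ext HW) => // y Wy; exact: GC.
Qed.

(** Differentiate [ginv *m G = 1] and multiply by the inverse from the right. *)
Lemma pd_ginv j x a b : W x -> pd j (fun y => ginv G y a b) x =
  - \sum_c \sum_d ginv G x a c * pd j (fun y => G y c d) x * ginv G x d b.
Proof.
move=> Wx.
have h a' b' : \sum_c (pd j (fun y => ginv G y a' c) x * G x c b' +
    ginv G x a' c * pd j (fun y => G y c b') x) = 0.
  have hG c := G_smooth 1 c b'; have hg c := Ck_ginv 1 a' c.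
  transitivity (pd j (fun y => \sum_c ginv G y a' c * G y c b') x).
    rewrite (pd_sum HW) //; last by move=> c; exact: (hCkM HW (hg c) (hG c)).
    by apply: eq_bigr => c _; rewrite (pdM HW j (hg c) (hG c)).
  rewrite (pd_ext HW _ (g := fun=> (a' == b')%:R)) //; first exact: (pd_cst HW).
  move=> y Wy; have := congr1 (fun M : 'M[R]_n => M a' b') (mulVmx (G_unit Wy)).
  by rewrite !mxE.
have e : \sum_b' \sum_c (pd j (fun y => ginv G y a c) x * G x c b' +
    ginv G x a c * pd j (fun y => G y c b') x) * ginv G x b' b = 0.
  by apply: big1 => b' _; rewrite -mulr_suml h mul0r.
apply/eqP; rewrite -addr_eq0 -[X in _ == X]e; apply/eqP.
under [RHS]eq_bigr => b' _ do under eq_bigr => c _ do rewrite mulrDl.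
under [RHS]eq_bigr => b' _ do rewrite big_split /=.
rewrite big_split /=; congr (_ + _); last by rewrite exchange_big.
rewrite exchange_big /= (bigD1 b) //= [X in _ = _ + X]big1 ?addr0.
  under eq_bigr => i _ do rewrite -mulrA; rewrite -mulr_sumr.
  have := congr1 (fun M : 'M[R]_n => M b b) (mulmxV (G_unit Wx)).
  by rewrite !mxE eqxx => ->; rewrite mulr1.
move=> c cb; under eq_bigr => i _ do rewrite -mulrA; rewrite -mulr_sumr.
have := congr1 (fun M : 'M[R]_n => M c b) (mulmxV (G_unit Wx)).
by rewrite !mxE (negbTE cb) => ->; rewrite mulr0.
Qed.

Lemma pd_christoffel_trace j k x : W x -> \sum_i pd j (christoffel G i i k) x =
  2^-1 * (\sum_i \sum_l ginv G x i l * pd j (pd k (fun y => G y i l)) x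
   - \sum_i \sum_l \sum_c \sum_d ginv G x i c * pd j (fun y => G y c d) x *
       ginv G x d l * pd k (fun y => G y i l) x).
Proof.
move=> Wx; rewrite -(pd_sum HW) //; last by move=> i; exact: Ck_christoffel.
rewrite (pd_ext HW _ (g := fun y => 2^-1 * \sum_i \sum_l ginv G y i l * pd k (fun y => G y i l) y)) //;
  last by move=> y Wy; exact: christoffel_trace.
have hC i l : Ck H W 1 (fun y => ginv G y i l * pd k (fun y => G y i l) y).
  by apply: hCkM => //; [exact: Ck_ginv | apply: hCk_pd; exact: G_smooth].
rewrite (pdZ HW) //; last by apply: hCk_sum => // i; exact: hCk_sum.
congr (_ * _); rewrite (pd_sum HW) //; last by move=> i; exact: hCk_sum.
rewrite -sumrB; apply: eq_bigr => i _; rewrite (pd_sum HW) // -sumrB; apply: eq_bigr => l _.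
rewrite (pdM HW) //; [|exact: Ck_ginv | apply: hCk_pd; exact: G_smooth].
rewrite addrC pd_ginv // mulNr; congr (_ - _).
exact (sum2_mull (I := 'I_n) (fun c d => ginv G x i c * pd j (fun y => G y c d) x * ginv G x d l)
  (pd k (fun y => G y i l) x)).
Qed.

Lemma trace_pd_christoffelC j k x : W x ->
  \sum_i pd j (christoffel G i i k) x = \sum_i pd k (christoffel G i i j) x.
Proof.
move=> Wx; refine (etrans (pd_christoffel_trace j k Wx) (etrans _ (esym (pd_christoffel_trace k j Wx)))).
refine (f_equal (fun z => 2^-1 * z) (f_equal2 (fun u v => u - v) _ _)).
  apply: eq_bigr => i _; apply: eq_bigr => l _; refine (f_equal (fun z => ginv G x i l * z) _).
  exact: (pd_young HW j k (G_smooth 2 i l) Wx).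
(* Renaming the pair of indices [i], [l] as [c], [d] swaps the two derivatives of the metric; the
   symmetry of the inverse matches the other factors. *)
refine (etrans (sum4C _) _).
apply: eq_bigr => i _; apply: eq_bigr => l _; apply: eq_bigr => c _; apply: eq_bigr => d _.
have hi := ginvC c i Wx; have hl := ginvC l d Wx.
move: hi hl; generalize (ginv G x c i) (ginv G x i c) (ginv G x l d) (ginv G x d l).
generalize (pd j (fun y => G y i l) x) (pd k (fun y => G y c d) x).
move=> p q r1 r2 r3 r4 -> ->; ring.
Qed.

Lemma ricciE x i j : ricci G x i j =
  \sum_l pd l (christoffel G l i j) x - \sum_l pd i (christoffel G l l j) x +
  (\sum_l \sum_q christoffel G l l q x * christoffel G q i j x -
   \sum_l \sum_q christoffel G l i q x * christoffel G q l j x).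
Proof.
rewrite mxE -sumrB -sumrB -big_split /=; apply: eq_bigr => l _.
by rewrite /riemann sumrB.
Qed.

Lemma ricciC x i j : W x -> ricci G x i j = ricci G x j i.
Proof.
move=> Wx; refine (etrans (ricciE x i j) (etrans _ (esym (ricciE x j i)))).
refine (f_equal2 (fun u v => u + v) (f_equal2 (fun u v => u - v) _ _) (f_equal2 (fun u v => u - v) _ _)).
- by apply: eq_bigr => l _; apply: (pd_ext HW _ Wx) => y Wy; exact: christoffelC.
- exact: (trace_pd_christoffelC i j Wx).
- apply: eq_bigr => l _; apply: eq_bigr => q _.
  by refine (f_equal (fun z => christoffel G l l q x * z) _); exact: christoffelC.
- refine (etrans (exchange_big _ _ _ _ _ _) _) => /=.
  apply: eq_bigr => q _; apply: eq_bigr => l _.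
  refine (etrans (mulrC _ _) (f_equal2 (fun u v => u * v) _ _)); exact: christoffelC.
Qed.

Lemma schoutenC x i j : W x -> schouten G x i j = schouten G x j i.
Proof.
move=> Wx; have e a b : schouten G x a b = (n%:R - 2)^-1 * (ricci G x a b - (2 * (n%:R - 1))^-1 *
    (scalar_curv G x * G x a b)) by rewrite mxE [X in _ * X]mxE; congr (_ * (_ + _)); rewrite !mxE.
by rewrite (e i j) (e j i) (GC i j Wx) (ricciC i j Wx).
Qed.

End Geometry.

Lemma jet2X (R : realType) (F : set_system R) (phi : R -> R) c0 c1 c2 k :
  jet2 F phi c0 c1 c2 ->
  jet2 F (fun t => phi t ^+ k.+2) (c0 ^+ k.+2) (k.+2%:R * c0 ^+ k.+1 * c1)
    (k.+2%:R * k.+1%:R * c0 ^+ k * c1 ^+ 2 + k.+2%:R * c0 ^+ k.+1 * c2).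
Proof.
move=> h; elim: k => [|k IH].
  have := jet2M h h; rewrite -expr2.
  have -> : c1 * c0 + c0 * c1 = 2 * c0 ^+ 1 * c1 by ring.
  have -> : c2 * c0 + 2 * c1 * c1 + c0 * c2 = 2 * 1 * c0 ^+ 0 * c1 ^+ 2 + 2 * c0 ^+ 1 * c2 by ring.
  by apply: jet2_eq => t; rewrite expr2.
have := jet2M h IH; rewrite -exprS.
have -> : c1 * c0 ^+ k.+2 + c0 * (k.+2%:R * c0 ^+ k.+1 * c1) = k.+3%:R * c0 ^+ k.+2 * c1.
  by rewrite -[k.+3%:R]natr1 (exprS _ k.+1); ring.
have -> : c2 * c0 ^+ k.+2 + 2 * c1 * (k.+2%:R * c0 ^+ k.+1 * c1) +
   c0 * (k.+2%:R * k.+1%:R * c0 ^+ k * c1 ^+ 2 + k.+2%:R * c0 ^+ k.+1 * c2) =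
   k.+3%:R * k.+2%:R * c0 ^+ k.+1 * c1 ^+ 2 + k.+3%:R * c0 ^+ k.+2 * c2.
  by rewrite -[k.+3%:R]natr1 -[k.+2%:R]natr1 (exprS _ k.+1) (exprS _ k); ring.
by apply: jet2_eq => t; rewrite -exprS.
Qed.

Lemma within_eps (R : realType) (p : nat) (W : set 'rV[R]_p) (f : 'rV[R]_p -> R) :
  (forall x, W x -> forall e, 0 < e -> exists2 d, 0 < d &
    forall y, W y -> `|y - x| < d -> `|f y - f x| <= e) -> {within W, continuous f}.
Proof.
move=> h; apply/subspace_continuousP => x Wx; apply/cvgrPdist_le => e e0.
have [d d0 hd] := h x Wx e e0.
rewrite near_withinE; apply/nbhs_ballP; exists d => //= y; rewrite -ball_normE /= => xy Wy.
by rewrite /= distrC; apply: hd; rewrite // distrC.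
Qed.

Lemma Ck_comp (R : realType) (p p' : nat) (S : pred 'I_p) (S' : pred 'I_p')
    (W : set 'rV[R]_p) (W' : set 'rV[R]_p') (Phi : 'rV[R]_p -> 'rV[R]_p') k h :
  relopen (orthant S) W -> relopen (orthant S') W' -> (forall x, W x -> W' (Phi x)) ->
  (forall j, Ck (orthant S) W k (fun x => Phi x 0 j)) -> Ck (orthant S') W' k h ->
  Ck (orthant S) W k (fun x => h (Phi x)).
Proof.
move=> DW DW' WW'; elim: k h => [|k IH] h hPhi hh.
  split=> //; apply: within_eps => x Wx e e0.
  have [d d0 hd] := within_cont_in DW' (Ck_cont hh) (WW' x Wx) e0.
  have d20 : 0 < d / 2 by rewrite divr_gt0.
  have hc j : exists2 d', 0 < d' & forall y, W y -> `|y - x| < d' -> `|Phi y 0 j - Phi x 0 j| <= d / 2.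
    have [d' d'0 hd'] := within_cont_in DW (Ck_cont (hPhi j)) Wx d20.
    by exists d' => // y Wy; apply: hd'; exact: relopen_sub DW Wy.
  pose dd j := projT1 (cid2 (hc j)).
  have hdd j : 0 < dd j /\ forall y, W y -> `|y - x| < dd j -> `|Phi y 0 j - Phi x 0 j| <= d / 2.
    by rewrite /dd; case: cid2.
  exists (\big[Num.min/1]_j dd j); first by apply: lt_bigmin => // j _; have [] := hdd j.
  move=> y Wy hy; apply: hd; first exact: relopen_sub DW' (WW' y Wy).
  apply: le_lt_trans (_ : d / 2 < d); last by rewrite ltr_pdivrMr // ltr_pMr // ltr1n.
  apply: rV_norm_le; first exact: ltW.
  move=> j; rewrite !mxE; have [_ h2] := hdd j; apply: h2 => //.
  by apply: lt_le_trans hy _; exact: bigmin_le.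
have hP0 j := Ck_S (hPhi j).
apply: (@Ck_succ _ _ S _ DW _ (fun i x => \sum_j partial (orthant S) i (fun x => Phi x 0 j) x *
    partial (orthant S') j h (Phi x))) => //.
- exact: (Ck_cont (IH h hP0 (Ck_S hh))).
- move=> i x Wx; have pF := dir_punctured i (relopen_sub DW Wx).
  have h1 := Ck_le (isT : 1 <= k.+1)%N hh.
  have g1 := Ck1_hasgrad DW' h1 (WW' x Wx).
  pose v : 'rV[R]_p' := \row_j partial (orthant S) i (fun x => Phi x 0 j) x.
  have := @hasgrad_path R p' _ pF (orthant S') (fun t => Phi (x + t *: delta_mx 0 i)) (Phi x) v
    _ _ h _ g1.
  have -> : \sum_j v 0 j * partial (orthant S') j h (Phi x) =
    \sum_j partial (orthant S) i (fun x => Phi x 0 j) x * partial (orthant S') j h (Phi x).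
    by apply: eq_bigr => j _; rewrite mxE.
  apply.
    by apply: filterS (dir_relopen i DW Wx) => t Wt; exact: relopen_sub DW' (WW' _ Wt).
  by move=> j; rewrite mxE; exact: (Ck_jet1 i DW (hPhi j)).
move=> i; apply: Ck_sum => // j _; apply: CkM => //; first exact: (Ck_partial i (hPhi j)).
apply: IH => //; exact: Ck_partial.
Qed.

Lemma Ck_coord (R : realType) (p : nat) (S : pred 'I_p) (W : set 'rV[R]_p) k j :
  relopen (orthant S) W -> Ck (orthant S) W k (fun x => x 0 j).
Proof.
move=> DW; have hc : {within W, continuous (fun x : 'rV[R]_p => x 0 j)}.
  by apply: continuous_subspaceT => x; exact: coord_continuous.
case: k => [|k]; first by split.
apply: (@Ck_succ _ _ S _ DW _ (fun i _ => (delta_mx 0 i : 'rV[R]_p) 0 j)) => // [i x Wx|i].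
  by apply: line_coord; apply: dir_punctured; exact: relopen_sub Wx.
exact: Ck_cst.
Qed.

Lemma box_compact (R : realType) (p : nat) (lo hi : 'I_p -> R) :
  compact [set x : 'rV[R]_p | forall i, lo i <= x 0 i <= hi i].
Proof.
have := @rV_compact R p (fun i => [set` `[lo i, hi i]]) (fun i => @segment_compact _ _ _).
by congr compact; apply: eq_set => x; apply: eq_forall => i; rewrite /= in_itv.
Qed.

(** * The tensor U and its eigenframes *)

Section Tensor.
Variables (R : realType) (m : nat) (W : set 'rV[R]_m.+1).
Notation n := (m.+1).
Notation V := 'rV[R]_m.+1.
Notation H := (@half_space R m).
Hypothesis HW : relopen H W.
Variable G : V -> 'M[R]_n.
Hypothesis G_smooth : forall k i j, Ck H W k (fun x => G x i j).
Hypothesis G_sym : forall x, W x -> (G x)^T = G x.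
Hypothesis G_pos : forall x, W x -> posdef (G x).
Implicit Types (x : V) (u : V -> R).

(** The squared norm of [du] through the inverse metric: polynomial in the first derivatives, hence
    differentiable where [gnorm] need not be. *)
Definition dnorm2 u x := \sum_i \sum_j ginv G x i j * pd i u x * pd j u x.

Lemma gnorm_grad u x : W x -> Defs.gnorm G x (grad G u x) ^+ 2 = dnorm2 u x.
Proof.
move=> Wx; have gs : (ginv G x)^T = ginv G x.
  by apply/matrixP => i j; rewrite mxE; exact: (ginvC G_sym).
have ge : grad G u x = du u x *m ginv G x.
  apply/rowP => i; rewrite !mxE; apply: eq_bigr => j _; rewrite mxE mulrC.
  by rewrite -[in LHS]gs mxE.
rewrite /Defs.gnorm sqr_sqrtr; last by apply: posdef_ge0; exact: G_pos.
rewrite /ip ge trmx_mul gs -!mulmxA (mulmxA (G x)) mulmxV; last exact: (G_unit G_sym G_pos).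
rewrite mul1mx mxE /dnorm2; apply: eq_bigr => i _; rewrite !mxE mulr_sumr.
by apply: eq_bigr => j _; rewrite !mxE; ring.
Qed.

Lemma UtensorE u x i j : W x -> Utensor G u x i j =
  pd i (pd j u) x - \sum_k christoffel G k i j x * pd k u x + pd i u x * pd j u x
  - 2^-1 * dnorm2 u x * G x i j + schouten G x i j.
Proof.
move=> Wx; rewrite /Utensor gnorm_grad //; have e (A B C D : 'M[R]_n) : (A + B - C + D) i j = A i j + B i j - C i j + D i j by rewrite !mxE.
rewrite e; congr (_ + _ - _ + _).
- by rewrite mxE.
- by rewrite mxE big_ord1 !mxE.
- by rewrite mxE.
Qed.

Lemma UtensorC u x : Ck H W 2 u -> W x -> (Utensor G u x)^T = Utensor G u x.
Proof.
move=> hu Wx; apply/matrixP => i j; rewrite mxE (UtensorE _ _ _ Wx) (UtensorE _ i j Wx).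
rewrite (pd_young HW j i hu Wx) (GC G_sym j i Wx) (schoutenC HW G_smooth G_sym G_pos j i Wx).
rewrite (mulrC (pd j u x)).
by under eq_bigr => k _ do rewrite (christoffelC HW G_sym k j i Wx).
Qed.

Lemma Ck_dnorm2 k u : Ck H W k.+1 u -> Ck H W k (dnorm2 u).
Proof.
move=> hu; apply: (hCk_sum HW) => i; apply: (hCk_sum HW) => j.
apply: (hCkM HW); last exact: hCk_pd.
apply: (hCkM HW); [exact: (Ck_ginv HW G_smooth G_sym G_pos) | exact: hCk_pd].
Qed.

Lemma Ck_Utensor k u i j : Ck H W k.+2 u -> Ck H W k (fun x => Utensor G u x i j).
Proof.
move=> hu; have hu1 := hCk_le (leqnSn k.+1) hu.
apply: (hCk_ext HW (fun x Wx => esym (UtensorE u i j Wx))).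
apply: (hCkD HW); last exact: (Ck_schouten HW G_smooth G_sym G_pos).
apply: (hCkB HW); first apply: (hCkD HW); first apply: (hCkB HW).
- by apply: hCk_pd; apply: hCk_pd.
- apply: (hCk_sum HW) => l; apply: (hCkM HW); last exact: hCk_pd.
  exact: (Ck_christoffel HW G_smooth G_sym G_pos).
- by apply: (hCkM HW); apply: hCk_pd.
- apply: (hCkM HW (f := fun x => 2^-1 * dnorm2 u x) (g := fun x => G x i j)); last exact: G_smooth.
  by apply: (hCkZ HW); exact: Ck_dnorm2.
Qed.

(** Membership in [Gamma1] rules out the default value of [get]: without an ordered list of real
    roots, [eigvals] would be the zero row, whose sum is not positive. *)
Lemma eigvals_frame u x : Ck H W 2 u -> W x -> Gamma1 (eigvals G x (Utensor G u x)) ->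
  sorted_row (eigvals G x (Utensor G u x)) /\
  exists Q, frame (G x) (Utensor G u x) Q (eigvals G x (Utensor G u x)).
Proof.
move=> hu Wx hl.
set P := [set lam : V | char_poly (ginv G x *m Utensor G u x) = \prod_(i < n) ('X - (lam 0 i)%:P) /\
    forall i j : 'I_n, (i <= j)%N -> lam 0 i <= lam 0 j].
have [hP|hP] := pselect (exists l, P l).
  have [h1 h2] : P (eigvals G x (Utensor G u x)) by exact: getPex.
  split=> //; apply: eigval_frame h1 => //; [exact: G_sym | exact: UtensorC | exact: G_pos].
move: hl; rewrite /Gamma1 /= [eigvals _ _ _](getPN (P := P)) => [|l Pl]; last by apply: hP; exists l.
by rewrite big1 ?ltxx // => i _; rewrite mxE.
Qed.

End Tensor.

(** * The symmetric function on its cone *)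

Section ConeFunction.
Variables (R : realType) (n : nat) (Gam : set 'rV[R]_n) (f : 'rV[R]_n -> R).
Hypothesis Gam_open : open Gam.
Hypotheses (f_smooth : smooth setT Gam f) (f_sym : symmetric_fun (closure Gam) f)
  (f_hom : homogeneous1 Gam f).
Implicit Types (l : 'rV[R]_n) (a b : 'I_n).

Lemma setT_orthant : [set: 'rV[R]_n] = orthant pred0.
Proof. by apply/seteqP; split. Qed.

Lemma open_relopen : relopen setT Gam.
Proof.
move=> x Gx; split=> //; have /nbhs_ballP[d /= d0 hd] := Gam_open Gx.
by exists d => // y _ yx; apply: hd; rewrite -ball_normE /= distrC.
Qed.

Lemma cone_hasgrad l : Gam l -> hasgrad setT f l (fun i => partial setT i f l).
Proof.
move=> Gl; have := open_relopen; have := f_smooth 1; rewrite setT_orthant => h1 h2.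
exact: (Ck1_hasgrad h2 h1 Gl).
Qed.

Lemma line_relopen l v : Gam l -> \forall t \near (0 : R)^', Gam (l + t *: v).
Proof.
move=> Gl; have [_ [d d0 hd]] := open_relopen Gl.
have v1 : 0 < `|v| + 1 by rewrite ltr_wpDl.
exists (d / (`|v| + 1)); first by rewrite /= divr_gt0.
move=> t /=; rewrite sub0r normrN ltr_pdivlMr // => ht _; apply: hd => //.
rewrite addrAC subrr add0r normrZ; apply: le_lt_trans ht.
by rewrite ler_wpM2l // lerDl.
Qed.

Lemma cone_jet l v : Gam l ->
  jet1 0^' (fun t => f (l + t *: v)) (f l) (\sum_i v 0 i * partial setT i f l).
Proof.
move=> Gl; have pF := punctured_filter_dnbhs R.
apply: (hasgrad_path pF (D := setT)); last exact: cone_hasgrad.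
  exact: filterE.
by move=> i; exact: line_coord.
Qed.

(** When two coordinates of [l] agree, transposing them exchanges the lines through [l] in the two
    directions, and [f] does not see the difference. *)
Lemma cone_partialC l a b : Gam l -> l 0 a = l 0 b -> partial setT a f l = partial setT b f l.
Proof.
move=> Gl lab; have pF := punctured_filter_dnbhs R.
have ha := cone_jet (delta_mx 0 a) Gl; have hb := cone_jet (delta_mx 0 b) Gl.
rewrite !sum_delta in ha hb; apply: (jet1_unique ha); apply: jet1_near hb.
apply: filterS (line_relopen (delta_mx 0 b) Gl) => t Gt.
rewrite -(f_sym (tperm a b)); last exact: subset_closure.
congr f; apply/rowP => i; rewrite !mxE eqxx /=.
case: tpermP => [->|->|/eqP ia /eqP ib]; rewrite ?eqxx ?lab ?(eq_sym b a) //.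
by rewrite (negbTE ia) (negbTE ib).
Qed.

(** Along the ray through [l] the function is linear by homogeneity; the derivative there is
    computed twice. *)
Lemma cone_euler l : Gam l -> \sum_a partial setT a f l * l 0 a = f l.
Proof.
move=> Gl; have pF := punctured_filter_dnbhs R.
have h := cone_jet l Gl; under eq_bigr => a _ do rewrite mulrC.
apply: (jet1_unique h).
apply: (jet1_near _ (jet1_lin pF (f l) (f l))).
near=> t; have -> : l + t *: l = (1 + t) *: l by rewrite scalerDl scale1r.
rewrite f_hom //; first by ring.
have : `|t| < 1 by near: t; apply: path_small.
by rewrite ltr_norml => /andP[h1 _]; rewrite -ltrBlDl sub0r.
Unshelve. all: by end_near. Qed.

End ConeFunction.

(** For curves such as that of the eigenvalues, which need not be differentiable: it is enough that
    the curve be Lipschitz and that its pairing with the gradient of [f] have a first-order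
    expansion. *)
Lemma hasgrad_lip (R : realType) (p : nat) (F : set_system R) (z : R -> 'rV[R]_p) (K : R)
    f x L c : punctured_filter F -> hasgrad setT f x L ->
  (\forall t \near F, `|z t - x| <= K * `|t|) ->
  jet1 F (fun t => \sum_i (z t 0 i - x 0 i) * L i) 0 c ->
  jet1 F (fun t => f (z t)) (f x) c.
Proof.
move=> pF hg hz hj.
have K0 : 0 < `|K| + 1 by rewrite ltr_wpDl.
have h0 : jet1 F (fun t => f (z t) - f x - \sum_i (z t 0 i - x 0 i) * L i) 0 0.
  apply/(jet1P pF) => e e0.
  have [d d0 hd] := hg (e / (`|K| + 1)) (divr_gt0 e0 K0).
  near=> t; rewrite subr0 mul0r subr0.
  have h1 : `|z t - x| <= K * `|t| by near: t.
  have h2 : `|z t - x| <= (`|K| + 1) * `|t|.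
    by apply: le_trans h1 _; rewrite ler_wpM2r // (le_trans (ler_norm _)) // lerDl.
  apply: le_trans (hd _ _ _) _ => //.
    apply: le_lt_trans h2 _; rewrite mulrC -ltr_pdivlMr //.
    by near: t; apply: path_small; exact: divr_gt0.
  have e10 : 0 <= e / (`|K| + 1) by rewrite ltW // divr_gt0.
  by apply: le_trans (ler_wpM2l e10 h2) _; rewrite mulrA divfK // gt_eqF.
have := jet1D (jet1D h0 hj) (jet1_cst pF (f x)); rewrite !add0r addr0.
by apply: jet1_eq => t; ring.
Unshelve. all: by end_near. Qed.

Lemma mx_jet1_lip (R : realType) (F : set_system R) p q (A : R -> 'M[R]_(p, q)) (A0 A1 : 'M[R]_(p, q)) :
  punctured_filter F -> (forall i j, jet1 F (fun t => A t i j) (A0 i j) (A1 i j)) ->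
  exists2 C, 0 < C & \forall t \near F, forall i j, `|A t i j - A0 i j| <= C * `|t|.
Proof.
move=> pF h; have [c c0 hc] := mx_bounded A1.
exists (c + 1); first by rewrite ltr_wpDl.
have hj i j : \forall t \near F, `|A t i j - A0 i j| <= (c + 1) * `|t|.
  have /(jet1P pF)/(_ 1 ltr01) := h i j; apply: filterS => t ht.
  rewrite -[X in `|X|](subrK (A1 i j * t)) addrC mulrDl.
  apply: le_trans (ler_normD _ _) _; apply: lerD => //.
  by rewrite normrM ler_wpM2r.
have hi i : \forall t \near F, forall j, `|A t i j - A0 i j| <= (c + 1) * `|t|.
  exact: filter_forall.
exact: filter_forall.
Qed.

(** * Differentiation of the equation through the eigenvalues *)

Section PdeDerivative.
Variables (R : realType) (m : nat) (W : set 'rV[R]_m.+1).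
Notation n := (m.+1).
Notation V := 'rV[R]_m.+1.
Notation H := (@half_space R m).
Hypothesis HW : relopen H W.
Variable G : V -> 'M[R]_n.
Hypothesis G_smooth : forall k i j, Ck H W k (fun x => G x i j).
Hypothesis G_sym : forall x, W x -> (G x)^T = G x.
Hypothesis G_pos : forall x, W x -> posdef (G x).
Variables (Gam : set V) (f : V -> R).
Hypotheses (Gam_open : open Gam) (Gam_ub : Gam `<=` Gamma1).
Hypotheses (f_smooth : smooth setT Gam f) (f_sym : symmetric_fun (closure Gam) f).
Implicit Types (x : V) (u : V -> R).

Definition eigU u x := eigvals G x (Utensor G u x).

Lemma interior_relopen x v : W x -> 0 < x 0 ord0 -> \forall t \near (0 : R)^', W (x + t *: v).
Proof.
move=> Wx x0; have [_ [d d0 hd]] := HW Wx.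
have pF := punctured_filter_dnbhs R.
have := path_close (z := fun t => x + t *: v) pF (fun i => line_coord x v pF i) d0.
by move=> h; near=> t; apply: hd; near: t => //; exact: (interior_near v Wx x0).
Unshelve. all: by end_near. Qed.

(** Along the line in direction [k], [frame_linearize] expands the sum of the eigenvalues weighted
    by the derivatives of [f], up to an error quadratic in [t]. Its condition on equal eigenvalues
    is the symmetry [cone_partialC]. *)
Lemma pde_linearized u P x k Q : Ck H W 3 u ->
  (forall y, W y -> Gam (eigU u y) /\ f (eigU u y) = P y) -> Ck H W 1 P ->
  W x -> 0 < x 0 ord0 -> frame (G x) (Utensor G u x) Q (eigU u x) ->
  pd k P x = \sum_a partial setT a f (eigU u x) *
    (Q *m G x *m (\matrix_(i, j) pd k (fun y => (ginv G y *m Utensor G u y) i j) x) *m Q^T) a a.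
Proof.
move=> hu hpde hP Wx x0 hQ; have pF := punctured_filter_dnbhs R.
set A1 := (X in _ *m G x *m X); set l0 := eigU u x.
pose e := delta_mx 0 k : V; pose z t := eigU u (x + t *: e).
have hu2 := hCk_le (isT : 2 <= 3)%N hu.
have eig y : W y -> sorted_row (eigU u y) /\ exists Q, frame (G y) (Utensor G u y) Q (eigU u y).
  move=> Wy; apply: (eigvals_frame HW G_smooth G_sym G_pos) => //.
  by apply: Gam_ub; case: (hpde y Wy).
have [s0 _] := eig x Wx; have [Gl fl] := hpde x Wx.
have hCU i j : Ck H W 1 (fun y => Utensor G u y i j).
  exact: (Ck_Utensor HW G_smooth G_sym G_pos).
have hCA i j : Ck H W 1 (fun y => (ginv G y *m Utensor G u y) i j).
  apply: (hCk_ext HW (f := fun y => \sum_q ginv G y i q * Utensor G u y q j)) => [y _|].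
    by rewrite mxE.
  apply: (hCk_sum HW) => q; apply: (hCkM HW) => //; exact: (Ck_ginv HW G_smooth G_sym G_pos).
have jet h : Ck H W 1 h -> jet1 0^' (fun t => h (x + t *: e)) (h x) (pd k h x).
  by move=> hh; have := line_jet1 HW e hh Wx x0; rewrite sum_delta.
have [CG CG0 hG] := mx_jet1_lip (A := fun t => G (x + t *: e)) (A0 := G x)
  (A1 := \matrix_(i, j) pd k (fun y => G y i j) x) pF
  (fun i j => eq_ind_r (jet1 _ _ _) (jet _ (G_smooth 1 i j)) (mxE _ _ i j)).
have [CU CU0 hU] := mx_jet1_lip (A := fun t => Utensor G u (x + t *: e)) (A0 := Utensor G u x)
  (A1 := \matrix_(i, j) pd k (fun y => Utensor G u y i j) x) pF
  (fun i j => eq_ind_r (jet1 _ _ _) (jet _ (hCU i j)) (mxE _ _ i j)).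
have jA i j : jet1 0^' (fun t => (ginv G (x + t *: e) *m Utensor G u (x + t *: e)) i j)
    ((ginv G x *m Utensor G u x) i j) (A1 i j).
  by rewrite [A1 i j]mxE; exact: (jet _ (hCA i j)).
have [CA CA0 hA] := mx_jet1_lip (A := fun t => ginv G (x + t *: e) *m Utensor G u (x + t *: e))
  (A0 := ginv G x *m Utensor G u x) pF jA.
(* A single Lipschitz constant for the metric, the tensor and the endomorphism, so that [C * |t|]
   serves as the size of the perturbation. *)
pose C := CG + CU + CA; have C0 : 0 < C by rewrite !addr_gt0.
have [CGC CUC CAC] : [/\ CG <= C, CU <= C & CA <= C] by split; rewrite /C; lra.
pose c a := partial setT a f l0.
have cC a b : l0 0 a = l0 0 b -> c a = c b.
  by move=> h; exact: (cone_partialC Gam_open f_smooth f_sym Gl h).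
have [K K0 hK] := frame_linearize hQ s0 cC.
have key : \forall t \near (0 : R)^', (forall i, `|z t 0 i - l0 0 i| <= K * (C * `|t|)) /\
   `|\sum_a c a * (z t 0 a - l0 0 a) - \sum_a c a * (Q *m G x *m
     (ginv G (x + t *: e) *m Utensor G u (x + t *: e) - ginv G x *m Utensor G u x) *m Q^T) a a|
    <= K * (C * `|t|) ^+ 2.
  near=> t; have Wt : W (x + t *: e) by near: t; exact: interior_relopen.
  have [st [Qt hQt]] := eig _ Wt.
  apply: (hK (C * `|t|) _ _ _ _ hQt st).
  - by rewrite mulr_ge0 // ltW.
  - have : `|t| < (K * C)^-1 by near: t; apply: path_small; rewrite invr_gt0 mulr_gt0.
    by move=> /ltW h; rewrite mulrA mulrC -ler_pdivlMr ?mulr_gt0 // div1r.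
  - move=> i j; apply: le_trans (_ : CG * `|t| <= _).
      by move: i j; near: t.
    exact: ler_wpM2r.
  - move=> i j; apply: le_trans (_ : CU * `|t| <= _).
      by move: i j; near: t.
    exact: ler_wpM2r.
  - move=> i j; apply: le_trans (_ : CA * `|t| <= _).
      by rewrite mxE [X in _ + X]mxE; move: i j; near: t.
    exact: ler_wpM2r.
(* The weighted increments of the eigenvalues have the jet of the weighted diagonal of the increment
   of the endomorphism, since the two differ by a multiple of [t ^+ 2]. *)
have jc : jet1 0^' (fun t => \sum_i (z t 0 i - l0 0 i) * c i) 0
    (\sum_a c a * (Q *m G x *m A1 *m Q^T) a a).
  have h1 : jet1 0^' (fun t => \sum_a c a * (Q *m G x *m
     (ginv G (x + t *: e) *m Utensor G u (x + t *: e) - ginv G x *m Utensor G u x) *m Q^T) a a) 0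
     (\sum_a c a * (Q *m G x *m A1 *m Q^T) a a).
    have e1 (B : 'M[R]_n) a : (Q *m G x *m B *m Q^T) a a =
       \sum_i \sum_j (Q *m G x) a i * Q a j * B i j.
      rewrite mxE exchange_big; apply: eq_bigr => j _; rewrite !mxE mulr_suml.
      by apply: eq_bigr => i _; ring.
    have e0 : (0 : R) = \sum_a c a * \sum_i \sum_j (Q *m G x) a i * Q a j * 0.
      rewrite big1 // => a _; rewrite big1 ?mulr0 // => i _; rewrite big1 // => j _.
      by rewrite mulr0.
    rewrite {3}e0; under [X in jet1 _ _ _ X]eq_bigr => a _ do rewrite e1.
    apply: (jet1_eq (phi := fun t => \sum_a c a * \sum_i \sum_j (Q *m G x) a i * Q a j *
       ((ginv G (x + t *: e) *m Utensor G u (x + t *: e)) i j - (ginv G x *m Utensor G u x) i j))).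
      move=> t; apply: eq_bigr => a _; rewrite e1; congr (_ * _).
      apply: eq_bigr => i _; apply: eq_bigr => j _; congr (_ * _).
      by rewrite [RHS]mxE [X in _ = _ + X]mxE.
    apply: jet1_sum => // a _; apply: jet1Z; apply: jet1_sum => // i _; apply: jet1_sum => // j _.
    apply: jet1Z; have := jet1B (jA i j) (jet1_cst pF ((ginv G x *m Utensor G u x) i j)).
    by rewrite subrr subr0.
  have h2 : jet1 0^' (fun t => \sum_a c a * (z t 0 a - l0 0 a) - \sum_a c a * (Q *m G x *m
     (ginv G (x + t *: e) *m Utensor G u (x + t *: e) - ginv G x *m Utensor G u x) *m Q^T) a a) 0 0.
    apply/(jet1P pF) => d d0; near=> t; rewrite subr0 mul0r subr0.
    have [_ h] : (forall i, `|z t 0 i - l0 0 i| <= K * (C * `|t|)) /\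
     `|\sum_a c a * (z t 0 a - l0 0 a) - \sum_a c a * (Q *m G x *m
     (ginv G (x + t *: e) *m Utensor G u (x + t *: e) - ginv G x *m Utensor G u x) *m Q^T) a a|
    <= K * (C * `|t|) ^+ 2 by near: t.
    apply: le_trans h _; rewrite exprMn expr2 (expr2 `|t|) !mulrA ler_wpM2r //.
    have : `|t| < d / (K * C * C) by near: t; apply: path_small; rewrite divr_gt0 // !mulr_gt0.
    by rewrite ltr_pdivlMr ?mulr_gt0 // => /ltW; rewrite mulrC.
  have := jet1D h2 h1; rewrite !add0r; apply: jet1_eq => t; rewrite subrK.
  by apply: eq_bigr => i _; rewrite mulrC.
have hz : \forall t \near (0 : R)^', `|z t - l0| <= (K * C) * `|t|.
  apply: filterS key => t [h _]; apply: rV_norm_le.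
    by rewrite mulr_ge0 // mulr_ge0 // ltW.
  by move=> i; rewrite !mxE -mulrA.
have hg := cone_hasgrad Gam_open f_smooth Gl.
have j1 := hasgrad_lip pF hg hz jc.
apply: (jet1_unique (jet _ hP)); rewrite -fl.
apply: jet1_near j1; near=> t.
have Wt : W (x + t *: e) by near: t; exact: interior_relopen.
by have [_ ->] := hpde _ Wt.
Unshelve. all: by end_near. Qed.

End PdeDerivative.

(** * First- and second-order conditions at a maximum *)

Lemma jet2_test (R : realType) (F : set_system R) (N : nat) (A B M : R) (sg w u : R -> R)
    sg0 sg1 sg2 w0 w1 w2 u0 u1 u2 :
  let th := A - (B - u0) ^+ N.+2 in
  let th1 := N.+2%:R * (B - u0) ^+ N.+1 in
  let th2 := - (N.+2%:R * N.+1%:R * (B - u0) ^+ N) in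
  jet2 F sg sg0 sg1 sg2 -> jet2 F w w0 w1 w2 -> jet2 F u u0 u1 u2 ->
  jet2 F (fun t => sg t ^+ 2 * w t - M * (A - (B - u t) ^+ N.+2))
    (sg0 ^+ 2 * w0 - M * th)
    (2 * sg0 * sg1 * w0 + sg0 ^+ 2 * w1 - M * (th1 * u1))
    (2 * (sg0 * sg2 + sg1 ^+ 2) * w0 + 4 * sg0 * sg1 * w1 + sg0 ^+ 2 * w2
      - M * (th2 * u1 ^+ 2 + th1 * u2)).
Proof.
move=> th th1 th2 js jw ju; have pF : punctured_filter F by case: js.
have h := jet2B (jet2M (jet2X 0 js) jw)
  (jet2Z M (jet2B (jet2_cst pF A) (jet2X N (jet2B (jet2_cst pF B) ju)))).
move: h; rewrite -/th !sub0r.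
set c1 := (X in jet2 _ _ _ X _); set c2 := (X in jet2 _ _ _ _ X).
have -> : c1 = 2 * sg0 * sg1 * w0 + sg0 ^+ 2 * w1 - M * (th1 * u1) by rewrite /c1 /th1; ring.
suff -> : c2 = 2 * (sg0 * sg2 + sg1 ^+ 2) * w0 + 4 * sg0 * sg1 * w1 + sg0 ^+ 2 * w2
      - M * (th2 * u1 ^+ 2 + th1 * u2) by [].
rewrite /c2 /th1 /th2; ring.
Qed.

Lemma max_first (R : realType) (sg0 sg1 w0 w1 th th1 u1 : R) : 0 < sg0 -> 0 < th ->
  2 * sg0 * sg1 * w0 + sg0 ^+ 2 * w1 - sg0 ^+ 2 * w0 / th * (th1 * u1) = 0 ->
  w1 = w0 * (th1 / th * u1 - 2 * (sg1 / sg0)).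
Proof.
move=> s0 t0 h; have s1 : sg0 != 0 by rewrite gt_eqF.
have t1 : th != 0 by rewrite gt_eqF.
apply: (mulfI (expf_neq0 2 s1)).
have -> : sg0 ^+ 2 * w1 = sg0 ^+ 2 * w0 / th * (th1 * u1) - 2 * sg0 * sg1 * w0.
  by apply/eqP; rewrite -subr_eq0 -[X in _ == X]h; apply/eqP; ring.
by field; rewrite s1 t1.
Qed.

(** The inequality [th2 <= - th1] turns the term with the second derivative of [theta] into a
    favourable multiple of [u1 ^+ 2]. *)
Lemma max_second (R : realType) (sg0 sg1 sg2 w0 w1 w2 th th1 th2 u1 u2 : R) :
  0 < sg0 -> 0 < th -> 0 <= w0 -> th2 <= - th1 ->
  2 * (sg0 * sg2 + sg1 ^+ 2) * w0 + 4 * sg0 * sg1 * w1 + sg0 ^+ 2 * w2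
      - sg0 ^+ 2 * w0 / th * (th2 * u1 ^+ 2 + th1 * u2) <= 0 ->
  w2 + 4 * (sg1 / sg0) * w1 + (2 * (sg2 / sg0) + 2 * (sg1 / sg0) ^+ 2) * w0
    - w0 * (th1 / th * u2 - th1 / th * u1 ^+ 2) <= 0.
Proof.
move=> s0 t0 ww h12 h; have s1 : sg0 != 0 by rewrite gt_eqF.
have t1 : th != 0 by rewrite gt_eqF.
rewrite -(pmulr_rle0 _ (exprn_gt0 2 s0)); apply: le_trans h.
rewrite -subr_ge0; set d := (X in 0 <= X).
have -> : d = sg0 ^+ 2 * w0 / th * ((- th1 - th2) * u1 ^+ 2).
  by rewrite /d; field; rewrite s1 t1.
apply: mulr_ge0; first by rewrite divr_ge0 ?mulr_ge0 ?sqr_ge0 // ltW.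
by rewrite mulr_ge0 ?sqr_ge0 // subr_ge0.
Qed.

Lemma bO_mulmx (R : realType) (Om : Type) p q r (A : Om -> 'M[R]_(p, q)) (B : Om -> 'M[R]_(q, r)) :
  (forall i j, bO (fun w => A w i j) (fun=> 1)) -> (forall i j, bO (fun w => B w i j) (fun=> 1)) ->
  forall i j, bO (fun w => (A w *m B w) i j) (fun=> 1).
Proof.
move=> hA hB i j; apply: (bO_eq (f := fun w => \sum_k A w i k * B w k j)) => [w|].
  by rewrite mxE.
apply: bO_sum => // k; apply: (bO_le (C := 1) _ (bOM (hA i k) (hB k j))) => //.
Qed.

(** * Sums over an eigenframe *)

Section FrameSums.
Variables (R : realType) (n : nat) (G U Q : 'M[R]_n) (l : 'rV[R]_n).
Hypothesis hQ : frame G U Q l.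
Hypothesis G_sym : G^T = G.

Lemma invmx_quad (v : 'I_n -> R) :
  \sum_i \sum_j invmx G i j * v i * v j = \sum_a (\sum_i Q a i * v i) ^+ 2.
Proof.
rewrite (frame_invmx hQ).
under [RHS]eq_bigr => a _ do rewrite expr2 mulr_suml.
under [RHS]eq_bigr => a _ do under eq_bigr => i _ do rewrite mulr_sumr.
rewrite [RHS]exchange_big; apply: eq_bigr => i _ /=; rewrite [RHS]exchange_big; apply: eq_bigr => j _ /=.
by rewrite mxE !mulr_suml; apply: eq_bigr => a _; rewrite mxE; ring.
Qed.

Lemma invmx_quad_ge0 (v : 'I_n -> R) : 0 <= \sum_i \sum_j invmx G i j * v i * v j.
Proof. by rewrite invmx_quad sumr_ge0 // => a _; exact: sqr_ge0. Qed.

(** Bounds the eigenframe by the metric alone, however large [U] may be. *)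
Lemma frame_entry a i : Q a i ^+ 2 <= invmx G i i.
Proof.
rewrite (frame_invmx hQ) mxE (bigD1 a) //= mxE -expr2 lerDl sumr_ge0 // => b _.
by rewrite mxE -expr2 sqr_ge0.
Qed.

Lemma coord_frame (v : 'I_n -> R) k :
  v k = \sum_a (G *m Q^T) k a * (\sum_i Q a i * v i).
Proof.
have h : G *m Q^T *m Q = 1%:M.
  by rewrite -mulmxA -(frame_invmx hQ) mulmxV //; exact: frame_unit hQ.
transitivity (\sum_i (G *m Q^T *m Q) k i * v i).
  by rewrite h (bigD1 k) //= mxE eqxx mul1r big1 ?addr0 // => i ik; rewrite mxE eq_sym (negbTE ik) mul0r.
under eq_bigr => i _ do rewrite mxE mulr_suml.
rewrite exchange_big; apply: eq_bigr => a _; rewrite mulr_sumr; apply: eq_bigr => i _ /=.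
by rewrite mulrA.
Qed.

Lemma coord_quad (v : 'I_n -> R) k :
  `|v k| <= (\sum_a `|(G *m Q^T) k a|) * Num.sqrt (\sum_i \sum_j invmx G i j * v i * v j).
Proof.
rewrite [X in `|X|]coord_frame invmx_quad; apply: le_trans (ler_norm_sum _ _ _) _.
rewrite mulr_suml; apply: ler_sum => a _; rewrite normrM ler_wpM2l //.
rewrite -sqrtr_sqr; apply: ler_wsqrtr; rewrite [leRHS](bigD1 a) //= lerDl sumr_ge0 // => b _.
exact: sqr_ge0.
Qed.

Lemma frame_sumG a : \sum_i \sum_j Q a i * Q a j * G i j = 1.
Proof.
have := congr1 (fun M : 'M[R]_n => M a a) (proj1 hQ); rewrite [in RHS]mxE eqxx => h; rewrite -[RHS]/(true%:R) -h.
rewrite mxE exchange_big; apply: eq_bigr => j _; rewrite !mxE mulr_suml.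
by apply: eq_bigr => i _; ring.
Qed.

Lemma frame_sum_mx (B : 'M[R]_n) a :
  (Q *m B *m Q^T) a a = \sum_i \sum_j Q a i * Q a j * B i j.
Proof.
rewrite mxE exchange_big; apply: eq_bigr => j _; rewrite !mxE mulr_suml.
by apply: eq_bigr => i _; ring.
Qed.

Lemma frame_sumU a : \sum_i \sum_j Q a i * Q a j * U i j = l 0 a.
Proof. by rewrite -frame_sum_mx (frame_diag hQ) mxE eqxx mulr1n. Qed.

(** With [D] and [E] the derivatives of the inverse metric and of [U], this splits the derivative of
    the endomorphism. The first part is a multiple of the eigenvalue because [U *m Q^T] is
    [G *m Q^T *m diag_mx l]. *)
Lemma frame_deriv (D E : 'M[R]_n) a : U^T = U ->
  (Q *m G *m (D *m U + invmx G *m E) *m Q^T) a a =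
  (Q *m G *m D *m G *m Q^T) a a * l 0 a + \sum_i \sum_j Q a i * Q a j * E i j.
Proof.
move=> sU; have e1 : U *m Q^T = G *m Q^T *m diag_mx l.
  have := congr1 trmx (proj2 hQ); rewrite !trmx_mul sU G_sym tr_diag_mx => ->.
  by rewrite mulmxA.
rewrite mulmxDr mulmxDl mxE; congr (_ + _).
  rewrite mulmxA -!mulmxA e1 !mulmxA mul_mx_diag [in LHS]mxE.
  by [].
by rewrite (mulmxA (Q *m G)) mulmxK ?frame_sum_mx //; exact: frame_unit hQ.
Qed.

End FrameSums.

Lemma bO_pull (R : realType) (Om Om' : Type) (p : Om' -> Om) (f g : Om -> R) :
  bO f g -> bO (fun w => f (p w)) (fun w => g (p w)).
Proof. by move=> [C C0 h]; exists C => // w; exact: h. Qed.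

(** * Expansion of the derivative of U *)

Section PdeExpand.
Variables (R : realType) (m : nat) (W : set 'rV[R]_m.+1).
Notation n := (m.+1).
Notation V := 'rV[R]_m.+1.
Notation H := (@half_space R m).
Hypothesis HW : relopen H W.
Variable G : V -> 'M[R]_n.
Hypothesis G_smooth : forall k i j, Ck H W k (fun x => G x i j).
Hypothesis G_sym : forall x, W x -> (G x)^T = G x.
Hypothesis G_pos : forall x, W x -> posdef (G x).
Implicit Types (x : V) (u : V -> R).

Lemma pd_dnorm2 u x k : Ck H W 2 u -> W x -> pd k (dnorm2 G u) x =
  \sum_i \sum_j ((pd k (fun y => ginv G y i j) x * pd i u x + ginv G x i j * pd k (pd i u) x) * pd j u x
    + ginv G x i j * pd i u x * pd k (pd j u) x).
Proof.
move=> hu Wx; have hg i j := Ck_ginv HW G_smooth G_sym G_pos 1 i j.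
have hd i := hCk_pd i hu.
have h1 i j := hCkM HW (hg i j) (hd i).
have h2 i j := hCkM HW (h1 i j) (hd j).
rewrite (pd_sum HW) // => [|i]; last exact: (hCk_sum HW).
apply: eq_bigr => i _; rewrite (pd_sum HW) //; apply: eq_bigr => j _.
by rewrite (pdM HW k (h1 i j) (hd j) Wx) (pdM HW k (hg i j) (hd i) Wx).
Qed.

Lemma pd_Utensor u x k i j : Ck H W 3 u -> W x -> pd k (fun y => Utensor G u y i j) x =
  pd k (pd i (pd j u)) x
  - \sum_l (pd k (christoffel G l i j) x * pd l u x + christoffel G l i j x * pd k (pd l u) x)
  + (pd k (pd i u) x * pd j u x + pd i u x * pd k (pd j u) x)
  - 2^-1 * (pd k (dnorm2 G u) x * G x i j + dnorm2 G u x * pd k (fun y => G y i j) x)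
  + pd k (fun y => schouten G y i j) x.
Proof.
move=> hu Wx; have hu2 := hCk_le (isT : 2 <= 3)%N hu.
rewrite (pd_ext HW k Wx (fun y Wy => UtensorE G_sym G_pos u i j Wy)).
have h1 : Ck H W 1 (pd i (pd j u)) by apply: hCk_pd; apply: hCk_pd.
have hd l : Ck H W 1 (pd l u) by exact: hCk_pd.
have hc l := Ck_christoffel HW G_smooth G_sym G_pos 1 l i j.
have h2' l := hCkM HW (hc l) (hd l).
have h2 : Ck H W 1 (fun y => \sum_l christoffel G l i j y * pd l u y) by exact: (hCk_sum HW).
have h12 := hCkB HW h1 h2.
have h3 := hCkM HW (hd i) (hd j).
have h123 := hCkD HW h12 h3.
have hn := Ck_dnorm2 HW G_smooth G_sym G_pos hu2.
have hn2 := hCkZ HW 2^-1 hn.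
have h4 := hCkM HW hn2 (G_smooth 1 i j).
have h1234 := hCkB HW h123 h4.
rewrite (pdD HW k h1234 (Ck_schouten HW G_smooth G_sym G_pos 1 i j) Wx).
rewrite (pdB HW k h123 h4 Wx) (pdD HW k h12 h3 Wx) (pdB HW k h1 h2 Wx).
rewrite (pd_sum HW _ _ k h2' Wx) (pdM HW k (hd i) (hd j) Wx) (pdM HW k hn2 (G_smooth 1 i j) Wx).
rewrite (pdZ HW 2^-1 k hn Wx) mulrDr !mulrA; congr (_ - _ + _ - _ + _).
by apply: eq_bigr => l _; exact: (pdM HW k (hc l) (hd l) Wx).
Qed.

Lemma pd3C u x i j k : Ck H W 3 u -> W x -> pd k (pd i (pd j u)) x = pd j (pd i (pd k u)) x.
Proof.
move=> hu Wx; have hu2 := hCk_le (isT : 2 <= 3)%N hu.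
rewrite (pd_young HW k i (hCk_pd j hu) Wx).
rewrite (pd_ext HW i Wx (fun y Wy => pd_young HW k j hu2 Wy)).
exact: (pd_young HW i j (hCk_pd k hu) Wx).
Qed.

End PdeExpand.

(** * Uniform bounds over a compact part of a chart *)

Section LocalSetting.
Variables (R : realType) (m : nat) (W : set 'rV[R]_m.+1).
Notation n := (m.+1).
Notation V := 'rV[R]_m.+1.
Notation H := (@half_space R m).
Hypothesis HW : relopen H W.
Variable G : V -> 'M[R]_n.
Hypothesis G_smooth : forall k i j, Ck H W k (fun x => G x i j).
Hypothesis G_sym : forall x, W x -> (G x)^T = G x.
Hypothesis G_pos : forall x, W x -> posdef (G x).
Variable K : set V.
Hypotheses (K_compact : compact K) (KW : K `<=` W).
Implicit Types (x : V) (u : V -> R).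

Section Family.
Variables (Om : Type) (p : Om -> V).
Hypothesis pK : forall w, K (p w).

Lemma bO_K (h : V -> R) : Ck H W 0 h -> bO (fun w => h (p w)) (fun=> 1).
Proof.
move=> hh; have [C hC] := hCk_bounded hh K_compact KW.
exists `|C| => // w; split=> //; rewrite mulr1 (le_trans (hC _ (pK w))) //.
exact: ler_norm.
Qed.

Lemma bO_ginv i j : bO (fun w => ginv G (p w) i j) (fun=> 1).
Proof. by apply: (bO_K (h := fun x => ginv G x i j)); exact: (Ck_ginv HW). Qed.

Lemma bO_frame_entry (U Q : Om -> 'M[R]_n) l a i :
  (forall w, frame (G (p w)) (U w) (Q w) (l w)) -> bO (fun w => Q w a i) (fun=> 1).
Proof.
move=> hQ; have [C C0 hC] := bO_ginv i i; exists (C + 1); first by rewrite addr_ge0.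
move=> w; split=> //; rewrite mulr1.
have h1 := frame_entry (hQ w) a i; have [_] := hC w; rewrite mulr1 => h2.
have h3 := le_trans h1 (le_trans (ler_norm _) h2).
have [h|h] := leP `|Q w a i| 1; first by rewrite (le_trans h) // lerDr.
apply: le_trans (_ : `|Q w a i| ^+ 2 <= _).
  by rewrite expr2 ler_peMl // ltW.
by rewrite -normrX ger0_norm ?sqr_ge0 // (le_trans h3) // lerDl.
Qed.

End Family.

(** Uniform ellipticity of the metric over [K]. Frames of the pencil formed by [G] and [G] itself
    are orthonormal frames; they depend on the point in no continuous way, but their entries are
    bounded, which is enough. *)
Lemma coord_bound : exists2 C, 0 < C & forall x (v : 'I_n -> R) k, K x ->
  `|v k| <= C * Num.sqrt (\sum_i \sum_j ginv G x i j * v i * v j).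
Proof.
pose Om := {w : V * 'M[R]_n * V | K w.1.1 /\ frame (G w.1.1) (G w.1.1) w.1.2 w.2}.
pose p (w : Om) := (projT1 w).1.1; pose Q (w : Om) := (projT1 w).1.2.
have pK w : K (p w) by case: w => w [].
have pQ w : frame (G (p w)) (G (p w)) (Q w) ((projT1 w).2) by case: w => w [].
have hb k a : bO (fun w => (G (p w) *m (Q w)^T) k a) (fun=> 1).
  apply: bO_mulmx => i j; first exact: (bO_K pK (h := fun x => G x i j)).
  apply: (bO_eq (f := fun w => Q w j i)) => [w|]; first by rewrite mxE.
  exact: (bO_frame_entry pK _ _ pQ).
have hs k : exists2 C, 0 <= C & forall w, \sum_a `|(G (p w) *m (Q w)^T) k a| <= C.
  have h a : exists2 C, 0 <= C & forall w, `|(G (p w) *m (Q w)^T) k a| <= C.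
    have [C C0 hC] := hb k a; exists C => // w; have [_] := hC w; by rewrite mulr1.
  exists (\sum_a projT1 (cid2 (h a))).
    by apply: sumr_ge0 => a _; case: cid2.
  by move=> w; apply: ler_sum => a _; case: cid2.
exists (1 + \sum_k projT1 (cid2 (hs k))).
  by rewrite ltr_pwDl // sumr_ge0 // => k _; case: cid2.
move=> x v k Kx; have [Q0 [l0 hQ0]] := frame_exists (G_sym (KW Kx)) (G_sym (KW Kx)) (G_pos (KW Kx)).
pose w : Om := exist _ (x, Q0, l0) (conj Kx hQ0).
apply: le_trans (coord_quad hQ0 v k) _; apply: ler_wpM2r; first exact: sqrtr_ge0.
apply: le_trans (_ : projT1 (cid2 (hs k)) <= _); first by case: (cid2 (hs k)) => C C0 hC; exact: (hC w).
rewrite (bigD1 k) //= addrCA lerDl addr_ge0 // sumr_ge0 // => i _.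
by case: cid2.
Qed.

End LocalSetting.

(** A [bO] statement indexed by this type is a bound uniform in the solution and in the point at
    once. *)
Record sample (T U : Type) (S : set T) (K : set U) :=
  Sample { pu : T; px : U; sample_u : S pu; sample_x : K px }.

Lemma sum2_frame5 (R : realType) (n : nat) (q : 'I_n -> R) (A B C D E : 'I_n -> 'I_n -> R) :
  \sum_i \sum_j q i * q j * (A i j - B i j + C i j - D i j + E i j) =
  \sum_i \sum_j q i * q j * A i j - \sum_i \sum_j q i * q j * B i j
  + \sum_i \sum_j q i * q j * C i j - \sum_i \sum_j q i * q j * D i j
  + \sum_i \sum_j q i * q j * E i j.
Proof.
rewrite -sumrB -big_split -sumrB -big_split; apply: eq_bigr => i _ /=.
rewrite -sumrB -big_split -sumrB -big_split; apply: eq_bigr => j _ /=; ring.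
Qed.

Lemma sum2_frame_sum (R : realType) (n : nat) (q h : 'I_n -> R) (B : 'I_n -> 'I_n -> 'I_n -> R) :
  \sum_i \sum_j q i * q j * (\sum_l B l i j * h l) =
  \sum_l (\sum_i \sum_j q i * q j * B l i j) * h l.
Proof.
under [RHS]eq_bigr => l _ do rewrite mulr_suml.
rewrite [RHS]exchange_big; apply: eq_bigr => i _ /=.
under [RHS]eq_bigr => l _ do rewrite mulr_suml.
rewrite [RHS]exchange_big; apply: eq_bigr => j _ /=.
by rewrite mulr_sumr; apply: eq_bigr => l _; rewrite mulrA.
Qed.

Lemma sum2_mul (R : realType) (n : nat) (q u v : 'I_n -> R) :
  \sum_i \sum_j q i * q j * (u i * v j) = (\sum_i q i * u i) * (\sum_j q j * v j).
Proof.
rewrite mulr_suml; apply: eq_bigr => i _; rewrite mulr_sumr; apply: eq_bigr => j _; ring.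
Qed.

Lemma sum2_scale (R : realType) (n : nat) (q : 'I_n -> R) (c : R) (B : 'I_n -> 'I_n -> R) :
  \sum_i \sum_j q i * q j * (c * B i j) = c * \sum_i \sum_j q i * q j * B i j.
Proof.
rewrite mulr_sumr; apply: eq_bigr => i _; rewrite mulr_sumr; apply: eq_bigr => j _; ring.
Qed.

Lemma sum_lin3 (R : realType) (n : nat) (v A B C : 'I_n -> R) (p q g : R) :
  ((\sum_j v j * A j) * p + g * (\sum_j v j * B j)) * q + g * p * (\sum_j v j * C j) =
  \sum_j v j * ((A j * p + g * B j) * q + g * p * C j).
Proof.
rewrite !mulrDl !mulr_suml !mulr_sumr !mulr_suml -!big_split; apply: eq_bigr => j _ /=; ring.
Qed.

Lemma sum2_frame_sum2 (R : realType) (n : nat) (q h g : 'I_n -> R) (B C : 'I_n -> 'I_n -> 'I_n -> R) :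
  \sum_i \sum_j q i * q j * (\sum_l (B l i j * h l + C l i j * g l)) =
  \sum_l ((\sum_i \sum_j q i * q j * C l i j) * g l + (\sum_i \sum_j q i * q j * B l i j) * h l).
Proof.
rewrite big_split /= -!sum2_frame_sum -big_split; apply: eq_bigr => i _ /=.
by rewrite -big_split; apply: eq_bigr => j _ /=; rewrite -mulrDr -big_split; congr (_ * _);
  apply: eq_bigr => l _; rewrite addrC.
Qed.

Lemma sum2_mul_sym (R : realType) (n : nat) (q u v : 'I_n -> R) :
  \sum_i \sum_j q i * q j * (v i * u j + u i * v j) =
  2 * (\sum_i q i * u i) * (\sum_j q j * v j).
Proof.
have e : \sum_i \sum_j q i * q j * (v i * u j + u i * v j) =
   \sum_i \sum_j q i * q j * (v i * u j) + \sum_i \sum_j q i * q j * (u i * v j).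
  rewrite -big_split; apply: eq_bigr => i _; rewrite -big_split; apply: eq_bigr => j _ /=.
  by rewrite mulrDr.
by rewrite e !sum2_mul; ring.
Qed.

Lemma sum2_scale2 (R : realType) (n : nat) (q : 'I_n -> R) (c d : R) (B C : 'I_n -> 'I_n -> R) :
  \sum_i \sum_j q i * q j * (2^-1 * (c * B i j + d * C i j)) =
  2^-1 * (c * (\sum_i \sum_j q i * q j * B i j) + d * (\sum_i \sum_j q i * q j * C i j)).
Proof.
rewrite -!sum2_scale -big_split mulr_sumr; apply: eq_bigr => i _ /=.
rewrite -big_split mulr_sumr; apply: eq_bigr => j _ /=; ring.
Qed.

Lemma congr_sum5 (R : zmodType) (A B C D E A' B' C' D' E' : R) :
  A = A' -> B = B' -> C = C' -> D = D' -> E = E' -> A - B + C - D + E = A' - B' + C' - D' + E'.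
Proof. by move=> -> -> -> -> ->. Qed.

Lemma jet1X (R : realType) (F : set_system R) (phi : R -> R) c0 c1 k : jet1 F phi c0 c1 ->
  jet1 F (fun t => phi t ^+ k.+1) (c0 ^+ k.+1) (k.+1%:R * c0 ^+ k * c1).
Proof.
move=> h; elim: k => [|k IH]; first by rewrite mulr1 mul1r.
have := jet1M h IH; rewrite -exprS.
have -> : c1 * c0 ^+ k.+1 + c0 * (k.+1%:R * c0 ^+ k * c1) = k.+2%:R * c0 ^+ k.+1 * c1.
  by rewrite -[k.+2%:R]natr1 (exprS _ k); ring.
by apply: jet1_eq => t; rewrite -exprS.
Qed.

Lemma jet1_test (R : realType) (F : set_system R) (N : nat) (A B M : R) (sg w u : R -> R)
    sg0 sg1 w0 w1 u0 u1 :
  jet1 F sg sg0 sg1 -> jet1 F w w0 w1 -> jet1 F u u0 u1 ->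
  jet1 F (fun t => sg t ^+ 2 * w t - M * (A - (B - u t) ^+ N.+2))
    (sg0 ^+ 2 * w0 - M * (A - (B - u0) ^+ N.+2))
    (2 * sg0 * sg1 * w0 + sg0 ^+ 2 * w1 - M * (N.+2%:R * (B - u0) ^+ N.+1 * u1)).
Proof.
move=> js jw ju; have pF : punctured_filter F by case: js.
have h := jet1B (jet1M (jet1X 1 js) jw)
  (jet1Z M (jet1B (jet1_cst pF A) (jet1X N.+1 (jet1B (jet1_cst pF B) ju)))).
move: h; rewrite !sub0r.
set c1 := (X in jet1 _ _ _ X).
suff -> : c1 = 2 * sg0 * sg1 * w0 + sg0 ^+ 2 * w1 - M * (N.+2%:R * (B - u0) ^+ N.+1 * u1) by [].
by rewrite /c1; ring.
Qed.

Lemma boundary_first (R : realType) (sg0 sg1 w0 w1 th th1 u1 : R) : 0 < sg0 -> 0 < th ->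
  2 * sg0 * sg1 * w0 + sg0 ^+ 2 * w1 - sg0 ^+ 2 * w0 / th * (th1 * u1) <= 0 ->
  w1 + 2 * (sg1 / sg0) * w0 <= w0 * (th1 / th) * u1.
Proof.
move=> s0 t0 h; have s1 : sg0 != 0 by rewrite gt_eqF.
have t1 : th != 0 by rewrite gt_eqF.
rewrite -subr_le0 -(pmulr_rle0 _ (exprn_gt0 2 s0)); apply: le_trans h.
rewrite le_eqVlt; apply/orP; left; apply/eqP; field; by rewrite s1 t1.
Qed.

Lemma cutoff_slope (R : realType) (r C g0 L g s : R) : s <= C * r -> L * g0 <= L * g ->
  L * g0 = r + 2 * (C * r) -> r <= L * g - 2 * s.
Proof. by move=> h1 h2 h3; lra. Qed.

Lemma small_radius (R : realType) (r C : R) : 0 < r -> r * (C + 1) <= 1 -> C * r ^+ 2 < r.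
Proof.
move=> r0 h; have : r * (r * (C + 1)) <= r * 1 by rewrite ler_wpM2l // ltW.
have : 0 < r ^+ 2 by rewrite exprn_gt0.
rewrite expr2; nra.
Qed.

(** * The local gradient estimate *)

Section CutOff.
Variables (R : realType) (m : nat) (W : set 'rV[R]_m.+1).
Notation n := (m.+1).
Notation V := 'rV[R]_m.+1.
Notation H := (@half_space R m).
Hypothesis HW : relopen H W.
Variables (xs : V) (r L : R).

Definition cutoff (x : V) := r ^+ 2 - \sum_i (x 0 i - xs 0 i) ^+ 2 + L * (x 0 ord0 - xs 0 ord0).

Lemma hCk_coord k i : Ck H W k (fun x => x 0 i).
Proof. by move: HW; rewrite half_orthant => h; exact: Ck_coord. Qed.

Lemma cutoff_Ck k : Ck H W k cutoff.
Proof.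
have h i : Ck H W k (fun x => x 0 i - xs 0 i).
  by apply: (hCkB HW); [exact: hCk_coord | exact: (hCk_cst HW)].
apply: (hCkD HW); last by apply: (hCkZ HW); exact: h.
apply: (hCkB HW); first exact: (hCk_cst HW).
apply: (hCk_sum HW) => i; apply: (hCk_ext HW (fun x _ => esym (expr2 _))).
exact: (hCkM HW).
Qed.

Lemma cutoff_cont : continuous cutoff.
Proof.
have h i : continuous (fun x : V => x 0 i - xs 0 i).
  have hc : continuous (fun x : V => x 0 i) by exact: coord_continuous.
  by move=> x; exact: (cvgB (hc x) (cvg_cst (xs 0 i))).
have h1 : continuous (fun x : V => \sum_i (x 0 i - xs 0 i) ^+ 2).
  apply: (sum_cont (f := fun i (x : V) => (x 0 i - xs 0 i) ^+ 2)) => i y.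
  by under eq_fun do rewrite expr2; exact: (cvgM (h i y) (h i y)).
move=> x.
exact: (cvgD (cvgB (cvg_cst (r ^+ 2)) (h1 x)) (cvgM (cvg_cst L) (h ord0 x))).
Qed.

Lemma pd_cutoff j x : W x -> pd j cutoff x = - 2 * (x 0 j - xs 0 j) + L * (j == ord0)%:R.
Proof.
move=> Wx; have pF := hdir_punctured HW j Wx.
have jc i : jet1 (dir_filter H j x) (fun t => (x + t *: delta_mx 0 j) 0 i - xs 0 i)
    (x 0 i - xs 0 i) ((delta_mx 0 j : V) 0 i).
  by have := jet1B (line_coord x (delta_mx 0 j) pF i) (jet1_cst pF (xs 0 i)); rewrite subr0.
apply: (pd_eq HW) => //.
have hs : jet1 (dir_filter H j x) (fun t => \sum_i ((x + t *: delta_mx 0 j) 0 i - xs 0 i) *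
      ((x + t *: delta_mx 0 j) 0 i - xs 0 i)) (\sum_i (x 0 i - xs 0 i) * (x 0 i - xs 0 i))
    (\sum_i ((delta_mx 0 j : V) 0 i * (x 0 i - xs 0 i) + (x 0 i - xs 0 i) * (delta_mx 0 j : V) 0 i)).
  by apply: jet1_sum => // i _; exact: jet1M.
have h := jet1D (jet1B (jet1_cst pF (r ^+ 2)) hs)
  (jet1Z L (jc ord0)).
have -> : - 2 * (x 0 j - xs 0 j) + L * (j == ord0)%:R = 0 - \sum_i
    ((delta_mx 0 j : V) 0 i * (x 0 i - xs 0 i) + (x 0 i - xs 0 i) * (delta_mx 0 j : V) 0 i)
    + L * (delta_mx 0 j : V) 0 ord0.
  rewrite sub0r mxE eqxx (eq_sym j); congr (_ + _).
  rewrite (bigD1 j) //= big1 ?addr0 => [|i ij]; first by rewrite mxE !eqxx /=; ring.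
  by rewrite mxE (negbTE ij) andbF mul0r mulr0 addr0.
have e y : cutoff y = r ^+ 2 - \sum_i (y 0 i - xs 0 i) * (y 0 i - xs 0 i) + L * (y 0 ord0 - xs 0 ord0).
  by congr (_ - _ + _); apply: eq_bigr => i _; rewrite expr2.
by rewrite e; apply: jet1_eq h => t; rewrite e.
Qed.

Lemma cutoff_near (x : V) : 0 < r -> 0 <= L * (x 0 ord0 - xs 0 ord0) ->
  `|x - xs| <= r / (2 * n%:R) -> r ^+ 2 / 2 <= cutoff x.
Proof.
move=> r0 hL hx; have n0 : 1 <= n%:R :> R by rewrite ler1n.
have n00 : 0 < n%:R :> R by lra.
suff h : \sum_i (x 0 i - xs 0 i) ^+ 2 <= r ^+ 2 / 2.
  rewrite /cutoff; apply: le_trans (_ : r ^+ 2 - \sum_i (x 0 i - xs 0 i) ^+ 2 <= _).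
    by rewrite lerBrDr -lerBrDl; apply: le_trans h _; lra.
  by rewrite lerDl.
apply: (@le_trans _ _ (\sum_(i < n) (r ^+ 2 / 2) / n%:R)).
  apply: ler_sum => i _; have := ler_norm_coord (x - xs) i; rewrite !mxE => h.
  have h1 := le_trans h hx.
  rewrite -[X in X <= _]ger0_norm ?sqr_ge0 // normrX.
  apply: le_trans (_ : (r / (2 * n%:R)) ^+ 2 <= _).
    by rewrite lerXn2r // ?nnegrE // divr_ge0 ?mulr_ge0 // ltW.
  rewrite -subr_ge0; have -> : r ^+ 2 / 2 / n%:R - (r / (2 * n%:R)) ^+ 2 =
    (r / (2 * n%:R)) ^+ 2 * (2 * n%:R - 1) by field; rewrite gt_eqF.
  by rewrite mulr_ge0 ?sqr_ge0 //; lra.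
rewrite sumr_const card_ord -[_ *+ n]mulr_natr divfK // gt_eqF //.
Qed.

(* The square is completed in the first coordinate. *)
Lemma cutoff_box x : 0 <= r -> 0 <= L -> 0 <= cutoff x -> forall i, `|x 0 i - xs 0 i| <= r + L.
Proof.
move=> r0 L0 h i; rewrite -ler_sqr ?nnegrE ?addr_ge0 // real_normK ?num_real //.
pose d j := x 0 j - xs 0 j.
have h1 : d i ^+ 2 <= r ^+ 2 + L * d ord0.
  have h2 : \sum_j d j ^+ 2 <= r ^+ 2 + L * d ord0 by move: h; rewrite /cutoff -/(d _) addrAC subr_ge0.
  apply: le_trans h2; rewrite (bigD1 i) //= lerDl sumr_ge0 // => j _; exact: sqr_ge0.
have h3 : d ord0 ^+ 2 <= r ^+ 2 + L * d ord0.
  have h2 : \sum_j d j ^+ 2 <= r ^+ 2 + L * d ord0 by move: h; rewrite /cutoff -/(d _) addrAC subr_ge0.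
  apply: le_trans h2; rewrite (bigD1 ord0) //= lerDl sumr_ge0 // => j _; exact: sqr_ge0.
have h4 : d ord0 <= r + L by rewrite leNgt; apply/negP => h4; nra.
rewrite -/(d i); apply: le_trans h1 _; nra.
Qed.

End CutOff.

(** * The Bernstein quantity for an abstract family of solutions *)

Section LocalEstimate.
Variables (R : realType) (m : nat) (W : set 'rV[R]_m.+1).
Notation n := (m.+1).
Notation V := 'rV[R]_m.+1.
Notation H := (@half_space R m).
Hypothesis HW : relopen H W.
Variable G : V -> 'M[R]_n.
Hypothesis G_smooth : forall k i j, Ck H W k (fun x => G x i j).
Hypothesis G_sym : forall x, W x -> (G x)^T = G x.
Hypothesis G_pos : forall x, W x -> posdef (G x).
Variables (Gam : set V) (f : V -> R) (c0 : R).
Hypotheses (Gam_open : open Gam) (Gam_ub : Gam `<=` Gamma1).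
Hypotheses (f_smooth : smooth setT Gam f) (f_sym : symmetric_fun (closure Gam) f)
  (f_hom : homogeneous1 Gam f) (f_mono : forall i lam, Gam lam -> 0 < partial setT i f lam)
  (c00 : 0 < c0) (f_sum : forall lam, Gam lam -> c0 <= \sum_i partial setT i f lam).
Variable K : set V.
Hypotheses (K_compact : compact K) (KW : K `<=` W).
Variables (a b : R) (S : set (V -> R)) (P : (V -> R) -> V -> R)
  (be ka : (V -> R) -> 'I_n -> V -> R).
Notation pt := (sample S K).
Implicit Types (x : V) (u : V -> R).
(** The size of [du] without reference to the metric. The shift [be] is assumed bounded, with first
    derivatives of linear growth in this size; its second derivatives grow quadratically once the
    Hessian term with coefficient [ka] is removed. *)
Definition D1 u x := \sum_i `|pd i u x|.
Hypotheses (S3 : forall u, S u -> Ck H W 3 u)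
  (Sab : forall u x, S u -> W x -> a <= u x <= b)
  (Spde : forall u x, S u -> W x -> Gam (eigU G u x) /\ f (eigU G u x) = P u x)
  (SP : forall u, S u -> Ck H W 1 (P u))
  (P0 : bO (fun w : pt => P (pu w) (px w)) (fun=> 1))
  (P1 : forall k, bO (fun w : pt => pd k (P (pu w)) (px w)) (fun w => 1 + D1 (pu w) (px w)))
  (beC : forall u k, S u -> Ck H W 2 (be u k))
  (be0 : forall k, bO (fun w : pt => be (pu w) k (px w)) (fun=> 1))
  (be1 : forall k j, bO (fun w : pt => pd j (be (pu w) k) (px w)) (fun w => 1 + D1 (pu w) (px w)))
  (be2 : forall k i j, bO (fun w : pt => pd j (pd i (be (pu w) k)) (px w)
      - ka (pu w) k (px w) * pd j (pd i (pu w)) (px w)) (fun w => (1 + D1 (pu w) (px w)) ^+ 2))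
  (ka0 : forall k, bO (fun w : pt => ka (pu w) k (px w)) (fun=> 1)).
Variables (N : nat) (A : R).
Hypotheses (hN : b - a <= N%:R) (hA : A = (b - a + 1) ^+ N.+2 + 1).

Definition Xk u k x := pd k u x - be u k x.
Definition wt u x := \sum_k \sum_l ginv G x k l * Xk u k x * Xk u l x.
(* With [1 <= b + 1 - y <= N + 1], the exponent makes [th'' <= - th'], and [A]
   keeps [th >= 1]. *)
Definition th y := A - (b + 1 - y) ^+ N.+2.
Definition th1 y := N.+2%:R * (b + 1 - y) ^+ N.+1.
Definition qq y := th1 y / th y.

Lemma th_range y : a <= y <= b -> 1 <= b + 1 - y <= b - a + 1.
Proof. by move=> /andP[h1 h2]; apply/andP; split; lra. Qed.

Lemma th_ge1 y : a <= y <= b -> 1 <= th y <= A.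
Proof.
move=> /th_range /andP[h1 h2]; have h0 : 0 <= b + 1 - y by lra.
have := lerXn2r N.+2 h0 (le_trans h0 h2) h2; rewrite /th hA => h.
have := exprn_ge0 N.+2 h0; lra.
Qed.

Lemma A_ge1 y : a <= y <= b -> 1 <= A.
Proof. by move=> /th_ge1 /andP[]; exact: le_trans. Qed.

Lemma qq_bound y : a <= y <= b ->
  A^-1 <= qq y <= N.+2%:R * (b - a + 1) ^+ N.+1.
Proof.
move=> hy; have /andP[h1 h2] := th_ge1 hy; have /andP[h3 h4] := th_range hy.
have A1 := A_ge1 hy; have t0 : 0 < th y by lra.
have A0 : 0 < A by lra.
have p1 : 1 <= (b + 1 - y) ^+ N.+1 by exact: exprn_ege1.
have p2 : (b + 1 - y) ^+ N.+1 <= (b - a + 1) ^+ N.+1 by apply: lerXn2r => //; rewrite nnegrE; lra.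
have N1 : 1 <= N.+2%:R :> R by rewrite ler1n.
have N0 : 0 <= N.+2%:R :> R by [].
have t1 : 1 <= th1 y by rewrite -[1]mulr1 ler_pM.
apply/andP; split.
  rewrite /qq ler_pdivlMr // mulrC ler_pdivrMr //.
  by apply: le_trans h2 _; rewrite ler_peMl // ltW.
rewrite /qq ler_pdivrMr // -[X in X <= _]mulr1; apply: ler_pM => //; first by lra.
by rewrite ler_wpM2l.
Qed.

Lemma th2_le y : a <= y <= b ->
  - (N.+2%:R * N.+1%:R * (b + 1 - y) ^+ N) <= - th1 y.
Proof.
move=> /th_range /andP[h1 h2]; rewrite lerN2 /th1 exprS -mulrA ler_wpM2l // ler_wpM2r ?exprn_ge0 //; first by lra.
by apply: le_trans h2 _; rewrite -natr1 lerD2r.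
Qed.

Section PointBounds.
Variables (Om : Type) (p : Om -> pt).
Notation U w := (pu (p w)).
Notation Y w := (px (p w)).
Hypothesis w1 : forall w, 1 <= wt (U w) (Y w).
Definition sp w := Num.sqrt (wt (U w) (Y w)).

Lemma pW w : W (Y w). Proof. exact: KW (sample_x (p w)). Qed.
Lemma pS w : S (U w). Proof. exact: sample_u (p w). Qed.

Lemma sp_ge1 w : 1 <= sp w.
Proof. by rewrite -sqrtr1; apply: ler_wsqrtr. Qed.

Lemma sp_ge0 w : 0 <= sp w. Proof. exact: sqrtr_ge0. Qed.

Lemma sp2 w : sp w ^+ 2 = wt (U w) (Y w).
Proof. by rewrite sqr_sqrtr // (le_trans _ (w1 w)). Qed.

Lemma bO_X k : bO (fun w => Xk (U w) k (Y w)) sp.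
Proof.
have [C C0 hC] := coord_bound HW G_smooth G_sym G_pos K_compact KW.
exists C; first exact: ltW.
by move=> w; split; [exact: sp_ge0 | exact: hC _ (fun k => Xk (U w) k (Y w)) k (sample_x (p w))].
Qed.

Lemma bO_sp g : bO g (fun=> 1) -> bO g sp.
Proof. by move=> hg; apply: (bO_le (C := 1) _ hg) => // w; rewrite mul1r sp_ge1. Qed.

Lemma bO_pdu k : bO (fun w => pd k (U w) (Y w)) sp.
Proof.
apply: (bO_eq (f := fun w => Xk (U w) k (Y w) + be (U w) k (Y w))) => [w|].
  by rewrite /Xk subrK.
by apply: bODs; [exact: bO_X | apply: bO_sp; exact: (bO_pull p (be0 k))].
Qed.

(** As [be] is bounded and [|X| >= 1], the size of [du] is at most a multiple of [|X|]; the growth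
    hypotheses thereby become powers of [sp]. *)
Lemma bO_D1 : bO (fun w => 1 + D1 (U w) (Y w)) sp.
Proof.
apply: bODs; first by apply: bO_sp; exact: bO_cst.
apply: bO_sum => [w|i]; first exact: sp_ge0.
have [C C0 hC] := bO_pdu i; exists C => // w; split; first exact: sp_ge0.
by rewrite normr_id; have [] := hC w.
Qed.

Lemma bO_trans (g1 g2 : Om -> R) h : bO h g1 -> bO g1 g2 -> bO h g2.
Proof.
move=> [C1 C10 h1] [C2 C20 h2]; exists (C1 * C2); first exact: mulr_ge0.
move=> w; have [a1 b1] := h1 w; have [a2 b2] := h2 w; split=> //.
apply: le_trans b1 _; rewrite -mulrA ler_wpM2l //.
by apply: le_trans b2; exact: ler_norm.
Qed.

Lemma bO_b1 k j : bO (fun w => pd j (be (U w) k) (Y w)) sp.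
Proof. exact: bO_trans (bO_pull p (be1 k j)) bO_D1. Qed.

Lemma bO_b2 k i j : bO (fun w => pd j (pd i (be (U w) k)) (Y w)
      - ka (U w) k (Y w) * pd j (pd i (U w)) (Y w)) (fun w => sp w * sp w).
Proof.
apply: (bO_le (C := 1) _ (bO_trans (bO_pull p (be2 k i j)) (bOX 2 bO_D1))) => // w.
by rewrite mul1r expr2.
Qed.

Lemma bO_P1 k : bO (fun w => pd k (P (U w)) (Y w)) sp.
Proof. exact: bO_trans (bO_pull p (P1 k)) bO_D1. Qed.

Lemma bO_q : bO (fun w => qq (U w (Y w))) (fun=> 1).
Proof.
(* The constant must be nonnegative even if there is no configuration and [b < a], hence the
   absolute value. *)
exists (N.+2%:R * (`|b - a| + 1) ^+ N.+1); first by rewrite mulr_ge0 // exprn_ge0 // addr_ge0.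
move=> w; split=> //; rewrite mulr1; have hy := Sab (pS w) (pW w).
have /andP[h1 h2] := qq_bound hy.
have A0 : 0 <= A^-1 by rewrite invr_ge0 (le_trans _ (A_ge1 hy)).
rewrite ger0_norm ?(le_trans A0) //; apply: le_trans h2 _; rewrite ler_wpM2l //.
have /andP[h3 h4] := th_range hy; have := ler_norm (b - a) => h5.
have d0 : 0 <= b - a + 1 by apply: le_trans (le_trans h3 h4).
have d1 : b - a + 1 <= `|b - a| + 1 by rewrite lerD2r.
by apply: lerXn2r; rewrite ?nnegrE // (le_trans d0).
Qed.

End PointBounds.


(** * Interior maxima *)

Section Sigma.
Variable sg : V -> R.
Hypothesis sgC : Ck H W 2 sg.

(* [y] is the maximum point; multiplying out the quotient makes [y] a maximum of
   [test u y] with value [0], with no denominator to differentiate. *)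
Definition test u y x :=
  sg x ^+ 2 * wt u x - (sg y ^+ 2 * wt u y / th (u y)) * (A - (b + 1 - u x) ^+ N.+2).

Lemma XkC u k : S u -> Ck H W 2 (Xk u k).
Proof. by move=> Su; apply: (hCkB HW); [apply: hCk_pd; exact: S3 | exact: beC]. Qed.

Lemma thC u y : S u -> W y -> 1 <= th (u y) <= A.
Proof. by move=> Su Wy; apply: th_ge1; exact: Sab. Qed.

Definition dgv x (v : V) k l := \sum_j v 0 j * pd j (fun y => ginv G y k l) x.
Definition d2g x (v : V) k l := \sum_i \sum_j v 0 i * v 0 j * pd j (pd i (fun y => ginv G y k l)) x.
Definition X1v u x (v : V) k := \sum_j v 0 j * (pd j (pd k u) x - pd j (be u k) x).
Definition X2v u x (v : V) k := \sum_i \sum_j v 0 i * v 0 j * (pd j (pd i (pd k u)) x - pd j (pd i (be u k)) x).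
Definition wt1 u x v := \sum_k \sum_l
  ((dgv x v k l * Xk u k x + ginv G x k l * X1v u x v k) * Xk u l x + ginv G x k l * Xk u k x * X1v u x v l).
Definition wt2 u x v := \sum_k \sum_l
  ((d2g x v k l * Xk u k x + 2 * dgv x v k l * X1v u x v k + ginv G x k l * X2v u x v k) * Xk u l x
   + 2 * (dgv x v k l * Xk u k x + ginv G x k l * X1v u x v k) * X1v u x v l
   + ginv G x k l * Xk u k x * X2v u x v l).

Lemma wt1_lin u x v : wt1 u x v = \sum_j v 0 j * wt1 u x (delta_mx 0 j).
Proof.
under [RHS]eq_bigr => j _ do rewrite mulr_sumr.
rewrite [RHS]exchange_big; apply: eq_bigr => k _ /=.
under [RHS]eq_bigr => j _ do rewrite mulr_sumr.
rewrite [RHS]exchange_big; apply: eq_bigr => l _ /=.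
rewrite /dgv /X1v; under [RHS]eq_bigr => j _ do rewrite !sum_delta.
exact: sum_lin3.
Qed.

Lemma wt_jet2 u x v : S u -> W x -> 0 < x 0 ord0 ->
  jet2 0^' (fun t => wt u (x + t *: v)) (wt u x) (wt1 u x v) (wt2 u x v).
Proof.
move=> Su Wx x0; have pF := punctured_filter_dnbhs R.
have jg k l : jet2 0^' (fun t => ginv G (x + t *: v) k l) (ginv G x k l) (dgv x v k l) (d2g x v k l).
  exact: (line_jet2 HW v (Ck_ginv HW G_smooth G_sym G_pos 2 k l) Wx x0).
have jX k : jet2 0^' (fun t => Xk u k (x + t *: v)) (Xk u k x) (X1v u x v k) (X2v u x v k).
  have := jet2B (line_jet2 HW v (hCk_pd k (S3 Su)) Wx x0) (line_jet2 HW v (beC k Su) Wx x0).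
  rewrite -!sumrB /X1v /X2v.
  under eq_bigr => j _ do rewrite -mulrBr.
  by under [X in jet2 _ _ _ _ X]eq_bigr => i _ do (rewrite -sumrB; under eq_bigr => j _ do rewrite -mulrBr).
by apply: jet2_sum => // k _; apply: jet2_sum => // l _; exact: (jet2M (jet2M (jg k l) (jX k)) (jX l)).
Qed.

Lemma interior_max u y v : S u -> W y -> 0 < y 0 ord0 -> 0 < sg y -> 0 <= wt u y ->
  (\forall t \near (0 : R)^', test u y (y + t *: v) <= 0) ->
  let s1 := \sum_i v 0 i * pd i sg y in
  let s2 := \sum_i \sum_j v 0 i * v 0 j * pd j (pd i sg) y in
  let u1 := \sum_i v 0 i * pd i u y in
  let u2 := \sum_i \sum_j v 0 i * v 0 j * pd j (pd i u) y in
  wt1 u y v = wt u y * (qq (u y) * u1 - 2 * (s1 / sg y)) /\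
  wt2 u y v + 4 * (s1 / sg y) * wt1 u y v + (2 * (s2 / sg y) + 2 * (s1 / sg y) ^+ 2) * wt u y
    - wt u y * (qq (u y) * u2 - qq (u y) * u1 ^+ 2) <= 0.
Proof.
move=> Su Wy y0 sy w0 hmax s1 s2 u1 u2.
have /andP[t1 _] := thC Su Wy; have t0 : 0 < th (u y) by apply: lt_le_trans t1.
have hu := hCk_le (isT : 2 <= 3)%N (S3 Su).
have := jet2_test N A (b + 1) (sg y ^+ 2 * wt u y / th (u y)) (line_jet2 HW v sgC Wy y0)
  (wt_jet2 v Su Wy y0) (line_jet2 HW v hu Wy y0).
rewrite -/s1 -/s2 -/u1 -/u2 -/(th (u y)) -/(th1 (u y)) divfK ?gt_eqF // subrr => h.
have [h1 h2] := jet2_max h hmax; split; first exact: max_first h1.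
exact: (max_second sy t0 w0 (th2_le (Sab Su Wy)) h2).
Qed.

(** The eigenframe is part of the configuration, so no frame has to be selected as the point or the
    solution varies; all choices obey the same bounds. *)
Record iconf := IConf { icp : pt; iQ : 'M[R]_n;
  ip0 : 0 < px icp 0 ord0; ips : 0 < sg (px icp); ip1 : 1 <= wt (pu icp) (px icp);
  ipQ : frame (G (px icp)) (Utensor G (pu icp) (px icp)) iQ (eigU G (pu icp) (px icp));
  ipmax : forall v, \forall t \near (0 : R)^', test (pu icp) (px icp) (px icp + t *: v) <= 0 }.

Section InteriorFamily.
Notation U w := (pu (icp w)).
Notation Y w := (px (icp w)).
Notation one := (fun _ : iconf => 1 : R).
Implicit Types (w : iconf) (i j k l c : 'I_n).

Let Yw w : W (Y w). Proof. exact: KW (sample_x (icp w)). Qed.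
Let Sw w : S (U w). Proof. exact: sample_u (icp w). Qed.
Let pK w : K (Y w). Proof. exact: sample_x (icp w). Qed.
Let hu2 w : Ck H W 2 (U w). Proof. exact: hCk_le (isT : 2 <= 3)%N (S3 (Sw w)). Qed.
Let lw w := eigU G (U w) (Y w).
Let Gl w : Gam (lw w). Proof. by have [] := Spde (Sw w) (Yw w). Qed.

Let bK (h : V -> R) : Ck H W 0 h -> bO (fun w => h (Y w)) one.
Proof. by move=> hh; exact: (bO_K K_compact KW pK hh). Qed.

Definition iu1 k w := pd k (U w) (Y w).
Definition iu2 k l w := pd l (pd k (U w)) (Y w).
Definition iX k w := Xk (U w) k (Y w).
Definition ib0 k w := be (U w) k (Y w).
Definition ib1 k l w := pd l (be (U w) k) (Y w).
Definition iP c i w := iQ w c i.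
Definition ig k l w := ginv G (Y w) k l.
Definition idg k l j w := pd j (fun y => ginv G y k l) (Y w).
Definition ig2 k l c w := d2g (Y w) (row c (iQ w)) k l.
Definition iu3 k c w := \sum_i \sum_j iQ w c i * iQ w c j * pd j (pd i (pd k (U w))) (Y w).
Definition ic k w := ka (U w) k (Y w).
Definition iuaa c w := uaa iP iu2 c w.
Definition ir k c w := \sum_i \sum_j iQ w c i * iQ w c j * pd j (pd i (be (U w) k)) (Y w)
   - ic k w * iuaa c w.
Definition iGm l c w := \sum_i \sum_j iQ w c i * iQ w c j * christoffel G l i j (Y w).
Definition iGm1 l c k w := \sum_i \sum_j iQ w c i * iQ w c j * pd k (christoffel G l i j) (Y w).
Definition ig1 c k w := \sum_i \sum_j iQ w c i * iQ w c j * pd k (fun y => G y i j) (Y w).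
Definition iA c w := \sum_i \sum_j iQ w c i * iQ w c j * schouten G (Y w) i j.
Definition iA1 c k w := \sum_i \sum_j iQ w c i * iQ w c j * pd k (fun y => schouten G y i j) (Y w).
Definition imu c k w := (iQ w *m G (Y w) *m (\matrix_(i, j) pd k (fun y => ginv G y i j) (Y w))
   *m G (Y w) *m (iQ w)^T) c c.
Definition isg1 k w := pd k sg (Y w) / sg (Y w).
Definition isg2 c w := (\sum_i \sum_j iQ w c i * iQ w c j * pd j (pd i sg) (Y w)) / sg (Y w).
Definition itau w := 1 + (sg (Y w))^-1.
Definition iV c w := Num.sqrt (\sum_k \sum_l ig k l w *
   X1a iP iu2 ib1 k c w * X1a iP iu2 ib1 l c w).
Definition ifa c w := partial setT c f (lw w).
Definition iq w := qq (U w (Y w)).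
Definition ip1' k w := pd k (P (U w)) (Y w).

Let s0 w : 0 < sg (Y w). Proof. exact: ips. Qed.
Let s1 := sp_ge1 (fun w => ip1 w).

Lemma itau_ge1 w : 1 <= itau w.
Proof. by rewrite lerDl invr_ge0 ltW. Qed.

Lemma ibP c i : bO (iP c i) one.
Proof. exact: (bO_frame_entry HW G_smooth G_sym G_pos K_compact KW pK c i (fun w => ipQ w)). Qed.

Lemma ibPP (F : 'I_n -> 'I_n -> iconf -> R) (g : iconf -> R) c : (forall w, 0 <= g w) ->
  (forall i j, bO (F i j) g) -> bO (fun w => \sum_i \sum_j iQ w c i * iQ w c j * F i j w) g.
Proof.
move=> g0 hF; apply: bO_sum => // i; apply: bO_sum => // j.
by apply: (bO_le (C := 1) _ (bOM (bOM (ibP c i) (ibP c j)) (hF i j))) => // w; rewrite !mul1r.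
Qed.

Let one0 w : 0 <= one w. Proof. by []. Qed.

Lemma isg_tau h : bO h one -> bO (fun w => h w / sg (Y w)) itau.
Proof.
move=> [C C0 hC]; exists C => // w; split; first exact: le_trans (itau_ge1 w).
have [_] := hC w; rewrite mulr1 => h1; rewrite normrM ler_pM // normfV gtr0_norm //.
by rewrite lerDr.
Qed.

Lemma Ck1_0 h k : Ck H W 1 h -> Ck H W 0 (pd k h).
Proof. exact: hCk_pd. Qed.

Lemma ibdg k l j : bO (idg k l j) one.
Proof. by apply: bK; apply: Ck1_0; exact: (Ck_ginv HW). Qed.

Lemma iX1aE k c w : X1a iP iu2 ib1 k c w = X1v (U w) (Y w) (row c (iQ w)) k.
Proof. by apply: eq_bigr => j _; rewrite mxE. Qed.

Lemma idgaE k l c w : dga iP idg k l c w = dgv (Y w) (row c (iQ w)) k l.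
Proof. by apply: eq_bigr => j _; rewrite mxE. Qed.

Notation iX2 := (X2 ic iP iu2 iu3 ir).
Notation iW1 := (W1 iX ig iu2 ib1 idg).
Notation iW2 := (W2 iX ic iP ig iu2 iu3 ib1 ir idg ig2).
Notation ilam := (lam iu1 iA iP ig iu2 iGm).
Notation irest := (rest iu1 iA iP ig iu2 iGm imu ig1 iA1 idg iGm1).

Lemma iX2E k c w : iX2 k c w = X2v (U w) (Y w) (row c (iQ w)) k.
Proof.
rewrite /X2 /ir subrK /iu3 /X2v -sumrB; apply: eq_bigr => i _.
by rewrite -sumrB; apply: eq_bigr => j _; rewrite !mxE mulrBr.
Qed.

Lemma iW1E j w : iW1 j w = wt1 (U w) (Y w) (delta_mx 0 j).
Proof.
apply: eq_bigr => k _; apply: eq_bigr => l _; rewrite /dgv /X1v !sum_delta; by [].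
Qed.

Lemma iW2E c w : iW2 c w = wt2 (U w) (Y w) (row c (iQ w)).
Proof.
by apply: eq_bigr => k _; apply: eq_bigr => l _; rewrite idgaE !iX1aE !iX2E.
Qed.

Lemma iframe1E v c w : frame1 iP v c w = \sum_i (row c (iQ w)) 0 i * v i w.
Proof. by apply: eq_bigr => i _; rewrite mxE. Qed.

Lemma icrit j w : iW1 j w = wt (U w) (Y w) * (iq w * iu1 j w - 2 * isg1 j w).
Proof.
have w0 : 0 <= wt (U w) (Y w) by apply: le_trans (ip1 w).
have [h _] := interior_max (Sw w) (Yw w) (ip0 w) (s0 w) w0 (ipmax w (delta_mx 0 j)).
by move: h; rewrite -iW1E !sum_delta.
Qed.

Lemma isecond c w : iW2 c w + 4 * frame1 iP isg1 c w * frame1 iP iW1 c w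
     + (2 * isg2 c w + 2 * frame1 iP isg1 c w ^+ 2) * wt (U w) (Y w)
     - wt (U w) (Y w) * (iq w * uaa iP iu2 c w - iq w * frame1 iP iu1 c w ^+ 2) <= 0.
Proof.
have w0 : 0 <= wt (U w) (Y w) by apply: le_trans (ip1 w).
have [_] := interior_max (Sw w) (Yw w) (ip0 w) (s0 w) w0 (ipmax w (row c (iQ w))).
rewrite -iW2E wt1_lin; under [X in 4 * _ * X]eq_bigr => j _ do rewrite -iW1E.
rewrite !iframe1E.
have -> : \sum_i row c (iQ w) 0 i * isg1 i w = (\sum_i row c (iQ w) 0 i * pd i sg (Y w)) / sg (Y w).
  by rewrite mulr_suml; apply: eq_bigr => i _; rewrite mulrA.
have e (h : V -> R) : \sum_i \sum_j row c (iQ w) 0 i * row c (iQ w) 0 j * pd j (pd i h) (Y w) =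
   \sum_i \sum_j iQ w c i * iQ w c j * pd j (pd i h) (Y w).
  by apply: eq_bigr => i _; apply: eq_bigr => j _; rewrite !mxE.
by rewrite !e.
Qed.

Lemma ilamE c w : ilam c w = lw w 0 c.
Proof.
refine (etrans _ (frame_sumU (ipQ w) c)); set u := U w; set y := Y w.
pose q := iQ w c; have yw : W y := Yw w.
have e : \sum_i \sum_j iQ w c i * iQ w c j * Utensor G u y i j = \sum_i \sum_j q i * q j *
   (pd i (pd j u) y - \sum_k christoffel G k i j y * pd k u y + pd i u y * pd j u y
  - 2^-1 * dnorm2 G u y * G y i j + schouten G y i j).
  apply: eq_bigr => i _; apply: eq_bigr => j _.
  by refine (f_equal (fun z => iQ w c i * iQ w c j * z) _); exact (UtensorE G_sym G_pos u i j yw).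
refine (etrans _ (esym (etrans e (sum2_frame5 q _ _ _ _ _)))).
refine (congr_sum5 _ _ _ _ _).
- apply: eq_bigr => i _; apply: eq_bigr => j _.
  by refine (f_equal (fun z => iQ w c i * iQ w c j * z) _); exact: (pd_young HW _ _ (hu2 w) yw).
- exact (esym (sum2_frame_sum q (fun l => pd l u y) (fun l i j => christoffel G l i j y))).
- exact (etrans (expr2 _) (esym (sum2_mul q (fun l => pd l u y) (fun l => pd l u y)))).
- refine (esym (etrans (sum2_scale q (2^-1 * dnorm2 G u y) (G y)) _)).
  by refine (etrans (f_equal (fun z => 2^-1 * dnorm2 G u y * z) (frame_sumG (ipQ w) c)) _); exact: mulr1.
- by [].
Qed.

Lemma ieuler w : \sum_c ifa c w * ilam c w = P (U w) (Y w).
Proof.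
have [_ <-] := Spde (Sw w) (Yw w).
rewrite -(cone_euler Gam_open f_smooth f_hom (Gl w)).
by apply: eq_bigr => c _; rewrite ilamE.
Qed.

(** In the eigenframe [frame_deriv] isolates the derivative of the inverse metric, and the symmetry
    of third derivatives moves [k] to the inside, where it becomes the index contracted with [X]. *)
Lemma ipde k w : \sum_c ifa c w * (iu3 k c w + irest k c w) = pd k (P (U w)) (Y w).
Proof.
rewrite (pde_linearized HW G_smooth G_sym G_pos Gam_open Gam_ub f_smooth f_sym k (S3 (Sw w))
  (fun y Wy => Spde (Sw w) Wy) (SP (Sw w)) (Yw w) (ip0 w) (ipQ w)).
apply: eq_bigr => c _; congr (_ * _).
have hC i j : Ck H W 1 (fun y => Utensor G (U w) y i j).
  exact: (Ck_Utensor HW G_smooth G_sym G_pos i j (S3 (Sw w))).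
have hg i j := Ck_ginv HW G_smooth G_sym G_pos 1 i j.
rewrite [X in _ *m X *m _](_ : _ =
   (\matrix_(i, j) pd k (fun y => ginv G y i j) (Y w)) *m Utensor G (U w) (Y w)
   + invmx (G (Y w)) *m (\matrix_(i, j) pd k (fun y => Utensor G (U w) y i j) (Y w))); last first.
  apply/matrixP => i j; rewrite [LHS]mxE [RHS]mxE ![in RHS]mxE -big_split /=.
  rewrite (pd_ext HW k (Yw w) (g := fun y => \sum_q ginv G y i q * Utensor G (U w) y q j)); last first.
    by move=> y _; rewrite mxE.
  have hM q := hCkM HW (hg i q) (hC q j).
  rewrite (pd_sum HW _ _ k hM (Yw w)); apply: eq_bigr => q _.
  by rewrite (pdM HW k (hg i q) (hC q j) (Yw w)) !mxE.
rewrite (frame_deriv (ipQ w) (G_sym (Yw w))); last exact: (UtensorC HW G_smooth G_sym G_pos).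
set u := U w; set y := Y w; pose q := iQ w c; have yw : W y := Yw w.
have e : \sum_i \sum_j iQ w c i * iQ w c j *
    (\matrix_(i, j) pd k (fun y => Utensor G u y i j) y) i j = \sum_i \sum_j q i * q j *
  (pd k (pd i (pd j u)) y
  - \sum_l (pd k (christoffel G l i j) y * pd l u y + christoffel G l i j y * pd k (pd l u) y)
  + (pd k (pd i u) y * pd j u y + pd i u y * pd k (pd j u) y)
  - 2^-1 * (pd k (dnorm2 G u) y * G y i j + dnorm2 G u y * pd k (fun y => G y i j) y)
  + pd k (fun y => schouten G y i j) y).
  apply: eq_bigr => i _; apply: eq_bigr => j _.
  refine (f_equal (fun z => iQ w c i * iQ w c j * z) (etrans (mxE _ _ _ _) _)).
  exact (pd_Utensor HW G_smooth G_sym G_pos k i j (S3 (Sw w)) yw).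
transitivity (imu c k w * lw w 0 c + (iu3 k c w
  - \sum_l (iGm l c w * iu2 l k w + iGm1 l c k w * iu1 l w)
  + 2 * ua iu1 iP c w * (\sum_i iP c i w * iu2 i k w)
  - 2^-1 * (dww iu1 ig iu2 idg k w + ww iu1 ig w * ig1 c k w) + iA1 c k w)).
  rewrite /rest ilamE; ring.
refine (f_equal (fun z => imu c k w * lw w 0 c + z) _).
refine (etrans _ (esym (etrans e (sum2_frame5 q _ _ _ _ _)))).
refine (congr_sum5 _ _ _ _ _).
- apply: eq_bigr => i _; apply: eq_bigr => j _.
  refine (f_equal (fun z => iQ w c i * iQ w c j * z) _).
  exact (esym (pd3C HW i j k (S3 (Sw w)) yw)).
- exact (esym (sum2_frame_sum2 q (fun l => pd l u y) (fun l => pd k (pd l u) y)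
    (fun l i j => pd k (christoffel G l i j) y) (fun l i j => christoffel G l i j y))).
- exact (esym (sum2_mul_sym q (fun l => pd l u y) (fun l => pd k (pd l u) y))).
- refine (esym (etrans (sum2_scale2 q _ _ (G y) (fun i j => pd k (fun y => G y i j) y)) _)).
  refine (f_equal (fun z => 2^-1 * (z + dnorm2 G u y * ig1 c k w)) _).
  refine (etrans (f_equal (fun z => pd k (dnorm2 G u) y * z) (frame_sumG (ipQ w) c)) _).
  exact (etrans (mulr1 _) (pd_dnorm2 HW G_smooth G_sym G_pos k (hu2 w) yw)).
- by [].
Qed.

Lemma iVE c w : \sum_k \sum_l ig k l w * X1a iP iu2 ib1 k c w * X1a iP iu2 ib1 l c w = iV c w ^+ 2.
Proof. by rewrite sqr_sqrtr //; exact: (invmx_quad_ge0 (ipQ w)). Qed.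

Lemma iXV k c : bO (X1a iP iu2 ib1 k c) (iV c).
Proof.
have [C C0 hC] := coord_bound HW G_smooth G_sym G_pos K_compact KW.
exists C; first exact: ltW.
by move=> w; split; [exact: sqrtr_ge0 | exact: hC _ (fun k => X1a iP iu2 ib1 k c w) k (pK w)].
Qed.

Lemma interior_estimate : exists2 C, 0 < C & forall w, sp icp w * sg (Y w) <= C.
Proof.
have [Cs Cs0 hCs] : bO (fun w => sg (Y w)) one by apply: bK; exact: (hCk_le (isT : 0 <= 2)%N).
have sgh : Ck H W 1 sg by exact: (hCk_le (isT : 1 <= 2)%N).
suff [C C0 hC] : exists2 C, 0 < C & forall w, sp icp w <= C * itau w.
  (* Multiplying by the cut-off: [itau] times [sg] is [sg + 1], bounded on [K]. *)
  exists (C * (Cs + 1)); first by rewrite mulr_gt0 // ltr_wpDl.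
  move=> w; have := hC w; rewrite -(ler_pM2r (s0 w)) => /le_trans; apply.
  rewrite -mulrA ler_pM2l // /itau mulrDl mul1r mulVf ?gt_eqF // lerD2r.
  by have [_] := hCs w; rewrite mulr1; apply: le_trans; exact: ler_norm.
have tau0 w : 0 <= itau w by exact: le_trans (itau_ge1 w).
have bsg1 (h : V -> R) : Ck H W 0 h -> bO (fun w => h (Y w) / sg (Y w)) itau.
  by move=> hh; apply: isg_tau; exact: bK.
have hsg2 c : bO (isg2 c) (fun w => itau w * itau w).
  have h : bO (isg2 c) itau.
    apply: isg_tau; apply: ibPP => // i j.
    by apply: (bK (h := pd j (pd i sg))); apply: hCk_pd; exact: hCk_pd.
  apply: (bO_le (C := 1) _ h) => // w; rewrite mul1r ler_peMl //; exact: itau_ge1.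
have hG0 q i j : Ck H W q (fun x => G x i j) by exact: G_smooth.
have hch q l i j : Ck H W q (christoffel G l i j) by exact: (Ck_christoffel HW).
have hsc q i j : Ck H W q (fun x => schouten G x i j) by exact: (Ck_schouten HW).
have hgi q i j : Ck H W q (fun x => ginv G x i j) by exact: (Ck_ginv HW).
have hmu c k : bO (imu c k) one.
  have hQ i j : bO (fun w => iQ w i j) one by exact: ibP.
  have hQT i j : bO (fun w => (iQ w)^T i j) one.
    by apply: (bO_eq (f := fun w => iQ w j i)) => [w|]; [rewrite mxE | exact: ibP].
  have hGw i j : bO (fun w => G (Y w) i j) one by exact: (bK (h := fun x => G x i j)).
  have hD i j : bO (fun w => (\matrix_(i, j) pd k (fun y => ginv G y i j) (Y w) : 'M[R]_n) i j) one.
    apply: (bO_eq (f := idg i j k)) => [w|]; first by rewrite mxE.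
    exact: ibdg.
  apply: (bO_mulmx (A := fun w => iQ w *m G (Y w) *m _ *m G (Y w)) _ hQT).
  apply: (bO_mulmx (A := fun w => iQ w *m G (Y w) *m _) _ hGw).
  by apply: (bO_mulmx (A := fun w => iQ w *m G (Y w)) _ hD); exact: bO_mulmx.
have hr k c : bO (ir k c) (fun w => sp icp w * sp icp w).
  have ss w : 0 <= sp icp w * sp icp w by rewrite mulr_ge0 ?sp_ge0.
  apply: (bO_eq (f := fun w => \sum_i \sum_j iQ w c i * iQ w c j *
     (pd j (pd i (be (U w) k)) (Y w) - ka (U w) k (Y w) * pd j (pd i (U w)) (Y w)))) => [w|]; last first.
    by apply: ibPP => // i j; exact: (bO_b2 (fun w => ip1 w)).
  rewrite /ir /iuaa /uaa mulr_sumr -sumrB; apply: eq_bigr => i _.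
  by rewrite mulr_sumr -sumrB; apply: eq_bigr => j _; rewrite /ic /iu2 /iP; ring.
have hu1E k w : iu1 k w = iX k w + ib0 k w by rewrite /iu1 /iX /Xk subrK.
have sE w : \sum_k \sum_l ig k l w * iX k w * iX l w = sp icp w ^+ 2 by rewrite (sp2 (fun w => ip1 w)).
have hcrit j w : iW1 j w = sp icp w ^+ 2 * (iq w * iu1 j w - 2 * isg1 j w).
  by rewrite (sp2 (fun w => ip1 w)); exact: icrit.
have hsec w : \sum_c ifa c w * (iW2 c w + 4 * frame1 iP isg1 c w * frame1 iP iW1 c w
     + (2 * isg2 c w + 2 * frame1 iP isg1 c w ^+ 2) * sp icp w ^+ 2
     - sp icp w ^+ 2 * (iq w * uaa iP iu2 c w - iq w * ua iu1 iP c w ^+ 2)) <= 0.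
  rewrite (sp2 (fun w => ip1 w)) -oppr_ge0 -sumrN sumr_ge0 // => c _.
  rewrite -mulrN mulr_ge0 //; first by apply: ltW; exact: f_mono.
  by rewrite oppr_ge0; exact: isecond.
have gC k l w : ig k l w = ig l k w by exact: (ginvC G_sym).
have u2C k l w : iu2 k l w = iu2 l k w by exact: (pd_young HW).
have A0 w : 0 < A^-1 by rewrite invr_gt0 (lt_le_trans _ (A_ge1 (Sab (Sw w) (Yw w)))).
(* The lower bound for [q] must be a positive number, and [1 <= A] is only known from a value taken
   by some solution; the empty family is therefore set aside. *)
have [w0|none] := pselect (exists w : iconf, True); last first.
  by exists 1 => // w; case: none; exists w.
have q0 : 0 < A^-1 by case: w0 => w _; exact: (A0 w).
apply: (@interior_bound R iconf n (sp icp) itau iq (fun w => P (U w) (Y w)) iV ifa isg1 isg2 iu1 ib0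
  iX ic iA ip1' iP ig iu2 iu3 ib1 ir iGm imu ig1 iA1 idg ig2 iGm1 c0 A^-1) => //.
- exact: itau_ge1.
- by move=> c w; exact: sqrtr_ge0.
- by move=> c w; exact: f_mono.
- by move=> w; exact: f_sum.
- by move=> w; have /andP[] := qq_bound (Sab (Sw w) (Yw w)).
- exact: (bO_q icp).
- exact: (bO_pull icp P0).
- by move=> i; apply: bsg1; exact: hCk_pd.
- by move=> k; exact: (bO_pull icp (be0 k)).
- by move=> k; exact: (bO_X icp).
- by move=> k; exact: (bO_pull icp (ka0 k)).
- by move=> c; apply: (ibPP (F := fun i j w => schouten G (Y w) i j) c one0) => i j; exact: (bK (hsc 0%N i j)).
- by move=> k; exact: (bO_P1 (fun w => ip1 w)).
- by move=> *; exact: ibP.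
- by move=> k l; exact: (bK (hgi 0%N k l)).
- by move=> k l; exact: (bO_b1 (fun w => ip1 w)).
- by move=> l c; apply: (ibPP (F := fun i j w => christoffel G l i j (Y w)) c one0) => i j; exact: (bK (hch 0%N l i j)).
- by move=> c k; apply: (ibPP (F := fun i j w => pd k (fun y => G y i j) (Y w)) c one0) => i j; exact: (bK (hCk_pd k (hG0 1%N i j))).
- by move=> c k; apply: (ibPP (F := fun i j w => pd k (fun y => schouten G y i j) (Y w)) c one0) => i j; exact: (bK (hCk_pd k (hsc 1%N i j))).
- by move=> *; exact: ibdg.
- move=> k l c; apply: (bO_eq (f := fun w => \sum_i \sum_j iQ w c i * iQ w c j *
    pd j (pd i (fun y => ginv G y k l)) (Y w))) => [w|].
    by apply: eq_bigr => i _; apply: eq_bigr => j _; rewrite !mxE.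
  apply: (ibPP (F := fun i j w => pd j (pd i (fun y => ginv G y k l)) (Y w)) c one0) => i j; exact: (bK (hCk_pd j (hCk_pd i (hgi 2%N k l)))).
- by move=> l c k; apply: (ibPP (F := fun i j w => pd k (christoffel G l i j) (Y w)) c one0) => i j; exact: (bK (hCk_pd k (hch 1%N l i j))).
- by move=> *; exact: iXV.
- by move=> *; exact: iVE.
- by move=> w; exact: ieuler.
- by move=> *; exact: ipde.
Qed.

End InteriorFamily.

End Sigma.

(** * Boundary maxima *)

Section BoundaryFamily.
Hypothesis Xbd : forall u x, S u -> W x -> x 0 ord0 = 0 -> \sum_k ginv G x ord0 k * Xk u k x = 0.

(** The gradient of the coordinate [x_0]: a positive multiple of the inward normal, free of square
    roots. *)
Definition conormal x : V := \row_j ginv G x ord0 j.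

(** The cut-off belongs to the configuration: the resulting constant must not depend on it, because
    the radius of the cut-off is chosen afterwards from that constant. *)
Record bconf := BConf { bcp : pt; bsg : V -> R; bcC : Ck H W 1 bsg;
  bc0 : px bcp 0 ord0 = 0; bcs : 0 < bsg (px bcp); bc1 : 1 <= wt (pu bcp) (px bcp);
  bcmax : \forall t \near (0 : R)^'+,
    test bsg (pu bcp) (px bcp) (px bcp + t *: conormal (px bcp)) <= 0 }.
Notation U w := (pu (bcp w)).
Notation Y w := (px (bcp w)).
Notation one := (fun _ : bconf => 1 : R).
Implicit Types (w : bconf) (i j k l c : 'I_n).

Let Yw w : W (Y w). Proof. exact: KW (sample_x (bcp w)). Qed.
Let Sw w : S (U w). Proof. exact: sample_u (bcp w). Qed.
Let pK w : K (Y w). Proof. exact: sample_x (bcp w). Qed.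
Let hu2 w : Ck H W 2 (U w). Proof. exact: hCk_le (isT : 2 <= 3)%N (S3 (Sw w)). Qed.

Lemma conormal_ge0 x : W x -> 0 <= conormal x 0 ord0.
Proof.
move=> Wx; rewrite mxE; have [Q [l hQ]] := frame_exists (G_sym Wx) (G_sym Wx) (G_pos Wx).
exact: le_trans (sqr_ge0 _) (frame_entry hQ ord0 ord0).
Qed.

Lemma boundary_max w :
  wt1 (U w) (Y w) (conormal (Y w)) +
    2 * ((\sum_j ginv G (Y w) ord0 j * pd j (bsg w) (Y w)) / bsg w (Y w)) * wt (U w) (Y w) <=
  wt (U w) (Y w) * qq (U w (Y w)) * \sum_j ginv G (Y w) ord0 j * pd j (U w) (Y w).
Proof.
have pF := punctured_filter_right R; set v := conormal (Y w); set y := Y w; set u := U w.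
have yw : W y := Yw w; have v0 : 0 <= v 0 ord0 := conormal_ge0 yw.
have s0 : 0 < bsg w y := bcs w.
have /andP[t1 _] := thC (Sw w) yw; have t0 : 0 < th (u y) by apply: lt_le_trans t1.
have vE h : \sum_j v 0 j * pd j h y = \sum_j ginv G y ord0 j * pd j h y.
  by apply: eq_bigr => j _; rewrite mxE.
have jet h : Ck H W 1 h -> jet1 0^'+ (fun t => h (y + t *: v)) (h y) (\sum_i v 0 i * pd i h y).
  by move=> hh; exact: (line_jet1_right HW hh yw v0).
have jg k l : jet1 0^'+ (fun t => ginv G (y + t *: v) k l) (ginv G y k l) (dgv y v k l).
  exact: (jet _ (Ck_ginv HW G_smooth G_sym G_pos 1 k l)).
have jX k : jet1 0^'+ (fun t => Xk u k (y + t *: v)) (Xk u k y) (X1v u y v k).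
  have := jet1B (jet _ (hCk_pd k (hu2 w))) (jet _ (hCk_le (isT : 1 <= 2)%N (beC k (Sw w)))).
  by rewrite -sumrB /X1v; under eq_bigr => j _ do rewrite -mulrBr.
have jw : jet1 0^'+ (fun t => wt u (y + t *: v)) (wt u y) (wt1 u y v).
  by apply: jet1_sum => // k _; apply: jet1_sum => // l _; exact: (jet1M (jet1M (jg k l) (jX k)) (jX l)).
have js := jet _ (bcC w).
have ju := jet _ (hCk_le (isT : 1 <= 2)%N (hu2 w)).
have := jet1_test N A (b + 1) (bsg w y ^+ 2 * wt u y / th (u y)) js jw ju.
rewrite -/(th (u y)) -/(th1 (u y)) divfK ?gt_eqF // subrr => h.
have := jet1_right_le h (bcmax w); rewrite !vE.
exact: boundary_first.
Qed.

Lemma boundary_estimate : exists2 C, 0 < C & forall w,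
  (\sum_j ginv G (Y w) ord0 j * pd j (bsg w) (Y w)) / bsg w (Y w) <= C.
Proof.
pose g k l w := ginv G (Y w) k l.
pose X k w := Xk (U w) k (Y w); pose u1 k w := pd k (U w) (Y w).
pose u2 k l w := pd l (pd k (U w)) (Y w); pose b1 k l w := pd l (be (U w) k) (Y w).
pose dg k l j w := pd j (fun y => ginv G y k l) (Y w).
have u2C k l w : u2 k l w = u2 l k w by exact: (pd_young HW).
have W1E j w : W1 X g u2 b1 dg j w = wt1 (U w) (Y w) (delta_mx 0 j).
  by apply: eq_bigr => k _; apply: eq_bigr => l _; rewrite /dgv /X1v !sum_delta.
apply: (@boundary_bound R bconf n ord0 (sp bcp) (fun w => qq (U w (Y w)))
  (fun w => (\sum_j ginv G (Y w) ord0 j * pd j (bsg w) (Y w)) / bsg w (Y w))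
  u1 (fun k w => be (U w) k (Y w)) X g u2 b1 dg) => //.
- exact: (sp_ge1 (fun w => bc1 w)).
- exact: (bO_q bcp).
- by move=> k; exact: (bO_pull bcp (be0 k)).
- by move=> k; exact: (bO_X bcp).
- by move=> k l; exact: (bO_ginv HW G_smooth G_sym G_pos K_compact KW pK).
- by move=> k l; exact: (bO_b1 (fun w => bc1 w)).
- move=> k l j; apply: (bO_K K_compact KW pK (h := pd j (fun y => ginv G y k l))).
  exact: (hCk_pd j (Ck_ginv HW G_smooth G_sym G_pos 1 k l)).
- by move=> k l w; exact: (ginvC G_sym).
- by move=> k w; rewrite /u1 /X /Xk subrK.
- by move=> w; apply: Xbd => //; exact: bc0.
- move=> l w l0.
  have hg j := Ck_ginv HW G_smooth G_sym G_pos 1 ord0 j.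
  have hX j := hCk_le (isT : 1 <= 2)%N (XkC j (Sw w)).
  have hM j := hCkM HW (hg j) (hX j).
  (* In a tangential direction [l] the line stays in [x_0 = 0], where the conormal component of [X]
     vanishes identically; so does its derivative. *)
  transitivity (pd l (fun y => \sum_j ginv G y ord0 j * Xk (U w) j y) (Y w)).
    rewrite (pd_sum HW _ _ l hM (Yw w)); apply: eq_bigr => j _.
    rewrite (pdM HW l (hg j) (hX j) (Yw w)); congr (_ + _ * _).
    by rewrite (pdB HW l (hCk_pd j (hu2 w)) (hCk_le (isT : 1 <= 2)%N (beC j (Sw w))) (Yw w)).
  apply: (pd_eq HW) => //; rewrite (Xbd (Sw w) (Yw w) (bc0 w)).
  have pF := hdir_punctured HW l (Yw w).
  apply: (jet1_near _ (jet1_cst pF 0)).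
  have HW' : relopen (orthant (pred1 (ord0 : 'I_n))) W by rewrite -half_orthant.
  have := dir_relopen l HW' (Yw w); rewrite -half_orthant; apply: filterS => t Wt.
  by rewrite (Xbd (Sw w) Wt) // !mxE (bc0 w) eqxx eq_sym (negbTE l0) mulr0 addr0.
- move=> w; rewrite (sp2 (fun w => bc1 w)); have := boundary_max w.
  rewrite wt1_lin; under eq_bigr => j _ do rewrite -W1E.
  suff -> : \sum_j conormal (Y w) 0 j * W1 X g u2 b1 dg j w = \sum_j g ord0 j w * W1 X g u2 b1 dg j w by [].
  by apply: eq_bigr => j _; rewrite mxE.
Qed.

End BoundaryFamily.

Lemma hCkX k q h : Ck H W q h -> Ck H W q (fun x => h x ^+ k).
Proof.
move=> hh; elim: k => [|k IH]; first exact: (hCk_cst HW).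
by apply: (hCk_ext HW (fun x _ => esym (exprS _ _))); exact: (hCkM HW).
Qed.

Lemma wtC u : S u -> Ck H W 2 (wt u).
Proof.
move=> Su; apply: (hCk_sum HW) => k; apply: (hCk_sum HW) => l.
apply: (hCkM HW); last exact: XkC.
by apply: (hCkM HW); [exact: (Ck_ginv HW) | exact: XkC].
Qed.

Lemma wt_ge0 u x : W x -> 0 <= wt u x.
Proof.
move=> Wx; have [Q [l hQ]] := frame_exists (G_sym Wx) (G_sym Wx) (G_pos Wx).
exact: (invmx_quad_ge0 hQ).
Qed.

(** * From the maximum to a bound at every point *)

Section MaxArgument.
Variable sg : V -> R.
Hypotheses (sg_cont : continuous sg) (sgC : Ck H W 2 sg)
  (sgK : forall x, H x -> 0 <= sg x -> K x).
Hypothesis no_bd_max : forall u y, S u -> K y -> y 0 ord0 = 0 -> 0 < sg y -> 1 <= wt u y ->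
  (\forall t \near (0 : R)^'+, test sg u y (y + t *: conormal y) <= 0) -> False.

Definition sgset := [set x | H x /\ 0 <= sg x].

Lemma sgset_sub : sgset `<=` K.
Proof. by move=> x [Hx sx]; exact: sgK. Qed.

Lemma sgset_compact : compact sgset.
Proof.
apply: (subclosed_compact _ K_compact sgset_sub).
apply: closedI.
  have := @closed_comp V R (fun x => x 0 ord0) [set y : R | 0 <= y].
  by apply; [move=> x _; exact: coord_continuous | exact: closed_ge].
have := @closed_comp V R sg [set y : R | 0 <= y].
by apply; [move=> x _; exact: sg_cont | exact: closed_ge].
Qed.

Lemma ratio_cont u : S u -> {within sgset, continuous (fun x => sg x ^+ 2 * wt u x / th (u x))}.
Proof.
move=> Su; have sub : sgset `<=` W by move=> x /sgset_sub /KW.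
have h2 k h : (k <= 2)%N -> Ck H W 2 h -> Ck H W k h by move=> hk; exact: hCk_le.
have hth : Ck H W 0 (fun x => th (u x)).
  apply: (hCkB HW); first exact: (hCk_cst HW).
  apply: hCkX; apply: (hCkB HW); first exact: (hCk_cst HW).
  exact: (hCk_le (isT : 0 <= 3)%N (S3 Su)).
suff [h _] : Ck H W 0 (fun x => sg x ^+ 2 * wt u x / th (u x)) by exact: continuous_subspaceW h.
apply: (hCkM HW (f := fun x => sg x ^+ 2 * wt u x)).
  by apply: (hCkM HW); [apply: hCkX; exact: h2 | apply: h2 => //; exact: wtC].
apply: (hCkV HW) => // x Wx; have /andP[h1 _] := thC Su Wx.
by rewrite gt_eqF // (lt_le_trans _ h1).
Qed.

(** By continuity the cut-off stays positive near [y], so the approaching points lie in the set over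
    which the quotient was maximized; clearing the denominator gives the sign of [test]. *)
Lemma test_near u y (F : set_system R) (z : R -> V) : Filter F -> S u -> K y -> 0 < sg y ->
  (forall x, sgset x -> sg x ^+ 2 * wt u x / th (u x) <= sg y ^+ 2 * wt u y / th (u y)) ->
  (\forall t \near F, H (z t)) -> z @ F --> y ->
  \forall t \near F, test sg u y (z t) <= 0.
Proof.
move=> FF Su Ky sy hmax hz zy.
have : \forall t \near F, 0 < sg (z t).
  have h : (fun t => sg (z t)) @ F --> sg y by apply: continuous_cvg => //; exact: sg_cont.
  have /cvgrPdist_lt/(_ _ sy) := h; apply: filterS => t; rewrite ltr_norml => /andP[_].
  by rewrite ltrBlDr ltrDl.
move=> hs; near=> t; have st : 0 < sg (z t) by near: t.
have Hz : H (z t) by near: t.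
have gz : sgset (z t) by split=> //; exact: ltW.
have /andP[t1 _] := thC Su (KW (sgset_sub gz)).
have t0 : 0 < th (u (z t)) by apply: lt_le_trans t1.
have := hmax _ gz; rewrite ler_pdivrMr // /test -/(th (u (z t))) subr_le0.
by [].
Unshelve. all: by end_near. Qed.

(** At the maximum point either [|X| < 1], or the cut-off vanishes, or the point is interior and
    [interior_estimate] applies; the remaining boundary points are excluded by assumption. The three
    terms of the bound cover these cases. *)
Lemma max_argument : exists2 C, 0 < C & forall u x, S u -> H x -> 0 <= sg x ->
  sg x ^+ 2 * wt u x <= C.
Proof.
have [C C0 hC] := interior_estimate sgC.
have [Cs hCs] := hCk_bounded (hCk_le (isT : 0 <= 2)%N sgC) K_compact KW.
pose B := (C ^+ 2 + Cs ^+ 2 + 1) * `|A|; exists (B + 1); first by rewrite ltr_wpDl // mulr_ge0 // !addr_ge0 ?sqr_ge0.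
move=> u x Su Hx sx; have gx : sgset x by [].
have [y] := EVT_max_rV (ex_intro _ x gx) sgset_compact (ratio_cont Su).
rewrite inE => gy hmax'; have hmax z : sgset z -> sg z ^+ 2 * wt u z / th (u z) <= sg y ^+ 2 * wt u y / th (u y).
  by move=> gz; apply: hmax'; rewrite inE.
have [Ky Kx] : K y /\ K x by split; exact: sgset_sub.
have [Wy Wx] := (KW Ky, KW Kx).
have /andP[ty1 tyA] := thC Su Wy; have /andP[tx1 txA] := thC Su Wx.
have ty0 : 0 < th (u y) by apply: lt_le_trans ty1.
have tx0 : 0 < th (u x) by apply: lt_le_trans tx1.
(* From the maximum point [y] to [x] the loss is only a factor [A], because [th] lies between 1 and
   [A] along solutions. *)
suff hy : sg y ^+ 2 * wt u y <= C ^+ 2 + Cs ^+ 2 + 1.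
  have := hmax x gx; rewrite ler_pdivrMr // => /le_trans; apply.
  apply: le_trans (_ : B <= _); last by rewrite lerDl.
  apply: ler_pM => //; last 1 first.
  - by apply: le_trans txA _; exact: ler_norm.
  - by apply: divr_ge0; [apply: mulr_ge0; [exact: sqr_ge0 | exact: wt_ge0] | exact: ltW].
  - exact: ltW.
  apply: le_trans hy; rewrite ler_pdivrMr // ler_peMr // mulr_ge0 ?sqr_ge0 ?wt_ge0 //.
have sy2 : sg y ^+ 2 <= Cs ^+ 2.
  have := hCs y Ky => h; have h0 : 0 <= Cs by apply: le_trans h.
  by rewrite -[sg y ^+ 2]ger0_norm ?sqr_ge0 // normrX lerXn2r ?nnegrE.
have C2 : 0 <= C ^+ 2 := sqr_ge0 C.
have [w1|w1] := ltP (wt u y) 1.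
  have : sg y ^+ 2 * wt u y <= Cs ^+ 2 * 1 by rewrite ler_pM ?sqr_ge0 ?wt_ge0 // ltW.
  by rewrite mulr1 => h; apply: (le_trans h); rewrite -addrA addrCA lerDl addr_ge0.
have [sy0|sy0] : sg y = 0 \/ 0 < sg y.
  by case: gy => _; rewrite le_eqVlt => /orP[/eqP <-|]; [left | right].
  by rewrite sy0 expr2 !mul0r !addr_ge0 ?sqr_ge0.
have pF := punctured_filter_dnbhs R; have pF' := punctured_filter_right R.
have cv (F : set_system R) (v : V) : punctured_filter F -> (fun t => y + t *: v) @ F --> y.
  move=> pF1; have FF : Filter F by exact: filter_filter.
  have h := path_close (z := fun t => y + t *: v) pF1 (fun i => line_coord y v pF1 i).
  by apply/cvgrPdist_lt => e e0; apply: filterS (h e e0) => t; rewrite distrC.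
have [y0|y0] : y 0 ord0 = 0 \/ 0 < y 0 ord0.
  by case: gy; rewrite /half_space /= le_eqVlt => /orP[/eqP <-|]; [left | right].
  exfalso; apply: (no_bd_max Su Ky y0 sy0 w1); apply: test_near => //; last exact: cv.
  near=> t; rewrite /half_space /= !mxE addr_ge0 ?y0 // mulr_ge0 //.
  by have := conormal_ge0 Wy; rewrite mxE.
have [l0 [Q hQ]] := eigvals_frame HW G_smooth G_sym G_pos (hCk_le (isT : 2 <= 3)%N (S3 Su)) Wy
  (Gam_ub (Spde Su Wy).1).
have ipm v : \forall t \near (0 : R)^', test sg u y (y + t *: v) <= 0.
  by apply: test_near => //; [exact: (interior_near v Wy y0) | exact: cv].
have := hC (@IConf sg (Sample Su Ky) Q y0 sy0 w1 hQ ipm); rewrite /sp /= => h.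
have : (Num.sqrt (wt u y) * sg y) ^+ 2 <= C ^+ 2.
  by rewrite lerXn2r ?nnegrE ?mulr_ge0 ?sqrtr_ge0 // ltW.
rewrite exprMn sqr_sqrtr ?wt_ge0 // mulrC => h'; apply: (le_trans h').
by rewrite -addrA lerDl addr_ge0 // sqr_ge0.
Unshelve. all: by end_near. Qed.

Lemma gradient_where_sg s0 : 0 < s0 -> exists C, forall u x k, S u -> H x -> s0 <= sg x ->
  `|pd k u x| <= C.
Proof.
move=> s00; have [C C0 hC] := max_argument.
have [D D0 hD] := coord_bound HW G_smooth G_sym G_pos K_compact KW.
have hb k : exists2 B, 0 <= B & forall u x, S u -> K x -> `|be u k x| <= B.
  have [B B0 hB] := be0 k; exists B => // u x Su Kx.
  by have [_] := hB (Sample Su Kx); rewrite mulr1.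
exists (D * Num.sqrt (C / s0 ^+ 2) + \sum_k projT1 (cid2 (hb k))).
move=> u x k Su Hx sx; have sx0 : 0 <= sg x by apply: le_trans sx; exact: ltW.
have Kx : K x by exact: sgK.
have -> : pd k u x = Xk u k x + be u k x by rewrite /Xk subrK.
apply: le_trans (ler_normD _ _) _; apply: lerD.
  apply: le_trans (hD x (fun k => Xk u k x) k Kx) _; rewrite ler_pM2l // ler_wsqrtr //.
  rewrite ler_pdivlMr ?exprn_gt0 //; apply: le_trans (hC u x Su Hx sx0).
  rewrite mulrC ler_wpM2r ?wt_ge0 //; first exact: KW.
  by rewrite lerXn2r ?nnegrE // ltW.
apply: le_trans (_ : projT1 (cid2 (hb k)) <= _).
  by case: (cid2 (hb k)) => B B0 hB; exact: hB.
by rewrite (bigD1 k) //= lerDl sumr_ge0 // => i _; case: cid2.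
Qed.

End MaxArgument.

(** The cut-off without tilt: [K] does not meet the boundary, so boundary maxima cannot occur. *)
Lemma interior_gradient (xs : V) (r : R) : 0 < r ->
  (forall x, H x -> (forall i, `|x 0 i - xs 0 i| <= r) -> K x) ->
  (forall x, K x -> 0 < x 0 ord0) ->
  exists C, forall u x k, S u -> H x -> `|x - xs| <= r / (2 * n%:R) -> `|pd k u x| <= C.
Proof.
move=> r0 hK K0.
have hsg x : H x -> 0 <= cutoff xs r 0 x -> K x.
  move=> Hx hx; apply: hK => // i; have := cutoff_box (ltW r0) (lexx 0) hx i.
  by rewrite addr0.
have [u y _ Ky y0|C hC] := gradient_where_sg (cutoff_cont (xs := xs) (r := r) (L := 0))
  (cutoff_Ck HW xs r 0 2) hsg _ (divr_gt0 (exprn_gt0 2 r0) (ltr0n R 2)).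
  by have := K0 y Ky; rewrite y0 ltxx.
exists C => u x k Su Hx hx; apply: hC => //.
by apply: cutoff_near => //; rewrite mul0r.
Qed.

(** The constants are chosen in the order [CB], the slope ratio [La], the radius [r]: neither [CB]
    nor [La] depends on [r], so [r] can be shrunk last. *)
Lemma boundary_gradient (xs : V) (rho : R) : 0 < rho -> xs 0 ord0 = 0 ->
  (forall x, H x -> (forall i, `|x 0 i - xs 0 i| <= rho) -> K x) ->
  (forall u x, S u -> W x -> x 0 ord0 = 0 -> \sum_k ginv G x ord0 k * Xk u k x = 0) ->
  exists2 d, 0 < d & exists C, forall u x k, S u -> H x -> `|x - xs| <= d -> `|pd k u x| <= C.
Proof.
move=> rho0 xs0 hK Xbd.
have [CB CB0 hCB] := boundary_estimate Xbd.
have [D D0 hD] := coord_bound HW G_smooth G_sym G_pos K_compact KW.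
(* Testing [coord_bound] on the differential of [x_0], whose squared length is [g^00], bounds [g^00]
   from below by [g0]. *)
pose g0 := D ^- 2; have g00 : 0 < g0 by rewrite invr_gt0 exprn_gt0.
have hg0 x : K x -> g0 <= ginv G x ord0 ord0.
  move=> Kx; have := hD x (fun i => (i == ord0)%:R) ord0 Kx.
  have -> : \sum_i \sum_j ginv G x i j * (i == ord0)%:R * (j == ord0)%:R = ginv G x ord0 ord0.
    rewrite (bigD1 ord0) //= [X in _ + X]big1 ?addr0 => [|i i0]; last first.
      by rewrite big1 // => j _; rewrite (negbTE i0) mulr0 mul0r.
    rewrite (bigD1 ord0) //= big1 ?addr0 => [|j j0]; first by rewrite !mulr1.
    by rewrite (negbTE j0) mulr0.
  rewrite eqxx normr1 => h1; have gg : 0 <= ginv G x ord0 ord0.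
    by have := conormal_ge0 (KW Kx); rewrite mxE.
  have : 1 ^+ 2 <= (D * Num.sqrt (ginv G x ord0 ord0)) ^+ 2.
    by rewrite lerXn2r // nnegrE // mulr_ge0 ?sqrtr_ge0 // ltW.
  by rewrite exprMn sqr_sqrtr // expr1n -ler_pdivrMl ?exprn_gt0 // mulr1.
have hB j : exists2 B, 0 <= B & forall x, K x -> `|ginv G x ord0 j| <= B.
  have [B hB] := hCk_bounded (Ck_ginv HW G_smooth G_sym G_pos 0 ord0 j) K_compact KW.
  exists `|B| => // x Kx; exact: le_trans (hB x Kx) (ler_norm _).
pose Cg := \sum_j projT1 (cid2 (hB j)).
have Cg0 : 0 <= Cg by apply: sumr_ge0 => j _; case: cid2.
have hCg x : K x -> \sum_j `|ginv G x ord0 j| <= Cg.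
  by move=> Kx; apply: ler_sum => j _; case: (cid2 (hB j)) => B B0 h; exact: h.
(* On the boundary the quadratic part of the cut-off has conormal derivative at least
   [- 2 * Cg * r]. With this ratio the tilt contributes at least [r + 2 * Cg * r], leaving [r]. *)
pose La := (1 + 2 * Cg) / g0; have La0 : 0 < La by rewrite divr_gt0 // ltr_pwDl // mulr_ge0.
(* The first bound keeps the support of the cut-off, a box of half-width at most [r + L], inside
   [K]; the second gives [CB * r ^+ 2 < r]. *)
pose r := Num.min (rho / (1 + La)) (CB + 1)^-1.
have CB1 : 0 < CB + 1 by rewrite addr_gt0.
have r0 : 0 < r by rewrite lt_min divr_gt0 ?addr_gt0 // invr_gt0.
pose L := La * r; have L0 : 0 <= L by rewrite mulr_ge0 // ltW.
pose sg := cutoff xs r L.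
have hsg x : H x -> 0 <= sg x -> K x.
  move=> Hx hx; apply: hK => // i; apply: le_trans (cutoff_box (ltW r0) L0 hx i) _.
  have -> : r + L = r * (1 + La) by rewrite /L; ring.
  by rewrite -ler_pdivlMr ?addr_gt0 // ge_min lexx.
(* On the boundary the tilt vanishes, so the cut-off is at most [r ^+ 2] while its conormal
   derivative is at least [r]; the quotient would exceed [CB]. *)
have nb u y : S u -> K y -> y 0 ord0 = 0 -> 0 < sg y -> 1 <= wt u y ->
    (\forall t \near (0 : R)^'+, test sg u y (y + t *: conormal y) <= 0) -> False.
  move=> Su Ky y0 sy w1 hmax.
  have sgC := cutoff_Ck HW xs r L 1.
  have := hCB (@BConf (Sample Su Ky) sg sgC y0 sy w1 hmax); rewrite /=.
  under eq_bigr => j _ do rewrite (pd_cutoff HW xs r L j (KW Ky)).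
  have d2 j : `|y 0 j - xs 0 j| <= r.
    have hs : 0 < r ^+ 2 - \sum_i (y 0 i - xs 0 i) ^+ 2.
      by move: sy; rewrite /sg /cutoff y0 xs0 subrr mulr0 addr0.
    rewrite -ler_sqr ?nnegrE ?(ltW r0) // real_normK ?num_real //.
    move: hs; rewrite subr_gt0 => /ltW; apply: le_trans.
    by rewrite (bigD1 j) //= lerDl sumr_ge0 // => i _; exact: sqr_ge0.
  have sr : sg y <= r ^+ 2.
    rewrite /sg /cutoff y0 xs0 subrr mulr0 addr0 lerBlDr lerDl sumr_ge0 // => i _.
    exact: sqr_ge0.
  have hsum : r <= \sum_j ginv G y ord0 j * (- 2 * (y 0 j - xs 0 j) + L * (j == ord0)%:R).
    have -> : \sum_j ginv G y ord0 j * (- 2 * (y 0 j - xs 0 j) + L * (j == ord0)%:R) =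
       L * ginv G y ord0 ord0 - 2 * \sum_j ginv G y ord0 j * (y 0 j - xs 0 j).
      have e1 : \sum_j ginv G y ord0 j * (j == ord0)%:R = ginv G y ord0 ord0.
        rewrite (bigD1 ord0) //= big1 ?addr0 => [|j j0]; first by rewrite mulr1.
        by rewrite (negbTE j0) mulr0.
      rewrite -e1 !mulr_sumr -sumrB; apply: eq_bigr => j _; ring.
    have h1 : \sum_j ginv G y ord0 j * (y 0 j - xs 0 j) <= Cg * r.
      apply: le_trans (_ : (\sum_j `|ginv G y ord0 j|) * r <= _); last first.
        by rewrite ler_wpM2r ?hCg // ltW.
      rewrite mulr_suml; apply: ler_sum => j _; apply: le_trans (ler_norm _) _.
      by rewrite normrM ler_wpM2l.
    have h2 : L * g0 <= L * ginv G y ord0 ord0 by rewrite ler_wpM2l // hg0.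
    have e2 : L * g0 = r + 2 * (Cg * r) by rewrite /L /La; field; rewrite gt_eqF.
    exact: cutoff_slope h1 h2 e2.
  rewrite leNgt => /negP; apply; rewrite ltr_pdivlMr //.
  apply: lt_le_trans hsum.
  have rC : r * (CB + 1) <= 1 by rewrite -ler_pdivlMr // div1r ge_min lexx orbT.
  apply: le_lt_trans (_ : CB * r ^+ 2 < r); first by rewrite ler_wpM2l // ltW.
  exact: small_radius.
have [C hC] := gradient_where_sg (cutoff_cont (xs := xs) (r := r) (L := L))
  (cutoff_Ck HW xs r L 2) hsg nb (divr_gt0 (exprn_gt0 2 r0) (ltr0n R 2)).
exists (r / (2 * n%:R)); first by rewrite divr_gt0 // mulr_gt0 // ltr0n.
exists C => u x k Su Hx hx; apply: hC => //.
by apply: cutoff_near => //; rewrite xs0 subr0 mulr_ge0.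
Qed.

End LocalEstimate.

Lemma bOMl (R : realType) (Om : Type) (f1 f2 g : Om -> R) : bO f1 (fun=> 1) -> bO f2 g ->
  bO (fun w => f1 w * f2 w) g.
Proof. by move=> h1 h2; apply: (bO_le (C := 1) _ (bOM h1 h2)) => // w; rewrite mul1r. Qed.

(** * Functions of the point and of the value of the solution *)

Section Composite.
Variables (R : realType) (m q : nat) (W : set 'rV[R]_m.+1).
Notation n := (m.+1).
Notation V := 'rV[R]_m.+1.
Notation H := (@half_space R m).
Hypothesis HW : relopen H W.
Variables (s : 'I_q -> 'I_n) (T : pred 'I_(q + 1)) (W2 : set 'rV[R]_(q + 1)).
Hypothesis HW2 : relopen (orthant T) W2.
Implicit Types (x : V) (u : V -> R) (h : 'rV[R]_(q + 1) -> R).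

(** The selection [s] serves two cases. With the identity this is the argument of [psi]; with
    [lift ord0] it is the argument of [eta], which thereby extends off the boundary as a function
    constant along [x_0]. *)
Definition graph u x : 'rV[R]_(q + 1) := row_mx (\row_j x 0 (s j)) (const_mx (u x)).
Hypothesis graphW : forall u x, W x -> W2 (graph u x).

Definition on_graph h u x := h (graph u x).
Definition dlast h := partial (orthant T) (rshift q ord0) h.

Lemma graph_coord u x j : graph u x 0 j = match fintype.split j with inl i => x 0 (s i) | inr _ => u x end.
Proof. by rewrite -[j in LHS]fintype.splitK; case: (fintype.split j) => i; rewrite ?row_mxEl ?row_mxEr !mxE. Qed.

Lemma hCk_x k i : Ck H W k (fun x => x 0 i).
Proof. by move: HW; rewrite half_orthant => h; exact: Ck_coord. Qed.

Lemma Ck_graph k u j : Ck H W k u -> Ck H W k (fun x => graph u x 0 j).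
Proof.
move=> hu; apply: (hCk_ext HW (fun x _ => esym (graph_coord u x j))).
by case: (fintype.split j) => i //; exact: hCk_x.
Qed.

Lemma Ck_composite k h u : Ck (orthant T) W2 k h -> Ck H W k u -> Ck H W k (on_graph h u).
Proof.
move=> hh hu; have HW' : relopen (orthant (pred1 (ord0 : 'I_n))) W by rewrite -half_orthant.
rewrite half_orthant; apply: (Ck_comp HW' HW2) => //; first by move=> x; exact: graphW.
by rewrite -half_orthant => j; exact: Ck_graph.
Qed.

Lemma pd_composite h u i x : Ck (orthant T) W2 1 h -> Ck H W 1 u -> W x ->
  pd i (on_graph h u) x = \sum_j (s j == i)%:R * on_graph (partial (orthant T) (lshift 1 j) h) u x
    + pd i u x * on_graph (dlast h) u x.
Proof.
move=> hh hu Wx; have pF := hdir_punctured HW i Wx.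
apply: (pd_eq HW) => //.
pose v : 'rV[R]_(q + 1) := row_mx (\row_j (s j == i)%:R) (const_mx (pd i u x)).
have := @hasgrad_path R (q + 1) _ pF (orthant T) (fun t => graph u (x + t *: delta_mx 0 i))
  (graph u x) v _ _ h _ (Ck1_hasgrad HW2 hh (graphW u Wx)).
rewrite big_split_ord big_ord1 /=.
have -> : v 0 (rshift q ord0) = pd i u x by rewrite row_mxEr mxE.
under eq_bigr => j _ do rewrite row_mxEl mxE.
apply.
  have HW' : relopen (orthant (pred1 (ord0 : 'I_n))) W by rewrite -half_orthant.
  have := dir_relopen i HW' Wx; rewrite -half_orthant; apply: filterS => t Wt.
  exact: relopen_sub HW2 (graphW u Wt).
move=> j; rewrite -[j]fintype.splitK; case: (fintype.split j) => k /=.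
  rewrite !row_mxEl !mxE; have := line_coord x (delta_mx 0 i) pF (s k).
  by rewrite mxE eqxx /=; apply: jet1_eq => t; rewrite row_mxEl !mxE.
rewrite !row_mxEr !mxE; have := pd_dir HW i hu Wx.
by apply: jet1_eq => t; rewrite row_mxEr mxE.
Qed.

Variables (lo hi : 'I_n -> R) (a b : R) (S : set (V -> R)).
Let K := [set x : V | forall i, lo i <= x 0 i <= hi i].
Hypothesis KW : K `<=` W.
Hypothesis boxW2 : forall z : 'rV[R]_(q + 1),
  (forall j, lo (s j) <= z 0 (lshift 1 j) <= hi (s j)) -> W2 z.
Hypothesis Sab : forall u x, S u -> W x -> a <= u x <= b.
Hypothesis S2 : forall u, S u -> Ck H W 2 u.
Notation pt := (sample S K).

Let Sw (w : pt) : S (pu w). Proof. exact: sample_u. Qed.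
Let Ww (w : pt) : W (px w). Proof. exact: KW (sample_x w). Qed.
Let S1 u : S u -> Ck H W 1 u. Proof. by move=> /S2; exact: hCk_le. Qed.

(** Since [a <= u <= b], the graph of every solution over [K] lies in one compact box of the larger
    space, whose sides [lo2], [hi2] add the interval of values to those of [K]. *)
Lemma bO_composite0 h : Ck (orthant T) W2 0 h ->
  bO (fun w : pt => on_graph h (pu w) (px w)) (fun=> 1).
Proof.
move=> hh.
pose lo2 (j : 'I_(q + 1)) := match fintype.split j with inl i => lo (s i) | inr _ => a end.
pose hi2 (j : 'I_(q + 1)) := match fintype.split j with inl i => hi (s i) | inr _ => b end.
have hc := @box_compact R (q + 1) lo2 hi2.
have sub : [set z : 'rV[R]_(q + 1) | forall j, lo2 j <= z 0 j <= hi2 j] `<=` W2.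
  by move=> z hz; apply: boxW2 => j; have := hz (lshift 1 j); rewrite /lo2 /hi2 (unsplitK (inl j)).
have [C hC] := Ck_bounded hh hc sub.
exists `|C| => // w; split=> //; rewrite mulr1; apply: le_trans (ler_norm C).
apply: hC => j; rewrite graph_coord /lo2 /hi2; case: (fintype.split j) => i.
  exact: (sample_x w).
exact: (Sab (Sw w) (Ww w)).
Qed.

Lemma D1_ge0 u x : 0 <= D1 u x.
Proof. exact: sumr_ge0. Qed.

Let one_D (w : pt) : 1 <= 1 + D1 (pu w) (px w). Proof. by rewrite lerDl D1_ge0. Qed.
Let D0 (w : pt) : 0 <= 1 + D1 (pu w) (px w). Proof. exact: le_trans (one_D w). Qed.

Lemma bO_pd_D1 i : bO (fun w : pt => pd i (pu w) (px w)) (fun w => 1 + D1 (pu w) (px w)).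
Proof.
exists 1 => // w; rewrite mul1r; split; first exact: D0.
apply: le_trans (_ : D1 (pu w) (px w) <= _); last by rewrite lerDr.
by rewrite /D1 (bigD1 i) //= lerDl sumr_ge0.
Qed.

Lemma bO_one_D1 (g : pt -> R) : bO g (fun=> 1) -> bO g (fun w => 1 + D1 (pu w) (px w)).
Proof. by move=> hg; apply: (bO_le (C := 1) _ hg) => // w; rewrite mul1r. Qed.

Lemma bO_D1_sq (g : pt -> R) : bO g (fun w => 1 + D1 (pu w) (px w)) ->
  bO g (fun w => (1 + D1 (pu w) (px w)) ^+ 2).
Proof. by move=> hg; apply: (bO_le (C := 1) _ hg) => // w; rewrite mul1r expr2 ler_peMl. Qed.

Lemma bO_composite1 h i : Ck (orthant T) W2 1 h ->
  bO (fun w : pt => pd i (on_graph h (pu w)) (px w)) (fun w => 1 + D1 (pu w) (px w)).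
Proof.
move=> hh; apply: (bO_eq (f := fun w : pt =>
   \sum_j (s j == i)%:R * on_graph (partial (orthant T) (lshift 1 j) h) (pu w) (px w)
    + pd i (pu w) (px w) * on_graph (dlast h) (pu w) (px w))) => [w|].
  by rewrite (pd_composite i hh (S1 (Sw w)) (Ww w)).
apply: bODs.
  apply: bO_sum => // j; apply: bOZ; apply: bO_one_D1; apply: bO_composite0; exact: Ck_partial.
apply: (bO_eq (fun w => mulrC _ _)).
exact: (bOMl (bO_composite0 (Ck_partial _ hh)) (bO_pd_D1 i)).
Qed.

(** The chain rule produces a single term with second derivatives of [u], multiplied by the last
    partial of [h]; the rest is at most quadratic in first derivatives. *)
Lemma bO_composite2 h i k : Ck (orthant T) W2 2 h ->
  bO (fun w : pt => pd k (pd i (on_graph h (pu w))) (px w)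
     - on_graph (dlast h) (pu w) (px w) * pd k (pd i (pu w)) (px w))
    (fun w => (1 + D1 (pu w) (px w)) ^+ 2).
Proof.
move=> hh; have h1 := Ck_le (isT : 1 <= 2)%N hh.
apply: (bO_eq (f := fun w : pt =>
   \sum_j (s j == i)%:R * pd k (on_graph (partial (orthant T) (lshift 1 j) h) (pu w)) (px w)
    + pd i (pu w) (px w) * pd k (on_graph (dlast h) (pu w)) (px w))) => [w|]; last first.
  apply: bODs.
    apply: bO_sum => [w|j]; first exact: sqr_ge0.
    by apply: bOZ; apply: bO_D1_sq; apply: bO_composite1; exact: Ck_partial.
  apply: (bO_le (C := 1) _ (bOM (bO_pd_D1 i) (bO_composite1 k (Ck_partial _ hh)))) => // w.
  by rewrite mul1r expr2.
have hj j : Ck H W 1 (on_graph (partial (orthant T) (lshift 1 j) h) (pu w)).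
  by apply: Ck_composite; [exact: Ck_partial | exact: S1].
have hl : Ck H W 1 (on_graph (dlast h) (pu w)).
  by apply: Ck_composite; [exact: Ck_partial | exact: S1].
have hu := hCk_pd i (S2 (Sw w)).
have hj' j := hCkZ HW (s j == i)%:R (hj j).
rewrite (pd_ext HW k (Ww w) (fun y Wy => pd_composite i h1 (S1 (Sw w)) Wy)).
rewrite (pdD HW k (hCk_sum HW _ _ hj') (hCkM HW hu hl) (Ww w)).
rewrite (pd_sum HW _ _ k hj' (Ww w)) (pdM HW k hu hl (Ww w)).
have e (A B C D E : R) : A = B -> A + C = B + (D * E + C) - E * D by move=> ->; ring.
by apply: e; apply: eq_bigr => j _; rewrite (pdZ HW _ k (hj j) (Ww w)).
Qed.

Variables (phi kap : 'I_n -> V -> R).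
Hypotheses (K_compact : compact K) (phiC : forall k, Ck H W 2 (phi k)) (kapC : forall k, Ck H W 2 (kap k)).
Variable h : 'rV[R]_(q + 1) -> R.
Hypothesis hh : Ck (orthant T) W2 2 h.

(** The shape of [beta]: a fixed part plus a fixed covector times a function of the graph of [u].
    The corresponding factor of the Hessian is [grad_slope]. *)
Definition grad_shift u k x := phi k x + kap k x * on_graph h u x.
Definition grad_slope u k x := kap k x * on_graph (dlast h) u x.

Let pK (w : pt) : K (px w). Proof. exact: sample_x. Qed.
Let hh1 := Ck_le (isT : 1 <= 2)%N hh.
Let hh0 := Ck_le (isT : 0 <= 2)%N hh.
Let bK (g : V -> R) : Ck H W 0 g -> bO (fun w : pt => g (px w)) (fun=> 1).
Proof. exact: (bO_K K_compact KW pK). Qed.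
Let phi1 k := hCk_le (isT : 1 <= 2)%N (phiC k).
Let kap1 k := hCk_le (isT : 1 <= 2)%N (kapC k).

Lemma shiftC u k : S u -> Ck H W 2 (grad_shift u k).
Proof. by move=> Su; apply: (hCkD HW) => //; apply: (hCkM HW) => //; exact: Ck_composite (S2 Su). Qed.

Lemma bO_shift0 k : bO (fun w : pt => grad_shift (pu w) k (px w)) (fun=> 1).
Proof.
apply: bODs; first by apply: bK; exact: hCk_le (phiC k).
exact: (bOMl (bK (hCk_le (isT : 0 <= 2)%N (kapC k))) (bO_composite0 hh0)).
Qed.

Lemma bO_slope k : bO (fun w : pt => grad_slope (pu w) k (px w)) (fun=> 1).
Proof.
exact: (bOMl (bK (hCk_le (isT : 0 <= 2)%N (kapC k))) (bO_composite0 (Ck_partial _ hh1))).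
Qed.

Let pd_shift u k i x : S u -> W x -> pd i (grad_shift u k) x =
  pd i (phi k) x + (pd i (kap k) x * on_graph h u x + kap k x * pd i (on_graph h u) x).
Proof.
move=> Su Wx; have hc := Ck_composite hh1 (S1 Su).
by rewrite (pdD HW i (phi1 k) (hCkM HW (kap1 k) hc) Wx) (pdM HW i (kap1 k) hc Wx).
Qed.

Lemma bO_shift1 k i : bO (fun w : pt => pd i (grad_shift (pu w) k) (px w)) (fun w => 1 + D1 (pu w) (px w)).
Proof.
apply: (bO_eq (fun w => esym (pd_shift k i (Sw w) (Ww w)))).
apply: bODs; first by apply: bO_one_D1; apply: bK; exact: hCk_pd.
apply: bODs.
  apply: bO_one_D1; exact: (bOMl (bK (hCk_pd i (kap1 k))) (bO_composite0 hh0)).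
exact: (bOMl (bK (hCk_le (isT : 0 <= 2)%N (kapC k))) (bO_composite1 i hh1)).
Qed.

Lemma bO_shift2 k i j : bO (fun w : pt => pd j (pd i (grad_shift (pu w) k)) (px w)
    - grad_slope (pu w) k (px w) * pd j (pd i (pu w)) (px w))
  (fun w => (1 + D1 (pu w) (px w)) ^+ 2).
Proof.
apply: (bO_eq (f := fun w : pt => pd j (pd i (phi k)) (px w) +
  (pd j (pd i (kap k)) (px w) * on_graph h (pu w) (px w) + pd i (kap k) (px w) * pd j (on_graph h (pu w)) (px w)
   + pd j (kap k) (px w) * pd i (on_graph h (pu w)) (px w)
   + kap k (px w) * (pd j (pd i (on_graph h (pu w))) (px w)
     - on_graph (dlast h) (pu w) (px w) * pd j (pd i (pu w)) (px w))))) => [w|].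
  have hc2 := Ck_composite hh (S2 (Sw w)); have hc := hCk_le (isT : 1 <= 2)%N hc2.
  rewrite (pd_ext HW j (Ww w) (fun y Wy => pd_shift k i (Sw w) Wy)).
  have h1 := hCk_pd i (phiC k); have h2 := hCk_pd i (kapC k); have h3 := hCk_pd i hc2.
  have h4 := hCkM HW h2 hc; have h5 := hCkM HW (kap1 k) h3.
  rewrite (pdD HW j h1 (hCkD HW h4 h5) (Ww w)) (pdD HW j h4 h5 (Ww w)).
  rewrite (pdM HW j h2 hc (Ww w)) (pdM HW j (kap1 k) h3 (Ww w)) /grad_slope; ring.
have k0 := bK (hCk_le (isT : 0 <= 2)%N (kapC k)).
apply: bODs; first by apply: bO_D1_sq; apply: bO_one_D1; apply: bK; apply: hCk_pd; exact: hCk_pd.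
apply: bODs; first apply: bODs; first apply: bODs.
- apply: bO_D1_sq; apply: bO_one_D1.
  exact: (bOMl (bK (hCk_pd j (hCk_pd i (kapC k)))) (bO_composite0 hh0)).
- apply: bO_D1_sq; exact: (bOMl (bK (hCk_pd i (kap1 k))) (bO_composite1 j hh1)).
- apply: bO_D1_sq; exact: (bOMl (bK (hCk_pd j (kap1 k))) (bO_composite1 i hh1)).
- exact: (bOMl k0 (bO_composite2 i j hh)).
Qed.

End Composite.

Lemma half_space_cylinder (R : realType) (m : nat) :
  [set z : 'rV[R]_(m.+1 + 1) | half_space (lsubmx z)] = orthant (pred1 (lshift 1 ord0)).
Proof.
apply/seteqP; split=> z /=; rewrite /half_space /= mxE; first by move=> h i /eqP ->.
by apply; rewrite /= eqxx.
Qed.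

Lemma lsubmx_dist (R : realType) (q r : nat) (y z : 'rV[R]_(q + r)) :
  `|lsubmx y - lsubmx z| <= `|y - z|.
Proof.
apply: rV_norm_le => // i; rewrite !mxE.
by have := ler_norm_coord (y - z) (lshift r i); rewrite !mxE.
Qed.

Lemma relopen_cylinder (R : realType) (m : nat) (W : set 'rV[R]_m.+1) : relopen half_space W ->
  relopen (orthant (pred1 (lshift 1 (ord0 : 'I_m.+1)))) [set z : 'rV[R]_(m.+1 + 1) | W (lsubmx z)].
Proof.
move=> HW z /HW[Hz [d d0 hd]]; rewrite -half_space_cylinder; split=> //.
exists d => // y Hy yz; apply: hd => //; exact: le_lt_trans (lsubmx_dist _ _) yz.
Qed.

Lemma bdry_emb_coord (R : realType) (m : nat) (y : 'rV[R]_m) (i : 'I_m) :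
  bdry_emb y 0 (lift ord0 i) = y 0 i.
Proof.
have e : (lift ord0 i : 'I_m.+1) = (rshift 1 i : 'I_m.+1) by apply: val_inj.
by rewrite e; exact: (row_mxEr (0 : 'rV[R]_1) y 0 i).
Qed.

Lemma bdry_emb_coord0 (R : realType) (m : nat) (y : 'rV[R]_m) : bdry_emb y 0 ord0 = 0.
Proof.
have e : (ord0 : 'I_m.+1) = (lshift m (ord0 : 'I_1) : 'I_m.+1) by apply: val_inj.
by rewrite e; exact: (etrans (row_mxEl (0 : 'rV[R]_1) y 0 ord0) (mxE _ _ _ _)).
Qed.

Lemma bdry_emb_half (R : realType) (m : nat) (y : 'rV[R]_m) : half_space (bdry_emb y).
Proof. by rewrite /half_space /= bdry_emb_coord0. Qed.

Lemma rowB (R : realType) (q : nat) (y z : 'rV[R]_q) i : (y - z) 0 i = y 0 i - z 0 i.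
Proof. by rewrite !mxE. Qed.

Lemma relopen_bdry (R : realType) (m : nat) (W : set 'rV[R]_m.+1) : relopen half_space W ->
  relopen (orthant pred0) [set z : 'rV[R]_(m + 1) | W (bdry_emb (lsubmx z))].
Proof.
move=> HW z /HW[Hz [d d0 hd]]; split=> //; exists d => // y _ yz; apply: hd.
  exact: bdry_emb_half.
apply: le_lt_trans yz; apply: rV_norm_le => // i; rewrite rowB.
case: (unliftP ord0 i) => [j ->|->]; last by rewrite !bdry_emb_coord0 subrr normr0.
rewrite !bdry_emb_coord.
by have := ler_norm_coord (y - z) (lshift 1 j); rewrite !mxE.
Qed.

(** * The estimate in one chart *)

Section ChartEstimate.
Variables (R : realType) (m : nat).
Notation n := (m.+1).
Notation V := 'rV[R]_m.+1.
Notation H := (@half_space R m).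
Variable G : V -> 'M[R]_n.
Variables (Gam : set V) (f : V -> R) (c0 : R).
Hypotheses (Gam_open : open Gam) (Gam_ub : Gam `<=` Gamma1).
Hypotheses (f_smooth : smooth setT Gam f) (f_sym : symmetric_fun (closure Gam) f)
  (f_hom : homogeneous1 Gam f) (f_mono : forall i lam, Gam lam -> 0 < partial setT i f lam)
  (c00 : 0 < c0) (f_sum : forall lam, Gam lam -> c0 <= \sum_i partial setT i f lam).
Variables (a b : R) (PsiF : 'rV[R]_(n + 1) -> R) (EtaF : 'rV[R]_(m + 1) -> R).
Implicit Types (x : V) (u : V -> R) (W : set V).

Definition is_metric W := [/\ forall k i j, Ck H W k (fun x => G x i j),
  forall x, W x -> (G x)^T = G x & forall x, W x -> posdef (G x)].

Definition psi_regular W :=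
  Ck (orthant (pred1 (lshift 1 ord0))) [set z : 'rV[R]_(n + 1) | W (lsubmx z)] 2 PsiF.

Definition eta_regular W :=
  Ck (orthant pred0) [set z : 'rV[R]_(m + 1) | W (bdry_emb (lsubmx z))] 2 EtaF.

Notation psi_at := (on_graph id PsiF).
Notation eta_at := (on_graph (lift ord0) EtaF).

Definition solution W u := [/\ Ck H W 3 u,
  forall x, W x -> a <= u x <= b,
  forall x, W x -> Gam (eigU G u x) /\ f (eigU G u x) = psi_at u x &
  forall x, W x -> x 0 ord0 = 0 -> normal_deriv G u x = eta_at u x - mean_curv G x].

Lemma ginv00_gt0 W x : is_metric W -> W x -> 0 < ginv G x ord0 ord0.
Proof.
move=> [Gs Gsym Gpos] Wx; have gu := G_unit Gsym Gpos Wx.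
pose e : V := delta_mx 0 ord0.
have gE k : (e *m ginv G x) 0 k = ginv G x ord0 k by rewrite -rowE mxE.
have : 0 < bil (G x) (e *m ginv G x) (e *m ginv G x).
  apply: Gpos => //; apply/negP => /eqP h.
  have : e *m ginv G x *m G x = 0 by rewrite h mul0mx.
  rewrite mulmxKV // => /matrixP/(_ 0 ord0); rewrite !mxE !eqxx => /eqP.
  by rewrite oner_eq0.
rewrite /bil mulmxKV // mxE (bigD1 ord0) //= big1 ?addr0.
  by rewrite [X in X * _]mxE !eqxx mul1r mxE gE.
by move=> i i0; rewrite [X in X * _]mxE (negbTE i0) andbF mul0r.
Qed.

(** The three conditions determine the unit inward normal, so the description by [get] can be
    replaced by a formula in the inverse metric. *)
Lemma normalE W x : is_metric W -> W x ->
  Defs.normal G x = \row_k (ginv G x ord0 k / Num.sqrt (ginv G x ord0 ord0)).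
Proof.
move=> Met Wx; have [Gs Gsym Gpos] := Met; set g0 := ginv G x ord0 ord0.
have gu := G_unit Gsym Gpos Wx.
pose e : V := delta_mx 0 ord0.
have gE k : (e *m ginv G x) 0 k = ginv G x ord0 k by rewrite -rowE mxE.
have g00 : 0 < g0 by exact: (ginv00_gt0 Met Wx).
have s0 : 0 < Num.sqrt g0 by rewrite sqrtr_gt0.
pose P := [set v : V | [/\ ip G x v v = 1, (forall i : 'I_m, ip G x v (bvec R i) = 0) & 0 < v 0 ord0]].
pose v0 : V := \row_k (ginv G x ord0 k / Num.sqrt g0).
have v0E : v0 = (Num.sqrt g0)^-1 *: (e *m ginv G x).
  by apply/rowP => k; rewrite !mxE mulrC; congr (_ * _); rewrite -gE mxE.
have v0G : v0 *m G x = (Num.sqrt g0)^-1 *: e by rewrite v0E -scalemxAl mulmxKV.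
have Pv0 : P v0.
  split.
  - rewrite /ip v0G -scalemxAl mxE mxE (bigD1 ord0) //= big1 ?addr0.
      rewrite [X in _ * (X * _)]mxE !eqxx mul1r !mxE -/g0 -[X in X / _](sqr_sqrtr (ltW g00)).
      by field; rewrite gt_eqF.
    by move=> i i0; rewrite [X in X * _]mxE (negbTE i0) andbF mul0r.
  - move=> i; rewrite /ip v0G -scalemxAl mxE mxE big1 ?mulr0 // => k _; rewrite !mxE.
    case: (eqVneq k ord0) => [->|k0]; last by rewrite andbF mul0r.
    by rewrite andbF mulr0.
  - by rewrite mxE divr_gt0.
(* Orthogonality to the boundary directions makes the lowered vector a multiple of the differential
   of [x_0]; unit length and the inward sign fix the factor. *)
have uniq v : P v -> v = v0.
  move=> [h1 h2 h3]; pose c := (v *m G x) 0 ord0.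
  have vG : v *m G x = c *: e.
    apply/rowP => i; case: (unliftP ord0 i) => [j ->|->].
      have := h2 j; rewrite /ip mxE (bigD1 (lift ord0 j)) //= big1 ?addr0.
        rewrite !mxE !eqxx mulr1 => ->; by rewrite andbF mulr0.
      by move=> k kj; rewrite [X in _ * X]mxE [X in _ * X]mxE (negbTE kj) andbF mulr0.
    by rewrite /c !mxE !eqxx mulr1.
  have vE : v = c *: (e *m ginv G x) by rewrite scalemxAl -vG mulmxK.
  have v00 : v 0 ord0 = c * g0 by rewrite vE mxE gE.
  have c0' : 0 < c by move: h3; rewrite v00 pmulr_lgt0.
  have hc : c ^+ 2 * g0 = 1.
    rewrite -[RHS]h1 /ip vG -scalemxAl mxE mxE (bigD1 ord0) //= big1 ?addr0.
      by rewrite [X in _ * (X * _)]mxE !eqxx mul1r mxE v00; ring.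
    by move=> i i0; rewrite [X in X * _]mxE (negbTE i0) andbF mul0r.
  have cs : c * Num.sqrt g0 = 1.
    apply/eqP; rewrite -(@eqrXn2 _ 2) //; last by rewrite mulr_ge0 // ltW.
    by rewrite exprMn sqr_sqrtr ?ltW // hc expr1n.
  rewrite vE v0E; congr (_ *: _); apply: (mulIf (lt0r_neq0 s0)).
  by rewrite cs mulVf // gt_eqF.
by apply: uniq; exact: getPex (ex_intro _ v0 Pv0).
Qed.

Section Shifted.
Variable W : set V.
Hypotheses (HW : relopen H W) (Met : is_metric W) (hPsi : psi_regular W).
Variables (lo hi : 'I_n -> R).
Let K := [set x : V | forall i, lo i <= x 0 i <= hi i].
Hypothesis KW : K `<=` W.
Variables (q : nat) (s : 'I_q -> 'I_n) (T : pred 'I_(q + 1)) (W2 : set 'rV[R]_(q + 1)).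
Hypotheses (HW2 : relopen (orthant T) W2) (graphW : forall u x, W x -> W2 (graph s u x)).
Hypothesis boxW2 : forall z : 'rV[R]_(q + 1),
  (forall j, lo (s j) <= z 0 (lshift 1 j) <= hi (s j)) -> W2 z.
Variables (phi kap : 'I_n -> V -> R) (h : 'rV[R]_(q + 1) -> R).
Hypotheses (phiC : forall k, Ck H W 2 (phi k)) (kapC : forall k, Ck H W 2 (kap k))
  (hh : Ck (orthant T) W2 2 h).

Let S : set (V -> R) := solution W.
Let Kc : compact K. Proof. exact: box_compact. Qed.
Let S3 u : S u -> Ck H W 3 u. Proof. by case. Qed.
Let S2 u : S u -> Ck H W 2 u. Proof. by move=> /S3; exact: hCk_le. Qed.
Let S1 u : S u -> Ck H W 1 u. Proof. by move=> /S3; exact: hCk_le. Qed.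
Let Sab u x : S u -> W x -> a <= u x <= b. Proof. by case=> _ h1 _ _; exact: h1. Qed.
Let Spde u x : S u -> W x -> Gam (eigU G u x) /\ f (eigU G u x) = psi_at u x.
Proof. by case=> _ _ h1 _; exact: h1. Qed.

Let HWP := relopen_cylinder HW.
Let graphP u x : W x -> [set z : 'rV[R]_(n + 1) | W (lsubmx z)] (graph id u x).
Proof.
move=> Wx; rewrite /graph /= row_mxKl.
by have -> : \row_j x 0 j = x by apply/rowP => j; rewrite mxE.
Qed.
Let boxP (z : 'rV[R]_(n + 1)) : (forall j, lo j <= z 0 (lshift 1 j) <= hi j) -> W (lsubmx z).
Proof. by move=> hz; apply: KW => j; rewrite mxE. Qed.
Let hPsi1 := Ck_le (isT : 1 <= 2)%N hPsi.
Let hPsi0 := Ck_le (isT : 0 <= 2)%N hPsi.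

Let P1 u : S u -> Ck H W 1 (psi_at u).
Proof. by move=> /S1; exact: (Ck_composite HW HWP graphP hPsi1). Qed.

Let exN : exists N : nat, b - a <= N%:R.
Proof.
exists (Num.bound `|b - a|); apply: le_trans (ler_norm _) (ltW _).
exact: archi_boundP.
Qed.

Lemma shifted_interior (xs : V) (r : R) : 0 < r ->
  (forall x, H x -> (forall i, `|x 0 i - xs 0 i| <= r) -> K x) ->
  (forall x, K x -> 0 < x 0 ord0) ->
  exists C, forall u x k, S u -> H x -> `|x - xs| <= r / (2 * n%:R) -> `|pd k u x| <= C.
Proof.
move=> r0 hK K0; have [Gs Gsym Gpos] := Met; have [N hN] := exN.
apply: (@interior_gradient R m W HW G Gs Gsym Gpos Gam f c0 Gam_open Gam_ub f_smooth f_sym f_hom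
  f_mono c00 f_sum K Kc KW a b S (fun u => psi_at u) (grad_shift s phi kap h) (grad_slope s T kap h)
  S3 Sab Spde P1 _ _ _ _ _ _ _ N _ hN erefl xs r r0 hK K0).
- exact: (bO_composite0 KW boxP Sab hPsi0).
- by move=> k; exact: (bO_composite1 HW HWP graphP KW boxP Sab S2 k hPsi1).
- by move=> u k; exact: (shiftC HW HW2 graphW S2 phiC kapC hh).
- exact: (bO_shift0 KW boxW2 Sab Kc phiC kapC hh).
- exact: (bO_shift1 HW HW2 graphW KW boxW2 Sab S2 Kc phiC kapC hh).
- exact: (bO_shift2 HW HW2 graphW KW boxW2 Sab S2 Kc phiC kapC hh).
- exact: (bO_slope KW boxW2 Sab Kc kapC hh).
Qed.

Lemma shifted_boundary (xs : V) (rho : R) : 0 < rho -> xs 0 ord0 = 0 ->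
  (forall x, H x -> (forall i, `|x 0 i - xs 0 i| <= rho) -> K x) ->
  (forall u x, S u -> W x -> x 0 ord0 = 0 ->
    \sum_k ginv G x ord0 k * Xk (grad_shift s phi kap h) u k x = 0) ->
  exists2 d, 0 < d & exists C, forall u x k, S u -> H x -> `|x - xs| <= d -> `|pd k u x| <= C.
Proof.
move=> r0 xs0 hK Xbd; have [Gs Gsym Gpos] := Met; have [N hN] := exN.
apply: (@boundary_gradient R m W HW G Gs Gsym Gpos Gam f c0 Gam_open Gam_ub f_smooth f_sym f_hom
  f_mono c00 f_sum K Kc KW a b S (fun u => psi_at u) (grad_shift s phi kap h) (grad_slope s T kap h)
  S3 Sab Spde P1 _ _ _ _ _ _ _ N _ hN erefl xs rho r0 xs0 hK Xbd).
- exact: (bO_composite0 KW boxP Sab hPsi0).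
- by move=> k; exact: (bO_composite1 HW HWP graphP KW boxP Sab S2 k hPsi1).
- by move=> u k; exact: (shiftC HW HW2 graphW S2 phiC kapC hh).
- exact: (bO_shift0 KW boxW2 Sab Kc phiC kapC hh).
- exact: (bO_shift1 HW HW2 graphW KW boxW2 Sab S2 Kc phiC kapC hh).
- exact: (bO_shift2 HW HW2 graphW KW boxW2 Sab S2 Kc phiC kapC hh).
- exact: (bO_slope KW boxW2 Sab Kc kapC hh).
Qed.

End Shifted.

(** Away from the boundary no condition has to be matched, and the shift is zero: [X = du]. *)
Lemma interior_chart W (xs : V) rho : relopen H W -> is_metric W -> psi_regular W ->
  0 < rho -> rho < xs 0 ord0 -> (forall x, H x -> `|x - xs| <= rho -> W x) ->
  exists C, forall u x k, solution W u -> H x -> `|x - xs| <= rho / (2 * n%:R) -> `|pd k u x| <= C.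
Proof.
move=> HW Met hPsi rho0 rho1 hW.
pose lo i := xs 0 i - rho; pose hi i := xs 0 i + rho.
have hlo x i : lo i <= x 0 i <= hi i -> `|x 0 i - xs 0 i| <= rho.
  by rewrite ler_norml /lo /hi => /andP[h1 h2]; apply/andP; split; lra.
have KH x : (forall i, lo i <= x 0 i <= hi i) -> 0 < x 0 ord0.
  by move=> /(_ ord0)/andP[h _]; move: h; rewrite /lo; lra.
have KW : [set x : V | forall i, lo i <= x 0 i <= hi i] `<=` W.
  move=> x Kx; apply: hW; first exact: ltW (KH x Kx).
  by apply: rV_norm_le => [|i]; [exact: ltW | rewrite rowB; exact: hlo].
have hz (k : 'I_n) : Ck H W 2 (fun _ : V => 0 : R) by exact: hCk_cst.
have graphP u x : W x -> [set z : 'rV[R]_(n + 1) | W (lsubmx z)] (graph id u x).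
  move=> Wx; rewrite /graph /= row_mxKl.
  by have -> : \row_j x 0 j = x by apply/rowP => j; rewrite mxE.
have boxP (z : 'rV[R]_(n + 1)) : (forall j, lo j <= z 0 (lshift 1 j) <= hi j) -> W (lsubmx z).
  by move=> h; apply: KW => j; rewrite mxE.
apply: (@shifted_interior W HW Met hPsi lo hi KW n id _ _ (relopen_cylinder HW) graphP boxP
  (fun _ _ => 0) (fun _ _ => 0) PsiF hz hz hPsi xs rho rho0) => [x _ h i|x].
  by have := h i; rewrite ler_norml /lo /hi => /andP[h1 h2]; apply/andP; split; lra.
exact: KH.
Qed.

(** The condition on [bdry_emb] makes [W] stable under projection to the boundary, so that [eta] can
    be evaluated over every point of [W] and [beta] is defined in the interior too. *)
Lemma boundary_chart W (xs : V) rho : relopen H W -> is_metric W -> psi_regular W -> eta_regular W ->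
  (forall x, W x -> W (bdry_emb (\row_j x 0 (lift ord0 j)))) ->
  0 < rho -> xs 0 ord0 = 0 -> (forall x, H x -> `|x - xs| <= rho -> W x) ->
  exists2 d, 0 < d & exists C, forall u x k, solution W u -> H x -> `|x - xs| <= d -> `|pd k u x| <= C.
Proof.
move=> HW Met hPsi hEta proj rho0 xs0 hW.
have [[u0 Su0]|noS] := pselect (exists u0, solution W u0); last first.
  by exists 1 => //; exists 0 => u x k Su; case: noS; exists u.
have [Gs Gsym Gpos] := Met.
(* In the first coordinate the box starts at 0, which keeps the compact set in the half-space. *)
pose lo i := if i == ord0 then 0 else xs 0 i - rho; pose hi i := xs 0 i + rho.
have hlo x i : lo i <= x 0 i <= hi i -> `|x 0 i - xs 0 i| <= rho.
  rewrite ler_norml /lo /hi => /andP[]; case: (eqVneq i ord0) => [->|_]; rewrite ?xs0 => h1 h2;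
    by apply/andP; split; lra.
have KH x : (forall i, lo i <= x 0 i <= hi i) -> H x.
  by move=> /(_ ord0)/andP[]; rewrite /lo eqxx.
have KW : [set x : V | forall i, lo i <= x 0 i <= hi i] `<=` W.
  move=> x Kx; apply: hW; first exact: KH.
  by apply: rV_norm_le => [|i]; [exact: ltW | rewrite rowB; exact: hlo].
pose ro x := (Num.sqrt (ginv G x ord0 ord0))^-1.
have gp x : W x -> 0 < ginv G x ord0 ord0 by exact: ginv00_gt0.
have roC : Ck H W 2 ro.
  apply: (hCkV HW) => [x Wx|]; first by rewrite gt_eqF // sqrtr_gt0 gp.
  by apply: (hCk_sqrt HW) => //; exact: (Ck_ginv HW).
pose kap (k : 'I_n) x := (k == ord0)%:R * ro x.
pose phi (k : 'I_n) x := pd k u0 x - kap k x * eta_at u0 x.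
have graphE u x : W x -> [set z : 'rV[R]_(m + 1) | W (bdry_emb (lsubmx z))] (graph (lift ord0) u x).
  by move=> Wx; rewrite /graph /= row_mxKl; exact: proj.
have kapC k : Ck H W 2 (kap k) by exact: hCkZ.
have phiC k : Ck H W 2 (phi k).
  have [u3 _ _ _] := Su0.
  apply: (hCkB HW); first exact: hCk_pd.
  apply: (hCkM HW); first exact: kapC.
  exact: (Ck_composite HW (relopen_bdry HW) graphE hEta (hCk_le (isT : 2 <= 3)%N u3)).
have boxE (z : 'rV[R]_(m + 1)) : (forall j, lo (lift ord0 j) <= z 0 (lshift 1 j) <= hi (lift ord0 j)) ->
    W (bdry_emb (lsubmx z)).
  move=> h; apply: KW => i; case: (unliftP ord0 i) => [j ->|->].
    by rewrite bdry_emb_coord mxE.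
  by rewrite bdry_emb_coord0 /lo /hi eqxx xs0 lexx add0r ltW.
apply: (@shifted_boundary W HW Met hPsi lo hi KW m (lift ord0) _ _ (relopen_bdry HW) graphE boxE
  phi kap EtaF phiC kapC hEta xs rho rho0 xs0).
  move=> x Hx h i; have := h i; rewrite ler_norml /lo /hi.
  case: (eqVneq i ord0) => [->|_]; rewrite ?xs0 => /andP[h1 h2]; apply/andP; split; try lra.
  exact: Hx.
move=> u x Su Wx x0; set e := eta_at u x; set e0 := eta_at u0 x.
pose g := Num.sqrt (ginv G x ord0 ord0); have g0 : 0 < g by rewrite sqrtr_gt0 gp.
(* The boundary condition multiplied by the square root of [g^00], so that it speaks of the conormal
   derivative. *)
have bc v : solution W v -> \sum_k ginv G x ord0 k * pd k v x = g * (eta_at v x - mean_curv G x).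
  move=> [_ _ _ hv]; rewrite -(hv x Wx x0) /normal_deriv (normalE Met Wx) mulr_sumr.
  by apply: eq_bigr => k _; rewrite mxE -/g; field; rewrite gt_eqF.
(* Only the component of index 0 of [kap] is nonzero; its conormal component is the square root of
   [g^00], exactly what the difference of the two boundary conditions requires. *)
have -> : \sum_k ginv G x ord0 k * Xk (grad_shift (lift ord0) phi kap EtaF) u k x =
   \sum_k ginv G x ord0 k * pd k u x - \sum_k ginv G x ord0 k * pd k u0 x
   + (\sum_k ginv G x ord0 k * (k == ord0)%:R) * (ro x * (e0 - e)).
  rewrite mulr_suml -sumrB -big_split; apply: eq_bigr => k _ /=.
  rewrite /Xk /grad_shift /phi /kap -/e -/e0; ring.
rewrite (bc u Su) (bc u0 Su0) -/e -/e0 (bigD1 ord0) //= big1 ?addr0 => [|k k0]; last first.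
  by rewrite (negbTE k0) mulr0.
rewrite mulr1 mulrA -[ginv G x ord0 ord0](sqr_sqrtr (ltW (gp x Wx))) /ro -/g.
by field; rewrite gt_eqF.
Qed.

Lemma relopen_ball xs r : relopen H [set x | H x /\ `|x - xs| < r].
Proof.
move=> x [Hx xr]; split=> //; exists (r - `|x - xs|); first by rewrite subr_gt0.
move=> y Hy yx; split=> //; have -> : y - xs = (y - x) + (x - xs) by rewrite addrA subrK.
by apply: le_lt_trans (ler_normD _ _) _; rewrite -ltrBrDr.
Qed.

Lemma solution_sub W W' u : relopen H W -> relopen H W' -> W' `<=` W -> solution W u -> solution W' u.
Proof.
move=> HW HW' sub [u3 uab upde ubd]; split.
- by move: HW HW' u3; rewrite half_orthant => HW HW'; exact: Ck_sub.
- by move=> x /sub; exact: uab.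
- by move=> x /sub; exact: upde.
- by move=> x /sub; exact: ubd.
Qed.

Lemma gradient_chart W xs : relopen H W -> is_metric W -> psi_regular W -> eta_regular W -> W xs ->
  exists2 d, 0 < d & exists C, forall u x k, solution W u -> H x -> `|x - xs| <= d -> `|pd k u x| <= C.
Proof.
move=> HW Met hPsi hEta Wxs; have [Hxs [r r0 hr]] := HW xs Wxs.
have [xs0|xs0] : xs 0 ord0 = 0 \/ 0 < xs 0 ord0.
  by move: Hxs; rewrite /half_space /= le_eqVlt => /orP[/eqP <-|]; [left | right].
  (* In the sup norm, setting [x_0] to 0 does not increase the distance to a boundary point; a ball
     centred there is stable under projection. *)
  pose W' : set V := [set x | H x /\ `|x - xs| < r].
  have HW' : relopen H W' by exact: relopen_ball.
  have sub : W' `<=` W by move=> x [Hx xr]; exact: hr.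
  have Met' : is_metric W'.
    have [h1 h2 h3] := Met; split=> [k i j|x /sub|x /sub]; [|exact: h2|exact: h3].
    by move: HW HW' (h1 k i j); rewrite half_orthant => HW HW'; exact: Ck_sub.
  have hPsi' : psi_regular W'.
    by apply: Ck_sub hPsi; [exact: relopen_cylinder | exact: relopen_cylinder | move=> z /sub].
  have hEta' : eta_regular W'.
    by apply: Ck_sub hEta; [exact: relopen_bdry | exact: relopen_bdry | move=> z /sub].
  have proj x : W' x -> W' (bdry_emb (\row_j x 0 (lift ord0 j))).
    move=> [Hx xr]; split; first exact: bdry_emb_half.
    apply: le_lt_trans xr; apply: rV_norm_le => // i; rewrite rowB.
    case: (unliftP ord0 i) => [j ->|->]; last by rewrite bdry_emb_coord0 xs0 subrr normr0.
    rewrite bdry_emb_coord mxE; have := ler_norm_coord (x - xs) (lift ord0 j).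
    by rewrite rowB.
  have r20 : 0 < r / 2 by rewrite divr_gt0.
  have hW' x : H x -> `|x - xs| <= r / 2 -> W' x.
    by move=> Hx h; split=> //; apply: le_lt_trans h _; rewrite ltr_pdivrMr // ltr_pMr // ltr1n.
  have [d d0 [C hC]] := boundary_chart HW' Met' hPsi' hEta' proj r20 xs0 hW'.
  exists d => //; exists C => u x k Su; apply: hC; exact: solution_sub Su.
pose rho := Num.min (r / 2) (xs 0 ord0 / 2).
have rho0 : 0 < rho by rewrite lt_min !divr_gt0.
have rho1 : rho < xs 0 ord0.
  by rewrite gt_min [X in _ || X]ltr_pdivrMr // ltr_pMr // ltr1n orbT.
have hW x : H x -> `|x - xs| <= rho -> W x.
  move=> Hx h; apply: hr => //; apply: le_lt_trans h _.
  by rewrite gt_min ltr_pdivrMr // ltr_pMr // ltr1n.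
have [C hC] := interior_chart HW Met hPsi rho0 rho1 hW.
exists (rho / (2 * n%:R)); first by rewrite divr_gt0 // mulr_gt0 // ltr0n.
by exists C => u x k Su Hx hx; exact: hC.
Qed.

End ChartEstimate.

(** * From charts to the manifold *)

Section Manifold.
Variables (R : realType) (m : nat) (M : topologicalType).
Variables (X : bmanifold R m M) (g : riem_metric X).
Notation n := (m.+1).
Notation V := 'rV[R]_m.+1.
Notation H := (@half_space R m).
Implicit Types (c : chart R m M) (q : M) (O : set M) (u : M -> R).

Lemma chart_imgP c O x : is_chart c ->
  chart_img c O x <-> chart_img c setT x /\ O (pnt c x).
Proof.
move=> [_ _ cK _ _]; split=> [[q [dq Oq] <-]|[[q [dq _] <-]]]; rewrite ?cK //.
  by split=> //; exists q.
by move=> Oq; exists q.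
Qed.

Lemma crd_img c O q : Defs.dom c q -> O q -> chart_img c O (crd c q).
Proof. by move=> dq Oq; exists q. Qed.

Lemma chart_img_half c O x : is_chart c -> chart_img c O x -> H x.
Proof.
move=> hc /(chart_imgP _ _ hc)[hx _]; case: hc => _ [U _ e] _ _ _.
by move: hx; rewrite e => -[].
Qed.

Lemma chart_img_relopen c O : is_chart c -> open O -> relopen H (chart_img c O).
Proof.
move=> hc oO x hx; split; first exact: chart_img_half hx.
have [hT Ox] := (chart_imgP O x hc).1 hx; case: (hc) => _ [U oU e] _ _ pc.
have := hT; rewrite e => -[Ux Hx].
have /nbhs_ballP[d1 /= d10 hd1] := open_nbhs_nbhs (conj oU Ux).
have /subspace_continuousP/(_ x hT) := pc.
move=> /(_ O (open_nbhs_nbhs (conj oO Ox))) /nbhs_ballP[d2 /= d20 hd2].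
exists (Num.min d1 d2); first by rewrite lt_min d10.
move=> y Hy; rewrite lt_min => /andP[y1 y2].
have hy : chart_img c setT y.
  by rewrite e; split=> //; apply: hd1; rewrite -ball_normE /= distrC.
apply/(chart_imgP _ _ hc); split=> //; apply: hd2 => //.
by rewrite -ball_normE /= distrC.
Qed.

Lemma chart_metric c O : atlas X c -> open O -> is_metric (gcomp g c) (chart_img c O).
Proof.
move=> ac oO; have hc := bm_chart ac.
have sub : chart_img c O `<=` chart_img c setT by move=> x /(chart_imgP _ _ hc)[].
split=> [k i j|x /sub hx|x /sub hx v v0].
- have := chart_img_relopen hc openT; have := chart_img_relopen hc oO.
  have := rm_smooth g ac i j k; rewrite half_orthant => h1 h2 h3.
  exact: (Ck_sub h3 h2 sub h1).
- exact: (rm_sym g ac hx).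
- exact: (rm_posdef g ac hx v0).
Qed.

Lemma chart_near c q (A : set V) d : atlas X c -> Defs.dom c q -> 0 < d ->
  (forall y, H y -> `|y - crd c q| <= d -> A y) -> \forall q' \near q, Defs.dom c q' /\ A (crd c q').
Proof.
move=> ac dq d0 hA; have hc := bm_chart ac; case: (hc) => od _ _ cc _.
have h1 : \forall q' \near q, Defs.dom c q' by exact: open_nbhs_nbhs.
have /subspace_continuousP/(_ q dq) := cc.
move=> /cvgrPdist_lt/(_ d d0); rewrite near_withinE => h2.
near=> q'; have dq' : Defs.dom c q' by near: q'.
split=> //; apply: hA; first exact: chart_img_half (crd_img dq' (I : setT q')).
rewrite distrC; apply: ltW; move: dq'; near: q'; exact: h2.
Unshelve. all: by end_near. Qed.

(** * Invariance of the gradient norm under changes of chart *)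

Section Invariance.
Variables (O : set M) (u : M -> R) (c c' : chart R m M) (q : M).
Hypotheses (oO : open O) (uC : Ck_on X O 1 u) (ac : atlas X c) (ac' : atlas X c')
  (dq : Defs.dom c q) (dq' : Defs.dom c' q) (Oq : O q).

(** A coordinate line of one chart becomes a curve in the other, possibly along the boundary; this
    is where expansions along paths into the half-space are needed. *)
Lemma chain_rule i : pd i (u \o pnt c) (crd c q) =
  \sum_k Defs.jacobian (transition c c') (crd c q) k i * pd k (u \o pnt c') (crd c' q).
Proof.
have hc := bm_chart ac; have hc' := bm_chart ac'.
have od' : open (Defs.dom c') by case: hc'.
pose W := chart_img c (Defs.dom c' `&` O); have HW : relopen H W.
  by apply: chart_img_relopen => //; exact: openI.
pose W1 := chart_img c (Defs.dom c'); have HW1 : relopen H W1 by exact: chart_img_relopen.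
have HW' := chart_img_relopen hc' oO.
have pK p : Defs.dom c p -> pnt c (crd c p) = p by case: hc => _ _ h _ _; exact: h.
have pK' p : Defs.dom c' p -> pnt c' (crd c' p) = p by case: hc' => _ _ h _ _; exact: h.
have Wq : W (crd c q) by exact: crd_img.
have Wq1 : W1 (crd c q) by exact: crd_img.
pose tau := transition c c'.
have tq : tau (crd c q) = crd c' q by rewrite /tau /transition pK.
have tauC k : Ck H W1 1 (fun x => tau x 0 k) by exact: (bm_smooth ac ac' k 1).
have vC : Ck H (chart_img c' O) 1 (u \o pnt c') by exact: uC.
have pF := hdir_punctured HW i Wq.
apply: (pd_eq HW) => //.
pose v : V := \row_k pd i (fun x => tau x 0 k) (crd c q).
have hg := pd_hasgrad HW' vC (crd_img dq' Oq).
have := @hasgrad_path R n _ pF H (fun t => tau (crd c q + t *: delta_mx 0 i)) (crd c' q) v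
  _ _ (u \o pnt c') _ hg.
have HWo : relopen (orthant (pred1 (ord0 : 'I_n))) W by rewrite -half_orthant.
have near : \forall t \near dir_filter H i (crd c q), W (crd c q + t *: delta_mx 0 i).
  by have := dir_relopen i HWo Wq; rewrite -half_orthant.
have tauO z : W z -> chart_img c' O (tau z) /\ u (pnt c' (tau z)) = u (pnt c z).
  move=> [p [dp [dp' Op]] <-]; rewrite /tau /transition pK // pK' //.
  by split=> //; exact: crd_img.
have -> : (u \o pnt c') (crd c' q) = (u \o pnt c) (crd c q) by rewrite /= pK // pK'.
under eq_bigr => k _ do rewrite mxE.
move=> h; under [X in jet1 _ _ _ X]eq_bigr => k _ do rewrite mxE.
apply: (jet1_near _ (h _ _)).
- by apply: filterS near => t /tauO[_ /= ->].
- by apply: filterS near => t /tauO[h1 _]; exact: chart_img_half h1.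
- move=> k; rewrite -tq mxE; exact: (pd_dir HW1 i (tauC k) Wq1).
Qed.

Lemma dnorm2_chart : dnorm2 (gcomp g c) (u \o pnt c) (crd c q) =
  dnorm2 (gcomp g c') (u \o pnt c') (crd c' q).
Proof.
have hc := bm_chart ac; have hc' := bm_chart ac'.
have dE G' (v : V -> R) x : dnorm2 G' v x = (du v x *m ginv G' x *m (du v x)^T) 0 0.
  rewrite mxE /dnorm2 exchange_big; apply: eq_bigr => j _ /=; rewrite !mxE mulr_suml.
  by apply: eq_bigr => i _; rewrite !mxE; ring.
set J := Defs.jacobian (transition c c') (crd c q).
have duE : du (u \o pnt c) (crd c q) = du (u \o pnt c') (crd c' q) *m J.
  apply/rowP => i; rewrite mxE chain_rule mxE; apply: eq_bigr => k _.
  by rewrite mulrC; congr (_ * _); rewrite mxE.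
have od' : open (Defs.dom c') by case: hc'.
have hJ : gcomp g c (crd c q) = J^T *m gcomp g c' (crd c' q) *m J.
  have := rm_tensor g ac ac' (crd_img dq dq'); rewrite /transition.
  by have -> : pnt c (crd c q) = q by case: hc => _ _ h _ _; exact: h.
have [_ Gs Gp] := chart_metric ac openT; have [_ Gs' Gp'] := chart_metric ac' openT.
have gu := G_unit Gs Gp (crd_img dq (I : setT q)).
have gu' := G_unit Gs' Gp' (crd_img dq' (I : setT q)).
(* The Jacobian is invertible because it transforms one nondegenerate metric into another; no
   inverse transition has to be differentiated. *)
have Ju : J \in unitmx by move: gu; rewrite hJ unitmx_mul => /andP[].
have JTu : J^T \in unitmx by rewrite unitmx_tr.
have gi : ginv (gcomp g c) (crd c q) = invmx J *m ginv (gcomp g c') (crd c' q) *m invmx J^T.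
  apply: (can_inj (mulmxK gu)); rewrite /ginv mulVmx // hJ !mulmxA mulmxKV //.
  by rewrite -(mulmxA (invmx J)) mulVmx // mulmx1 mulVmx.
rewrite !dE duE gi trmx_mul !mulmxA mulmxK //.
by rewrite -(mulmxA _ (invmx J^T)) mulVmx // mulmx1.
Qed.

End Invariance.

(** * Bounds near a point of the manifold *)

Section Problem.
Variables (Gam : set V) (f : V -> R) (psi eta : M -> R -> R) (a b : R) (O : set M).
Hypotheses (oO : open O) (psiC : Ck_onxR X O 2 psi) (etaC : Ck_bdryxR X O 2 eta).

Definition chart_psi c (z : 'rV[R]_(n + 1)) := psi (pnt c (lsubmx z)) (rsubmx z 0 0).
Definition chart_eta c (z : 'rV[R]_(m + 1)) := eta (pnt c (bdry_emb (lsubmx z))) (rsubmx z 0 0).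

Definition admissible u := [/\ Ck_on X O 3 u, interior_eq g Gam f psi O u,
  boundary_eq g eta O u & forall q, O q -> a <= u q <= b].

Lemma chart_solution c u : atlas X c -> admissible u ->
  solution (gcomp g c) Gam f a b (chart_psi c) (chart_eta c) (chart_img c O) (u \o pnt c).
Proof.
move=> ac [uC ueq ubd uab]; have hc := bm_chart ac.
have pK p : Defs.dom c p -> pnt c (crd c p) = p by case: hc => _ _ h _ _; exact: h.
split; first exact: uC.
- by move=> x [q [dq Oq] <-]; rewrite /= pK //; exact: uab.
- move=> x [q [dq Oq] <-]; have [h1 h2] := ueq c q ac dq Oq; split=> //.
  rewrite [LHS]h1 /on_graph /chart_psi /graph row_mxKl row_mxKr mxE.
  have -> : \row_j crd c q 0 j = crd c q by apply/rowP => j; rewrite mxE.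
  by rewrite /= pK.
- move=> x [q [dq Oq] <-] x0.
  rewrite (ubd c q ac dq Oq) //; last by exists c.
  rewrite /on_graph /chart_eta /graph row_mxKl row_mxKr mxE.
  have -> : bdry_emb (\row_j crd c q 0 (lift ord0 j)) = crd c q.
    apply/rowP => i; case: (unliftP ord0 i) => [j ->|->]; last by rewrite bdry_emb_coord0.
    by rewrite bdry_emb_coord mxE.
  by rewrite /= pK.
Qed.

Variable c0 : R.
Hypotheses (Gam_open : open Gam) (Gam_ub : Gam `<=` Gamma1).
Hypotheses (f_smooth : smooth setT Gam f) (f_sym : symmetric_fun (closure Gam) f)
  (f_hom : homogeneous1 Gam f) (f_mono : forall i lam, Gam lam -> 0 < partial setT i f lam)
  (c00 : 0 < c0) (f_sum : forall lam, Gam lam -> c0 <= \sum_i partial setT i f lam).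

Definition gradient_at c q u := Defs.gnorm (gcomp g c) (crd c q) (grad (gcomp g c) (u \o pnt c) (crd c q)).

(** The neighbourhood and the bounds are produced in one chart around [q]; invariance of the norm
    makes the constant valid in every chart at the nearby points. *)
Lemma gradient_near q : O q -> exists C, \forall q' \near q,
  forall u c, admissible u -> atlas X c -> Defs.dom c q' -> gradient_at c q' u <= C.
Proof.
move=> Oq; have [c ac dq] := bm_cover X q; have hc := bm_chart ac.
pose W := chart_img c O; have HW : relopen H W := chart_img_relopen hc oO.
have Met := chart_metric ac oO; have [Gs Gsym Gpos] := Met.
have hPsi : psi_regular (chart_psi c) W.
  by have := psiC ac; rewrite half_space_cylinder.
have hEta : eta_regular (chart_eta c) W.
  by have := etaC ac; rewrite setT_orthant.
have Wq : W (crd c q) by exact: crd_img.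
have [d d0 [C1 hC1]] := gradient_chart Gam_open Gam_ub f_smooth f_sym f_hom f_mono c00 f_sum
  a b HW Met hPsi hEta Wq.
have near1 := chart_near ac dq d0 (A := fun x => forall (u : V -> R) k,
  solution (gcomp g c) Gam f a b (chart_psi c) (chart_eta c) W u -> `|pd k u x| <= C1)
  (fun y Hy yd (v : V -> R) k Sv => hC1 v y k Sv Hy yd).
pose B i j := `|ginv (gcomp g c) (crd c q) i j| + 1.
have near2 i j : \forall q' \near q, `|ginv (gcomp g c) (crd c q') i j| <= B i j.
  have [gc _] := Ck_ginv HW Gs Gsym Gpos 0 i j.
  have [d' d'0 hd'] := within_cont_in HW gc Wq ltr01.
  have d'2 : 0 < d' / 2 by rewrite divr_gt0.
  have h := chart_near ac dq d'2 (A := fun x => `|ginv (gcomp g c) x i j| <= B i j).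
  apply: filterS (h _) => [q' []//|y Hy yd].
  have yd' : `|y - crd c q| < d' by apply: le_lt_trans yd _; rewrite ltr_pdivrMr // ltr_pMr // ltr1n.
  rewrite -[X in `|X|](subrK (ginv (gcomp g c) (crd c q) i j)) addrC /B.
  by apply: le_trans (ler_normD _ _) _; rewrite lerD2l; exact: hd'.
have near2' : \forall q' \near q, forall i j, `|ginv (gcomp g c) (crd c q') i j| <= B i j.
  have near2i i : \forall q' \near q, forall j, `|ginv (gcomp g c) (crd c q') i j| <= B i j.
    exact: (@filter_forall M 'I_n _ (nbhs q) _ (near2 i)).
  exact: (@filter_forall M 'I_n _ (nbhs q) _ near2i).
(* The norm is evaluated in the chosen chart, with [B] bounding the inverse metric and [C1] the
   first derivatives. *)
exists (Num.sqrt (\sum_i \sum_j B i j * C1 * C1)).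
near=> q' => u c' Au ac' dq'.
have [d1 h1] : Defs.dom c q' /\ (forall (u : V -> R) k, solution (gcomp g c) Gam f a b (chart_psi c)
  (chart_eta c) W u -> `|pd k u (crd c q')| <= C1) by near: q'; exact: near1.
have h2 : forall i j, `|ginv (gcomp g c) (crd c q') i j| <= B i j by near: q'.
have Oq' : O q' by near: q'; exact: open_nbhs_nbhs.
have [_ Gsym' Gpos'] := chart_metric ac' oO.
rewrite /gradient_at -[X in X <= _]ger0_norm ?sqrtr_ge0 // -sqrtr_sqr.
rewrite (gnorm_grad Gsym' Gpos' (u \o pnt c') (crd_img dq' Oq')); apply: ler_wsqrtr.
have uC1 : Ck_on X O 1 u.
  by move=> e ae; case: Au => uC _ _ _; exact: (hCk_le (isT : 1 <= 3)%N (uC e ae)).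
rewrite (dnorm2_chart oO uC1 ac' ac dq' d1 Oq').
have Su := chart_solution ac Au.
apply: le_trans (ler_norm _) _; apply: le_trans (ler_norm_sum _ _ _) _; apply: ler_sum => i _.
apply: le_trans (ler_norm_sum _ _ _) _; apply: ler_sum => j _.
rewrite !normrM; apply: ler_pM; [exact: mulr_ge0 | exact: normr_ge0 | | exact: h1].
by apply: ler_pM; [exact: normr_ge0 | exact: normr_ge0 | exact: h2 | exact: h1].
Unshelve. all: by end_near. Qed.

End Problem.
End Manifold.

(** * Globalization by compactness *)

Unset Implicit Arguments.

Theorem theorem1p3 (R : realType) (m : nat) (hn : (3 <= m.+1)%N)
    (Gam : set 'rV[R]_m.+1) (f : 'rV[R]_m.+1 -> R)
    (Gam_open : open Gam) (Gam_convex : convex_set Gam)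
    (Gam_sym : symmetric_set Gam) (Gam_cone : is_cone Gam)
    (Gam_lb : Gamman `<=` Gam) (Gam_ub : Gam `<=` Gamma1)
    (f_smooth : smooth setT Gam f)
    (f_cont : {within closure Gam, continuous f})
    (f_sym : symmetric_fun (closure Gam) f)
    (f_pos : forall lam, Gam lam -> 0 < f lam)
    (f_hom : homogeneous1 Gam f)
    (f_mono : forall i lam, Gam lam -> 0 < partial setT i f lam)
    (f_sum : exists2 c0 : R, 0 < c0 &
       forall lam, Gam lam -> c0 <= \sum_i partial setT i f lam)
    (M : topologicalType) (X : bmanifold R m M) (g : riem_metric X)
    (M_compact : compact [set: M]) (bdry_neq0 : bdry X !=set0)
    (O1 O2 : set M) (O1_open : open O1) (O2_open : open O2)
    (O2_O1 : closure O2 `<=` O1)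
    (psi eta : M -> R -> R)
    (psi_C2 : Ck_onxR X O1 2 psi) (eta_C2 : Ck_bdryxR X O1 2 eta)
    (a b : R) :
  exists2 C : R, 0 < C &
    forall u : M -> R,
      Ck_on X O1 3 u ->
      interior_eq g Gam f psi O1 u ->
      boundary_eq g eta O1 u ->
      (forall q, O1 q -> a <= u q <= b) ->
      grad_le g C O2 u.
Proof.
have [c0 c00 f_sum'] := f_sum.
pose A := admissible g Gam f psi eta a b O1.
have cO : compact (closure O2).
  by apply: subclosed_compact M_compact _ => //; exact: closed_closure.
pose P (C : R) (q : M) := forall u c, A u -> atlas X c -> Defs.dom c q -> gradient_at g c q u <= C.
(* The bound [P C] is monotone in [C], so the covering form of compactness, with the constant
   tending to infinity as parameter, merges the local constants over the closure of [O2]. *)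
have [C0 [_ hC0]] : \forall C \near +oo, closure O2 `<=` P C.
  apply: ((compact_near_coveringP (closure O2)).1 cO R +oo P _) => q Oq.
  have [C hC] := gradient_near g a b O1_open psi_C2 eta_C2 Gam_open Gam_ub f_smooth f_sym f_hom f_mono
    c00 f_sum' (O2_O1 q Oq).
  exists ([set q' | P C q'], [set D : R | C <= D]).
    by split; [exact: hC | exists C; split=> [|D]; [exact: num_real | exact: ltW]].
  move=> [q' D] /= [h1 h2] u c Au ac dq; exact: le_trans (h1 u c Au ac dq) h2.
(* The property near infinity holds strictly beyond [C0], and the constant must be positive whatever
   the sign of [C0]. *)
exists (`|C0| + 1); first by rewrite ltr_wpDl.
move=> u u3 uint ubd uab c q ac dq Oq.
have : P (`|C0| + 1) q.
  apply: hC0; last exact: subset_closure.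
  by rewrite (le_lt_trans (ler_norm _)) // ltrDl.
by apply.
Qed.
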